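(* Let $Y_0$ be a prescribed initial parametrization and let $Y^{[0]}$ and $Y^{[2]}$ be solutions on $[0,T]$ of $$Y^{[0]}_t=V_0[Y^{[0]}],\qquad Y^{[2]}_t=V_0[Y^{[2]}]+h^2V_2[Y^{[2]}],\qquad Y^{[0]}(0)=Y^{[2]}(0)=Y_0,$$ where $V_0[\cdot],V_2[\cdot]$ are the velocity fields defined in the context. Assume that both $Y=Y^{[0]}$ and $Y=Y^{[2]}$ are regular embedded counterclockwise closed parametrizations satisfying the regularity assumptions (Reg) of the context on $[0,T]$, with constants $c,M>0$ independent of $h$. For $r\in\{0,2\}$ let $Y_h^{[r]}=I_hY^{[r]}$, and let $d_h^{[r]}$ be the defect functional of $Y^{[r]}$ defined in the context. Then there exist $h_0>0$ and $C>0$ such that for all $0<h\le h_0$, $t\in[0,T-h^2]$, $\phi_h\in[S_h]^2$ and $\beta_h\in S_h$, $$|d_h^{[0]}(\phi_h)|\le Ch^2\|\phi_h\|_{0,h},\qquad \bigl|d_h^{[0]}\bigl(I_h[\beta_hT_h[Y_h^{[0]}]]\bigr)\bigr|\le Ch^4\|\beta_h\|_{0,h},$$ and $$|d_h^{[2]}(\phi_h)|\le Ch^4\|\phi_h\|_{0,h},\qquad \bigl|d_h^{[2]}\bigl(I_h[\beta_hT_h[Y_h^{[2]}]]\bigr)\bigr|\le Ch^6\|\beta_h\|_{0,h}.$$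
   Context: **Grid.** $I=\mathbb R/\mathbb Z$. For an integer $J\ge3$, $h=1/J$, $\rho_j=jh$ with indices mod $J$, $I_j=(\rho_{j-1},\rho_j)$. $S_h$ is the space of continuous periodic functions affine on each $I_j$; $I_h$ is nodal interpolation (componentwise for vectors, also for expressions specified only at the nodes). $\|v\|_{0,h}^2=h\sum_j|v(\rho_j)|^2$. **Smooth curves.** $R$ is clockwise rotation by $\pi/2$. For a regular counterclockwise $Y:I\to\mathbb R^2$: $\vec\tau=Y_\rho/|Y_\rho|$, $\vec n=R\vec\tau$, $\partial_s=|Y_\rho|^{-1}\partial_\rho$, $\partial_s\vec\tau=-\kappa\vec n$, $\partial_s\vec n=\kappa\vec\tau$. **Polygons.** For $Z_h\in[S_h]^2$: $\Gamma[Z_h]=Z_h(I)$, $\vec h_j=Z_h(\rho_j)-Z_h(\rho_{j-1})$, $\widetilde T_h[Z_h](\rho_j)=\dfrac{\vec h_j+\vec h_{j+1}}{|\vec h_j|+|\vec h_{j+1}|}$, $\widetilde N_h[Z_h](\rho_j)=R\widetilde T_h[Z_h](\rho_j)$, $T_h=\widetilde T_h/|\widetilde T_h|$ at the nodes. For $v,w\in[S_h]^2$, $$m_{Z_h}(v,w)=\tfrac12\sum_j(|\vec h_j|+|\vec h_{j+1}|)\bigl(v(\rho_j)\cdot\widetilde N_h[Z_h](\rho_j)\bigr)\bigl(w(\rho_j)\cdot\widetilde N_h[Z_h](\rho_j)\bigr),$$ $$a_{Z_h}(v,w)=\sum_j|\vec h_j|^{-1}(v(\rho_j)-v(\rho_{j-1}))\cdot(w(\rho_j)-w(\rho_{j-1})).$$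 **Defect.** For a time-dependent curve $Y$ and $t\in[0,T-h^2]$, let $v_h=I_h\bigl[(Y(t+h^2)-Y(t))/h^2\bigr]$, $Y_h=I_hY(t)$ and $$d_h(\phi_h)=m_{Y_h}(v_h,\phi_h)+a_{Y_h}(Y_h,\phi_h)+h^2a_{Y_h}(v_h,\phi_h),\qquad\phi_h\in[S_h]^2 .$$ **Velocity fields.** For a regular curve $Y$ (all quantities evaluated on $Y$) let $\alpha_0=-\kappa$, let $\beta_0$ be the periodic solution of $$(-\partial_{ss}+\kappa^2)\beta_0=\tfrac14(|Y_\rho|)_\rho\kappa^2-3\kappa\partial_s\kappa ,$$ $V_0[Y]=\alpha_0\vec n+\beta_0\vec\tau$, $$\alpha_2=-\tfrac12\partial_{ss}\kappa+\tfrac32\kappa^3-2\kappa\partial_s\beta_0+\tfrac12\kappa\beta_0^2-\tfrac1{12}\kappa_{\rho\rho}-\frac{(|Y_\rho|)_\rho}{4|Y_\rho|}\kappa_\rho-\tfrac14|Y_\rho|^2\kappa^3-\bigl(\tfrac12(|Y_\rho|)_\rho\kappa+\tfrac16|Y_\rho|\kappa_\rho\bigr)\beta_0,$$ let $\beta_2$ be the periodic solution of $$\begin{aligned}(-\partial_{ss}+\kappa^2)\beta_2={}&2\kappa\partial_s\alpha_2+\alpha_2\partial_s\kappa-\frac{S_4[Y]+S_2[V_0,Y]}{|Y_\rho|}-\frac{\kappa^2}{8|Y_\rho|^3}\bigl[|Y_\rho|^4(\partial_s\beta_0-\kappa^2)\bigr]_\rho\\&-\frac{(|Y_\rho|)_\rho\kappa}{4}\bigl(\partial_{ss}\kappa+\kappa^3+\beta_0\partial_s\kappa\bigr)-\tfrac14\partial_s\bigl[(\partial_s\kappa+\kappa\beta_0)^2\bigr],\end{aligned}$$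 and $V_2[Y]=\alpha_2\vec n+\beta_2\vec\tau$, where $$S_4[Y]=\frac{|Y_\rho|^3\kappa^3}{96}\bigl((|Y_\rho|)_\rho\kappa+2|Y_\rho|\kappa_\rho\bigr)+\frac{(|Y_\rho|)_{\rho\rho}\kappa}{48}\bigl((|Y_\rho|)_\rho\kappa+4|Y_\rho|\kappa_\rho\bigr)+\frac{(|Y_\rho|)_\rho\kappa_\rho}{24}\bigl(|Y_\rho|\kappa_\rho-(|Y_\rho|)_\rho\kappa\bigr),$$ $$\begin{aligned}S_2[u,Y]={}&-\Bigl(\frac{(|Y_\rho|)_\rho}{12}\partial_{ss}u+\frac{|Y_\rho|^2\kappa^2}{24}\partial_su\Bigr)_\rho\cdot\vec\tau+\bigl(\tfrac12(|Y_\rho|)_\rho\kappa+\tfrac16|Y_\rho|\kappa_\rho\bigr)(\partial_su)_\rho\cdot\vec n\\&+\tfrac16(\partial_su)_{\rho\rho}\cdot\vec\tau_\rho+\tfrac1{12}(\partial_su)_\rho\cdot\vec\tau_{\rho\rho}.\end{aligned}$$ **(Reg).** For a curve $Y$ evolving by $Y_t=V_0+h^2V_2$ with $V_i=\alpha_i\vec n+\beta_i\vec\tau$ (for $Y=Y^{[0]}$ the second-order coefficients $\alpha_2,\beta_2,V_2$ in (Reg) are taken to be zero): $Y,Y_t,Y_{tt},Y_{ttt}$ are continuous in time with values in $[W^{6,\infty}(I)]^2,[W^{6,\infty}(I)]^2,[W^{3,\infty}(I)]^2,[W^{2,\infty}(I)]^2$ respectively; $\alpha_0,\beta_0,\alpha_2,\beta_2\in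 C([0,T];H^3(I))\cap C^1([0,T];H^2(I))$; $\inf_{I\times[0,T]}|Y_\rho|\ge c>0$; and $$\sup_{0\le t\le T}\bigl(\|Y\|_{W^{6,\infty}(I)}+\|Y_t\|_{W^{6,\infty}(I)}+\|Y_{tt}\|_{W^{3,\infty}(I)}+\|Y_{ttt}\|_{W^{2,\infty}(I)}+\|V_2[Y]\|_{W^{3,\infty}(I)}\bigr)\le M .$$ *)

(* Defs.v *)
From HB Require Import structures.
From mathcomp Require Import all_boot all_order.
From mathcomp Require Import ssralg ssrnum ssrint interval zmodp matrix archimedean.
From mathcomp Require Import all_classical all_reals all_analysis.

Set Implicit Arguments.
Unset Strict Implicit.
Unset Printing Implicit Defensive.

Import Order.TTheory GRing.Theory Num.Theory.
Import numFieldNormedType.Exports.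

Local Open Scope ring_scope.
Local Open Scope classical_set_scope.

Section Plane.
Context {R : realType}.
Implicit Types u v : 'rV[R]_2.

Definition dotp u v : R := \sum_(i < 2) u 0 i * v 0 i.

(* `|v| on 'rV[R]_2 is the sup norm of the library, hence a separate
   Euclidean norm. *)
Definition enorm v : R := Num.sqrt (dotp v v).

(* clockwise rotation by pi/2: (v0, v1) |-> (v1, - v0) *)
Definition rot v : 'rV[R]_2 := \row_(i < 2) if i == 0 then v 0 1 else - v 0 0.

End Plane.

(* Functions on I = R/Z are 1-periodic functions on R. *)
Section Sobolev.
Context {R : realType}.
Implicit Types (f g phi : R -> R) (k : nat) (p : \bar R) (F G : R -> R -> R) (T t : R).

Let mu := @lebesgue_measure R.

Definition C1_periodic phi : Prop :=
  [/\ periodic phi 1, forall x, derivable phi x 1 & continuous phi^`()].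

(* Weak derivative on I, with C^1 test functions. *)
Definition weak_deriv f g : Prop :=
  forall phi, C1_periodic phi ->
    \int[mu]_(x in `[0, 1]) (f x * phi^`() x) =
    - \int[mu]_(x in `[0, 1]) (g x * phi x).

Definition Lp_norm p f : \bar R := 
  let f01 : R -> R := f \_ `[0, 1] in ('N[mu]_p[EFin \o f01])%E.

Definition weak_derivs k f (g : nat -> R -> R) : Prop :=
  [/\ g 0%N = f,
      forall i, (i <= k)%N -> mu.-integrable `[0, 1] (EFin \o g i) &
      forall i, (i < k)%N -> weak_deriv (g i) (g i.+1)].

(* The W^{k,p}(I) norm, sum of the L^p norms of the weak derivatives of order
   0, ..., k.  Those are unique almost everywhere, so the infimum is over at most
   one value; it is +oo if some weak derivative does not exist. *)
Definition sobolev_norm k p f : \bar R :=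
  ereal_inf [set (\sum_(i < k.+1) Lp_norm p (g i))%E | g in weak_derivs k f].

Definition sobolev_norm2 k p (v : R -> 'rV[R]_2) : \bar R :=
  (\sum_(i < 2) sobolev_norm k p (fun x => v x 0%R i))%E.

(* Membership in W^{k,p}(I) for k >= 1; an element is identified with its
   continuous representative. *)
Definition in_sobolev k p f : Prop :=
  [/\ periodic f 1, continuous f & (sobolev_norm k p f < +oo)%E].

(* F \in C([0, T]; W^{k,p}(I)), time being the first argument of F *)
Definition C0_sobolev T k p F : Prop :=
  forall t, 0 <= t <= T ->
    in_sobolev k p (F t) /\
    sobolev_norm k p (F s \- F t) @[s --> within `[0, T] (nbhs t)] --> 0%E.

Definition C0_sobolev2 T k p (Y : R -> R -> 'rV[R]_2) : Prop :=
  forall i : 'I_2, C0_sobolev T k p (fun t x => Y t x 0 i).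

(* G is the time derivative of F for the W^{k,p}(I) norm; within `[0, T]
   makes it one-sided at the end points. *)
Definition sobolev_tderiv T k p F G : Prop :=
  forall t, 0 <= t <= T ->
    sobolev_norm k p (fun x => (s - t)^-1 * (F s x - F t x) - G t x)
      @[s --> within `[0, T] t^'] --> 0%E.

(* F \in C^1([0, T]; W^{k,p}(I)) *)
Definition C1_sobolev T k p F : Prop :=
  C0_sobolev T k p F /\
  exists2 G, C0_sobolev T k p G & sobolev_tderiv T k p F G.

(* F \in C([0, T]; H^3(I)) /\ F \in C^1([0, T]; H^2(I)) *)
Definition coef_regular T F : Prop :=
  C0_sobolev T 3 2%:E F /\ C1_sobolev T 2 2%:E F.

(* Z = Y_t on [0, T], one-sided at the end points *)
Definition tderiv T (Y Z : R -> R -> 'rV[R]_2) : Prop :=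
  forall t, 0 <= t <= T -> forall x,
    (s - t)^-1 *: (Y s x - Y t x) @[s --> within `[0, T] t^'] --> Z t x.

End Sobolev.

Section Curves.
Context {R : realType}.
Implicit Types (Y u : R -> 'rV[R]_2) (b : R -> R) (x t : R).

Definition regular Y : Prop :=
  [/\ forall x, derivable Y x 1, continuous Y^`() & forall x, Y^`() x != 0].

Definition embedded Y : Prop := 
  forall x y, 0 <= x < 1 -> 0 <= y < 1 -> Y x = Y y -> x = y.

(* positive enclosed signed area *)
Definition counterclockwise Y : Prop :=
  0 < 2^-1 * \int[@lebesgue_measure R]_(x in `[0, 1])
                (Y x 0 0 * Y^`() x 0 1 - Y x 0 1 * Y^`() x 0 0).

Definition closed_curve Y : Prop :=
  [/\ periodic Y 1, regular Y, embedded Y & counterclockwise Y].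

Definition speed Y : R -> R := fun x => enorm (Y^`() x).

Definition ds Y (V : normedModType R) (f : R -> V) : R -> V :=
  fun x => (speed Y x)^-1 *: f^`() x.

Definition tau Y : R -> 'rV[R]_2 := fun x => (speed Y x)^-1 *: Y^`() x.

Definition nor Y : R -> 'rV[R]_2 := fun x => rot (tau Y x).

(* solves ds tau = - kappa n *)
Definition kappa Y : R -> R := fun x => - dotp (ds Y (tau Y) x) (nor Y x).

(* b is a periodic (classical) solution of (- d_ss + kappa^2) b = rhs *)
Definition periodic_solution Y (rhs b : R -> R) : Prop :=
  [/\ periodic b 1, forall x, derivable b x 1, forall x, derivable b^`() x 1 &
      forall x, - ds Y (ds Y b) x + kappa Y x ^+ 2 * b x = rhs x].

Definition alpha0 Y : R -> R := fun x => - kappa Y x.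

Definition is_beta0 Y b : Prop :=
  periodic_solution Y
    (fun x => 4^-1 * (speed Y)^`() x * kappa Y x ^+ 2
              - 3 * kappa Y x * ds Y (kappa Y) x) b.

Definition velocity Y (a b : R -> R) : R -> 'rV[R]_2 :=
  fun x => a x *: nor Y x + b x *: tau Y x.

Definition V0 Y b0 := velocity Y (alpha0 Y) b0.

Definition alpha2 Y b0 : R -> R := fun x =>
  let q := speed Y x in let q' := (speed Y)^`() x in
  let k := kappa Y x in let k' := (kappa Y)^`() x in
  - 2^-1 * ds Y (ds Y (kappa Y)) x + 3 / 2 * k ^+ 3
  - 2 * k * ds Y b0 x + 2^-1 * k * b0 x ^+ 2
  - 12^-1 * (kappa Y)^`(2) x - q' / (4 * q) * k'
  - 4^-1 * q ^+ 2 * k ^+ 3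
  - (2^-1 * q' * k + 6^-1 * q * k') * b0 x.

Definition S4 Y : R -> R := fun x =>
  let q := speed Y x in let q' := (speed Y)^`() x in
  let q'' := (speed Y)^`(2) x in
  let k := kappa Y x in let k' := (kappa Y)^`() x in
  q ^+ 3 * k ^+ 3 / 96 * (q' * k + 2 * q * k')
  + q'' * k / 48 * (q' * k + 4 * q * k')
  + q' * k' / 24 * (q * k' - q' * k).

Definition S2 u Y : R -> R := fun x =>
  let q := speed Y x in let q' := (speed Y)^`() x in
  let k := kappa Y x in let k' := (kappa Y)^`() x in
  - dotp ((fun y : R => ((speed Y)^`() y / 12) *: ds Y (ds Y u) y
             + (speed Y y ^+ 2 * kappa Y y ^+ 2 / 24) *: ds Y u y)^`() x)
         (tau Y x)
  + (2^-1 * q' * k + 6^-1 * q * k') * dotp ((ds Y u)^`() x) (nor Y x)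
  + 6^-1 * dotp ((ds Y u)^`(2) x) ((tau Y)^`() x)
  + 12^-1 * dotp ((ds Y u)^`() x) ((tau Y)^`(2) x).

Definition is_beta2 Y b0 b : Prop :=
  periodic_solution Y
    (fun x =>
       let q := speed Y x in let q' := (speed Y)^`() x in
       let k := kappa Y x in let dk := ds Y (kappa Y) x in
       2 * k * ds Y (alpha2 Y b0) x + alpha2 Y b0 x * dk
       - (S4 Y x + S2 (V0 Y b0) Y x) / q
       - k ^+ 2 / (8 * q ^+ 3)
         * (fun y : R => speed Y y ^+ 4
                         * (ds Y b0 y - kappa Y y ^+ 2))^`() x
       - q' * k / 4 * (ds Y (ds Y (kappa Y)) x + k ^+ 3 + b0 x * dk)
       - 4^-1 * ds Y (fun y : R => (ds Y (kappa Y) y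
                                    + kappa Y y * b0 y) ^+ 2 : R) x) b.

Definition V2 Y b0 b2 := velocity Y (alpha2 Y b0) b2.

(* The regularity assumptions (Reg) with the constants c and M, for the
   coefficients a0, b0, a2, b2 of the normal and tangential velocities. *)
Definition curve_reg (T c M : R) (Y : R -> R -> 'rV[R]_2)
    (a0 b0 a2 b2 : R -> R -> R) : Prop :=
  exists Yt Ytt Yttt : R -> R -> 'rV[R]_2,
  [/\ [/\ tderiv T Y Yt, tderiv T Yt Ytt & tderiv T Ytt Yttt],
      [/\ C0_sobolev2 T 6 +oo%E Y, C0_sobolev2 T 6 +oo%E Yt,
          C0_sobolev2 T 3 +oo%E Ytt & C0_sobolev2 T 2 +oo%E Yttt],
      [/\ coef_regular T a0, coef_regular T b0,
          coef_regular T a2 & coef_regular T b2],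
      (forall t x, 0 <= t <= T -> c <= speed (Y t) x) &
      (forall t, 0 <= t <= T ->
        (sobolev_norm2 6 +oo (Y t) + sobolev_norm2 6 +oo (Yt t)
         + sobolev_norm2 3 +oo (Ytt t) + sobolev_norm2 2 +oo (Yttt t)
         + sobolev_norm2 3 +oo (velocity (Y t) (a2 t) (b2 t)) <= M%:E)%E)].

End Curves.

Section Grid.
Context {R : realType}.
Variable J : nat.
Implicit Types (Z v w phi : R -> 'rV[R]_2) (b : R -> R).

Definition mesh : R := J%:R^-1.

Definition node (j : int) : R := j%:~R * mesh.

Definition in_Sh b : Prop :=
  [/\ continuous b, periodic b 1 &
      forall j : int, exists p q : R, forall x,
        node (j - 1) < x < node j -> b x = p + q * x].

Definition in_Sh2 phi : Prop := forall i : 'I_2, in_Sh (fun x => phi x 0 i).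

(* The piecewise affine function with the value g j at node j. *)
Definition interp (V : lmodType R) (g : int -> V) : R -> V := fun x =>
  let j := Num.floor (x / mesh) in
  let th := x / mesh - j%:~R in
  (1 - th) *: g j + th *: g (j + 1).

Definition norm0h b : R :=
  Num.sqrt (mesh * \sum_(1 <= j < J.+1) `|b (node j)| ^+ 2).

Definition norm0h2 phi : R :=
  Num.sqrt (mesh * \sum_(1 <= j < J.+1) enorm (phi (node j)) ^+ 2).

Definition edge Z (j : int) : 'rV[R]_2 := Z (node j) - Z (node (j - 1)).

Definition Ttilde Z (j : int) : 'rV[R]_2 :=
  (enorm (edge Z j) + enorm (edge Z (j + 1)))^-1
    *: (edge Z j + edge Z (j + 1)).

Definition Ntilde Z (j : int) : 'rV[R]_2 := rot (Ttilde Z j).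

Definition Th Z (j : int) : 'rV[R]_2 :=
  (enorm (Ttilde Z j))^-1 *: Ttilde Z j.

Definition mform Z v w : R :=
  2^-1 * \sum_(1 <= j < J.+1)
    (enorm (edge Z j) + enorm (edge Z (j%:Z + 1)))
    * dotp (v (node j)) (Ntilde Z j) * dotp (w (node j)) (Ntilde Z j).

Definition aform Z v w : R :=
  \sum_(1 <= j < J.+1)
    (enorm (edge Z j))^-1 * dotp (edge v j) (edge w j).

Definition defect (Y : R -> R -> 'rV[R]_2) (t : R) phi : R :=
  let vh := interp (fun j => (mesh ^+ 2)^-1
              *: (Y (t + mesh ^+ 2) (node j) - Y t (node j))) in
  let Yh := interp (fun j => Y t (node j)) in
  mform Yh vh phi + aform Yh Yh phi + mesh ^+ 2 * aform Yh vh phi.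

(* I_h [b T_h [I_h Y]] *)
Definition tangential b Y : R -> 'rV[R]_2 :=
  let Yh := interp (fun j => Y (node j)) in
  interp (fun j => b (node j) *: Th Yh j).

End Grid.
Arguments mesh {R} J.

(* Main.v *)
From Pilot Require Import Defs.
From HB Require Import structures.
From mathcomp Require Import all_boot all_order all_algebra.
From mathcomp Require Import all_classical all_reals all_analysis.
From mathcomp Require Import measurable_realfun ess_sup_inf.
From mathcomp Require Import ring lra.
Import Pilot.Defs.
Set Implicit Arguments.
Unset Strict Implicit.
Unset Printing Implicit Defensive.
Import Order.TTheory GRing.Theory Num.Theory.
Import numFieldNormedType.Exports.
Local Open Scope ring_scope.
Local Open Scope classical_set_scope.

(** Testing at a single node turns the defect there into a vector D_j of the plane.
Let E_j be the sum of the two difference quotients at that node, which is parallel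
to T_h. The products D_j . E_j and D_j . R E_j are combinations of jumps between the
two edges at the node, and these two edges are exchanged by changing the sign of the
step; hence only even powers of h survive, and the bounds of order h^2, h^4, h^6
follow once the coefficients below these orders vanish. In the normal direction the
latter are the definitions of alpha_0 and alpha_2, in the tangential direction the
equations for beta_0 and beta_2. The time difference quotient brings in Y_tt, of which
only R tau . Y_tt and a combination of tau . Y_tt' and tau . Y_tt'' enter. They are found
by comparing the equations of the flow at the times t and t + h^2: all quantities in
these equations change by O(h^2), which replaces elliptic estimates for the time
derivatives of beta_0 and beta_2. *)

(** * Weak derivatives and Sobolev bounds *)

(** All constants have to be independent of the mesh, the time and the node. The estimates are
    therefore proved for families: one index collects mesh and time, another one also the node, and
    each class of functions ([CL], [bdd], [Ex], [CS]) carries a bound uniform over its index.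
    Limited regularity shapes the proof in three places. Time derivatives are given only pointwise
    in space, so space derivatives of time differences are controlled through finite differences in
    space. V2 is bounded in W^{3,infinity}, and reading the equations for alpha_2 and beta_2
    backwards gains one derivative of kappa and one of beta_2. Y_tt is bounded only in
    W^{3,infinity}, one order short of the tangential bound h^6; the missing coefficient comes from
    the relation for tau . Y_tt'', whose right side is smoother. The algebraic identities hold
    exactly for the velocity V0; the passage to V0 + h^2 V2 costs O(h^2) and is a perturbation. The
    products at a node are of order h^3 and h^5 for the first flow, h^5 and h^7 for the second, and
    summation over 1/h nodes loses one power. *)

Section Calculus.
Context {R : realType}.
Implicit Types (f g h phi : R -> R).

Lemma is_derive_continuous f g (x : R) : is_derive x 1 f (g x) -> {for x, continuous f}.
Proof. by case=> df _; apply/differentiable_continuous/derivable1_diffP. Qed.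

Lemma is_derive_mvt f g (a b : R) : (forall x : R, is_derive x 1 f (g x)) ->
  exists c, [/\ Num.min a b <= c, c <= Num.max a b & f b - f a = g c * (b - a)].
Proof.
move=> fg; have cf : continuous f by move=> x; exact: is_derive_continuous (fg x).
have [ab|ba] := leP a b.
  have [c] := MVT_segment ab (fun (x : R) _ => fg x) (continuous_subspaceT cf).
  by rewrite in_itv/= => /andP[ac cb] E; exists c; split.
have [c] := MVT_segment (ltW ba) (fun (x : R) _ => fg x) (continuous_subspaceT cf).
rewrite in_itv/= => /andP[ac cb] E; exists c; split => //.
by rewrite -opprB E -mulrN opprB.
Qed.

Lemma is_derive_const_fun f : (forall x : R, is_derive x 1 f (0 : R)) ->
  forall x y, f x = f y.
Proof.
move=> f0 x y; have [c [_ _]] := is_derive_mvt y x f0.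
by rewrite mul0r => /eqP; rewrite subr_eq0 => /eqP.
Qed.

Lemma is_derive_lip f g (K : R) : (forall x : R, is_derive x 1 f (g x)) ->
  (forall x, `|g x| <= K) -> forall x y, `|f x - f y| <= K * `|x - y|.
Proof.
move=> fg gK x y; have [c [_ _ ->]] := is_derive_mvt y x fg.
by rewrite normrM ler_wpM2r.
Qed.

Lemma lipschitz_continuous f (K : R) : (forall x y, `|f x - f y| <= K * `|x - y|) ->
  continuous f.
Proof.
move=> fK x; apply/cvgrPdist_lt => e e0; near=> y.
apply: le_lt_trans (fK _ _) _.
have K1 : K <= `|K| + 1 by rewrite (le_trans (ler_norm _))// lerDl.
apply: le_lt_trans (ler_wpM2r _ K1) _ => //.
have p : 0 < `|K| + 1 by rewrite ltr_wpDl.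
rewrite mulrC -ltr_pdivlMr//; near: y.
by apply/nbhs_ballP; exists (e / (`|K| + 1)) => //=; exact: divr_gt0.
Unshelve. all: by end_near. Qed.

Lemma periodic_int f : periodic f 1 -> forall (n : int) x, f (x + n%:~R) = f x.
Proof.
move=> pf; have pn (n : nat) x : f (x + n%:R) = f x by exact: (periodicn pf n x).
move=> [n|n] x; first by rewrite -[n%:~R]/(n%:R) pn.
by rewrite NegzE mulrNz -pmulrn -[in RHS](subrK n.+1%:R x) pn.
Qed.

Lemma periodic_ball f (Q : R -> Prop) : periodic f 1 ->
  (forall x, 0 <= x <= 1 -> Q (f x)) -> forall x, Q (f x).
Proof.
move=> pf fQ x; rewrite -(periodic_int pf (- Num.floor x) x); apply: fQ.
have /andP[] := floor_itv x.
rewrite mulrNz; rewrite intrD => ? ?; apply/andP; split; lra.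
Qed.

Let mu := @lebesgue_measure R.
Definition int01 f : R := \int[mu]_(x in `[0, 1]) f x.

Lemma continuous_integrable f (a b : R) : continuous f ->
  mu.-integrable `[a, b] (EFin \o f).
Proof.
move=> cf; apply: continuous_compact_integrable; first exact: segment_compact.
exact: continuous_subspaceT.
Qed.

Lemma is_derive_oo f g (a b : R) : (forall x : R, is_derive x 1 f (g x)) ->
  derivable_oo_LRcontinuous f a b /\ {in `]a, b[%R, f^`() =1 g}.
Proof.
move=> fg; have cf : continuous f by move=> x; exact: is_derive_continuous (fg x).
split; first split.
- by move=> x _; case: (fg x).
- exact/cvg_at_right_filter/cf.
- exact/cvg_at_left_filter/cf.
- by move=> x _; rewrite derive1E; apply: derive_val.
Qed.

Lemma int_derive f g (a b : R) : a < b -> (forall x : R, is_derive x 1 f (g x)) ->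
  continuous g -> \int[mu]_(x in `[a, b]) g x = f b - f a.
Proof.
move=> ab fg cg; have [df fE] := is_derive_oo a b fg.
by rewrite /Rintegral (continuous_FTC2 ab (continuous_subspaceT cg) df fE).
Qed.

Lemma int01_by_parts f f' g g' : (forall x : R, is_derive x 1 f (f' x)) -> continuous f' ->
  (forall x : R, is_derive x 1 g (g' x)) -> continuous g' ->
  int01 (fun x => f x * g' x) = f 1 * g 1 - f 0 * g 0 - int01 (fun x => f' x * g x).
Proof.
move=> ff cf gg cg; have [? ?] := is_derive_oo 0 1 ff; have [? ?] := is_derive_oo 0 1 gg.
by apply: Rintegration_by_parts => //; exact: continuous_subspaceT.
Qed.

Lemma is_derive0_const f (a b : R) : a <= b ->
  (forall y : R, a <= y <= b -> is_derive y 1 f (0 : R)) -> f b = f a.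
Proof.
move=> ab df.
have d0 (y : R) : y \in `]a, b[%R -> is_derive y 1 f ((fun=> 0 : R) y).
  by rewrite in_itv/= => /andP[/ltW ay /ltW yb]; apply: df; rewrite ay.
have cf : {within `[a, b], continuous f}.
  apply: derivable_within_continuous => y.
  by rewrite in_itv/= => /df[].
have [c _] := MVT_segment ab d0 cf.
by rewrite mul0r => /eqP; rewrite subr_eq0 => /eqP.
Qed.

(** The fundamental theorem of calculus yields a primitive on one bounded interval at a time; [A n]
    is the one on (-n, n). Two of them agree where both are defined, having the same derivative and
    the same value at 0, so letting n depend on x does no harm. *)
Lemma primitive_glue (A : nat -> R -> R) g : (forall n, A n 0 = 0) ->
  (forall n (x : R), `|x| < n%:R -> is_derive x 1 (A n) (g x)) ->
  exists f, f 0 = 0 /\ forall x : R, is_derive x 1 f (g x).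
Proof.
move=> A0 dA.
have AA n m (x : R) : `|x| < n%:R -> `|x| < m%:R -> A n x = A m x.
  move=> xn xm.
  have dx (y : R) : `|y| <= `|x| -> is_derive y 1 (A n - A m) (0 : R).
    move=> yx; rewrite -[0](subrr (g y)); apply: is_deriveB; apply: dA.
      exact: le_lt_trans xn.
    exact: le_lt_trans xm.
  suff : (A n - A m) x = (A n - A m) 0.
    by rewrite -![(A n - A m) _]/(A n _ - A m _) !A0 subrr => /eqP; rewrite subr_eq0 => /eqP.
  have [x0|x0] := leP 0 x.
    apply: (is_derive0_const x0) => y /andP[y0 yx].
    by apply: dx; rewrite (ger0_norm y0) (ger0_norm x0).
  apply/esym; apply: (is_derive0_const (ltW x0)) => y /andP[y0 yx].
  by apply: dx; rewrite (ler0_norm yx) (ltr0_norm x0) lerN2.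
pose N (x : R) := (Num.truncn `|x|).+1.
have NP x : `|x| < (N x)%:R by rewrite truncnS_gt.
exists (fun x => A (N x) x); split; first by rewrite A0.
move=> x; have h := dA (N x) x (NP x).
apply: (near_eq_is_derive _ h); near=> y; apply: AA; last exact: NP.
near: y; have : 0 < (N x)%:R - `|x| by rewrite subr_gt0.
move=> e0; apply/nbhs_ballP; exists ((N x)%:R - `|x|) => //= y.
rewrite /ball/= distrC => xy.
have := ler_normD (y - x) x; rewrite subrK; lra.
Unshelve. all: by end_near. Qed.

Lemma primitive g : continuous g ->
  exists f, f 0 = 0 /\ forall x : R, is_derive x 1 f (g x).
Proof.
move=> cg; apply: (@primitive_glue (fun n x => \int[mu]_(t in `[- n%:R, x]) g t
   - \int[mu]_(t in `[- n%:R, 0]) g t)) => [n|n x]; first by rewrite subrr.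
rewrite ltr_norml => /andP[nx xn].
have [d1 d2] := continuous_FTC1_closed xn
  (continuous_integrable (- n%:R) n%:R cg) nx (cg x).
rewrite -[g x]subr0; apply: is_deriveB.
by split; [exact: d1|rewrite -derive1E; exact: d2].
Qed.

End Calculus.

(** * Integrals over one period, and integration by parts with an integrable factor *)

Section WeakDerivatives.
Context {R : realType}.
Implicit Types (f g h phi psi : R -> R).
Let mu := @lebesgue_measure R.

Definition int01_able f := mu.-integrable `[0, 1] (EFin \o f).

Lemma mu01 : mu `[0, 1] = 1%E.
Proof. by rewrite /mu lebesgue_measure_itv/= lte_fin ltr01 oppr0 adde0. Qed.

Lemma continuous_bounded01 f : continuous f ->
  exists B, 0 < B /\ forall x, 0 <= x <= 1 -> `|f x| <= B.
Proof.
move=> cf; have cn : {within `[0, 1], continuous (fun x => `|f x|)}.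
  by apply: continuous_subspaceT => x; apply: continuous_comp; [exact: cf|exact: norm_continuous].
have [c _ cP] := EVT_max ler01 cn.
exists (`|f c| + 1); split; first by rewrite ltr_wpDl.
by move=> x xI; rewrite (le_trans (cP x _)) ?lerDl// in_itv.
Qed.

Lemma int01_ableM f psi : int01_able f -> continuous psi ->
  int01_able (fun x => f x * psi x).
Proof.
move=> fi cpsi.
have := @integrableMl _ _ _ mu `[0, 1] _ (EFin \o f) psi fi.
rewrite /int01_able; apply => //.
  exact: measurable_funTS (continuous_measurable_fun cpsi).
have [B [B0 BP]] := continuous_bounded01 cpsi.
exists B; split; first exact: num_real.
by move=> x Bx y /=; rewrite in_itv/= => /BP yB; exact: le_trans yB (ltW Bx).
Qed.

Lemma int01_able_continuous f : continuous f -> int01_able f.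
Proof. exact: continuous_integrable. Qed.

Lemma int01_ableB f g : int01_able f -> int01_able g -> int01_able (fun x => f x - g x).
Proof. by move=> fi gi; exact: integrableB fi gi. Qed.

Lemma int01_ableZ f c : int01_able f -> int01_able (fun x => c * f x).
Proof. by move=> fi; apply: (integrableZl _ c fi). Qed.

Lemma int01B f g : int01_able f -> int01_able g ->
  int01 (fun x => f x - g x) = int01 f - int01 g.
Proof. by move=> fi gi; apply: RintegralB. Qed.

Lemma int01D f g : int01_able f -> int01_able g ->
  int01 (fun x => f x + g x) = int01 f + int01 g.
Proof. by move=> fi gi; apply: RintegralD. Qed.

Lemma int01Z c f : int01_able f -> int01 (fun x => c * f x) = c * int01 f.
Proof. by move=> fi; apply: RintegralZl. Qed.

Lemma int01_cst c : int01 (fun _ : R => c) = c.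
Proof. by rewrite /int01 Rintegral_cst// [X in fine X]mu01 mulr1. Qed.

Lemma eq_int01 f g : (forall x, 0 <= x <= 1 -> f x = g x) -> int01 f = int01 g.
Proof. by move=> fg; apply: eq_Rintegral => x; rewrite inE/= in_itv/=; exact: fg. Qed.

Lemma int01_able_norm f : int01_able f -> int01_able (fun x => `|f x|).
Proof. by move=> fi; exact: (integrable_norm fi). Qed.

Lemma int01_norm_le f psi B : int01_able f -> continuous psi ->
  (forall x, 0 <= x <= 1 -> `|psi x| <= B) ->
  `|int01 (fun x => f x * psi x)| <= B * int01 (fun x => `|f x|).
Proof.
move=> fi cpsi psiB; apply: (le_trans (le_normr_Rintegral _ (int01_ableM fi cpsi))) => //.
rewrite -int01Z; last exact: int01_able_norm.
apply: le_Rintegral => //.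
- exact/int01_able_norm/int01_ableM.
- exact/int01_ableZ/int01_able_norm.
- by move=> x; rewrite /= in_itv/= => xI; rewrite normrM mulrC ler_wpM2r// psiB.
Qed.

Lemma int_norm_le01 f (x : R) : int01_able f -> 0 <= x <= 1 ->
  `|\int[mu]_(t in `[0, x]) f t| <= int01 (fun x => `|f x|).
Proof.
move=> fi /andP[x0 x1].
have sub : `[0, x] `<=` (`[0, 1] : set R) by apply: subset_itvl; rewrite bnd_simp.
have fix_ : mu.-integrable `[0, x] (EFin \o f) by exact: integrableS fi.
apply: (le_trans (le_normr_Rintegral _ fix_)) => //.
have H := int01_able_norm fi.
rewrite /int01 /Rintegral fine_le//.
- apply: integrable_fin_num => //; exact: integrableS H.
- exact: integrable_fin_num.
- by apply: ge0_subset_integral => //; case/integrableP: H.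
Qed.

Lemma int01_approx f e : int01_able f -> 0 < e ->
  exists k, continuous k /\ int01 (fun x => `|f x - k x|) <= e.
Proof.
move=> fi e0; have [] := @approximation_continuous_integrable R `[0, 1] f _ _ fi => //.
  by rewrite [X in (X < _)%E]mu01 ltry.
move=> k [ck ki kcvg].
have /fine_cvgP[_ /cvgrPdist_le /(_ _ e0)[N _ /(_ N (leqnn N))]] := kcvg.
rewrite /= sub0r normrN => h; exists (k N); split; first exact: ck.
apply: le_trans h; rewrite /int01 /Rintegral; exact: ler_norm.
Qed.

(** For continuous g this is ordinary integration by parts. The general case follows by
    approximation in L^1, since every term depends on g continuously in the L^1 norm, with constants
    given by bounds of phi and phi'. *)
Lemma int01_by_parts_ae g phi phi' : int01_able g ->
  (forall x : R, is_derive x 1 phi (phi' x)) -> continuous phi' ->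
  int01 (fun x => (\int[mu]_(t in `[0, x]) g t) * phi' x)
  = int01 g * phi 1 - int01 (fun x => g x * phi x).
Proof.
move=> gi dphi cphi'.
have cphi : continuous phi by move=> x; exact: is_derive_continuous (dphi x).
have [B1 [B10 B1P]] := continuous_bounded01 cphi.
have [B2 [B20 B2P]] := continuous_bounded01 cphi'.
pose G x := \int[mu]_(t in `[0, x]) g t.
apply/eqP; rewrite -subr_eq0 -normr_eq0; apply/negPn/negP => /eqP.
rewrite -/(G _); set L := `|_|; move=> L0.
have {}L0 : 0 < L by rewrite lt_neqAle eq_sym normr_ge0 andbT; apply/eqP.
(* The three errors of the approximation are at most B2 e, B1 e and B1 e; this choice makes their
   sum L / 2, which contradicts that the discrepancy L is positive. *)
pose e := L / (2 * (B1 + B1 + B2)).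
have BB : 0 < B1 + B1 + B2 by lra.
have e0 : 0 < e by rewrite divr_gt0// mulr_gt0.
have [k [ck ke]] := int01_approx gi e0.
have [K [K0 dK]] := primitive ck.
have cK : continuous K by move=> x; exact: is_derive_continuous (dK x).
have KE x : 0 <= x -> K x = \int[mu]_(t in `[0, x]) k t.
  rewrite le_eqVlt => /predU1P[<-|x0]; first by rewrite set_itv1 Rintegral_set1.
  by rewrite (int_derive x0 dK ck) K0 subr0.
have ki := int01_able_continuous ck.
have gki := int01_ableB gi ki.
have GK x : 0 <= x <= 1 -> `|G x - K x| <= e.
  move=> xI; rewrite KE; last by case/andP: xI.
  have sub : `[0, x] `<=` (`[0, 1] : set R).
    by apply: subset_itvl; rewrite bnd_simp; case/andP: xI.
  rewrite -RintegralB//; [|exact: integrableS gi|exact: integrableS ki].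
  by apply: le_trans ke; exact: int_norm_le01.
have Gc : {within `[0, 1], continuous G} by exact: parameterized_integral_continuous.
have Gm : mu.-integrable `[0, 1] (EFin \o G).
  by apply: continuous_compact_integrable => //; exact: segment_compact.
have := int01_by_parts dK ck dphi cphi'; rewrite K0 mul0r subr0 => IBP.
have E1 : `|int01 (fun x => (G x - K x) * phi' x)| <= B2 * e.
  have GKi := int01_ableB Gm (int01_able_continuous cK).
  apply: le_trans (int01_norm_le GKi cphi' B2P) _.
  rewrite ler_pM2l// -[leRHS]int01_cst.
  apply: le_Rintegral => [//|||x].
  - exact: int01_able_norm.
  - by apply: int01_able_continuous => x; exact: cvg_cst.
  - by rewrite /= in_itv/=; exact: GK.
have E2 : `|int01 (fun x => (g x - k x) * phi x)| <= B1 * e.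
  by apply: le_trans (int01_norm_le gki cphi B1P) _; rewrite ler_pM2l.
have E3 : `|(int01 g - K 1) * phi 1| <= e * B1.
  rewrite normrM ler_pM ?B1P ?lexx ?ler01//.
  have -> : int01 g = G 1 by [].
  by apply: GK; rewrite ler01 lexx.
have D1 : int01 (fun x => (G x - K x) * phi' x)
   = int01 (fun x => G x * phi' x) - int01 (fun x => K x * phi' x).
  rewrite -int01B; [|exact: int01_ableM|exact/int01_ableM/cphi'/int01_able_continuous].
  by apply: eq_int01 => x _; rewrite mulrBl.
have D2 : int01 (fun x => (g x - k x) * phi x)
   = int01 (fun x => g x * phi x) - int01 (fun x => k x * phi x).
  rewrite -int01B; [|exact: int01_ableM|exact/int01_ableM/cphi/int01_able_continuous].
  by apply: eq_int01 => x _; rewrite mulrBl.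
have LE : L <= B2 * e + B1 * e + e * B1.
  have -> : L = `|int01 (fun x => (G x - K x) * phi' x)
     + int01 (fun x => (g x - k x) * phi x) - (int01 g - K 1) * phi 1|.
    rewrite D1 D2 IBP /L; congr `|_|.
    move: (int01 (fun x : R => G x * phi' x)) (int01 (fun x => g x * phi x))
      (int01 (fun x => k x * phi x)) (int01 g) => a b c d; clear; ring.
  apply: le_trans (ler_normB _ _) _; apply: lerD => //.
  by apply: le_trans (ler_normD _ _) _; apply: lerD.
have eE : (B1 + B1 + B2) * e = L / 2 by rewrite /e; field; apply/eqP; lra.
move: LE eE L0; clear; move: L e => L e; lra.
Qed.

End WeakDerivatives.

(** * Lipschitz representatives of W^{k,infinity} functions on the circle *)

Section SobolevRegularity.
Context {R : realType}.
Implicit Types (f g h phi psi : R -> R).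
Let mu := @lebesgue_measure R.

Lemma int_ae_le g K (x y : R) : int01_able g -> 0 <= x -> x <= y -> y <= 1 ->
  {ae mu, forall x, `[0, 1] x -> `|g x| <= K} ->
  `|(\int[mu]_(t in `[0, y]) g t) - \int[mu]_(t in `[0, x]) g t| <= K * (y - x).
Proof.
move=> gi x0 xy y1 gK.
have suby : `[0, y] `<=` (`[0, 1] : set R) by apply: subset_itvl; rewrite bnd_simp.
have subxy : `]x, y] `<=` (`[0, 1] : set R).
  by move=> t; rewrite /= !in_itv/= => /andP[xt ty]; rewrite (le_trans x0 (ltW xt)) (le_trans ty y1).
have giy : mu.-integrable `[0, y] (EFin \o g) by exact: integrableS gi.
have gixy : mu.-integrable `]x, y] (EFin \o g) by exact: integrableS gi.
rewrite Rintegral_itvB ?bnd_simp//.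
apply: (le_trans (le_normr_Rintegral _ gixy)) => //.
have cK : mu.-integrable `]x, y] (EFin \o fun=> K).
  have : int01_able (fun _ : R => K) by apply: int01_able_continuous => z; exact: cvg_cst.
  by move=> H; exact: integrableS H.
have KE : \int[mu]_(t in `]x, y]) K = K * (y - x).
  rewrite Rintegral_cst//; congr (_ * _).
  rewrite [X in fine X](_ : _ = mu `]x, y])// /mu lebesgue_measure_itv/= lte_fin.
  by move: xy; rewrite le_eqVlt => /predU1P[->|xy]; rewrite ?ltxx ?subrr ?xy.
rewrite -KE; case: (ltrP x y) => [xlty|yx]; last first.
  by rewrite set_itv_ge ?Rintegral_set0// bnd_simp -leNgt.
(* A negative K would make [0, 1] a null set. *)
have K0 : 0 <= K.
  rewrite leNgt; apply/negP => K0.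
  have : mu `[0, 1] = 0%E.
    apply/eqP; rewrite eq_le measure_ge0 andbT.
    case: gK => N [mN N0 sN]; rewrite -N0; apply: le_measure; rewrite ?inE//.
    by move=> t t01; apply: sN => /= /(_ t01) /(le_trans (normr_ge0 _)); rewrite leNgt K0.
  by rewrite [mu _]mu01 => -[] /eqP; rewrite oner_eq0.
rewrite /Rintegral fine_le//.
- by apply: integrable_fin_num => //; exact: integrable_norm gixy.
- exact: integrable_fin_num.
- apply: ae_ge0_le_integral => //.
  + by case/integrableP: (integrable_norm gixy).
  + apply: (@filterS _ _ (ae_filter_ringOfSetsType mu) _ _ _ gK).
    by move=> t tK txy; rewrite lee_fin; apply: tK; exact: subxy.
Qed.

(** Between points of different periods the estimate passes through the period ends: one piece runs
    from x to the end of its period, the other from the start of the period of y to y, and their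
    lengths add up to at most y - x. *)
Lemma lip_periodize H (K : R) : H 0 = H 1 ->
  (forall x y, 0 <= x -> x <= y -> y <= 1 -> `|H y - H x| <= K * (y - x)) ->
  exists h, [/\ periodic h 1, (forall x, 0 <= x <= 1 -> h x = H x) &
    forall x y, `|h x - h y| <= K * `|x - y|].
Proof.
move=> H01 HK; pose h x := H (x - (Num.floor x)%:~R); exists h.
have fl (x : R) : 0 <= x - (Num.floor x)%:~R < 1.
  by have /andP[] := floor_itv x; rewrite intrD => ? ?; apply/andP; split; lra.
have K0 : 0 <= K.
  have := HK 0 1 (lexx _) ler01 (lexx _); rewrite subr0 mulr1; exact: le_trans.
split.
- move=> x; rewrite /h -[1]/(1%:~R) floorDrz ?intr_int// intrD; congr H.
  by rewrite intrKfloor; lra.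
- move=> x /andP[x0]; rewrite le_eqVlt => /predU1P[->|x1].
    by rewrite /h floor1 subrr.
  rewrite /h (_ : Num.floor x = 0) ?subr0//.
  by apply/eqP; rewrite floor_eq x0.
- have wlg x y : x <= y -> `|h x - h y| <= K * `|x - y|.
    move=> xy; rewrite distrC (distrC x) (ger0_norm (x := y - x)) ?subr_ge0//.
    have := le_floor xy; rewrite le_eqVlt => /predU1P[E|E].
      have /andP[a1 a2] := fl x; have /andP[b1 b2] := fl y; rewrite /h.
      rewrite -E in b1 b2 *; have := HK _ _ a1 _ (ltW b2).
      by rewrite lerD2r opprB addrA subrK; exact.
    have {}E : (Num.floor x)%:~R + 1 <= (Num.floor y)%:~R :> R.
      by rewrite -[1]/(1%:~R) -intrD ler_int; rewrite lezD1.
    have /andP[a1 a2] := fl x; have /andP[b1 b2] := fl y.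
    have Hx := HK _ _ a1 (ltW a2) (lexx _).
    have Hy := HK _ _ (lexx _) b1 (ltW b2).
    rewrite /h; rewrite -H01 in Hx.
    have -> : H (y - (Num.floor y)%:~R) - H (x - (Num.floor x)%:~R)
       = (H (y - (Num.floor y)%:~R) - H 0) + (H 0 - H (x - (Num.floor x)%:~R)) by ring.
    apply: (le_trans (ler_normD _ _)); apply: le_trans (lerD Hy Hx) _.
    rewrite -mulrDr ler_wpM2l//; lra.
  move=> x y; case: (leP x y) => [|/ltW] xy; first exact: wlg.
  by rewrite distrC (distrC x); exact: wlg.
Qed.

Lemma derive1_is f g : (forall x : R, is_derive x 1 f (g x)) -> derive1 f = g.
Proof. by move=> fg; apply/funext => x; rewrite derive1E; apply: derive_val. Qed.

Lemma is_derive_der f : (forall x : R, derivable f x 1) ->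
  forall x : R, is_derive x 1 f (derive1 f x).
Proof. by move=> df x; split; [exact: df|rewrite derive1E]. Qed.

(** The primitive of g is Lipschitz because g is essentially bounded, and it closes up periodically
    because g has mean zero. *)
Lemma weak_top g K : int01_able g ->
  {ae mu, forall x, `[0, 1] x -> `|g x| <= K} -> int01 g = 0 ->
  exists h, [/\ periodic h 1, (forall x y, `|h x - h y| <= K * `|x - y|) &
    forall phi, C1_periodic phi ->
      int01 (fun x => h x * derive1 phi x) = - int01 (fun x => g x * phi x)].
Proof.
move=> gi gK g0; pose H x := \int[mu]_(t in `[0, x]) g t.
have [||h [ph hH hK]] := @lip_periodize H K.
- by rewrite [RHS]g0 /H set_itv1 Rintegral_set1.
- by move=> x y x0 xy y1; exact: int_ae_le.
exists h; split => // phi [pphi dphi cphi].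
have := int01_by_parts_ae gi (is_derive_der dphi) cphi.
rewrite g0 mul0r sub0r => <-.
by apply: eq_int01 => x xI; rewrite hH.
Qed.

Lemma primitive_periodic g : continuous g -> periodic g 1 -> int01 g = 0 ->
  exists f, C1_periodic f /\ forall x : R, is_derive x 1 f (g x).
Proof.
move=> cg pg g0; have [f [f0 fg]] := primitive cg; exists f; split => //.
have f1 : f 1 = 0.
  by rewrite -[RHS]g0 /int01 (int_derive ltr01 fg cg) f0 subr0.
split.
- have sh (x : R) : is_derive x 1 (fun x => f (x + 1) - f x) (0 : R).
    rewrite -[0](subrr (g x)); apply: is_deriveB.
    rewrite -[X in is_derive _ _ _ X]mulr1 -[X in X * _](pg x).
    have d1 : is_derive x 1 (fun x : R => x + 1) (1 : R).
      by rewrite -[X in is_derive _ _ _ X]addr0; apply: is_deriveD.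
    have := @is_derive1_comp _ f (fun x => x + 1) x _ _ (fg (x + 1)) d1.
    by [].
  move=> x; have := is_derive_const_fun sh x 0.
  by rewrite add0r f0 f1 subr0 => /eqP; rewrite subr_eq0 => /eqP.
- by move=> x; case: (fg x).
- by rewrite (derive1_is fg).
Qed.

(** Lemma of du Bois-Reymond on the circle: psi minus its mean is the derivative of a periodic C^1
    function, hence of an admissible test function. *)
Lemma weak_const f : int01_able f ->
  (forall phi, C1_periodic phi -> int01 (fun x => f x * derive1 phi x) = 0) ->
  forall psi, continuous psi -> periodic psi 1 ->
  int01 (fun x => f x * psi x) = int01 f * int01 psi.
Proof.
move=> fi f0 psi cpsi ppsi; pose m := int01 psi.
have cm : continuous (fun x => psi x - m).
  by move=> x; apply: cvgB; [exact: cpsi|exact: cvg_cst].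
have [] := primitive_periodic cm.
- by move=> x; rewrite ppsi.
- rewrite int01B ?int01_cst ?subrr//; first exact: int01_able_continuous.
  by apply: int01_able_continuous => x; exact: cvg_cst.
move=> phi [phiC phiD]; have := f0 _ phiC; rewrite (derive1_is phiD) => E.
have -> : (fun x => f x * psi x) = (fun x => f x * (psi x - m) + m * f x).
  by apply/funext => x; ring.
rewrite int01D; [|exact: int01_ableM|exact: int01_ableZ].
rewrite E add0r int01Z; last exact: fi.
exact: mulrC.
Qed.

(** f and h have the same weak derivative and so differ by a constant. The equality is tested
    against continuous functions, since f is only known almost everywhere. *)
Lemma weak_step f g h : int01_able f -> weak_deriv f g -> continuous h ->
  (forall phi, C1_periodic phi ->
     int01 (fun x => h x * derive1 phi x) = - int01 (fun x => g x * phi x)) ->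
  exists c, forall psi, continuous psi -> periodic psi 1 ->
    int01 (fun x => f x * psi x) = int01 (fun x => (h x + c) * psi x).
Proof.
move=> fi fg ch hg; exists (int01 (fun x => f x - h x)) => psi cpsi ppsi.
have hi := int01_able_continuous ch.
have fhi := int01_ableB fi hi.
have := weak_const fhi _ cpsi ppsi.
set c := int01 (fun x => f x - h x) => fh.
have E : int01 (fun x => (f x - h x) * psi x) = c * int01 psi.
  apply: fh => phi Cphi; have [_ _ cphi] := Cphi.
  under [X in int01 X]eq_fun do rewrite mulrBl.
  rewrite int01B ?hg //; [|exact: int01_ableM|exact: int01_ableM].
  by rewrite [X in X - _]fg// subrr.
have ex : (fun x => (h x + c) * psi x) = (fun x => h x * psi x + c * psi x).
  by apply/funext => x; rewrite mulrDl.
rewrite ex int01D; [|exact: int01_ableM|exact/int01_ableZ/int01_able_continuous].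
rewrite int01Z -?E; last exact: int01_able_continuous.
rewrite -int01D; [|exact: int01_ableM|exact: int01_ableM].
by congr int01; apply/funext => x; ring.
Qed.

Lemma C1_periodic_cst (c : R) : C1_periodic (fun=> c).
Proof.
have d (x : R) : is_derive x 1 (fun=> c) ((fun=> 0 : R) x) by exact: is_derive_cst.
split; [by []|by move=> x; case: (d x)|].
by rewrite (derive1_is d) => x; exact: cvg_cst.
Qed.

Lemma weak_deriv_int0 f g : weak_deriv f g -> int01 g = 0.
Proof.
move=> /(_ _ (C1_periodic_cst 1)).
have d (x : R) : is_derive x 1 (fun _ : R => 1 : R) ((fun=> 0 : R) x) by exact: is_derive_cst.
rewrite (derive1_is d).
under eq_Rintegral do rewrite mulr0.
under [in RHS]eq_Rintegral do rewrite mulr1.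
by rewrite -/(int01 _) int01_cst => /esym/eqP; rewrite oppr_eq0 => /eqP.
Qed.

(** The highest derivative is essentially bounded and gives a Lipschitz primitive. Each further
    order takes a periodic primitive of the function just found, whose mean vanishes because it
    represents a weak derivative. At the end H 0 equals f only in the sense of distributions. *)
Lemma weak_regular k f (g : nat -> R -> R) K : weak_derivs k.+1 f g ->
  {ae mu, forall x, `[0, 1] x -> `|g k.+1 x| <= K} ->
  exists H : nat -> R -> R, [/\ forall i, (i <= k)%N -> periodic (H i) 1,
    forall i, (i < k)%N -> forall x : R, is_derive x 1 (H i) (H i.+1 x),
    forall x y, `|H k x - H k y| <= K * `|x - y| &
    forall psi, continuous psi -> periodic psi 1 ->
     int01 (fun x => f x * psi x) = int01 (fun x => H 0 x * psi x)].
Proof.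
elim: k f g => [|k IH] f g [g0 gi gw] gK.
  have w := gw 0%N isT; rewrite g0 in w.
  have [h [ph hK hE]] := weak_top (gi 1%N isT) gK (weak_deriv_int0 w).
  have fi : int01_able f by rewrite -g0; exact: gi.
  have [c cP] := weak_step fi w (lipschitz_continuous hK) hE.
  exists (fun=> fun x => h x + c); split => //.
  - by move=> i _ x; rewrite ph.
  - move=> x y; have -> : h x + c - (h y + c) = h x - h y by ring.
    exact: hK.
have [|H [pH dH lH eH]] := IH (g 1%N) (fun i => g i.+1) _ gK.
  by split => // i ik; [exact: gi|exact: gw].
have w := gw 0%N isT; rewrite g0 in w.
have cH : continuous (H 0).
  case: k {IH g0 gi gw gK w} pH dH lH eH => [|k] pH dH lH eH.
    exact: lipschitz_continuous lH.
  by move=> x; exact: is_derive_continuous (dH 0%N isT x).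
have H0 : int01 (H 0) = 0.
  have c1 : continuous (fun _ : R => 1 : R) by move=> x; exact: cvg_cst.
  have := eH _ c1 (fun=> erefl).
  under [in LHS]eq_fun do rewrite mulr1.
  under [in RHS]eq_fun do rewrite mulr1.
  by move=> <-; exact: weak_deriv_int0 w.
have [A [CA dA]] := primitive_periodic cH (pH 0%N isT) H0.
have fi : int01_able f by rewrite -g0; exact: gi.
have cA : continuous A by move=> x; exact: is_derive_continuous (dA x).
have [|c cP] := weak_step fi w cA.
  move=> phi [pphi dphi cphi]; have [pA _ _] := CA.
  rewrite (int01_by_parts dA cH (is_derive_der dphi) cphi).
  rewrite -[1]add0r pA pphi subrr sub0r eH// => x.
  exact: is_derive_continuous (is_derive_der dphi x).
exists (fun i => if i is i'.+1 then H i' else fun x => A x + c); split => //.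
- case=> [_ x|i ik]; last exact: pH.
  by have [pA _ _] := CA; rewrite pA.
- case=> [_ x|i ik]; last exact: dH.
  by rewrite -[X in is_derive _ _ _ X]addr0; apply: is_deriveD.
Qed.

(** The primitive of f^2 is nondecreasing and, as the integral over a period is zero, periodic;
    hence it is constant. *)
Lemma int01_sq0 f : continuous f -> periodic f 1 ->
  int01 (fun x => f x * f x) = 0 -> forall x, f x = 0.
Proof.
move=> cf pf f0; have cff : continuous (fun x => f x * f x).
  by move=> x; apply: cvgM; exact: cf.
have [F [[pF _ _] dF]] := primitive_periodic cff (fun x => congr2 *%R (pf x) (pf x)) f0.
have Fmono x y : x <= y -> F x <= F y.
  move=> xy; have [c [_ _]] := is_derive_mvt x y dF.
  move/eqP; rewrite subr_eq => /eqP ->; rewrite lerDr mulr_ge0 ?subr_ge0//.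
  by rewrite -expr2 sqr_ge0.
have F1 : F 1 = F 0 by rewrite -[1]add0r pF.
have Fc x : F x = F 0.
  apply: (@periodic_ball _ F (fun y => y = F 0)) => // {}x /andP[x0 x1].
  by apply/eqP; rewrite eq_le [F 0 <= _]Fmono// andbT -F1 Fmono.
move=> x; have := derive1_is dF; have -> : F = fun=> F 0 by apply/funext => y; exact: Fc.
have d (y : R) : is_derive y 1 (fun _ : R => F 0) ((fun=> 0 : R) y) by exact: is_derive_cst.
rewrite (derive1_is d) => /(congr1 (fun u => u x)) /esym/eqP.
by rewrite mulf_eq0 orbb => /eqP.
Qed.

(** For continuous f the difference f - H 0 is itself an admissible test function, so it vanishes
    everywhere. *)
Lemma weak_regular_continuous k f (g : nat -> R -> R) K :
  continuous f -> periodic f 1 -> weak_derivs k.+1 f g ->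
  {ae mu, forall x, `[0, 1] x -> `|g k.+1 x| <= K} ->
  exists H : nat -> R -> R, [/\ H 0%N = f, forall i, (i <= k)%N -> periodic (H i) 1,
    forall i, (i < k)%N -> forall x : R, is_derive x 1 (H i) (H i.+1 x) &
    forall x y, `|H k x - H k y| <= K * `|x - y| ].
Proof.
move=> cf pf wf gK; have [H [pH dH lH eH]] := weak_regular wf gK.
exists H; split => //; apply/funext => x; apply/esym/eqP; rewrite -subr_eq0; apply/eqP; move: x.
have cH : continuous (H 0).
  case: k {gK wf} pH dH lH eH => [|k] pH dH lH eH; first exact: lipschitz_continuous lH.
  by move=> x; exact: is_derive_continuous (dH 0%N isT x).
have cfH : continuous (fun x => f x - H 0 x).
  by move=> x; apply: cvgB; [exact: cf|exact: cH].
have pfH : periodic (fun x => f x - H 0 x) 1 by move=> x; rewrite pf pH.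
apply: int01_sq0 => //.
under [X in int01 X]eq_fun do rewrite mulrBl.
rewrite int01B ?eH ?subrr//; exact/int01_ableM/cfH/int01_able_continuous.
Qed.

End SobolevRegularity.

(** * Families with uniform bounds and their time derivatives *)

Section Classes.
Context {R : realType}.
Let mu := @lebesgue_measure R.

Definition unif_bounded (P : Type) (F : P -> R -> R) : Prop :=
  exists K, forall p x, `|F p x| <= K.

(* Bounds in C^{k,1}, uniform in the parameter. *)
Fixpoint CL (P : Type) (k : nat) (F : P -> R -> R) : Prop :=
  unif_bounded F /\
  if k is k'.+1 then (forall p x, derivable (F p) x 1) /\ CL k' (fun p => derive1 (F p))
  else exists K, forall p x y, `|F p x - F p y| <= K * `|x - y|.

Lemma sobolev_norm_witness k (f : R -> R) M : (sobolev_norm k +oo f <= M%:E)%E ->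
  exists g, weak_derivs k f g /\ forall i, (i <= k)%N -> (Lp_norm +oo (g i) <= (M + 1)%:E)%E.
Proof.
move=> fM.
have /ereal_inf_lt[] : (sobolev_norm k +oo f < (M + 1)%:E)%E.
  by apply: le_lt_trans fM _; rewrite lte_fin ltrDl.
move=> _ [g wg <-] gM; exists g; split => // i ik; apply: le_trans (ltW gM).
rewrite (bigD1 (Ordinal (ik : (i < k.+1)%N)))//= leeDl//.
by apply: sume_ge0 => j _; exact: Lnorm_ge0.
Qed.

Lemma Lp_norm_ae (g : R -> R) K : (Lp_norm +oo g <= K%:E)%E ->
  {ae mu, forall x, `[0, 1] x -> `|g x| <= K}.
Proof.
rewrite /Lp_norm unlock /=; case: ifPn => [_|].
  move=> /ess_supP; apply: (@filterS _ _ (ae_filter_ringOfSetsType mu)) => x.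
  by move=> h xI; move: h; rewrite /= patchE mem_set.
(* The norm of exponent infinity is defined by cases on whether the whole space has positive
   measure; the other case is excluded here. *)
rewrite -leNgt => h; exfalso; move: h; apply/negP; rewrite -ltNge.
have H : (0%:E < mu `[0%R, 1%R])%E by rewrite [X in (_ < X)%E]mu01 lte01.
by apply: (lt_le_trans H); apply: le_measure => //; rewrite inE.
Qed.

Lemma ae01_exists (Q : R -> Prop) : {ae mu, forall x, `[0, 1] x -> Q x} ->
  exists x, 0 <= x <= 1 /\ Q x.
Proof.
move=> [N [mN N0 sN]]; apply/not_existsP => h.
have : mu `[0, 1] = 0%E.
  apply/eqP; rewrite eq_le measure_ge0 andbT -N0.
  apply: le_measure; rewrite ?inE// => x x01; apply: sN => /= /(_ x01) Qx.
  by apply: (h x); split => //; move: x01; rewrite /= in_itv.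
by rewrite [mu _]mu01 => -[] /eqP; rewrite oner_eq0.
Qed.

Lemma periodic_near_bound (f : R -> R) (K B x0 : R) : periodic f 1 -> 0 <= x0 <= 1 -> `|f x0| <= B ->
  (forall x y, `|f x - f y| <= K * `|x - y|) -> forall x, `|f x| <= B + K.
Proof.
move=> pf /andP[x00 x01] fB fK; apply: (@periodic_ball _ f (fun y => `|y| <= B + K)) => // x /andP[x0' x1'].
have K0 : 0 <= K by have := fK 1 0; rewrite subr0 normr1 mulr1; exact: le_trans.
have -> : f x = f x0 + (f x - f x0) by ring.
apply: (le_trans (ler_normD _ _)); apply: lerD => //; apply: (le_trans (fK _ _)).
rewrite -[leRHS]mulr1 ler_wpM2l// ler_norml; apply/andP; split; lra.
Qed.

Lemma periodic_deriv_zero (f g : R -> R) : periodic f 1 -> (forall x : R, is_derive x 1 f (g x)) ->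
  exists x, 0 <= x <= 1 /\ g x = 0.
Proof.
move=> pf fg; have [c []] := is_derive_mvt 0 1 fg.
have f1 : f 1 = f 0 by rewrite -[in LHS](add0r 1) pf.
rewrite min_l ?max_r ?ler01// => c0 c1; rewrite f1 subrr subr0 mulr1 => g0.
by exists c; rewrite c0 c1.
Qed.

Lemma chain_CL (P : Type) (H : P -> nat -> R -> R) K : forall k,
  (forall p i, (i <= k)%N -> forall x, `|H p i x| <= K) ->
  (forall p i, (i < k)%N -> forall x : R, is_derive x 1 (H p i) (H p i.+1 x)) ->
  (forall p x y, `|H p k x - H p k y| <= K * `|x - y|) ->
  CL k (fun p => H p 0%N).
Proof.
move=> k; elim: k H => [|k IH] H bH dH lH.
  by split; [exists K => p x; exact: bH|exists K].
split; first by exists K => p x; exact: bH.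
split; first by move=> p x; case: (dH p 0%N isT x).
have -> : (fun p => derive1 (H p 0%N)) = (fun p => H p 1%N).
  by apply/funext => p; exact: derive1_is (dH p 0%N isT).
by apply: (IH (fun p i => H p i.+1)) => // p i ik; [exact: bH|exact: dH].
Qed.

(** By periodicity every derivative of positive order vanishes somewhere, so its Lipschitz constant
    bounds it, and this bound is a Lipschitz constant one order below. Thus the bound of the highest
    weak derivative descends to all orders without loss. *)
Lemma sobolev_CL (P : Type) k (F : P -> R -> R) M :
  (forall p, continuous (F p)) -> (forall p, periodic (F p) 1) ->
  (forall p, (sobolev_norm k.+1 +oo (F p) <= M%:E)%E) -> CL k F.
Proof.
move=> cF pF FM; pose K := M + 1.
have ex p : exists H : nat -> R -> R, [/\ H 0%N = F p,
    forall i, (i <= k)%N -> forall x, `|H i x| <= K + K,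
    forall i, (i < k)%N -> forall x : R, is_derive x 1 (H i) (H i.+1 x) &
    forall x y, `|H k x - H k y| <= (K + K) * `|x - y|].
  have [g [wg gM]] := sobolev_norm_witness (FM p).
  have [H [H0 pH dH lH]] := weak_regular_continuous (cF p) (pF p) wg (Lp_norm_ae (gM _ (leqnn _))).
  have K0 : 0 <= K by have := lH 1 0; rewrite subr0 normr1 mulr1; exact: le_trans.
  have [x0 [x0I Fx0]] := ae01_exists (Lp_norm_ae (gM 0%N isT)).
  have {}Fx0 : `|H 0%N x0| <= K by rewrite H0; case: wg Fx0 => ->.
  have bH i : (i < k)%N -> forall x, `|H i.+1 x| <= K.
    move=> ik; have {}ik : (0 < i.+1 <= k)%N by [].
    move: (i.+1) ik => j; move: {2}(k - j)%N (leqnn (k - j)) => n.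
    elim: n j => [|n IH] j nj /andP[j0 jk].
      have jE : j = k by move: nj; rewrite leqn0 subn_eq0 => kj; apply/eqP; rewrite eqn_leq jk.
      case: j j0 jk jE {nj} => // j _ jk jE.
      have [z [zI Hz]] := periodic_deriv_zero (pH j (ltnW jk)) (dH j jk).
      have := @periodic_near_bound (H j.+1) K 0 z (pH _ jk) zI.
      by rewrite Hz normr0 add0r; apply => //; rewrite jE.
    case: (ltngtP j k) jk => // [jk _|jE _].
      case: j j0 jk nj => // j _ jk nj.
      have [z [zI Hz]] := periodic_deriv_zero (pH j (ltnW (ltnW jk))) (dH j (ltnW jk)).
      have := @periodic_near_bound (H j.+1) K 0 z (pH _ (ltnW jk)) zI.
      rewrite Hz normr0 add0r; apply => //.
      apply: (is_derive_lip (dH _ jk)); apply: IH.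
        by rewrite -ltnS -subSn// subSS.
      by rewrite ltnS leq0n.
    apply: IH; last by rewrite j0 jE leqnn.
    by rewrite jE subnn.
  (* The function itself need not vanish anywhere: its bound K + K comes from a point where it is at
     most K and from its Lipschitz constant K. *)
  exists H; split => //.
    case=> [_|i ik x]; last by rewrite (le_trans (bH i ik x)) ?lerDl.
    apply: (periodic_near_bound (pH 0%N isT) x0I Fx0).
    case: k {FM wg gM} bH dH lH pH => [|k] bH dH lH pH; first exact: lH.
    by apply: (is_derive_lip (dH 0%N isT)); exact: bH.
  by move=> x y; apply: le_trans (lH x y) _; rewrite ler_wpM2r// lerDl.
pose H p := projT1 (cid (ex p)).
have HP p := projT2 (cid (ex p)).
have -> : F = fun p => H p 0%N by apply/funext => p; have [] := HP p.
by apply: (@chain_CL _ H (K + K)) => p; have [] := HP p.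
Qed.

End Classes.

(** * Algebra of families with uniform C^{k,1} bounds *)

Section ClassClosure.
Context {R : realType} {P : Type}.
Implicit Types (F G : P -> R -> R) (k : nat).

Definition isder (F G : P -> R -> R) := forall p (x : R), is_derive x 1 (F p) (G p x).

Lemma isder_derive1 F G : isder F G -> (fun p => derive1 (F p)) = G.
Proof. by move=> FG; apply/funext => p; exact: derive1_is (FG p). Qed.

Lemma isderD F F' G G' : isder F F' -> isder G G' ->
  isder (fun p x => F p x + G p x) (fun p x => F' p x + G' p x).
Proof. by move=> FF GG p x; exact: is_deriveD. Qed.

Lemma isderN F F' : isder F F' -> isder (fun p x => - F p x) (fun p x => - F' p x).
Proof. by move=> FF p x; exact: is_deriveN. Qed.

Lemma isderB F F' G G' : isder F F' -> isder G G' ->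
  isder (fun p x => F p x - G p x) (fun p x => F' p x - G' p x).
Proof. by move=> FF GG p x; exact: is_deriveB. Qed.

Lemma isderM F F' G G' : isder F F' -> isder G G' ->
  isder (fun p x => F p x * G p x) (fun p x => F' p x * G p x + F p x * G' p x).
Proof.
move=> FF GG p x; have := @is_deriveM _ _ (F p) (G p) x 1 _ _ (FF p x) (GG p x).
by move=> h; apply: (is_derive_eq h); rewrite /GRing.scale/=; ring.
Qed.

Lemma isder_cst (c : P -> R) : isder (fun p _ => c p) (fun _ _ => 0).
Proof. by move=> p x; exact: is_derive_cst. Qed.

Lemma isderZ (c : P -> R) F F' : isder F F' ->
  isder (fun p x => c p * F p x) (fun p x => c p * F' p x).
Proof.
move=> FF; have := isderM (isder_cst c) FF; move=> h p x.
by apply: (is_derive_eq (h p x)); rewrite mul0r add0r.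
Qed.

Lemma isderV F F' : isder F F' -> (forall p x, F p x != 0) ->
  isder (fun p x => (F p x)^-1) (fun p x => - (F p x)^-1 ^+ 2 * F' p x).
Proof.
move=> FF F0 p x; have := is_deriveV (F0 p x) (FF p x).
move=> h; apply: (is_derive_eq h); rewrite /GRing.scale/=.
by rewrite -exprVn.
Qed.

Lemma isder_ext F G G' : isder F G -> (forall p x, G p x = G' p x) -> isder F G'.
Proof. by move=> FG GG p x; apply: (is_derive_eq (FG p x)); exact: GG. Qed.

Lemma isder_uniq F G G' : isder F G -> isder F G' -> G = G'.
Proof. by move=> /isder_derive1 <- /isder_derive1. Qed.

Lemma unif_boundedM F G : unif_bounded F -> unif_bounded G ->
  unif_bounded (fun p x => F p x * G p x).
Proof.
move=> [K FK] [K' GK]; exists (K * K') => p x; rewrite normrM.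
by apply: ler_pM.
Qed.

Lemma unif_boundedD F G : unif_bounded F -> unif_bounded G ->
  unif_bounded (fun p x => F p x + G p x).
Proof.
move=> [K FK] [K' GK]; exists (K + K') => p x; apply: (le_trans (ler_normD _ _)).
by apply: lerD; [exact: FK|exact: GK].
Qed.

Lemma unif_boundedN F : unif_bounded F -> unif_bounded (fun p x => - F p x).
Proof. by move=> [K FK]; exists K => p x; rewrite normrN. Qed.

Lemma unif_boundedV F c : 0 < c -> (forall p x, c <= `|F p x|) ->
  unif_bounded (fun p x => (F p x)^-1).
Proof.
move=> c0 Fc; exists c^-1 => p x; rewrite normfV lef_pV2 ?Fc// posrE//.
exact: lt_le_trans (Fc p x).
Qed.

Lemma CL_bounded k F : CL k F -> unif_bounded F.
Proof. by case: k => [|k] []. Qed.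

Lemma CL_isder k F : CL k.+1 F -> isder F (fun p => derive1 (F p)).
Proof. by move=> [_ [dF _]] p x; exact: is_derive_der. Qed.

Lemma CL_derive k F : CL k.+1 F -> CL k (fun p => derive1 (F p)).
Proof. by move=> [_ [_]]. Qed.

Lemma CL_der k F G : CL k.+1 F -> isder F G -> CL k G.
Proof. by move=> /CL_derive + /isder_derive1 FG; rewrite FG. Qed.

Lemma CL_intro k F G : unif_bounded F -> isder F G -> CL k G -> CL k.+1 F.
Proof.
move=> bF FG GL; split => //; split; first by move=> p x; case: (FG p x).
by rewrite (isder_derive1 FG).
Qed.

Lemma CL_lip k F : CL k F -> exists K, 0 <= K /\ forall p x y, `|F p x - F p y| <= K * `|x - y|.
Proof.
case: k => [[_ [K FK]]|k FL].
  exists `|K|; split => // p x y; apply: le_trans (FK p x y) _.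
  by rewrite ler_wpM2r// ler_norm.
have [K FK] := CL_bounded (CL_derive FL); exists `|K|; split => // p x y.
by apply: (is_derive_lip (CL_isder FL p)) => z; apply: le_trans (FK p z) (ler_norm _).
Qed.

Lemma CLS k F : CL k.+1 F -> CL k F.
Proof.
elim: k F => [|k IH] F FL.
  by have [K [_ FK]] := CL_lip FL; split; [exact: CL_bounded FL|exists K].
exact: (CL_intro (CL_bounded FL) (CL_isder FL) (IH _ (CL_derive FL))).
Qed.

Lemma CL_le k l F : (l <= k)%N -> CL k F -> CL l F.
Proof.
elim: k => [|k IH]; first by rewrite leqn0 => /eqP ->.
by rewrite leq_eqVlt => /predU1P[->//|lk] /CLS; exact: IH.
Qed.

Lemma CL_cst k (c : P -> R) K : (forall p, `|c p| <= K) -> CL k (fun p _ => c p).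
Proof.
have z k' : CL k' (fun (_ : P) (_ : R) => 0 : R).
  elim: k' => [|k' IH].
    by split; exists 0 => p *; rewrite ?subr0 ?normr0 ?mul0r.
  by apply: (CL_intro _ (isder_cst (fun=> 0)) IH); exists 0 => p x; rewrite normr0.
move=> cK; case: k => [|k].
  split; first by exists K => p x.
  by exists 0 => p x y; rewrite subrr normr0 mul0r.
by apply: (CL_intro _ (isder_cst c) (z k)); exists K => p x.
Qed.

Lemma CL_num k (c : R) : CL k (fun (_ : P) _ => c).
Proof. exact: (@CL_cst k (fun=> c) `|c|). Qed.

Lemma CLD k F G : CL k F -> CL k G -> CL k (fun p x => F p x + G p x).
Proof.
elim: k F G => [|k IH] F G FL GL.
  split; first exact: unif_boundedD (CL_bounded FL) (CL_bounded GL).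
  have [K [_ FK]] := CL_lip FL; have [K' [_ GK]] := CL_lip GL.
  exists (K + K') => p x y; rewrite mulrDl.
  have -> : F p x + G p x - (F p y + G p y) = (F p x - F p y) + (G p x - G p y) by ring.
  apply: (le_trans (ler_normD _ _)); apply: (lerD (FK p x y) (GK p x y)).
apply: (CL_intro _ (isderD (CL_isder FL) (CL_isder GL))).
  exact: unif_boundedD (CL_bounded FL) (CL_bounded GL).
by apply: IH; exact: CL_derive.
Qed.

Lemma CLM k F G : CL k F -> CL k G -> CL k (fun p x => F p x * G p x).
Proof.
elim: k F G => [|k IH] F G FL GL.
  split; first exact: unif_boundedM (CL_bounded FL) (CL_bounded GL).
  have [K [K0 FK]] := CL_lip FL; have [K' [K'0 GK]] := CL_lip GL.
  have [B FB] := CL_bounded FL; have [B' GB] := CL_bounded GL.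
  exists (K * B' + B * K') => p x y.
  have -> : F p x * G p x - F p y * G p y = (F p x - F p y) * G p x + F p y * (G p x - G p y) by ring.
  apply: (le_trans (ler_normD _ _)); rewrite [leRHS]mulrDl !normrM; apply: lerD.
    by rewrite mulrAC; apply: ler_pM.
  by rewrite -mulrA; apply: ler_pM.
apply: (CL_intro _ (isderM (CL_isder FL) (CL_isder GL))).
  exact: unif_boundedM (CL_bounded FL) (CL_bounded GL).
by apply: CLD; apply: IH; (exact: CL_derive || exact: CLS).
Qed.

Lemma CLN k F : CL k F -> CL k (fun p x => - F p x).
Proof.
move=> FL; have := CLM (CL_num k (-1)) FL.
by congr CL; apply/funext => p; apply/funext => x; rewrite mulN1r.
Qed.

Lemma CLB k F G : CL k F -> CL k G -> CL k (fun p x => F p x - G p x).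
Proof. by move=> FL GL; apply: CLD => //; exact: CLN. Qed.

Lemma CLX k F n : CL k F -> CL k (fun p x => F p x ^+ n).
Proof.
move=> FL; elim: n => [|n IH].
  by have := CL_num k 1; congr CL; apply/funext => p; apply/funext => x; rewrite expr0.
by have := CLM FL IH; congr CL; apply/funext => p; apply/funext => x; rewrite exprS.
Qed.

Lemma CLV k F c : 0 < c -> (forall p x, c <= `|F p x|) -> CL k F ->
  CL k (fun p x => (F p x)^-1).
Proof.
move=> c0 Fc; have F0 p x : F p x != 0 by rewrite -normr_gt0; exact: lt_le_trans (Fc p x).
elim: k => [|k IH] FL.
  split; first exact: unif_boundedV Fc.
  have [K [K0 FK]] := CL_lip FL; have [B VB] := unif_boundedV c0 Fc.
  exists (B * B * K) => p x y.
  have -> : (F p x)^-1 - (F p y)^-1 = (F p x)^-1 * (F p y)^-1 * (F p y - F p x).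
    by field; rewrite !F0.
  rewrite !normrM (distrC (F p y)) -[leRHS]mulrA.
  by apply: ler_pM => //; exact: ler_pM.
apply: (CL_intro _ (isderV (CL_isder FL) F0)); first exact: unif_boundedV Fc.
apply: CLM; last exact: CL_derive.
by apply: CLN; apply: CLX; apply: IH; exact: CLS.
Qed.

Lemma isder_sqrt F F' c : 0 < c -> (forall p x, c <= F p x) -> isder F F' ->
  isder (fun p x => Num.sqrt (F p x)) (fun p x => 2^-1 * (Num.sqrt (F p x))^-1 * F' p x).
Proof.
move=> c0 Fc FF p x; have Fx : 0 < F p x by exact: lt_le_trans (Fc p x).
have := @is_derive1_comp _ Num.sqrt (F p) x _ _ (is_derive1_sqrt Fx) (FF p x).
by move=> h; apply: (is_derive_eq h); rewrite invfM.
Qed.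

Lemma CL_sqrt k F c : 0 < c -> (forall p x, c <= F p x) -> CL k F ->
  CL k (fun p x => Num.sqrt (F p x)).
Proof.
move=> c0 Fc.
have sc p x : Num.sqrt c <= Num.sqrt (F p x) by rewrite ler_wsqrtr.
have sc0 : 0 < Num.sqrt c by rewrite sqrtr_gt0.
have bS : unif_bounded F -> unif_bounded (fun p x => Num.sqrt (F p x)).
  move=> [K FK]; exists (Num.sqrt K) => p x; rewrite ger0_norm ?sqrtr_ge0//.
  by rewrite ler_wsqrtr// (le_trans (ler_norm _)).
elim: k => [|k IH] FL.
  split; first exact/bS/(CL_bounded FL).
  have [K [K0 FK]] := CL_lip FL.
  exists (K / Num.sqrt c) => p x y.
  set a := Num.sqrt (F p x); set b := Num.sqrt (F p y).
  have E : F p x - F p y = (a - b) * (a + b).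
    have Fx : 0 <= F p x by exact: le_trans (ltW c0) (Fc p x).
    have Fy : 0 <= F p y by exact: le_trans (ltW c0) (Fc p y).
    rewrite -(sqr_sqrtr Fx) -(sqr_sqrtr Fy) -/a -/b; ring.
  have ab : Num.sqrt c <= a + b by rewrite (le_trans (sc p x)) ?lerDl ?sqrtr_ge0.
  rewrite mulrAC ler_pdivlMr//; apply: le_trans (FK p x y).
  by rewrite E normrM ler_wpM2l// (le_trans ab)// ler_norm.
apply: (CL_intro _ (isder_sqrt c0 Fc (CL_isder FL))); first exact/bS/(CL_bounded FL).
apply: CLM; last exact: CL_derive.
apply: CLM; first exact: CL_num.
apply: (CLV sc0); last by apply: IH; exact: CLS.
by move=> p x; rewrite ger0_norm ?sqrtr_ge0.
Qed.

(** Turns a Lipschitz bound that is uniform in the parameter into a uniform bound of a derivative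
    whose existence is known for each parameter separately. *)
Lemma CL0_der_bounded F G : CL 0 F -> isder F G -> unif_bounded G.
Proof.
move=> FL FG; have [K [K0 FK]] := CL_lip FL; exists K => p x.
have [d <-] := FG p x; have -> : 'D_1 (F p) x = derive1 (F p) x by rewrite derive1E.
have /cvg_norm cv : h^-1 *: (F p (h *: 1 + x) - F p x) @[h --> 0^'] --> 'D_1 (F p) x by exact: d.
rewrite derive1E; move/cvgr_to_le : cv; apply; near=> h.
have h0 : h != 0 by near: h; exact: nbhs_dnbhs_neq.
rewrite normrZ normfV ler_pdivrMl ?normr_gt0// mulrC.
by apply: le_trans (FK _ _ _) _; rewrite /GRing.scale/= mulr1 addrK.
Unshelve. all: by end_near. Qed.

End ClassClosure.

(** * Derivatives in time and finite differences in space *)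

Section TimeDerivative.
Context {R : realType}.
Implicit Types (F G : R -> R) (T : R).

(** Differentiability on [0, T] in the form of an explicit first-order estimate: one-sided at the
    end points, and stable under linear combinations of the values at finitely many space points. *)
Definition TD T F F1 := forall t, 0 <= t <= T -> forall e, 0 < e ->
  exists2 d, 0 < d & forall s, 0 <= s <= T -> `|s - t| < d ->
    `|F s - F t - (s - t) * F1 t| <= e * `|s - t|.

Lemma TD_tderiv T (Y Z : R -> R -> 'rV[R]_2) (x : R) (i : 'I_2) : tderiv T Y Z ->
  TD T (fun t => Y t x 0 i) (fun t => Z t x 0 i).
Proof.
move=> YZ t tT e e0; have := YZ t tT x.
move/cvgrPdist_le => /(_ e e0); rewrite near_withinE => -[d /= d0 dP].
exists d => // s sT sd; have [->|st] := eqVneq s t; first by rewrite !subrr mul0r subr0 normr0 mulr0.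
have := dP s; rewrite /ball_/= distrC => /(_ sd st).
rewrite in_itv/= => /(_ sT) H.
have {}H : `|Z t x 0 i - (s - t)^-1 * (Y s x 0 i - Y t x 0 i)| <= e.
  apply: le_trans H; rewrite [leRHS]/Num.Def.normr/= mx_normrE.
  by apply: le_trans; last exact: (le_bigmax _ _ (0, i)); rewrite /= !mxE.
have st0 : s - t != 0 by rewrite subr_eq0.
have -> : Y s x 0 i - Y t x 0 i - (s - t) * Z t x 0 i =
   - (s - t) * (Z t x 0 i - (s - t)^-1 * (Y s x 0 i - Y t x 0 i)) by field.
by rewrite normrM normrN mulrC ler_wpM2r.
Qed.

Lemma TDD T F F1 G G1 : TD T F F1 -> TD T G G1 ->
  TD T (fun t => F t + G t) (fun t => F1 t + G1 t).
Proof.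
move=> FF GG t tT e e0; have e2 : 0 < e / 2 by rewrite divr_gt0.
have [d d0 dP] := FF t tT _ e2; have [d' d'0 d'P] := GG t tT _ e2.
exists (Num.min d d'); first by rewrite lt_min d0.
move=> s sT; rewrite lt_min => /andP[/(dP s sT) sd /(d'P s sT) sd'].
have -> : F s + G s - (F t + G t) - (s - t) * (F1 t + G1 t) =
  (F s - F t - (s - t) * F1 t) + (G s - G t - (s - t) * G1 t) by ring.
apply: (le_trans (ler_normD _ _)); apply: le_trans (lerD sd sd') _.
by rewrite -mulrDl -splitr.
Qed.

Lemma TDN T F F1 : TD T F F1 -> TD T (fun t => - F t) (fun t => - F1 t).
Proof.
move=> FF t tT e e0; have [d d0 dP] := FF t tT e e0; exists d => // s sT sd.
have -> : - F s - - F t - (s - t) * - F1 t = - (F s - F t - (s - t) * F1 t) by ring.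
by rewrite normrN; exact: dP.
Qed.

Lemma TDB T F F1 G G1 : TD T F F1 -> TD T G G1 ->
  TD T (fun t => F t - G t) (fun t => F1 t - G1 t).
Proof. by move=> FF GG; exact: TDD FF (TDN GG). Qed.

Lemma TD_sq T (t0 c : R) : TD T (fun s => (s - t0) ^+ 2 * c) (fun s => 2 * (s - t0) * c).
Proof.
move=> t tT e e0; exists (e / (`|c| + 1)); first by rewrite divr_gt0// ltr_wpDl.
move=> s sT sd.
have -> : (s - t0) ^+ 2 * c - (t - t0) ^+ 2 * c - (s - t) * (2 * (t - t0) * c)
  = c * (s - t) * (s - t) by ring.
rewrite 2!normrM ler_wpM2r//; move: sd; rewrite ltr_pdivlMr ?ltr_wpDl// => /ltW.
by apply: le_trans; rewrite mulrC ler_wpM2l// lerDl.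
Qed.

Lemma TD_lin T (c : R) : TD T (fun s => s * c) (fun=> c).
Proof.
move=> t tT e e0; exists 1 => // s sT sd.
have -> : s * c - t * c - (s - t) * c = 0 by ring.
by rewrite normr0 mulr_ge0// ltW.
Qed.

Lemma TD_mean T F F1 (a b K : R) : TD T F F1 -> 0 <= a -> a <= b -> b <= T ->
  (forall s, a <= s <= b -> `|F1 s| <= K) -> `|F b - F a| <= K * (b - a).
Proof.
move=> FF a0 ab bT FK.
have dF (s : R) : s \in `]a, b[%R -> is_derive s 1 F (F1 s).
  rewrite in_itv/= => /andP[sa sb].
  have sT : 0 <= s <= T by rewrite (le_trans a0 (ltW sa)) (le_trans (ltW sb) bT).
  have cv : h^-1 *: ((F \o shift s) (h *: 1) - F s) @[h --> 0^'] --> F1 s.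
    apply/cvgrPdist_le => e e0; have [d d0 dP] := FF s sT e e0.
    pose d' := Num.min d (Num.min (s - a) (b - s)).
    have d'0 : 0 < d' by rewrite !lt_min d0 !subr_gt0 sa.
    exists d' => //= h; rewrite /ball_/= sub0r normrN /d' !lt_min => /and3P[hd h1 h2] h0.
    have hT : 0 <= h + s <= T.
      move: h1 h2; rewrite !ltr_norml => /andP[? ?] /andP[? ?]; apply/andP; split; lra.
    have := dP (h + s) hT; rewrite addrK => /(_ hd) H.
    have -> : F1 s - h^-1 *: ((F \o shift s) (h *: 1) - F s) =
       - h^-1 * (F (h + s) - F s - h * F1 s).
      by rewrite /= /GRing.scale/= mulr1; field.
    by rewrite normrM normrN normfV ler_pdivrMl ?normr_gt0// [leRHS]mulrC.
  apply: DeriveDef; first by apply/cvg_ex; exists (F1 s); exact: cv.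
  by apply: cvg_lim cv; exact: Rhausdorff.
have cF : {within `[a, b], continuous F}.
  apply/subspace_continuousP => s; rewrite /= in_itv/= => /andP[sa sb].
  have sT : 0 <= s <= T by rewrite (le_trans a0 sa) (le_trans sb bT).
  apply/cvgrPdist_le => e e0; have [d d0 dP] := FF s sT 1 ltr01.
  rewrite near_withinE; pose B := `|F1 s| + 1.
  have B0 : 0 < B by rewrite ltr_wpDl.
  exists (Num.min d (e / B)); first by rewrite /= lt_min d0 divr_gt0.
  move=> u; rewrite /ball_/= distrC lt_min => /andP[ud ue]; rewrite in_itv/= => /andP[ua ub].
  have uT : 0 <= u <= T by rewrite (le_trans a0 ua) (le_trans ub bT).
  have := dP u uT ud; rewrite mul1r => H.
  have -> : F s - F u = - (F u - F s - (u - s) * F1 s) - (u - s) * F1 s by ring.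
  apply: (le_trans (ler_normB _ _)); rewrite normrN normrM.
  move: ue; rewrite ltr_pdivlMr// /B mulrDr mulr1; move: H.
  move: `|u - s| `|F1 s| `|_| => x y z; lra.
have [c cab ->] := MVT_segment ab dF cF.
rewrite normrM (ger0_norm (x := b - a)) ?subr_ge0// ler_wpM2r ?subr_ge0// FK//.
Qed.

(** The mean value inequality is applied to F(t) - t F1(a), whose derivative is at most K (b - a) in
    size; hence the constant K in place of K / 2. *)
Lemma TD_taylor2 T F F1 F2 (a b K : R) : TD T F F1 -> TD T F1 F2 ->
  0 <= a -> a <= b -> b <= T -> (forall s, a <= s <= b -> `|F2 s| <= K) ->
  `|F b - F a - (b - a) * F1 a| <= K * (b - a) ^+ 2.
Proof.
move=> FF FF1 a0 ab bT FK.
have K0 : 0 <= K by apply: le_trans (FK a _); rewrite ?lexx.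
have := TD_mean (TDB FF (@TD_lin T (F1 a))) a0 ab bT (K := K * (b - a)).
have -> : F b - b * F1 a - (F a - a * F1 a) = F b - F a - (b - a) * F1 a by ring.
have -> : K * (b - a) * (b - a) = K * (b - a) ^+ 2 by ring.
apply => s /andP[sa sb].
have := TD_mean FF1 a0 sa (le_trans sb bT) (K := K).
move=> H; apply: (le_trans (H _)).
  by move=> u /andP[ua us]; apply: FK; rewrite ua (le_trans us sb).
by rewrite ler_wpM2l// lerD2r.
Qed.

Lemma TD_taylor3 T F F1 F2 F3 (a b K : R) : TD T F F1 -> TD T F1 F2 -> TD T F2 F3 ->
  0 <= a -> a <= b -> b <= T -> (forall s, a <= s <= b -> `|F3 s| <= K) ->
  `|F b - F a - (b - a) * F1 a - 2^-1 * (b - a) ^+ 2 * F2 a| <= K * (b - a) ^+ 3.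
Proof.
move=> FF FF1 FF2 a0 ab bT FK.
have K0 : 0 <= K by apply: le_trans (FK a _); rewrite ?lexx.
have := TD_mean (TDB (TDB FF (@TD_lin T (F1 a))) (@TD_sq T a (2^-1 * F2 a)))
  a0 ab bT (K := K * (b - a) ^+ 2).
have -> : F b - b * F1 a - (b - a) ^+ 2 * (2^-1 * F2 a) -
  (F a - a * F1 a - (a - a) ^+ 2 * (2^-1 * F2 a)) =
  F b - F a - (b - a) * F1 a - 2^-1 * (b - a) ^+ 2 * F2 a by ring.
have -> : K * (b - a) ^+ 2 * (b - a) = K * (b - a) ^+ 3 by ring.
apply => s /andP[sa sb].
have -> : F1 s - F1 a - 2 * (s - a) * (2^-1 * F2 a) = F1 s - F1 a - (s - a) * F2 a by field.
have := TD_taylor2 FF1 FF2 a0 sa (le_trans sb bT) (K := K).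
move=> H; apply: (le_trans (H _)).
  by move=> u /andP[ua us]; apply: FK; rewrite ua (le_trans us sb).
by rewrite ler_wpM2l// ler_sqr ?nnegrE ?subr_ge0// lerD2r.
Qed.

(** Iterated forward difference with step y. As a finite combination of point values it commutes
    with the time derivative, which is only known pointwise in x; bounds on space derivatives are
    recovered from it by [fdiff_derive_le]. *)
Fixpoint fdiff (k : nat) (y : R) (F : R -> R) : R -> R :=
  if k is k'.+1 then fdiff k' y (fun x => F (x + y) - F x) else F.

Lemma fdiffB k y F G x : fdiff k y (fun z => F z - G z) x = fdiff k y F x - fdiff k y G x.
Proof.
elim: k F G => [//|k IH] F G /=; rewrite -IH; congr (fdiff k y _ x).
by apply/funext => z; ring.
Qed.

Lemma fdiffZ k y c F x : fdiff k y (fun z => c * F z) x = c * fdiff k y F x.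
Proof.
elim: k F => [//|k IH] F /=; rewrite -IH; congr (fdiff k y _ x).
by apply/funext => z; ring.
Qed.

Lemma TD_fdiff T (F F1 : R -> R -> R) k y : (forall x, TD T (F^~ x) (F1^~ x)) ->
  forall x, TD T (fun t => fdiff k y (F t) x) (fun t => fdiff k y (F1 t) x).
Proof.
elim: k F F1 => [//|k IH] F F1 FF x /=.
by apply: (IH (fun t z => F t (z + y) - F t z) (fun t z => F1 t (z + y) - F1 t z)) => z; exact: TDB.
Qed.

Lemma is_derive_shift F (g y x : R) : is_derive (x + y) 1 F g ->
  is_derive x 1 (fun z => F (z + y)) g.
Proof.
move=> FG; have d1 : is_derive x 1 (fun x : R => x + y) (1 : R).
  by rewrite -[X in is_derive _ _ _ X]addr0; apply: is_deriveD.
have := @is_derive1_comp _ F (fun x => x + y) x _ _ FG d1.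
by rewrite mulr1.
Qed.

Lemma fdiff_mvt k y (H : nat -> R -> R) x :
  (forall i, (i < k)%N -> forall x : R, is_derive x 1 (H i) (H i.+1 x)) ->
  exists2 z, `|z - x| <= k%:R * `|y| & fdiff k y (H 0%N) x = y ^+ k * H k z.
Proof.
elim: k H => [|k IH] H dH; first by exists x; rewrite ?subrr ?normr0 ?mul0r ?expr0 ?mul1r.
have [|z zx zE] := IH (fun i z => H i (z + y) - H i z).
  move=> i ik u; apply: is_deriveB; first exact/is_derive_shift/dH/ltnW.
  exact/dH/ltnW.
have [c [c1 c2 cE]] := is_derive_mvt z (z + y) (dH k (ltnSn k)).
exists c; last by rewrite /= zE cE addrAC subrr add0r exprSr -mulrA [y * _]mulrC.
have cz : `|c - z| <= `|y|.
  move: c1 c2; rewrite ge_min le_max => /orP[] ? /orP[] ?; have := ler_norm y; have := ler_norm (- y); rewrite normrN => ? ?; rewrite ler_norml; apply/andP; split; lra.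
have -> : c - x = (c - z) + (z - x) by ring.
by apply: (le_trans (ler_normD _ _)); rewrite -natr1 mulrDl mul1r addrC; exact: lerD.
Qed.

End TimeDerivative.

(** * Expansions in powers of the step *)

Section Iterated.
Context {R : realType} {P : Type}.
Implicit Types (F G : P -> R -> R) (k i : nat).

Definition dn i F : P -> R -> R := iter i (fun G p => derive1 (G p)) F.

Lemma dnS i F : dn i.+1 F = dn i (fun p => derive1 (F p)).
Proof. by rewrite /dn iterSr. Qed.

Lemma CL_dn k i F : CL (k + i) F -> CL k (dn i F).
Proof.
elim: i F => [|i IH] F; first by rewrite addn0.
by rewrite addnS dnS => /CL_derive; exact: IH.
Qed.

Lemma isder_dn k i F : CL k F -> (i < k)%N -> isder (dn i F) (dn i.+1 F).
Proof.
move=> FL ik; apply: (@CL_isder _ _ (k - i.+1)%N); apply: CL_dn.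
by rewrite addSnnS subnK.
Qed.

(** Of the k + 1 differences, k are turned into derivatives by the mean value theorem and the last
    one uses the Lipschitz bound of the k-th derivative. *)
Lemma CL_fdiff k F : CL k F -> exists K, 0 <= K /\
  forall p y x, `|fdiff k.+1 y (F p) x| <= K * `|y| ^+ k.+1.
Proof.
move=> FL; have FLk : CL 0 (dn k F) by apply: CL_dn; rewrite add0n.
have [K [K0 FK]] := CL_lip FLk; exists K; split => // p y x.
have [|z zx /= ->] := @fdiff_mvt _ k y (fun i z => dn i F p (z + y) - dn i F p z) x.
  move=> i ik u; apply: is_deriveB; first exact/is_derive_shift/(isder_dn FL ik).
  exact: (isder_dn FL ik).
rewrite normrM normrX exprS [leRHS]mulrCA mulrA [leRHS]mulrC ler_wpM2l ?exprn_ge0//.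
by apply: le_trans (FK _ _ _) _; rewrite addrAC subrr add0r mulrC.
Qed.

Lemma CL_fdiff_le k j F : CL k F -> (j <= k.+1)%N -> exists K, 0 <= K /\
  forall p y x, `|fdiff j y (F p) x| <= K * `|y| ^+ j.
Proof.
move=> FL; case: j => [_|j]; last by rewrite ltnS => jk; exact: CL_fdiff (CL_le jk FL).
have [K FK] := CL_bounded FL; exists `|K|; split => // p y x /=.
by rewrite expr0 mulr1 (le_trans (FK p x))// ler_norm.
Qed.

(** For small y the k-th difference is y^k times a value of [H k] near x, so a bound B |y|^k for all
    y passes to [H k x] by continuity. *)
Lemma fdiff_derive_le k (H : nat -> R -> R) (B : R) :
  (forall i, (i < k)%N -> forall x : R, is_derive x 1 (H i) (H i.+1 x)) ->
  continuous (H k) -> (forall y x, `|fdiff k y (H 0%N) x| <= B * `|y| ^+ k) ->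
  forall x, `|H k x| <= B.
Proof.
move=> dH cH HB x; rewrite leNgt; apply/negP => Bx.
have := cH x; move/cvgrPdist_lt => /(_ (`|H k x| - B)); rewrite subr_gt0 => /(_ Bx).
(* With this y the intermediate point of [fdiff_mvt] stays within distance d of x. *)
move=> [d /= d0 dP]; pose y := d / 2 / (k%:R + 1).
have k0 : 0 < k%:R + 1 :> R by rewrite ltr_wpDl.
have y0 : 0 < y by rewrite !divr_gt0.
have [z zx E] := fdiff_mvt y x dH; have := HB y x.
rewrite E normrM normrX mulrC ler_pM2r ?exprn_gt0 ?normr_gt0 ?gt_eqF// => Hz.
have : `|H k x - H k z| < `|H k x| - B.
  apply: dP; rewrite /ball_/= distrC; apply: (le_lt_trans zx).
  rewrite gtr0_norm// /y mulrA ltr_pdivrMr// mulrDr mulr1.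
  have -> : k%:R * (d / 2) = d * k%:R / 2 by field.
  have : 0 <= d * k%:R by rewrite mulr_ge0// ltW.
  by move: (d * _) => u; lra.
have -> : `|H k x| = `|(H k x - H k z) + H k z| by rewrite subrK.
move=> h1; have := ler_normD (H k x - H k z) (H k z); lra.
Qed.

End Iterated.

(** * Finite expansions and their products, inverses and square roots *)

Section Expansions.
Context {R : realType} {Q S : Type} (pr : S -> Q) (eta : S -> R).
Hypothesis eta1 : forall s, `|eta s| <= 1.
Implicit Types (F G : S -> R) (f g : Q -> R) (l : seq (Q -> R)).

Definition bdd (T : Type) (F : T -> R) := exists K, forall s, `|F s| <= K.

(* F = f0 + eta f1 + ... + eta^n f_n + O(eta^(n+1)), with coefficients that do
   not see the sign of the step, which S may record besides the point of Q. *)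
Fixpoint Ex F l : Prop :=
  if l is f :: l' then bdd f /\ exists G, (forall s, F s = f (pr s) + eta s * G s) /\ Ex G l'
  else bdd F.

Lemma bddD (T : Type) (F G : T -> R) : bdd F -> bdd G -> bdd (fun s => F s + G s).
Proof.
move=> [K FK] [L GL]; exists (K + L) => s; apply: (le_trans (ler_normD _ _)).
exact: lerD.
Qed.

Lemma bddM (T : Type) (F G : T -> R) : bdd F -> bdd G -> bdd (fun s => F s * G s).
Proof. by move=> [K FK] [L GL]; exists (K * L) => s; rewrite normrM; exact: ler_pM. Qed.

Lemma bddN (T : Type) (F : T -> R) : bdd F -> bdd (fun s => - F s).
Proof. by move=> [K FK]; exists K => s; rewrite normrN. Qed.

Lemma bddB (T : Type) (F G : T -> R) : bdd F -> bdd G -> bdd (fun s => F s - G s).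
Proof. by move=> FK GL; apply: bddD => //; exact: bddN. Qed.

Lemma bdd_cst (T : Type) (c : R) : bdd (fun _ : T => c).
Proof. by exists `|c|. Qed.

Lemma bddX (T : Type) (F : T -> R) n : bdd F -> bdd (fun s => F s ^+ n).
Proof. by move=> [K FK]; exists (K ^+ n) => s; rewrite normrX lerXn2r ?nnegrE// (le_trans _ (FK s)). Qed.

Lemma bddV (T : Type) (F : T -> R) c : 0 < c -> (forall s, c <= `|F s|) -> bdd (fun s => (F s)^-1).
Proof.
move=> c0 Fc; exists c^-1 => s; rewrite normfV lef_pV2 ?Fc// posrE//.
exact: lt_le_trans (Fc s).
Qed.

Lemma bdd_comp (T U : Type) (F : T -> R) (p : U -> T) : bdd F -> bdd (fun u => F (p u)).
Proof. by move=> [K FK]; exists K => s. Qed.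

Lemma bdd_eta : bdd eta.
Proof. by exists 1. Qed.

Lemma Ex_bdd F l : Ex F l -> bdd F.
Proof.
elim: l F => [//|f l IH] F [bf [G [FG /IH bG]]].
have -> : F = fun s => f (pr s) + eta s * G s by apply/funext.
by apply: bddD; [exact: bdd_comp|exact: bddM bdd_eta bG].
Qed.

Lemma Ex_trunc F l l' : Ex F (l ++ l') -> Ex F l.
Proof.
elim: l F => [|f l IH] F /=; first exact: Ex_bdd.
by move=> [bf [G [FG /IH GL]]]; split => //; exists G.
Qed.

Lemma Ex_belast F f l : Ex F (f :: l) -> Ex F (belast f l).
Proof. by rewrite lastI -cats1; exact: Ex_trunc. Qed.

Fixpoint sadd l l' := match l, l' with
  | f :: l, g :: l' => (fun q => f q + g q) :: sadd l l' | _, _ => [::] end.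

Definition sscale f l := [seq (fun q => f q * g q) | g <- l].

(** Cauchy product cut at n coefficients: if F = f + eta F' and G = g + eta G', then F G = f g + eta
    (f G' + F' G), and in F' G the factor G is needed to one order less, hence [belast]. *)
Fixpoint smul n l l' := match n, l, l' with
  | n.+1, f :: l, g :: l' => (fun q => f q * g q) ::
      sadd (sscale f l') (smul n l (belast g l'))
  | _, _, _ => [::] end.

Lemma ExD F G l l' : size l = size l' -> Ex F l -> Ex G l' ->
  Ex (fun s => F s + G s) (sadd l l').
Proof.
elim: l l' F G => [|f l IH] [|g l'] // F G; first by move=> _; exact: bddD.
move=> [sl] [bf [F' [FF FL]]] [bg [G' [GG GL]]]; split; first exact: bddD.
exists (fun s => F' s + G' s); split; last exact: IH.
by move=> s; rewrite FF GG; ring.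
Qed.

Lemma ExZ f F l : bdd f -> Ex F l -> Ex (fun s => f (pr s) * F s) (sscale f l).
Proof.
move=> bf; elim: l F => [|g l IH] F /=; first by apply: bddM; exact: bdd_comp.
move=> [bg [G [FG /IH GL]]]; split; first exact: bddM.
by exists (fun s => f (pr s) * G s); split => // s; rewrite FG; ring.
Qed.

Lemma ExM F G l l' : size l = size l' -> Ex F l -> Ex G l' ->
  Ex (fun s => F s * G s) (smul (size l) l l').
Proof.
elim: l l' F G => [|f l IH] [|g l'] // F G; first by move=> _; exact: bddM.
move=> [sl] [bf [F' [FF FL]]] GL; have [bg [G' [GG G'L]]] := GL.
split; first exact: bddM.
exists (fun s => f (pr s) * G' s + F' s * G s); split; first by move=> s; rewrite FF GG; ring.
apply: ExD; [|exact: ExZ|apply: IH => //; [by rewrite size_belast|exact: Ex_belast]].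
have : size (smul (size l) l (belast g l')) = size l.
  have : size (belast g l') = size l by rewrite size_belast.
  move: (belast g l'); elim: (l) => [|a m IHm] [|a' m'] //= [sm].
  have : size (smul (size m) m (belast a' m')) = size m by apply: IHm; rewrite size_belast.
  rewrite /sscale; move: (smul _ _ _) => w sw; congr _.+1.
  have : size w = size m' by rewrite sw.
  rewrite -sm; elim: (m') w {sw} => [|c m2 IH2] [|d w] //= [sw].
  by rewrite IH2.
by move=> ->; rewrite /sscale size_map.
Qed.

Lemma Ex_ext F F' l l' : (forall s, F s = F' s) -> size l = size l' ->
  (forall i, (i < size l)%N -> forall q, nth (fun=> 0) l i q = nth (fun=> 0) l' i q) ->
  Ex F l -> Ex F' l'.
Proof.
move=> /funext <- sl ll; suff -> : l = l' by [].
by apply: (eq_from_nth (x0 := fun=> 0)) => // i /ll; move/funext.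
Qed.

Lemma ExC f l : bdd f -> all (fun=> true) l -> Ex (fun s => f (pr s)) (f :: [seq (fun=> 0) | _ <- l]).
Proof.
move=> bf _; split => //; exists (fun=> 0); split; first by move=> s; rewrite mulr0 addr0.
elim: l => [|g l IH] /=; first exact: bdd_cst.
split; first exact: bdd_cst.
by exists (fun=> 0); split => // s; rewrite mulr0 addr0.
Qed.

(** From F = f + eta G follows 1/F = 1/f - eta (1/f) G (1/F), where 1/F on the right is needed to
    one order less. *)
Fixpoint sinv n l := match n, l with
  | n.+1, f :: l => (fun q => (f q)^-1) ::
     sscale (fun q => - (f q)^-1) (smul n l (sinv n (belast f l)))
  | _, _ => [::] end.

Lemma size_sinv n l : size l = n -> size (sinv n l) = n.
Proof.
have szm m (a b : seq (Q -> R)) : size a = m -> size b = m -> size (smul m a b) = m.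
  elim: m a b => [|m IH] [|x a] [|y b] //= [sa] [sb].
  have := IH a (belast y b) sa; rewrite size_belast => /(_ sb).
  rewrite /sscale; move: (smul _ _ _) => w sw; congr _.+1.
  have : size w = size b by rewrite sw.
  rewrite -sb; elim: (b) w {sw} => [|c m2 IH2] [|d w] //= [sw].
  by rewrite IH2.
elim: n l => [|n IH] [|f l] //= [sl]; rewrite size_map szm// IH// size_belast//.
Qed.

Lemma ExV F l c : 0 < c -> (forall s, c <= `|F s|) ->
  (forall f l', l = f :: l' -> forall q, c <= `|f q|) ->
  Ex F l -> Ex (fun s => (F s)^-1) (sinv (size l) l).
Proof.
move=> c0 Fc; have F0 s : F s != 0 by rewrite -normr_gt0; exact: lt_le_trans (Fc s).
move: {1 3}(size l) (erefl (size l)) => n; elim: n l => [|n IH] [|f l] //.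
  by move=> _ _ _; exact: bddV Fc.
move=> [sl] /(_ f l erefl) fc FL; have [bf [G [FG GL]]] := FL.
have f0 q : f q != 0 by rewrite -normr_gt0; exact: lt_le_trans (fc q).
have bf' : bdd (fun q => (f q)^-1) by exact: bddV fc.
split => //; exists (fun s => - (f (pr s))^-1 * (G s * (F s)^-1)); split.
  move=> s; have := FG s; have := F0 s; have := f0 (pr s); move: (F s) (f (pr s)) (G s) (eta s).
  move=> x y g e y0 x0 xE; have eg : e * g = x - y by rewrite xE; ring.
  have -> : e * (- y^-1 * (g / x)) = - y^-1 * (e * g / x) by ring.
  by rewrite eg; field; rewrite x0 y0.
apply: (@ExZ (fun q => - (f q)^-1)); first exact: bddN.
have FV : Ex (fun s => (F s)^-1) (sinv n (belast f l)).
  apply: IH; first by rewrite size_belast.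
    by move=> g m; case: (l) => [|g' l'] //= [<- _]; exact: fc.
  exact: Ex_belast.
by rewrite {1}sl; apply: ExM => //; rewrite size_sinv ?size_belast.
Qed.

Lemma size_sadd l l' : size l = size l' -> size (sadd l l') = size l.
Proof. by elim: l l' => [|f l IH] [|g l'] //= [/IH ->]. Qed.

Lemma size_smul n l l' : size l = n -> size l' = n -> size (smul n l l') = n.
Proof.
elim: n l l' => [|n IH] [|f l] [|g l'] //= [sl] [sl'].
by rewrite size_sadd /sscale size_map ?sl' ?IH// size_belast sl'.
Qed.

(** From F = f + eta G follows sqrt F = sqrt f + eta G / (sqrt f + sqrt F), where sqrt F on the
    right is needed to one order less. *)
Fixpoint ssqrt n l := match n, l with
  | n.+1, f :: l => let s0 q := Num.sqrt (f q) in
     s0 :: smul n l (sinv n (if ssqrt n (belast f l) is g :: m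
       then (fun q => s0 q + g q) :: m else [::]))
  | _, _ => [::] end.

Lemma size_ssqrt n l : size l = n -> size (ssqrt n l) = n.
Proof.
elim: n l => [|n IH] [|f l] //= [sl]; congr _.+1; apply: size_smul => //.
apply: size_sinv; have : size (ssqrt n (belast f l)) = n by rewrite IH// size_belast.
by case: ssqrt.
Qed.

Lemma Ex_sqrt F l c : 0 < c -> (forall s, c <= F s) ->
  (forall f l', l = f :: l' -> forall q, c <= f q) ->
  Ex F l -> Ex (fun s => Num.sqrt (F s)) (ssqrt (size l) l).
Proof.
move=> c0 Fc.
have sc0 : 0 < Num.sqrt c by rewrite sqrtr_gt0.
have bS (T : Type) (G : T -> R) : bdd G -> bdd (fun s => Num.sqrt (G s)).
  move=> [K GK]; exists (Num.sqrt K) => s; rewrite ger0_norm ?sqrtr_ge0//.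
  by rewrite ler_wsqrtr// (le_trans (ler_norm _)).
move: {1 3}(size l) (erefl (size l)) => n; elim: n l => [|n IH] [|f l] //.
  by move=> _ _; exact: bS.
move=> [sl] /(_ f l erefl) fc FL; have [bf [G [FG GL]]] := FL.
pose rt s := Num.sqrt (F s); pose s0 q := Num.sqrt (f q).
have rtc s : Num.sqrt c <= rt s by rewrite ler_wsqrtr.
have s0c q : Num.sqrt c <= s0 q by rewrite ler_wsqrtr.
have SL : Ex rt (ssqrt n (belast f l)).
  apply: IH; first by rewrite size_belast.
    by move=> g m; case: (l) => [|g' l'] //= [<- _].
  exact: Ex_belast.
have sSL : size (ssqrt n (belast f l)) = n by rewrite size_ssqrt ?size_belast.
have s0b : bdd s0 by exact: bS.
split => //; exists (fun s => G s * (s0 (pr s) + rt s)^-1); split.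
  move=> s; rewrite -/(rt s) -/(s0 _).
  have p : s0 (pr s) + rt s != 0.
    by rewrite gt_eqF// addr_gt0// (lt_le_trans sc0).
  have E : eta s * G s = (rt s - s0 (pr s)) * (s0 (pr s) + rt s).
    have F0 : 0 <= F s by exact: le_trans (ltW c0) (Fc s).
    have f0 : 0 <= f (pr s) by exact: le_trans (ltW c0) (fc _).
    have -> : eta s * G s = F s - f (pr s) by rewrite FG; ring.
    rewrite -[in LHS](sqr_sqrtr F0) -[in LHS](sqr_sqrtr f0) -/(rt s) -/(s0 _); ring.
  by rewrite mulrA E mulfK//; ring.
have addL m : Ex rt m -> Ex (fun s => s0 (pr s) + rt s)
    (if m is g :: m' then (fun q => s0 q + g q) :: m' else [::]).
  case: m => [|g m] /=; first by apply: bddD; exact: bdd_comp.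
  move=> [bg [H [HH HL]]]; split; first exact: bddD.
  by exists H; split => // s; rewrite HH addrA.
have {}addL := addL _ SL.
set m := (if _ is _ :: _ then _ else _) in addL *.
have sm : size m = n by rewrite /m; move: sSL; case: ssqrt.
rewrite {1}sl; apply: ExM; first by rewrite size_sinv.
  by [].
rewrite -[X in sinv X]sm; apply: (@ExV _ _ (Num.sqrt c)) => //.
  by move=> s; rewrite (le_trans (rtc s))// ger0_norm ?lerDr ?addr_ge0 ?sqrtr_ge0.
move=> g m' mE q; move: (mE); rewrite /m.
case E : ssqrt => [//|g' m2] [<- _].
have s0q : Num.sqrt c <= s0 q by [].
have g'0 : 0 <= g' q.
  move: E; case: (n) sl => [//|n'] sln; case: (l) sln => //= f' l' _ [<- _].
  exact: sqrtr_ge0.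
by rewrite (le_trans s0q)// ger0_norm ?lerDl ?addr_ge0 ?sqrtr_ge0.
Qed.

End Expansions.

(** * Even and odd parts with respect to the sign of the step *)

Section Parity.
Context {R : realType} {Q : Type} (h : Q -> R).
Hypothesis h1 : forall q, `|h q| <= 1.

(** The Boolean names the side of the node: the edge after it belongs to the step h, the edge before
    it to the step - h. *)
Definition sgstep (s : Q * bool) : R := if s.2 then h s.1 else - h s.1.
Definition sqstep (q : Q) : R := h q ^+ 2.

Lemma sgstep_le1 s : `|sgstep s| <= 1.
Proof. by rewrite /sgstep; case: s.2; rewrite ?normrN. Qed.

Lemma sqstep_le1 q : `|sqstep q| <= 1.
Proof. by rewrite /sqstep normrX exprn_ile1. Qed.

Implicit Types (F : Q * bool -> R) (f : Q -> R).

Lemma Ex_odd3 F f0 f1 f2 : Ex fst sgstep F [:: f0; f1; f2] ->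
  exists X, (forall q, F (q, true) - F (q, false) = h q * X q) /\
    Ex id sqstep X [:: fun q => 2 * f1 q].
Proof.
move=> [_ [F0 [FE0 [b1 [F1 [FE1 [_ [F2 [FE2 b2]]]]]]]]].
exists (fun q => 2 * f1 q + sqstep q * (F2 (q, true) + F2 (q, false))); split.
  by move=> q; rewrite FE0 [F (_, false)]FE0 !FE1 !FE2 /sgstep /sqstep/=; ring.
split; first by apply: bddM => //; exact: bdd_cst.
exists (fun q => F2 (q, true) + F2 (q, false)); split => //.
by apply: bddD; exact: (bdd_comp _ b2).
Qed.

(** The even coefficients cancel between the two sides. The coefficient f4 serves to push the
    remainder to h^5, which after division by h leaves two full orders in h^2. *)
Lemma Ex_odd5 F f0 f1 f2 f3 f4 : Ex fst sgstep F [:: f0; f1; f2; f3; f4] ->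
  exists X, (forall q, F (q, true) - F (q, false) = h q * X q) /\
    Ex id sqstep X [:: fun q => 2 * f1 q; fun q => 2 * f3 q].
Proof.
move=> [_ [F0 [FE0 [b1 [F1 [FE1 [_ [F2 [FE2 [b3 [F3 [FE3 [_ [F4 [FE4 b4]]]]]]]]]]]]]]].
exists (fun q => 2 * f1 q + sqstep q * (2 * f3 q + sqstep q * (F4 (q, true) + F4 (q, false)))); split.
  by move=> q; rewrite FE0 [F (_, false)]FE0 !FE1 !FE2 !FE3 !FE4 /sgstep /sqstep/=; ring.
split; first by apply: bddM => //; exact: bdd_cst.
eexists; split => //; split; first by apply: bddM => //; exact: bdd_cst.
eexists; split => //.
by apply: bddD; exact: (bdd_comp _ b4).
Qed.

Lemma Ex_even5 F f0 f1 f2 f3 f4 : Ex fst sgstep F [:: f0; f1; f2; f3; f4] ->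
  Ex id sqstep (fun q => F (q, true) + F (q, false)) [:: fun q => 2 * f0 q; fun q => 2 * f2 q].
Proof.
move=> [b0 [F0 [FE0 [b1 [F1 [FE1 [b2 [F2 [FE2 [b3 [F3 [FE3 [b4 [F4 [FE4 bF]]]]]]]]]]]]]]].
split; first by apply: bddM => //; exact: bdd_cst.
exists (fun q => 2 * f2 q + sqstep q * (2 * f4 q + h q * (F4 (q, true) - F4 (q, false)))); split.
  by move=> q; rewrite FE0 [F (_, false)]FE0 !FE1 !FE2 !FE3 !FE4 /sgstep /sqstep/=; ring.
split; first by apply: bddM => //; exact: bdd_cst.
eexists; split => //; apply: bddD; first by apply: bddM => //; exact: bdd_cst.
apply: bddM; first by exists 1.
by apply: bddB; exact: (bdd_comp _ bF).
Qed.

End Parity.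

(** * Frame components of the geometric quantities *)

Section PlaneVectors.
Context {R : realType}.
Implicit Types (u v : 'rV[R]_2).

Definition vec (a b : R) : 'rV[R]_2 := \row_(i < 2) if i == 0 then a else b.

Lemma vec0 a b : vec a b 0 0 = a. Proof. by rewrite mxE. Qed.
Lemma vec1 a b : vec a b 0 1 = b. Proof. by rewrite mxE. Qed.

Lemma vecP u v : u 0 0 = v 0 0 -> u 0 1 = v 0 1 -> u = v.
Proof.
move=> h0 h1; apply/rowP => i; case: i => [[|[|//]] hi].
- by rewrite (_ : Ordinal hi = 0)//; apply: val_inj.
- by rewrite (_ : Ordinal hi = 1)//; apply: val_inj.
Qed.

Lemma vec_eta u : u = vec (u 0 0) (u 0 1).
Proof. by apply: vecP; rewrite ?vec0 ?vec1. Qed.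

Lemma vecD a b c d : vec a b + vec c d = vec (a + c) (b + d).
Proof. by apply: vecP; rewrite !mxE. Qed.
Lemma vecZ a b c : c *: vec a b = vec (c * a) (c * b).
Proof. by apply: vecP; rewrite !mxE. Qed.
Lemma rot_vec a b : rot (vec a b) = vec b (- a).
Proof. by apply: vecP; rewrite !mxE. Qed.
Lemma dotpE u v : dotp u v = u 0 0 * v 0 0 + u 0 1 * v 0 1.
Proof.
rewrite /dotp big_ord_recl big_ord_recl big_ord0 addr0; congr (_ + _ * _).
  by congr (u _ _); apply: val_inj.
by congr (v _ _); apply: val_inj.
Qed.
Lemma dotp_vec a b c d : dotp (vec a b) (vec c d) = a * c + b * d.
Proof. by rewrite dotpE !vec0 !vec1. Qed.

Lemma derive1_vec (f g : R -> R) (x : R) : derivable f x 1 -> derivable g x 1 ->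
  derive1 (fun x => vec (f x) (g x)) x = vec (derive1 f x) (derive1 g x).
Proof.
move=> df dg.
have d : derivable (fun x => vec (f x) (g x)) x 1.
  apply/derivable_mxP => i j; rewrite (ord1 i) {i}.
  case: j => [[|[|//]] hj].
    rewrite (_ : Ordinal hj = 0); last exact: val_inj.
    by under eq_fun do rewrite vec0.
  rewrite (_ : Ordinal hj = 1); last exact: val_inj.
  by under eq_fun do rewrite vec1.
rewrite derive1E (derive_mx d); apply: vecP; rewrite mxE ?vec0 ?vec1 derive1E.
  by under eq_fun do rewrite vec0.
by under eq_fun do rewrite vec1.
Qed.

Lemma derivable_coord (Y : R -> 'rV[R]_2) (x : R) i : derivable Y x 1 ->
  derivable (fun x => Y x 0 i) x 1 /\ derive1 Y x 0 i = derive1 (fun x => Y x 0 i) x.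
Proof.
move=> dY; split; first by move/derivable_mxP : (dY); exact.
by rewrite derive1E (derive_mx dY) mxE derive1E.
Qed.

End PlaneVectors.

Section Frame.
Context {R : realType} {P : Type}.
Variables (w cc ss : P -> R -> R).
Hypothesis dcc : isder cc (fun p x => - (w p x * ss p x)).
Hypothesis dss : isder ss (fun p x => w p x * cc p x).
Hypothesis cs1 : forall p x, cc p x ^+ 2 + ss p x ^+ 2 = 1.
Implicit Types (t n : P -> R -> R).

(* The vector with components t and n in the moving frame of the tangent (cc, ss)
   and the normal (ss, - cc). *)
Definition fr t n p x := vec (t p x * cc p x + n p x * ss p x) (t p x * ss p x - n p x * cc p x).

Lemma derive1_fr t n t' n' : isder t t' -> isder n n' -> forall p,
  derive1 (fr t n p) = fr (fun p x => t' p x + w p x * n p x) (fun p x => n' p x - w p x * t p x) p.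
Proof.
move=> dt dn p; apply/funext => x.
have d0 := isderD (isderM dt dcc) (isderM dn dss).
have d1 := isderB (isderM dt dss) (isderM dn dcc).
rewrite /fr derive1_vec; [|by case: (d0 p x)|by case: (d1 p x)].
by rewrite (derive1_is (d0 p)) (derive1_is (d1 p)); congr vec; ring.
Qed.

Lemma dotp_fr t n t' n' p x : dotp (fr t n p x) (fr t' n' p x) = t p x * t' p x + n p x * n' p x.
Proof.
rewrite dotp_vec; have := cs1 p x; move: (cc p x) (ss p x) (t p x) (n p x) (t' p x) (n' p x).
move=> a b c d e f ab; have -> : (c * a + d * b) * (e * a + f * b) + (c * b - d * a) * (e * b - f * a)
  = (c * e + d * f) * (a ^+ 2 + b ^+ 2) by ring.
by rewrite ab mulr1.
Qed.

Lemma frZ (c : P -> R -> R) t n p x : c p x *: fr t n p x = fr (fun p x => c p x * t p x) (fun p x => c p x * n p x) p x.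
Proof. by rewrite /fr vecZ; congr vec; ring. Qed.

Lemma frD t n t' n' p x : fr t n p x + fr t' n' p x = fr (fun p x => t p x + t' p x) (fun p x => n p x + n' p x) p x.
Proof. by rewrite /fr vecD; congr vec; ring. Qed.

End Frame.

(** * Regularity of the speed, the frame and the curvature *)

Section CurveGeometry.
Context {R : realType} {P : Type}.
Variables (Y : P -> R -> 'rV[R]_2) (c : R).
Hypothesis c0 : 0 < c.
Hypothesis dY : forall p (x : R), derivable (Y p) x 1.
Hypothesis cY : forall p x, c <= speed (Y p) x.
Let X p x := Y p x 0 0.
Let Z p x := Y p x 0 1.

Let q p := speed (Y p).
Let cc p x := tau (Y p) x 0 0.
Let ss p x := tau (Y p) x 0 1.
Let k p := kappa (Y p).

Lemma speedE p x : q p x = Num.sqrt (derive1 (X p) x ^+ 2 + derive1 (Z p) x ^+ 2).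
Proof.
rewrite /q /speed /enorm dotpE -!expr2.
by rewrite !(derivable_coord _ (@dY p x)).2.
Qed.

Lemma speed_gt0 p x : 0 < q p x. Proof. exact: lt_le_trans (cY p x). Qed.

Lemma speed_sqr p x : q p x ^+ 2 = derive1 (X p) x ^+ 2 + derive1 (Z p) x ^+ 2.
Proof. by rewrite speedE sqr_sqrtr// addr_ge0 ?sqr_ge0. Qed.

Lemma tau0E p x : cc p x = (q p x)^-1 * derive1 (X p) x.
Proof. by rewrite /cc /tau mxE (derivable_coord _ (@dY p x)).2. Qed.

Lemma tau1E p x : ss p x = (q p x)^-1 * derive1 (Z p) x.
Proof. by rewrite /ss /tau mxE (derivable_coord _ (@dY p x)).2. Qed.

Lemma tau_vec p : tau (Y p) = fun x => vec (cc p x) (ss p x).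
Proof. by apply/funext => x; exact: vec_eta. Qed.

Lemma tau_unit p x : cc p x ^+ 2 + ss p x ^+ 2 = 1.
Proof.
rewrite tau0E tau1E !exprMn -mulrDr -speed_sqr -exprMn mulVf ?expr1n//.
by rewrite gt_eqF// speed_gt0.
Qed.

Hypothesis XL : CL 5 X.
Hypothesis ZL : CL 5 Z.

Lemma isder_X : isder X (fun p x => q p x * cc p x).
Proof.
apply: (isder_ext (CL_isder XL)) => p x; rewrite tau0E mulVKf//.
by rewrite gt_eqF// speed_gt0.
Qed.

Lemma isder_Z : isder Z (fun p x => q p x * ss p x).
Proof.
apply: (isder_ext (CL_isder ZL)) => p x; rewrite tau1E mulVKf//.
by rewrite gt_eqF// speed_gt0.
Qed.

Lemma CL_speed : CL 4 q.
Proof.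
have -> : q = fun p x => Num.sqrt (derive1 (X p) x ^+ 2 + derive1 (Z p) x ^+ 2).
  by apply/funext => p; apply/funext => x; exact: speedE.
apply: (@CL_sqrt _ _ _ _ (c ^+ 2)); first exact: exprn_gt0.
  by move=> p x; rewrite -speed_sqr ler_sqr ?cY// nnegrE ?ltW// speed_gt0.
by apply: CLD; apply: CLX; exact: CL_derive.
Qed.

Lemma CL_speedV : CL 4 (fun p x => (q p x)^-1).
Proof. by apply: (CLV c0 _ CL_speed) => p x; rewrite ger0_norm ?cY// ltW// speed_gt0. Qed.

Lemma CL_tau0 : CL 4 cc.
Proof.
have -> : cc = fun p x => (q p x)^-1 * derive1 (X p) x by apply/funext => p; apply/funext => x; exact: tau0E.
by apply: CLM; [exact: CL_speedV|exact: CL_derive].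
Qed.

Lemma CL_tau1 : CL 4 ss.
Proof.
have -> : ss = fun p x => (q p x)^-1 * derive1 (Z p) x by apply/funext => p; apply/funext => x; exact: tau1E.
by apply: CLM; [exact: CL_speedV|exact: CL_derive].
Qed.

Lemma kappaE p x : k p x = (q p x)^-1 * (derive1 (ss p) x * cc p x - derive1 (cc p) x * ss p x).
Proof.
rewrite /k /kappa /ds /nor tau_vec derive1_vec.
- by rewrite vecZ rot_vec dotp_vec -/(q p x); ring.
- by case: (CL_isder CL_tau0 p x).
- by case: (CL_isder CL_tau1 p x).
Qed.

Lemma CL_kappa : CL 3 k.
Proof.
have -> : k = fun p x => (q p x)^-1 * (derive1 (ss p) x * cc p x - derive1 (cc p) x * ss p x).
  by apply/funext => p; apply/funext => x; exact: kappaE.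
apply: CLM; first exact/CLS/CL_speedV.
apply: CLB; apply: CLM.
- exact: CL_derive CL_tau1.
- exact: CLS CL_tau0.
- exact: CL_derive CL_tau0.
- exact: CLS CL_tau1.
Qed.

(** The derivative of a unit vector is orthogonal to it, hence determined by its product with the
    other vector of the frame, which is q k by the definition of the curvature. *)
Lemma frame_derivatives :
  isder cc (fun p x => - ((q p x * k p x) * ss p x)) /\
  isder ss (fun p x => (q p x * k p x) * cc p x).
Proof.
have dc := CL_isder CL_tau0; have dz := CL_isder CL_tau1.
have orth p x : cc p x * derive1 (cc p) x + ss p x * derive1 (ss p) x = 0.
  have h := isderD (isderM dc dc) (isderM dz dz).
  have e : (fun p x => cc p x * cc p x + ss p x * ss p x) = fun _ _ => 1.
    by apply/funext => p'; apply/funext => x'; rewrite -!expr2 tau_unit.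
  rewrite e in h; have := isder_uniq h (isder_cst (fun=> 1)).
  move=> /(congr1 (fun f => f p x)) => {}h.
  have : 2 * (cc p x * derive1 (cc p) x + ss p x * derive1 (ss p) x) = 0.
    by rewrite -[RHS]h; ring.
  by move/eqP; rewrite mulf_eq0 pnatr_eq0 => /eqP.
have qk p x : q p x * k p x = derive1 (ss p) x * cc p x - derive1 (cc p) x * ss p x.
  by rewrite kappaE mulVKf// gt_eqF// speed_gt0.
split; [apply: (isder_ext dc)|apply: (isder_ext dz)] => p x; rewrite qk.
- have := orth p x; have := tau_unit p x.
  move: (cc p x) (ss p x) (derive1 (cc p) x) (derive1 (ss p) x) => a b a' b' u o.
  have : a' * (a ^+ 2 + b ^+ 2) = - ((b' * a - a' * b) * b) + a * (a * a' + b * b') by ring.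
  by rewrite u o mulr1 mulr0 addr0.
- have := orth p x; have := tau_unit p x.
  move: (cc p x) (ss p x) (derive1 (cc p) x) (derive1 (ss p) x) => a b a' b' u o.
  have : b' * (a ^+ 2 + b ^+ 2) = ((b' * a - a' * b) * a) + b * (a * a' + b * b') by ring.
  by rewrite u o mulr1 mulr0 addr0.
Qed.

Lemma tau_fr p x : tau (Y p) x = fr cc ss (fun _ _ => 1) (fun _ _ => 0) p x.
Proof. by rewrite tau_vec /fr; congr vec; ring. Qed.

Lemma nor_fr p x : nor (Y p) x = fr cc ss (fun _ _ => 0) (fun _ _ => 1) p x.
Proof. by rewrite /nor tau_vec rot_vec /fr; congr vec; ring. Qed.

Lemma velocity_fr (a b : P -> R -> R) p x : velocity (Y p) (a p) (b p) x = fr cc ss b a p x.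
Proof. by rewrite /velocity /nor tau_vec rot_vec !vecZ vecD /fr; congr vec; ring. Qed.

End CurveGeometry.

(** * The velocity equations written with derivatives in rho *)

Section Forms.
Context {R : realType}.
Implicit Types q k b : R.

(** The second rho-derivative of beta_0, solved for from its equation. Trailing digits count
    rho-derivatives, and q, k, b stand for the speed, the curvature and beta_0. *)
Definition beta0_form q q1 k k1 b b1 : R :=
  q1 * q^-1 * b1 + q ^+ 2 * (k ^+ 2 * b - 4^-1 * q1 * k ^+ 2) + 3 * q * k * k1.

Definition alpha2_form q q1 k k1 k2 b b1 : R :=
  - 2^-1 * (q^-1 * (q^-1 * k2 - q^-1 ^+ 2 * q1 * k1)) + 3 / 2 * k ^+ 3
  - 2 * k * (q^-1 * b1) + 2^-1 * k * b ^+ 2 - 12^-1 * k2 - 4^-1 * q^-1 * q1 * k1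
  - 4^-1 * q ^+ 2 * k ^+ 3 - (2^-1 * q1 * k + 6^-1 * q * k1) * b.

Definition S4_form q q1 q2 k k1 : R :=
  96^-1 * q ^+ 3 * k ^+ 3 * (q1 * k + 2 * q * k1)
  + 48^-1 * q2 * k * (q1 * k + 4 * q * k1)
  + 24^-1 * q1 * k1 * (q * k1 - q1 * k).

(* Components in the moving frame of the arc-length derivative of V0, and
   their first two derivatives. *)
Definition ft q k b1 : R := q^-1 * b1 - k ^+ 2.
Definition ft1 q q1 k k1 b1 b2 : R := q^-1 * b2 - q^-1 ^+ 2 * q1 * b1 - 2 * k * k1.
Definition ft2 q q1 q2 k k1 k2 b1 b2 b3 : R :=
  q^-1 * b3 - 2 * q^-1 ^+ 2 * q1 * b2 - q^-1 ^+ 2 * q2 * b1 + 2 * q^-1 ^+ 3 * q1 ^+ 2 * b1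
  - 2 * k1 ^+ 2 - 2 * k * k2.
Definition fn q k k1 b : R := - (q^-1 * k1) - k * b.
Definition fn1 q q1 k k1 k2 b b1 : R := - (q^-1 * k2) + q^-1 ^+ 2 * q1 * k1 - k1 * b - k * b1.
Definition fn2 q q1 q2 k k1 k2 k3 b b1 b2 : R :=
  - (q^-1 * k3) + 2 * q^-1 ^+ 2 * q1 * k2 + q^-1 ^+ 2 * q2 * k1 - 2 * q^-1 ^+ 3 * q1 ^+ 2 * k1
  - k2 * b - 2 * k1 * b1 - k * b2.

(** Here m and n are the frame components of the rho-derivative of d_s V0, and m1, n1 are the
    rho-derivatives of m and n as scalars, without the rotation of the frame. *)
Definition S2_form q q1 q2 k k1 k2 k3 b b1 b2 b3 : R :=
  let w := q * k in let w1 := q1 * k + q * k1 in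
  let f := ft q k b1 in let f1 := ft1 q q1 k k1 b1 b2 in
  let f2 := ft2 q q1 q2 k k1 k2 b1 b2 b3 in
  let g := fn q k k1 b in let g1 := fn1 q q1 k k1 k2 b b1 in
  let g2 := fn2 q q1 q2 k k1 k2 k3 b b1 b2 in
  let m := f1 + w * g in let n := g1 - w * f in
  let m1 := f2 + w1 * g + w * g1 in let n1 := g2 - w1 * f - w * f1 in
  - (12^-1 * (q2 * q^-1 * m - q1 ^+ 2 * q^-1 ^+ 2 * m + q1 * q^-1 * m1)
     + 24^-1 * ((2 * q * q1 * k ^+ 2 + 2 * q ^+ 2 * k * k1) * f + q ^+ 2 * k ^+ 2 * f1)
     + w * (12^-1 * q1 * q^-1 * n + 24^-1 * q ^+ 2 * k ^+ 2 * g))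
  + (2^-1 * q1 * k + 6^-1 * q * k1) * n
  - 6^-1 * (n1 - w * m) * w - 12^-1 * (m * w ^+ 2 + n * w1).

(** The value that the equation for beta_2 prescribes for [dssV2]. Neither alpha_2 nor beta_2 enters
    it, which makes it both smoother and easier to compare at two times. *)
Definition G2_form q q1 q2 k k1 k2 k3 b b1 b2 b3 : R :=
  S4_form q q1 q2 k k1 + S2_form q q1 q2 k k1 k2 k3 b b1 b2 b3
  + 8^-1 * q^-1 ^+ 2 * k ^+ 2 * (4 * q ^+ 3 * q1 * (q^-1 * b1 - k ^+ 2)
      + q ^+ 4 * (q^-1 * b2 - q^-1 ^+ 2 * q1 * b1 - 2 * k * k1))
  + 4^-1 * q * q1 * k * (q^-1 * (q^-1 * k2 - q^-1 ^+ 2 * q1 * k1) + k ^+ 3 + b * (q^-1 * k1))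
  + 2^-1 * (q^-1 * k1 + k * b) * (q^-1 * k2 - q^-1 ^+ 2 * q1 * k1 + k1 * b + k * b1).

(* q (d_ss V2) . tau for V2 = a n + e tau *)
Definition dssV2 q q1 k k1 a a1 e e1 e2 : R :=
  q^-1 * e2 - q^-1 ^+ 2 * q1 * e1 - q * k ^+ 2 * e + 2 * k * a1 + a * k1.

End Forms.

Opaque CL.

Ltac CLatom f := match goal with
  | H : CL ?m f |- CL ?n _ => refine (@CL_le _ _ m n _ _ H); reflexivity
  end.

Ltac CLtac := repeat match goal with
  | |- CL ?m (fun p x => (@?F p x) + (@?G p x)) => refine (@CLD _ _ m F G _ _)
  | |- CL ?m (fun p x => (@?F p x) * (@?G p x)) => refine (@CLM _ _ m F G _ _)
  | |- CL ?m (fun p x => - (@?F p x)) => refine (@CLN _ _ m F _)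
  | |- CL ?m (fun p x => (@?F p x) ^+ ?n) => refine (@CLX _ _ m F n _)
  | |- CL ?m (fun _ _ => ?c) => refine (@CL_num _ _ m c)
  | |- CL _ (fun p x => (?f p x)^-1) => CLatom (fun p x => (f p x)^-1)
  | |- CL _ (fun p x => ?f p x) => is_var f; CLatom f
  | |- CL _ ?f => is_var f; CLatom f
  end.

(** * Regularity gained from the velocity equations *)

Section Regularity.
Context {R : realType} {P : Type}.
Implicit Types (q k b : P -> R -> R).

Lemma CL_up (m : nat) (F G : P -> R -> R) : CL 0 F -> isder F G -> CL m G -> CL m.+1 F.
Proof. by move=> F0 FG GL; apply: (CL_intro (CL_bounded F0) FG GL). Qed.

(** Bootstrap: the equation expresses beta_0'' by beta_0, beta_0' and the geometry, so every pass
    raises the order. It ends at C^{4,1} because kappa' is only C^{2,1}. *)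
Lemma CL_beta0 q q1 k k1 b b1 b2 : CL 4 q -> CL 4 (fun p x => (q p x)^-1) -> CL 3 q1 ->
  CL 3 k -> CL 2 k1 -> CL 2 b -> isder b b1 -> isder b1 b2 ->
  (forall p x, b2 p x = beta0_form (q p x) (q1 p x) (k p x) (k1 p x) (b p x) (b1 p x)) ->
  CL 4 b.
Proof.
move=> qL qVL q1L kL k1L bL db db1 b2E.
have step m : (m <= 2)%N -> CL m b -> CL m b1 -> CL m b2.
  move=> m2 bm b1m; have -> : b2 = fun p x => beta0_form (q p x) (q1 p x) (k p x) (k1 p x) (b p x) (b1 p x).
    by apply/funext => p; apply/funext => x; exact: b2E.
  have qm : CL m q by apply: CL_le qL; exact: leq_trans m2 _.
  have qVm : CL m (fun p x => (q p x)^-1) by apply: CL_le qVL; exact: leq_trans m2 _.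
  have q1m : CL m q1 by apply: CL_le q1L; exact: leq_trans m2 _.
  have km : CL m k by apply: CL_le kL; exact: leq_trans m2 _.
  have k1m : CL m k1 by apply: CL_le k1L; exact: leq_trans m2 _.
  by rewrite /beta0_form; CLtac.
have b1L : CL 1 b1 by exact: CL_der bL db.
have b10 : CL 0 b1 by exact: CL_le b1L.
have b0 : CL 0 b by exact: CL_le bL.
have b2L : CL 1 b2 by apply: step => //; exact: CL_le bL.
have b1L2 : CL 2 b1 by exact: CL_up db1 b2L.
have b2L2 : CL 2 b2 by apply: step.
have b1L3 : CL 3 b1 by exact: CL_up db1 b2L2.
exact: CL_up db b1L3.
Qed.

(** kappa'' enters alpha_2 with the coefficient - [lead], kept away from zero by its term 1/12. A
    C^{2,1} bound on alpha_2 therefore yields one more derivative of kappa than the regularity of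
    the curve does. *)
Lemma CL_kappa4 q q1 k k1 k2 b b1 a c : 0 < c -> (forall p x, c <= q p x) ->
  CL 4 q -> CL 4 (fun p x => (q p x)^-1) -> CL 3 q1 ->
  CL 3 k -> isder k k1 -> isder k1 k2 -> CL 3 b -> isder b b1 -> CL 2 a ->
  (forall p x, a p x = alpha2_form (q p x) (q1 p x) (k p x) (k1 p x) (k2 p x) (b p x) (b1 p x)) ->
  CL 4 k.
Proof.
move=> c0 qc qL qVL q1L kL dk dk1 bL db aL aE.
have k1L : CL 2 k1 by exact: CL_der kL dk.
have b1L : CL 2 b1 by exact: CL_der bL db.
have l0 p x : 0 <= 2^-1 * (q p x)^-1 ^+ 2 :> R by rewrite mulr_ge0 ?sqr_ge0.
pose lead p x : R := 2^-1 * (q p x)^-1 ^+ 2 + 12^-1.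
have leadL : CL 2 (fun p x => (lead p x)^-1).
  apply: (@CLV _ _ _ _ 12^-1).
  - by lra.
  - move=> p x; rewrite ger0_norm /lead ?addr_ge0 ?lerDr//.
  - rewrite /lead; CLtac.
have k2E p x : k2 p x = (lead p x)^-1 * (- a p x + 2^-1 * (q p x)^-1 ^+ 3 * q1 p x * k1 p x
    + 3 / 2 * k p x ^+ 3 - 2 * k p x * ((q p x)^-1 * b1 p x) + 2^-1 * k p x * b p x ^+ 2
    - 4^-1 * (q p x)^-1 * q1 p x * k1 p x - 4^-1 * q p x ^+ 2 * k p x ^+ 3
    - (2^-1 * q1 p x * k p x + 6^-1 * q p x * k1 p x) * b p x).
  have q0 : 0 < q p x by exact: lt_le_trans (qc p x).
  rewrite aE /alpha2_form /lead; field.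
  by rewrite !gt_eqF// addr_gt0// mulr_gt0// exprn_gt0.
have k2L : CL 2 k2.
  have -> : k2 = fun p x => (lead p x)^-1 * (- a p x + 2^-1 * (q p x)^-1 ^+ 3 * q1 p x * k1 p x
    + 3 / 2 * k p x ^+ 3 - 2 * k p x * ((q p x)^-1 * b1 p x) + 2^-1 * k p x * b p x ^+ 2
    - 4^-1 * (q p x)^-1 * q1 p x * k1 p x - 4^-1 * q p x ^+ 2 * k p x ^+ 3
    - (2^-1 * q1 p x * k p x + 6^-1 * q p x * k1 p x) * b p x).
    by apply/funext => p; apply/funext => x; exact: k2E.
  by CLtac.
apply: CL_up dk _; first exact: CL_le kL.
by apply: CL_up dk1 k2L; exact: CL_le k1L.
Qed.

Lemma CL_G2 q q1 q2 k k1 k2 k3 b b1 b2 b3 m :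
  CL m q -> CL m (fun p x => (q p x)^-1) -> CL m q1 -> CL m q2 -> CL m k -> CL m k1 ->
  CL m k2 -> CL m k3 -> CL m b -> CL m b1 -> CL m b2 -> CL m b3 ->
  CL m (fun p x => G2_form (q p x) (q1 p x) (q2 p x) (k p x) (k1 p x) (k2 p x) (k3 p x)
    (b p x) (b1 p x) (b2 p x) (b3 p x)).
Proof.
move=> *; rewrite /G2_form /S4_form /S2_form /ft /ft1 /ft2 /fn /fn1 /fn2 /=.
by CLtac.
Qed.

Lemma CL_dssV2 m q q1 k k1 a a1 e e1 e2 : CL m q -> CL m (fun p x => (q p x)^-1) -> CL m q1 ->
  CL m k -> CL m k1 -> CL m a -> CL m a1 -> CL m e -> CL m e1 -> CL m e2 ->
  CL m (fun p x => dssV2 (q p x) (q1 p x) (k p x) (k1 p x) (a p x) (a1 p x) (e p x) (e1 p x) (e2 p x)).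
Proof. by move=> *; rewrite /dssV2; CLtac. Qed.

(** Solved for e'', the equation has a right side bounded in C^{1,1}, which raises e by one
    order. *)
Lemma CL_beta2 q q1 k k1 a a1 e e1 e2 (g : P -> R -> R) c : 0 < c -> (forall p x, c <= q p x) ->
  CL 2 q -> CL 2 (fun p x => (q p x)^-1) -> CL 2 q1 -> CL 2 k -> CL 2 k1 -> CL 2 a ->
  isder a a1 -> CL 2 e -> isder e e1 -> isder e1 e2 -> CL 1 g ->
  (forall p x, dssV2 (q p x) (q1 p x) (k p x) (k1 p x) (a p x) (a1 p x) (e p x) (e1 p x) (e2 p x)
    = g p x) ->
  CL 3 e.
Proof.
move=> c0 qc qL qVL q1L kL k1L aL da eL de de1 gL gE.
have e1L : CL 1 e1 by exact: CL_der eL de.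
have a1L : CL 1 a1 by exact: CL_der aL da.
have e2L : CL 1 e2.
  have -> : e2 = fun p x => q p x * (g p x - (- ((q p x)^-1 ^+ 2 * q1 p x * e1 p x)
       - q p x * k p x ^+ 2 * e p x + 2 * k p x * a1 p x + a p x * k1 p x)).
    apply/funext => p; apply/funext => x; rewrite -gE /dssV2; field.
    by rewrite gt_eqF// (lt_le_trans c0).
  by CLtac.
apply: CL_up de _; first exact: CL_le eL.
by apply: CL_up de1 e2L; exact: CL_le e1L.
Qed.

End Regularity.

Ltac isdertac := repeat match goal with
  | |- isder (fun p x => (@?F p x) + (@?G p x)) _ => eapply (@isderD _ _ F _ G _)
  | |- isder (fun p x => (@?F p x) * (@?G p x)) _ => eapply (@isderM _ _ F _ G _)
  | |- isder (fun p x => - (@?F p x)) _ => eapply (@isderN _ _ F _)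
  | |- isder (fun p x => (@?F p x) ^+ 2) _ => eapply (@isderM _ _ F _ F _)
  | |- isder (fun _ _ => ?c) _ => exact (@isder_cst _ _ (fun=> c))
  | H : isder ?f _ |- isder (fun p x => ?f p x) _ => exact H
  | H : isder ?f _ |- isder ?f _ => exact H
  | H : isder (fun p x => (?f p x)^-1) _ |- isder (fun p x => (?f p x)^-1) _ => exact H
  end.

Lemma derive1n2 {R : realType} {V : normedModType R} (f : R -> V) : derive1n 2 f = derive1 (derive1 f).
Proof. by []. Qed.

Lemma fr_ext {R : realType} {P : Type} (cc ss t n t' n' : P -> R -> R) p x :
  t p x = t' p x -> n p x = n' p x -> fr cc ss t n p x = fr cc ss t' n' p x.
Proof. by rewrite /fr => -> ->. Qed.

(** * Translation of the velocity fields into frame components *)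

Section FrameComponents.
Context {R : realType} {P : Type}.
Variables (Y : P -> R -> 'rV[R]_2) (c : R).
Hypothesis c0 : 0 < c.
Hypothesis dY : forall p (x : R), derivable (Y p) x 1.
Hypothesis cY : forall p x, c <= speed (Y p) x.
Hypothesis XL : CL 5 (fun p x => Y p x 0 0).
Hypothesis ZL : CL 5 (fun p x => Y p x 0 1).
Variables (q q1 q2 k k1 k2 k3 cc ss : P -> R -> R).
Hypothesis qE : q = fun p => speed (Y p).
Hypothesis kE : k = fun p => kappa (Y p).
Hypothesis ccE : cc = fun p x => tau (Y p) x 0 0.
Hypothesis ssE : ss = fun p x => tau (Y p) x 0 1.
Hypotheses (dq : isder q q1) (dq1 : isder q1 q2).
Hypotheses (dk : isder k k1) (dk1 : isder k1 k2) (dk2 : isder k2 k3).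

Let q_gt0 p x : 0 < q p x.
Proof. by rewrite qE; exact: lt_le_trans (cY p x). Qed.

Let q_neq0 p x : q p x != 0.
Proof. by rewrite gt_eqF. Qed.

Lemma isder_speedV : isder (fun p x => (q p x)^-1) (fun p x => - (q p x)^-1 ^+ 2 * q1 p x).
Proof. exact: isderV. Qed.

Lemma dsE (f f' : P -> R -> R) p : isder f f' ->
  ds (Y p) (f p) = fun x => (q p x)^-1 * f' p x.
Proof.
move=> df; apply/funext => x; rewrite /ds -[speed (Y p) x](congr1 (fun g => g p x) qE).
by rewrite (derive1_is (df p)).
Qed.

Let frd : isder cc (fun p x => - (q p x * k p x * ss p x)) /\
  isder ss (fun p x => q p x * k p x * cc p x).
Proof. by rewrite qE kE ccE ssE; exact: (frame_derivatives c0 dY cY XL ZL). Qed.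

Let w p x := q p x * k p x.

Lemma derive1_frame t n t' n' p : isder t t' -> isder n n' ->
  derive1 (fr cc ss t n p) =
  fr cc ss (fun p x => t' p x + w p x * n p x) (fun p x => n' p x - w p x * t p x) p.
Proof. by move=> dt dn; rewrite (@derive1_fr _ _ w cc ss frd.1 frd.2 _ _ _ _ dt dn). Qed.

Lemma ds_frame t n t' n' p : isder t t' -> isder n n' ->
  ds (Y p) (fr cc ss t n p) =
  fr cc ss (fun p x => (q p x)^-1 * (t' p x + w p x * n p x))
    (fun p x => (q p x)^-1 * (n' p x - w p x * t p x)) p.
Proof.
move=> dt dn; apply/funext => x; rewrite /ds (derive1_frame p dt dn).
rewrite -[speed (Y p) x](congr1 (fun g => g p x) qE).
by rewrite (frZ cc ss (fun p x => (q p x)^-1)).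
Qed.

Lemma tauE p : tau (Y p) = fr cc ss (fun _ _ => 1) (fun _ _ => 0) p.
Proof. by apply/funext => x; rewrite ccE ssE; exact: tau_fr. Qed.

Lemma norE p : nor (Y p) = fr cc ss (fun _ _ => 0) (fun _ _ => 1) p.
Proof. by apply/funext => x; rewrite ccE ssE; exact: nor_fr. Qed.

Lemma dotp_frame t n t' n' p x :
  dotp (fr cc ss t n p x) (fr cc ss t' n' p x) = t p x * t' p x + n p x * n' p x.
Proof. by rewrite dotp_fr// => p' x'; rewrite ccE ssE; exact: (tau_unit c0 dY cY). Qed.

Lemma beta0_ode (b : P -> R -> R) : (forall p, is_beta0 (Y p) (b p)) ->
  exists b1 b2, [/\ isder b b1, isder b1 b2 & forall p x,
    b2 p x = beta0_form (q p x) (q1 p x) (k p x) (k1 p x) (b p x) (b1 p x)].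
Proof.
move=> hb; exists (fun p => derive1 (b p)), (fun p => derive1 (derive1 (b p))).
have db : isder b (fun p => derive1 (b p)).
  by move=> p x; apply: is_derive_der => y; case: (hb p) => _ /(_ y).
have db1 : isder (fun p => derive1 (b p)) (fun p => derive1 (derive1 (b p))).
  by move=> p x; apply: is_derive_der => y; case: (hb p) => _ _ /(_ y).
split => // p x; have [_ _ _ /(_ x)] := hb p.
rewrite (dsE p db) (dsE p (isderM isder_speedV db1)).
rewrite -[kappa (Y p)](congr1 (fun g => g p) kE) -[speed (Y p)](congr1 (fun g => g p) qE).
rewrite (dsE p dk) (derive1_is (dq p)) /beta0_form => E.
(* Multiplication by q^2 turns the two arc-length derivatives into rho-derivatives with leading
   coefficient - 1. *)
have {E} : q p x ^+ 2 * (- ((q p x)^-1 * (- (q p x)^-1 ^+ 2 * q1 p x * derive1 (b p) x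
     + (q p x)^-1 * derive1 (derive1 (b p)) x)) + k p x ^+ 2 * b p x) =
     q p x ^+ 2 * (4^-1 * q1 p x * k p x ^+ 2 - 3 * k p x * ((q p x)^-1 * k1 p x)).
  by rewrite E.
have := q_neq0 p x.
move: (q p x) (q1 p x) (k p x) (k1 p x) (b p x) (derive1 (b p) x) (derive1 (derive1 (b p)) x).
move=> Q Q1 K K1 B B1 B2 Q0.
have -> : Q ^+ 2 * (- (Q^-1 * (- Q^-1 ^+ 2 * Q1 * B1 + Q^-1 * B2)) + K ^+ 2 * B)
  = - B2 + Q^-1 * Q1 * B1 + Q ^+ 2 * K ^+ 2 * B by field.
have -> : Q ^+ 2 * (4^-1 * Q1 * K ^+ 2 - 3 * K * (Q^-1 * K1)) =
  Q ^+ 2 * (4^-1 * Q1 * K ^+ 2) - 3 * Q * K * K1 by field.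
move=> E; have -> : B2 = Q^-1 * Q1 * B1 + Q ^+ 2 * K ^+ 2 * B - (- B2 + Q^-1 * Q1 * B1 + Q ^+ 2 * K ^+ 2 * B) by ring.
by rewrite E; ring.
Qed.

Variables (b b1 b2 b3 : P -> R -> R).
Hypotheses (db : isder b b1) (db1 : isder b1 b2) (db2 : isder b2 b3).

Lemma alpha2E p x : alpha2 (Y p) (b p) x = alpha2_form (q p x) (q1 p x) (k p x) (k1 p x)
  (k2 p x) (b p x) (b1 p x).
Proof.
rewrite /alpha2 -[kappa (Y p)](congr1 (fun g => g p) kE) -[speed (Y p)](congr1 (fun g => g p) qE).
rewrite (dsE p dk) (dsE p (isderM isder_speedV dk1)) (dsE p db) (derive1_is (dq p)).
rewrite derive1n2 (derive1_is (dk p)) (derive1_is (dk1 p)) /alpha2_form.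
have := q_neq0 p x; move: (q p x) => Q Q0.
by field.
Qed.

Lemma S4E p x : S4 (Y p) x = S4_form (q p x) (q1 p x) (q2 p x) (k p x) (k1 p x).
Proof.
rewrite /S4 -[kappa (Y p)](congr1 (fun g => g p) kE) -[speed (Y p)](congr1 (fun g => g p) qE).
rewrite (derive1_is (dk p)) derive1n2 (derive1_is (dq p)) (derive1_is (dq1 p)).
by rewrite /S4_form; field.
Qed.

Lemma S2E p x : S2 (V0 (Y p) (b p)) (Y p) x = S2_form (q p x) (q1 p x) (q2 p x)
  (k p x) (k1 p x) (k2 p x) (k3 p x) (b p x) (b1 p x) (b2 p x) (b3 p x).
Proof.
rewrite /S2 -[kappa (Y p)](congr1 (fun g => g p) kE) -[speed (Y p)](congr1 (fun g => g p) qE).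
have dqV := isder_speedV.
pose f p x := ft (q p x) (k p x) (b1 p x).
pose f1 p x := ft1 (q p x) (q1 p x) (k p x) (k1 p x) (b1 p x) (b2 p x).
pose f2 p x := ft2 (q p x) (q1 p x) (q2 p x) (k p x) (k1 p x) (k2 p x) (b1 p x) (b2 p x) (b3 p x).
pose g p x := fn (q p x) (k p x) (k1 p x) (b p x).
pose g1 p x := fn1 (q p x) (q1 p x) (k p x) (k1 p x) (k2 p x) (b p x) (b1 p x).
pose g2 p x := fn2 (q p x) (q1 p x) (q2 p x) (k p x) (k1 p x) (k2 p x) (k3 p x) (b p x) (b1 p x) (b2 p x).
pose w1 p x := q1 p x * k p x + q p x * k1 p x.
have df : isder f f1.
  apply: isder_ext; first by rewrite /f /ft; isdertac.
  by move=> p' x'; rewrite /f1 /ft1 /=; ring.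
have df1 : isder f1 f2.
  apply: isder_ext; first by rewrite /f1 /ft1; isdertac.
  by move=> p' x'; rewrite /f2 /ft2 /=; ring.
have dg : isder g g1.
  apply: isder_ext; first by rewrite /g /fn; isdertac.
  by move=> p' x'; rewrite /g1 /fn1 /=; ring.
have dg1 : isder g1 g2.
  apply: isder_ext; first by rewrite /g1 /fn1; isdertac.
  by move=> p' x'; rewrite /g2 /fn2 /=; ring.
have dw : isder w w1 by rewrite /w /w1; isdertac.
have dsu p' : ds (Y p') (V0 (Y p') (b p')) = fr cc ss f g p'.
  have -> : V0 (Y p') (b p') = fr cc ss b (fun p x => - k p x) p'.
    apply/funext => x'; rewrite /V0 (_ : alpha0 (Y p') = (fun p x => - k p x) p').
      by rewrite ccE ssE; exact: (velocity_fr Y (fun p x => - k p x)).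
    by rewrite /alpha0 kE.
  rewrite (ds_frame p' db (isderN dk)); apply/funext => x'.
  apply: fr_ext; rewrite /f /g /ft /fn /w; have := q_neq0 p' x'; move: (q p' x') => Q Q0; field.
    by [].
  by [].
pose m p x := f1 p x + w p x * g p x.
pose n p x := g1 p x - w p x * f p x.
pose m1 p x := f2 p x + w1 p x * g p x + w p x * g1 p x.
pose n1 p x := g2 p x - w1 p x * f p x - w p x * f1 p x.
have dm : isder m m1.
  apply: isder_ext; first by rewrite /m; isdertac.
  by move=> p' x'; rewrite /m1 /=; ring.
have dn : isder n n1.
  apply: isder_ext; first by rewrite /n; isdertac.
  by move=> p' x'; rewrite /n1 /=; ring.
have dsu' p' : derive1 (ds (Y p') (V0 (Y p') (b p'))) = fr cc ss m n p'.
  by rewrite dsu (derive1_frame p' df dg).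
have dssu p' : ds (Y p') (ds (Y p') (V0 (Y p') (b p'))) =
    fr cc ss (fun p x => (q p x)^-1 * m p x) (fun p x => (q p x)^-1 * n p x) p'.
  by rewrite dsu (ds_frame p' df dg).
pose et p x := 12^-1 * q1 p x * ((q p x)^-1 * m p x) + 24^-1 * (q p x ^+ 2 * k p x ^+ 2) * f p x.
pose en p x := 12^-1 * q1 p x * ((q p x)^-1 * n p x) + 24^-1 * (q p x ^+ 2 * k p x ^+ 2) * g p x.
pose et1 p x := 12^-1 * (q2 p x * (q p x)^-1 * m p x - q1 p x ^+ 2 * (q p x)^-1 ^+ 2 * m p x
    + q1 p x * (q p x)^-1 * m1 p x)
  + 24^-1 * ((2 * q p x * q1 p x * k p x ^+ 2 + 2 * q p x ^+ 2 * k p x * k1 p x) * f p x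
    + q p x ^+ 2 * k p x ^+ 2 * f1 p x).
have det : isder et et1.
  apply: isder_ext; first by rewrite /et; isdertac.
  by move=> p' x'; rewrite /et1 /=; ring.
have [en1 den] : exists en1, isder en en1 by eexists; rewrite /en; isdertac.
have EE : (fun y : R => (derive1 (q p) y / 12) *: ds (Y p) (ds (Y p) (V0 (Y p) (b p))) y
      + (q p y ^+ 2 * k p y ^+ 2 / 24) *: ds (Y p) (V0 (Y p) (b p)) y) = fr cc ss et en p.
  apply/funext => y; rewrite dssu dsu (derive1_is (dq p)).
  rewrite (frZ cc ss (fun p y => q1 p y / 12)) (frZ cc ss (fun p y => q p y ^+ 2 * k p y ^+ 2 / 24)).
  by rewrite frD; apply: fr_ext; rewrite /et /en; ring.
rewrite EE (derive1_frame p det den) derive1n2 dsu' (derive1_frame p dm dn).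
have c1 := @isder_cst R P (fun=> 1); have c0' := @isder_cst R P (fun=> 0).
have ta1 p' : derive1 (tau (Y p')) = fr cc ss (fun _ _ => 0) (fun p x => - w p x) p'.
  rewrite tauE (derive1_frame p' c1 c0'); apply/funext => y.
  by apply: fr_ext; ring.
rewrite derive1n2 ta1 (derive1_frame p c0' (isderN dw)) tauE norE !dotp_frame.
rewrite (derive1_is (dq p)) (derive1_is (dk p)) /S2_form /=.
rewrite -/(f p x) -/(f1 p x) -/(f2 p x) -/(g p x) -/(g1 p x) -/(g2 p x) -/(w p x) -/(w1 p x).
rewrite -/(m p x) -/(n p x) -/(m1 p x) -/(n1 p x) /et1 /en.
by have := q_neq0 p x; move: (q p x) => Q Q0; field.
Qed.

Variables (a a1 e e1 e2 : P -> R -> R).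
Hypotheses (aE : forall p x, a p x = alpha2 (Y p) (b p) x).
Hypotheses (da : isder a a1) (de : isder e e1) (de1 : isder e1 e2).

Lemma beta2_ode : (forall p, is_beta2 (Y p) (b p) (e p)) -> forall p x,
  dssV2 (q p x) (q1 p x) (k p x) (k1 p x) (a p x) (a1 p x) (e p x) (e1 p x) (e2 p x) =
  G2_form (q p x) (q1 p x) (q2 p x) (k p x) (k1 p x) (k2 p x) (k3 p x) (b p x) (b1 p x)
    (b2 p x) (b3 p x).
Proof.
move=> he p x; have [_ _ _ /(_ x)] := he p.
have -> : alpha2 (Y p) (b p) = a p by apply/funext => y; rewrite aE.
rewrite S4E S2E.
rewrite -[kappa (Y p)](congr1 (fun g => g p) kE) -[speed (Y p)](congr1 (fun g => g p) qE).
have dqV := isder_speedV.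
rewrite (dsE p de) (dsE p (isderM dqV de1)) (dsE p da) (dsE p dk) (dsE p (isderM dqV dk1)) (dsE p db).
rewrite (derive1_is (dq p)).
pose u1 p x := q p x ^+ 4 * ((q p x)^-1 * b1 p x - k p x ^+ 2).
pose u1' p x := 4 * q p x ^+ 3 * q1 p x * ((q p x)^-1 * b1 p x - k p x ^+ 2)
  + q p x ^+ 4 * ((q p x)^-1 * b2 p x - (q p x)^-1 ^+ 2 * q1 p x * b1 p x - 2 * k p x * k1 p x).
have dq4 : isder (fun p x => q p x ^+ 4) (fun p x => 4 * q p x ^+ 3 * q1 p x).
  have h := isderM (isderM dq dq) (isderM dq dq).
  rewrite (_ : (fun p x => q p x ^+ 4) = (fun p x => q p x * q p x * (q p x * q p x))).
    by apply: (isder_ext h) => p' x' /=; ring.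
  by apply/funext => p'; apply/funext => x'; ring.
have du1 : isder u1 u1'.
  have h : isder (fun p x => (q p x)^-1 * b1 p x - k p x ^+ 2)
    (fun p x => - (q p x)^-1 ^+ 2 * q1 p x * b1 p x + (q p x)^-1 * b2 p x
        - (k1 p x * k p x + k p x * k1 p x)) by isdertac.
  by apply: (isder_ext (isderM dq4 h)) => p' x'; rewrite /u1' /=; ring.
pose u2 p x := ((q p x)^-1 * k1 p x + k p x * b p x) ^+ 2.
pose u2' p x := 2 * ((q p x)^-1 * k1 p x + k p x * b p x) *
  ((q p x)^-1 * k2 p x - (q p x)^-1 ^+ 2 * q1 p x * k1 p x + k1 p x * b p x + k p x * b1 p x).
have du2 : isder u2 u2'.
  apply: isder_ext; first by rewrite /u2; isdertac.
  by move=> p' x'; rewrite /u2' /=; ring.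
rewrite -/(u1 p) (derive1_is (du1 p)) -/(u2 p) (dsE p du2) /u1' /u2' /dssV2 /G2_form.
move: (S4_form _ _ _ _ _) (S2_form _ _ _ _ _ _ _ _ _ _ _) => s4 s2.
move/(congr1 (fun z => q p x * z)); have := q_neq0 p x.
move: (q p x) (q1 p x) (k p x) (k1 p x) (k2 p x) (b p x) (b1 p x) (b2 p x) (a p x) (a1 p x)
  (e p x) (e1 p x) (e2 p x).
move=> Q Q1 K K1 K2 B B1 B2 A A1 E E1 E2 Q0.
(* The difference to be shown zero is the right side of H minus its left side. *)
move=> H; apply/eqP; rewrite -subr_eq0; apply/eqP.
set lhs := (X in X = _) in H; set rhs := (X in _ = X) in H.
rewrite -[RHS](subrr lhs) {1}H /lhs /rhs.
by field.
Qed.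

End FrameComponents.

(** * Difference quotients *)

Section Taylor.
Context {R : realType}.

Definition tsum (k : nat) (a : nat -> R) (y : R) : R := \sum_(i < k) a i * y ^+ i / (i`!)%:R.

Lemma is_derive_pow k (y : R) : is_derive y 1 (fun z : R => z ^+ k.+1) (k.+1%:R * y ^+ k).
Proof.
elim: k => [|k IH].
  rewrite (_ : (fun z : R => z ^+ 1) = id); last by apply/funext => z; rewrite expr1.
  by rewrite expr0 mulr1; exact: is_derive_id.
have h := is_deriveM (is_derive_id y (1 : R)) IH.
rewrite (_ : (fun z : R => z ^+ k.+2) = id * (fun z : R => z ^+ k.+1)); last first.
  by apply/funext => z; rewrite exprS.
apply: (is_derive_eq h); rewrite /GRing.scale/= -[k.+2%:R]natr1 exprS; ring.
Qed.

Lemma is_derive_tsum k a (y : R) : is_derive y 1 (tsum k.+1 a) (tsum k (fun i => a i.+1) y).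
Proof.
elim: k => [|k IH].
  have -> : tsum 1 a = fun=> a 0%N.
    by apply/funext => z; rewrite /tsum big_ord1 expr0 fact0 mulr1 divr1.
  by rewrite /tsum big_ord0; exact: is_derive_cst.
have -> : tsum k.+2 a = fun z => tsum k.+1 a z + (a k.+1 / (k.+1`!)%:R) * z ^+ k.+1.
  by apply/funext => z; rewrite {1}/tsum big_ord_recr/= -/(tsum _ _ _); congr (_ + _); ring.
have dX := is_derive_pow k y.
have dC : is_derive y 1 (fun z => (a k.+1 / (k.+1`!)%:R) * z ^+ k.+1)
    ((a k.+1 / (k.+1`!)%:R) * (k.+1%:R * y ^+ k)) by exact: is_deriveZ.
have dD : is_derive y 1 (fun z => tsum k.+1 a z + (a k.+1 / (k.+1`!)%:R) * z ^+ k.+1)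
    (tsum k (fun i => a i.+1) y + (a k.+1 / (k.+1`!)%:R) * (k.+1%:R * y ^+ k)) by exact: is_deriveD.
apply: (is_derive_eq dD).
rewrite [in RHS]/tsum big_ord_recr/= -/(tsum _ _ _); congr (_ + _).
rewrite factS natrM invfM.
have : k.+1%:R != 0 :> R by rewrite pnatr_eq0.
by move: (k.+1%:R : R) => m m0; field; rewrite m0 pnatr_eq0 -lt0n fact_gt0.
Qed.

Lemma is_derive_growth (f g : R -> R) (d B : R) : f 0 = 0 -> 0 <= B ->
  (forall y : R, is_derive y 1 f (g y)) -> (forall y, `|y| <= d -> `|g y| <= B) ->
  forall y, `|y| <= d -> `|f y| <= B * `|y|.
Proof.
move=> f0 B0 fg gB y yd; have [c [c1 c2]] := is_derive_mvt 0 y fg.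
rewrite f0 !subr0 => ->; rewrite normrM ler_wpM2r// gB// (le_trans _ yd)//.
move: c1 c2; rewrite ge_min le_max => /orP[] ? /orP[] ?;
  have := ler_norm y; have := ler_norm (- y); rewrite normrN => ? ?;
  rewrite ler_norml; apply/andP; split; have := normr_ge0 y; lra.
Qed.

Lemma taylor_CL (P : Type) k (F : P -> R -> R) : CL k F -> exists K, 0 <= K /\
  forall p x y, `|F p (x + y) - tsum k.+1 (fun i => dn i F p x) y| <= K * `|y| ^+ k.+1.
Proof.
elim: k F => [|k IH] F FL.
  have [K [K0 FK]] := CL_lip FL; exists K; split => // p x y.
  rewrite /tsum big_ord1 expr0 fact0 mulr1 divr1 expr1.
  by apply: le_trans (FK _ _ _) _; rewrite addrAC subrr add0r.
have [K [K0 FK]] := IH _ (CL_derive FL); exists K; split => // p x y.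
pose r z := F p (x + z) - tsum k.+2 (fun i => dn i F p x) z.
have dr (z : R) : is_derive z 1 r (derive1 (F p) (x + z) -
     tsum k.+1 (fun i => dn i (fun p => derive1 (F p)) p x) z).
  apply: is_deriveB.
    have -> : (fun z => F p (x + z)) = (fun z => F p (z + x)) by apply/funext => u; rewrite addrC.
    by apply: is_derive_shift; rewrite addrC; exact: (CL_isder FL p).
  have := is_derive_tsum k.+1 (fun i => dn i F p x) z.
  by move=> h; apply: (is_derive_eq h); congr tsum; apply/funext => i; rewrite dnS.
have r0 : r 0 = 0.
  rewrite /r addr0 /tsum big_ord_recl/= expr0 fact0 mulr1 divr1 big1 ?addr0 ?subrr// => i _.
  by rewrite expr0n/= mulr0 mul0r.
have B0 : 0 <= K * `|y| ^+ k.+1 by rewrite mulr_ge0// exprn_ge0.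
have H := is_derive_growth (d := `|y|) r0 B0 dr.
rewrite exprSr mulrA; apply: H (lexx _) => z zy.
by apply: le_trans (FK p x z) _; rewrite ler_wpM2l// lerXn2r// nnegrE.
Qed.

End Taylor.

Section Quotients.
Context {R : realType} {Q P : Type} (h : Q -> R) (pr : Q -> P) (pt : Q -> R).
Hypothesis h0 : forall q, 0 < h q.
Hypothesis h1 : forall q, `|h q| <= 1.

Fixpoint ev (S : Type) (p : S -> Q) (eta : S -> R) (l : seq (Q -> R)) (s : S) : R :=
  if l is f :: l' then f (p s) + eta s * ev p eta l' s else 0.

(** [Ex] nests its remainders; they arise from F by subtracting a coefficient and dividing by the
    step, once for each member of the list. *)
Lemma Ex_of_remainder (S : Type) (p : S -> Q) (eta : S -> R) l F :
  (forall s, eta s != 0) -> (forall i, (i < size l)%N -> bdd (nth (fun=> 0) l i)) ->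
  (exists K, forall s, `|F s - ev p eta l s| <= K * `|eta s| ^+ size l) -> Ex p eta F l.
Proof.
move=> eta0; elim: l F => [|f l IH] F bl [K FK] /=.
  by exists K => s; have := FK s; rewrite /= subr0 expr0 mulr1.
split; first exact: (bl 0%N).
exists (fun s => (F s - f (p s)) / eta s); split.
  by move=> s; rewrite mulrCA mulfV// mulr1; ring.
apply: IH; first by move=> i il; exact: (bl i.+1).
exists K => s; have e0 : 0 < `|eta s| by rewrite normr_gt0.
have -> : (F s - f (p s)) / eta s - ev p eta l s =
   (eta s)^-1 * (F s - (f (p s) + eta s * ev p eta l s)) by have := eta0 s; move=> ?; field.
rewrite normrM normfV ler_pdivrMl//.
by apply: le_trans (FK s) _; rewrite /= exprS mulrCA.
Qed.

Definition dquot (F : P -> R -> R) (s : Q * bool) : R :=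
  (F (pr s.1) (pt s.1 + sgstep h s) - F (pr s.1) (pt s.1)) / sgstep h s.

Lemma sgstep_neq0 s : sgstep h s != 0.
Proof. by rewrite /sgstep; case: s.2; rewrite ?oppr_eq0 gt_eqF. Qed.

Lemma norm_sgstep s : `|sgstep h s| = h s.1.
Proof. by rewrite /sgstep; case: s.2; rewrite ?normrN gtr0_norm. Qed.

Definition dcoef (F : P -> R -> R) (i : nat) : Q -> R :=
  fun q => dn i F (pr q) (pt q) / (i`!)%:R.

Lemma dcoef_bdd k i F : CL k F -> (i <= k)%N -> bdd (dcoef F i).
Proof.
move=> FL ik; have : CL (k - i) (dn i F) by apply: CL_dn; rewrite subnK.
move/CL_bounded => [K FK]; rewrite /dcoef; apply: bddM; last exact: bdd_cst.
by exists K => q.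
Qed.

Lemma ev_dcoef F n m s :
  sgstep h s ^+ m * ev fst (sgstep h) [seq dcoef F (m + i) | i <- iota 0 n] s =
  \sum_(m <= i < m + n) dn i F (pr s.1) (pt s.1) * sgstep h s ^+ i / (i`!)%:R.
Proof.
elim: n m => [|n IH] m; first by rewrite addn0 big_geq//= mulr0.
rewrite big_ltn; last by rewrite addnS ltnS leq_addr.
rewrite -addSnnS -IH /= addn0 mulrDr mulrA -exprSr.
rewrite -[1%N]addn0 iotaDl -map_comp /dcoef; congr (_ + _); first by ring.
by congr (_ * ev _ _ _ _); apply: eq_map => i /=; rewrite addnA addn1.
Qed.

(** A C^{k,1} function gives k coefficients: its Taylor remainder has order k + 1, and one power is
    spent on the division by the step. *)
Lemma dquot_Ex k F : CL k F ->
  Ex fst (sgstep h) (dquot F) [seq dcoef F (1 + i) | i <- iota 0 k].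
Proof.
move=> FL; apply: Ex_of_remainder; first exact: sgstep_neq0.
  move=> i; rewrite size_map size_iota => ik.
  rewrite (nth_map 0%N) ?size_iota// nth_iota// add0n.
  by apply: (@dcoef_bdd k).
have [K [K0 FK]] := taylor_CL FL; exists K => s.
have e0 := sgstep_neq0 s; have e0' : 0 < `|sgstep h s| by rewrite normr_gt0.
have E := ev_dcoef F k 1 s; rewrite expr1 in E.
have -> : dquot F s - ev fst (sgstep h) [seq dcoef F (1 + i) | i <- iota 0 k] s =
  (sgstep h s)^-1 * (F (pr s.1) (pt s.1 + sgstep h s)
     - tsum k.+1 (fun i => dn i F (pr s.1) (pt s.1)) (sgstep h s)).
  rewrite /tsum big_ord_recl/= expr0 fact0 mulr1 divr1.
  rewrite -(big_mkord xpredT (fun i => dn i.+1 F (pr s.1) (pt s.1) * sgstep h s ^+ i.+1 / (i.+1`!)%:R)).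
  rewrite -(big_add1 _ _ 0 k.+1 xpredT (fun i => dn i F (pr s.1) (pt s.1) * sgstep h s ^+ i / (i`!)%:R)).
  rewrite -[k.+1]add1n -E /dquot; field.
  by [].
rewrite normrM normfV ler_pdivrMl// size_map size_iota mulrCA -exprS.
exact: FK.
Qed.

End Quotients.

Opaque Ex.
Section Explicit.
Context {R : realType} {Q S : Type} (p : S -> Q) (eta : S -> R).
Hypothesis eta1 : forall s, `|eta s| <= 1.
Implicit Types (F G : S -> R) (f g i r : Q -> R).

(** The last coefficient stays unnamed: it keeps the remainder at the fifth power of the step, and
    its value does not matter after taking even or odd parts. *)
Lemma Ex_5 F l a0 a1 a2 a3 : size l = 5%N ->
  (forall q, nth (fun=> 0) l 0 q = a0 q) -> (forall q, nth (fun=> 0) l 1 q = a1 q) ->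
  (forall q, nth (fun=> 0) l 2 q = a2 q) -> (forall q, nth (fun=> 0) l 3 q = a3 q) ->
  Ex p eta F l -> exists a4, Ex p eta F [:: a0; a1; a2; a3; a4].
Proof.
case: l => [|l0 [|l1 [|l2 [|l3 [|l4 [|]]]]]] //= _.
by move=> /funext <- /funext <- /funext <- /funext <-; exists l4.
Qed.

Lemma ExM5 F G f0 f1 f2 f3 f4 g0 g1 g2 g3 g4 :
  Ex p eta F [:: f0; f1; f2; f3; f4] -> Ex p eta G [:: g0; g1; g2; g3; g4] ->
  exists k4, Ex p eta (fun s => F s * G s) [:: (fun q => f0 q * g0 q);
    (fun q => f0 q * g1 q + f1 q * g0 q); (fun q => f0 q * g2 q + f1 q * g1 q + f2 q * g0 q);
    (fun q => f0 q * g3 q + f1 q * g2 q + f2 q * g1 q + f3 q * g0 q); k4].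
Proof.
move=> FL GL; have := ExM eta1 (erefl : size [:: f0; f1; f2; f3; f4] = size [:: g0; g1; g2; g3; g4]) FL GL.
by apply: Ex_5 => //= q; ring.
Qed.

Lemma ExD5 F G f0 f1 f2 f3 f4 g0 g1 g2 g3 g4 :
  Ex p eta F [:: f0; f1; f2; f3; f4] -> Ex p eta G [:: g0; g1; g2; g3; g4] ->
  Ex p eta (fun s => F s + G s) [:: (fun q => f0 q + g0 q);
    (fun q => f1 q + g1 q); (fun q => f2 q + g2 q); (fun q => f3 q + g3 q);
    (fun q => f4 q + g4 q)].
Proof.
move=> FL GL.
exact: (ExD (erefl : size [:: f0; f1; f2; f3; f4] = size [:: g0; g1; g2; g3; g4]) FL GL).
Qed.

Lemma ExV5 F f0 f1 f2 f3 f4 c : 0 < c -> (forall s, c <= `|F s|) -> (forall q, c <= `|f0 q|) ->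
  Ex p eta F [:: f0; f1; f2; f3; f4] -> exists i4, Ex p eta (fun s => (F s)^-1) [:: (fun q => (f0 q)^-1);
    (fun q => - f1 q * (f0 q)^-1 ^+ 2); (fun q => - f2 q * (f0 q)^-1 ^+ 2 + f1 q ^+ 2 * (f0 q)^-1 ^+ 3);
    (fun q => - f3 q * (f0 q)^-1 ^+ 2 + 2 * f1 q * f2 q * (f0 q)^-1 ^+ 3 - f1 q ^+ 3 * (f0 q)^-1 ^+ 4);
    i4].
Proof.
move=> c0 Fc fc FL; have := ExV eta1 c0 Fc _ FL.
move=> H; apply: (Ex_5 _ _ _ _ _ (H _)) => //=.
- by move=> q; ring.
- by move=> q; ring.
- by move=> q; ring.
- by move=> f l [<- _].
Qed.

(** The coefficients of the root are recognised by the equations that squaring imposes on them, so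
    that no root appears in the formulas. *)
Lemma Ex_sqrt5 F f0 f1 f2 f3 f4 r0 r1 r2 r3 c : 0 < c -> (forall s, c <= F s) ->
  (forall q, c <= f0 q) -> (forall q, 0 <= r0 q) ->
  (forall q, f0 q = r0 q ^+ 2) -> (forall q, f1 q = 2 * r0 q * r1 q) ->
  (forall q, f2 q = 2 * r0 q * r2 q + r1 q ^+ 2) ->
  (forall q, f3 q = 2 * r0 q * r3 q + 2 * r1 q * r2 q) ->
  Ex p eta F [:: f0; f1; f2; f3; f4] ->
  exists r4, Ex p eta (fun s => Num.sqrt (F s)) [:: r0; r1; r2; r3; r4].
Proof.
move=> c0 Fc fc r00 e0 e1 e2 e3 FL; have := Ex_sqrt eta1 c0 Fc _ FL.
have se q : Num.sqrt (f0 q) = r0 q by rewrite e0 sqrtr_sqr ger0_norm.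
have rn q : r0 q != 0.
  by apply/eqP => rq; have := fc q; rewrite e0 rq expr0n/= leNgt c0.
have rn2 q : r0 q + r0 q != 0 by rewrite -mulr2n mulrn_eq0 /= rn.
move=> H; apply: (Ex_5 _ _ _ _ _ (H _)) => //=.
- by move=> q; rewrite se e1; field; rewrite ?rn2 ?rn.
- by move=> q; rewrite se e1 e2; field; rewrite ?rn2 ?rn.
- by move=> q; rewrite se e1 e2 e3; field; rewrite ?rn2 ?rn.
- by move=> f l [<- _].
Qed.

Lemma ExM2 F G f0 f1 g0 g1 : Ex p eta F [:: f0; f1] -> Ex p eta G [:: g0; g1] ->
  Ex p eta (fun s => F s * G s) [:: (fun q => f0 q * g0 q); (fun q => f0 q * g1 q + f1 q * g0 q)].
Proof.
move=> FL GL; have := ExM eta1 (erefl : size [:: f0; f1] = size [:: g0; g1]) FL GL.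
by apply: Ex_ext => //= -[|[|//]] _ q /=; ring.
Qed.

Lemma ExV2 F f0 f1 c : 0 < c -> (forall s, c <= `|F s|) -> (forall q, c <= `|f0 q|) ->
  Ex p eta F [:: f0; f1] ->
  Ex p eta (fun s => (F s)^-1) [:: (fun q => (f0 q)^-1); (fun q => - f1 q * (f0 q)^-1 ^+ 2)].
Proof.
move=> c0 Fc fc FL; have := ExV eta1 c0 Fc _ FL => H.
apply: (Ex_ext _ _ _ (H _)) => //=; last by move=> f l [<- _].
by case=> [|[|//]] _ q /=; ring.
Qed.

Lemma ExD2 F G f0 f1 g0 g1 : Ex p eta F [:: f0; f1] -> Ex p eta G [:: g0; g1] ->
  Ex p eta (fun s => F s + G s) [:: (fun q => f0 q + g0 q); (fun q => f1 q + g1 q)].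
Proof.
move=> FL GL; exact: (ExD (erefl : size [:: f0; f1] = size [:: g0; g1]) FL GL).
Qed.

Lemma ExN2 F f0 f1 : Ex p eta F [:: f0; f1] ->
  Ex p eta (fun s => - F s) [:: (fun q => - f0 q); (fun q => - f1 q)].
Proof.
move=> FL; have := ExZ (f := fun=> -1) (bdd_cst Q (-1)) FL.
by apply: Ex_ext => [s|//|[|[|//]] _ q] /=; ring.
Qed.

Lemma ExC2 f : bdd f -> Ex p eta (fun s => f (p s)) [:: f; (fun=> 0)].
Proof. by move=> bf; exact: (@ExC _ _ _ p eta f [:: f] bf). Qed.

Lemma Ex2_ext F F' f0 f1 g0 g1 : Ex p eta F [:: f0; f1] -> (forall s, F s = F' s) ->
  (forall q, f0 q = g0 q) -> (forall q, f1 q = g1 q) -> Ex p eta F' [:: g0; g1].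
Proof. by move=> FL /funext <- /funext <- /funext <-. Qed.

End Explicit.

(** * The defect at a node *)

Section NodeForms.
Context {R : realType}.
Variables (q E1 E2 E3 N1 N2 N3 : R).
(* Coefficients of r = |e|, 1/r and e/r in powers of the step, where e is the
   edge divided by the step, with components q + E1 eta + ... and N1 eta + ... *)
Definition nr2 : R := E2 + N1 ^+ 2 / (2 * q).
Definition nr3 : R := E3 + N1 * N2 / q - E1 * N1 ^+ 2 / (2 * q ^+ 2).
Definition ni1 : R := - E1 * q^-1 ^+ 2.
Definition ni2 : R := - nr2 * q^-1 ^+ 2 + E1 ^+ 2 * q^-1 ^+ 3.
Definition ni3 : R := - nr3 * q^-1 ^+ 2 + 2 * E1 * nr2 * q^-1 ^+ 3 - E1 ^+ 3 * q^-1 ^+ 4.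
Definition quo1 (a0 a1 : R) : R := a0 * ni1 + a1 * q^-1.
Definition quo3 (a0 a1 a2 a3 : R) : R := a0 * ni3 + a1 * ni2 + a2 * ni1 + a3 * q^-1.
Definition ut1 := quo1 q E1.
Definition ut3 := quo3 q E1 E2 E3.
Definition un1 := quo1 0 N1.
Definition un3 := quo3 0 N1 N2 N3.

(** [tang1], [tang3] and [norm1], [norm3] are the first two coefficients, in powers of h^2, of the
    two expressions in [node_expansion]. D and M are the tangential and normal coefficients of the
    difference quotients of the velocity; A and B are those of the time increment at the node. *)
Definition tang1 (D0 D1 M0 M1 : R) : R :=
  2^-1 * (2 * E1) * ((2 * ut1) ^+ 2 + (2 * un1) ^+ 2) + 2 * quo1 D0 D1 * (2 * q).
Definition tang3 (D0 D1 D2 D3 M0 M1 : R) : R :=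
  4 * (nr3 * (ut1 ^+ 2 + un1 ^+ 2) + 2 * E1 * (ut1 * ut3 + un1 * un3)
     + quo3 D0 D1 D2 D3 * q + quo1 D0 D1 * E2 + quo1 M0 M1 * N2).

Definition norm1 (B0 : R) : R := 2 * q ^+ 2 * B0 - 4 * q * un1.
Definition norm3 (A0 B0 B1 D0 D1 M0 M1 : R) : R :=
  2 * q ^+ 2 * B1 + 6 * q * E2 * B0 - 2 * q * nr2 * B0 - 2 * q * N2 * A0
  - 4 * (un3 * q + un1 * E2 - ut1 * N2) - 4 * quo1 M0 M1 * q.
End NodeForms.

Section NodeAlgebra.
Context {R : realType} {Q : Type} (h : Q -> R).
Hypothesis h0 : forall q, 0 < h q.
Hypothesis h1 : forall q, `|h q| <= 1.
Variables (et en dt dn' : Q * bool -> R) (q E1 E2 E3 E4 N1 N2 N3 N4 : Q -> R).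
Variables (D0 D1 D2 D3 D4 M0 M1 M2 M3 M4 : Q -> R) (c : R).
Hypothesis c0 : 0 < c.
Hypothesis qc : forall s, c <= q s.
Hypothesis rc : forall s, c <= Num.sqrt (et s ^+ 2 + en s ^+ 2).
Local Notation E5 F l := (Ex fst (sgstep h) F l).
Hypothesis etE : E5 et [:: q; E1; E2; E3; E4].
Hypothesis enE : E5 en [:: (fun=> 0); N1; N2; N3; N4].

Let r s := Num.sqrt (et s ^+ 2 + en s ^+ 2).
Let sg1 := sgstep_le1 h1.
Let sq1 := sqstep_le1 h1.

Let q_gt0 s : 0 < q s. Proof. exact: lt_le_trans (qc s). Qed.
Let q_neq0 s : q s != 0. Proof. by rewrite gt_eqF. Qed.

Lemma node_r : exists r4, E5 r [:: q; E1; (fun s => nr2 (q s) (E2 s) (N1 s));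
   (fun s => nr3 (q s) (E1 s) (E3 s) (N1 s) (N2 s)); r4].
Proof.
have [f4 tt_] := ExM5 sg1 etE etE; have [g4 nn] := ExM5 sg1 enE enE.
have := ExD5 tt_ nn => F.
have eF : (fun s => et s * et s + en s * en s) = fun s => et s ^+ 2 + en s ^+ 2.
  by apply/funext => s; rewrite !expr2.
rewrite eF in F; rewrite /r; apply: (@Ex_sqrt5 _ _ _ _ _ sg1 _ _ _ _ _ _ _ _ _ _ (c ^+ 2)) F.
- exact: exprn_gt0.
- move=> s; have a0 : 0 <= et s ^+ 2 + en s ^+ 2 by rewrite addr_ge0// sqr_ge0.
  by rewrite -(sqr_sqrtr a0) ler_sqr ?nnegrE ?sqrtr_ge0 ?rc// ltW.
- by move=> s /=; rewrite mul0r addr0 -expr2 ler_sqr ?nnegrE ?qc// ltW.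
- by move=> s; rewrite ltW.
- by move=> s /=; ring.
- by move=> s /=; ring.
- by move=> s /=; rewrite /nr2; have := q_neq0 s => ?; field.
- by move=> s /=; rewrite /nr2 /nr3; have := q_neq0 s => ?; field.
Qed.

Lemma node_i : exists i4, E5 (fun s => (r s)^-1) [:: (fun s => (q s)^-1);
   (fun s => ni1 (q s) (E1 s)); (fun s => ni2 (q s) (E1 s) (E2 s) (N1 s));
   (fun s => ni3 (q s) (E1 s) (E2 s) (E3 s) (N1 s) (N2 s)); i4].
Proof.
have [r4 rE] := node_r; apply: (@ExV5 _ _ _ _ _ sg1 _ _ _ _ _ _ c) rE => //.
- by move=> s; rewrite ger0_norm ?rc// sqrtr_ge0.
- by move=> s; rewrite ger0_norm ?qc// ltW.
Qed.

Lemma node_quo F f0 f1 f2 f3 f4 : E5 F [:: f0; f1; f2; f3; f4] ->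
  exists X, (forall s, F (s, true) / r (s, true) - F (s, false) / r (s, false) = h s * X s) /\
  Ex id (sqstep h) X [:: (fun s => 2 * quo1 (q s) (E1 s) (f0 s) (f1 s));
    (fun s => 2 * quo3 (q s) (E1 s) (E2 s) (E3 s) (N1 s) (N2 s) (f0 s) (f1 s) (f2 s) (f3 s))].
Proof.
move=> FE; have [i4 iE] := node_i; have [k4 /Ex_odd5 [X [XE XL]]] := ExM5 sg1 FE iE.
exists X; split; first exact: XE.
by apply: (Ex2_ext XL) => // s; rewrite /quo1 /quo3; ring.
Qed.

(** The first expression is the tangential product at the node divided by h^3, the second the normal
    product divided by h, with the jumps of the time increment replaced by those of the velocity. *)
Lemma node_expansion : E5 dt [:: D0; D1; D2; D3; D4] -> E5 dn' [:: M0; M1; M2; M3; M4] ->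
  exists Xr Xut Xun Xpt Xpn : Q -> R,
  [/\ [/\ forall s, r (s, true) - r (s, false) = h s * Xr s,
       forall s, et (s, true) / r (s, true) - et (s, false) / r (s, false) = h s * Xut s,
       forall s, en (s, true) / r (s, true) - en (s, false) / r (s, false) = h s * Xun s,
       forall s, dt (s, true) / r (s, true) - dt (s, false) / r (s, false) = h s * Xpt s &
       forall s, dn' (s, true) / r (s, true) - dn' (s, false) / r (s, false) = h s * Xpn s],
   Ex id (sqstep h) (fun s => 2^-1 * Xr s * (Xut s ^+ 2 + Xun s ^+ 2)
      + Xpt s * (et (s, true) + et (s, false)) + Xpn s * (en (s, true) + en (s, false)))
    [:: (fun s => tang1 (q s) (E1 s) (N1 s) (D0 s) (D1 s) (M0 s) (M1 s));
        (fun s => tang3 (q s) (E1 s) (E2 s) (E3 s) (N1 s) (N2 s) (N3 s)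
           (D0 s) (D1 s) (D2 s) (D3 s) (M0 s) (M1 s))] &
   forall vt vn A0 A1 B0 B1, Ex id (sqstep h) vt [:: A0; A1] -> Ex id (sqstep h) vn [:: B0; B1] ->
   Ex id (sqstep h) (fun s =>
     2^-1 * (vn s * (et (s, true) + et (s, false)) - vt s * (en (s, true) + en (s, false)))
      * ((et (s, true) + et (s, false)) ^+ 2 + (en (s, true) + en (s, false)) ^+ 2)
      / (r (s, true) + r (s, false))
     - (Xun s * (et (s, true) + et (s, false)) - Xut s * (en (s, true) + en (s, false)))
     - h s ^+ 2 * (Xpn s * (et (s, true) + et (s, false)) - Xpt s * (en (s, true) + en (s, false))))
    [:: (fun s => norm1 (q s) (E1 s) (N1 s) (B0 s));
        (fun s => norm3 (q s) (E1 s) (E2 s) (E3 s) (N1 s) (N2 s) (N3 s) (A0 s) (B0 s) (B1 s)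
          (D0 s) (D1 s) (M0 s) (M1 s))]].
Proof.
move=> dtE dnE.
have [r4 rE] := node_r; have [Xr [XrE XrL]] := Ex_odd5 rE.
have [Xut [XutE XutL]] := node_quo etE; have [Xun [XunE XunL]] := node_quo enE.
have [Xpt [XptE XptL]] := node_quo dtE; have [Xpn [XpnE XpnL]] := node_quo dnE.
have EtL := Ex_even5 h1 etE; have EnL := Ex_even5 h1 enE; have RL := Ex_even5 h1 rE.
exists Xr, Xut, Xun, Xpt, Xpn; split => //.
- have h2 : Ex id (sqstep h) (fun _ => 2^-1) [:: (fun=> 2^-1); (fun=> 0)].
    exact: (@ExC2 _ _ _ id (sqstep h) (fun=> 2^-1) (bdd_cst _ _)).
  have U := ExD2 (ExM2 sq1 XutL XutL) (ExM2 sq1 XunL XunL).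
  have W := ExD2 (ExD2 (ExM2 sq1 (ExM2 sq1 h2 XrL) U) (ExM2 sq1 XptL EtL)) (ExM2 sq1 XpnL EnL).
  apply: (Ex2_ext W) => s; first by rewrite !expr2.
    by rewrite /tang1 /ut1 /un1 /=; ring.
  by rewrite /tang3 /ut1 /un1 /ut3 /un3 /=; field.
- move=> vt vn A0 A1 B0 B1 vtL vnL.
  have h2 : Ex id (sqstep h) (fun _ => 2^-1) [:: (fun=> 2^-1); (fun=> 0)].
    exact: (@ExC2 _ _ _ id (sqstep h) (fun=> 2^-1) (bdd_cst _ _)).
  have hh : Ex id (sqstep h) (fun s => h s ^+ 2) [:: (fun=> 0); (fun=> 1)].
    have bz : bdd (fun _ : Q => 1 : R) by exact: bdd_cst.
    have [b1 b2] : bdd (fun _ : Q => 0 : R) /\ bdd (fun _ : Q => 0 : R) by split; exact: bdd_cst.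
    Transparent Ex. split => //; exists (fun=> 1); split; first by move=> s; rewrite add0r mulr1.
    by split => //; exists (fun=> 0); split => // s; rewrite mulr0 addr0.
    Opaque Ex.
  have RV : Ex id (sqstep h) (fun s => (r (s, true) + r (s, false))^-1)
     [:: (fun s => (2 * q s)^-1); (fun s => - (2 * nr2 (q s) (E2 s) (N1 s)) * (2 * q s)^-1 ^+ 2)].
    apply: (@ExV2 _ _ _ _ _ sq1 _ _ _ c) RL => //.
      move=> s; have := rc (s, true); have := sqrtr_ge0 (et (s, false) ^+ 2 + en (s, false) ^+ 2).
      rewrite -/(r _) -/(r (s, true)) => a b; rewrite ger0_norm; first lra.
      by rewrite addr_ge0// sqrtr_ge0.
    by move=> s; have := qc s; have := c0; move=> a b; rewrite ger0_norm; lra.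
  have vRE := ExD2 (ExM2 sq1 vnL EtL) (ExN2 (ExM2 sq1 vtL EnL)).
  have EE := ExD2 (ExM2 sq1 EtL EtL) (ExM2 sq1 EnL EnL).
  have uRE := ExD2 (ExM2 sq1 XunL EtL) (ExN2 (ExM2 sq1 XutL EnL)).
  have pRE := ExD2 (ExM2 sq1 XpnL EtL) (ExN2 (ExM2 sq1 XptL EnL)).
  have W := ExD2 (ExD2 (ExM2 sq1 (ExM2 sq1 (ExM2 sq1 h2 vRE) EE) RV) (ExN2 uRE))
     (ExN2 (ExM2 sq1 hh pRE)).
  apply: (Ex2_ext W) => s; first by rewrite !expr2.
    by rewrite /norm1 /un1 /=; have := q_neq0 s => ?; field.
  by rewrite /norm3 /un1 /ut1 /un3 /=; have := q_neq0 s => ?; field.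
Qed.

End NodeAlgebra.

(** * Algebraic identities behind the velocity fields *)

Section Identities.
Context {R : realType}.
Implicit Types (q k b w A B : R).

(** [beta0_form1] and [beta0_form2] are the first two derivatives of [beta0_form], that is, the
    third and fourth derivatives of beta_0. *)
Definition beta0_form1 q q1 q2 k k1 k2 b b1 b2 : R :=
  (q2 * q^-1 - q1 ^+ 2 * q^-1 ^+ 2) * b1 + q1 * q^-1 * b2
  + (2 * q * q1 * k ^+ 2 + 2 * q ^+ 2 * k * k1) * b + q ^+ 2 * k ^+ 2 * b1
  - 4^-1 * (2 * q * q1 ^+ 2 * k ^+ 2 + q ^+ 2 * q2 * k ^+ 2 + 2 * q ^+ 2 * q1 * k * k1)
  + 3 * (q1 * k * k1 + q * k1 ^+ 2 + q * k * k2).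

Definition beta0_form2 q q1 q2 q3 k k1 k2 k3 b b1 b2 b3 : R :=
  (q3 * q^-1 - 3 * q1 * q2 * q^-1 ^+ 2 + 2 * q1 ^+ 3 * q^-1 ^+ 3) * b1
  + 2 * (q2 * q^-1 - q1 ^+ 2 * q^-1 ^+ 2) * b2 + q1 * q^-1 * b3
  + (2 * q1 ^+ 2 * k ^+ 2 + 2 * q * q2 * k ^+ 2 + 8 * q * q1 * k * k1
     + 2 * q ^+ 2 * k1 ^+ 2 + 2 * q ^+ 2 * k * k2) * b
  + 2 * (2 * q * q1 * k ^+ 2 + 2 * q ^+ 2 * k * k1) * b1 + q ^+ 2 * k ^+ 2 * b2
  - 4^-1 * (2 * q1 ^+ 3 * k ^+ 2 + 6 * q * q1 * q2 * k ^+ 2 + 8 * q * q1 ^+ 2 * k * k1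
     + q ^+ 2 * q3 * k ^+ 2 + 4 * q ^+ 2 * q2 * k * k1 + 2 * q ^+ 2 * q1 * k1 ^+ 2
     + 2 * q ^+ 2 * q1 * k * k2)
  + 3 * (q2 * k * k1 + 2 * q1 * k1 ^+ 2 + 2 * q1 * k * k2 + 3 * q * k1 * k2 + q * k * k3).

(* Components in the moving frame of the derivatives of B tau + A n; w = |Y_rho| kappa. *)
Definition vT1 w A B1 : R := B1 + w * A.
Definition vN1 w B A1 : R := A1 - w * B.
Definition vT2 w w1 A A1 B B2 : R := B2 + 2 * w * A1 + w1 * A - w ^+ 2 * B.
Definition vN2 w w1 A A2 B B1 : R := A2 - 2 * w * B1 - w1 * B - w ^+ 2 * A.
Definition vT3 w w1 w2 A A1 A2 B B1 B3 : R :=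
  B3 + 3 * w1 * A1 + 2 * w * A2 + w2 * A - 2 * w * w1 * B - w ^+ 2 * B1 + w * vN2 w w1 A A2 B B1.
Definition vN3 w w1 w2 A A1 A3 B B1 B2 : R :=
  A3 - 3 * w1 * B1 - 2 * w * B2 - w2 * B - 2 * w * w1 * A - w ^+ 2 * A1 - w * vT2 w w1 A A1 B B2.
Definition vT4 w w1 w2 w3 A A1 A2 A3 B B1 B2 B4 : R :=
  B4 + 4 * w2 * A1 + 5 * w1 * A2 + 2 * w * A3 + w3 * A - 2 * (w1 ^+ 2 + w * w2) * B
  - 4 * w * w1 * B1 - w ^+ 2 * B2 + w1 * vN2 w w1 A A2 B B1
  + w * (A3 - 3 * w1 * B1 - 2 * w * B2 - w2 * B - 2 * w * w1 * A - w ^+ 2 * A1)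
  + w * vN3 w w1 w2 A A1 A3 B B1 B2.

Definition wf q k := q * k.
Definition wf1 q q1 k k1 := q1 * k + q * k1.
Definition wf2 q q1 q2 k k1 k2 := q2 * k + 2 * q1 * k1 + q * k2.
Definition wf3 q q1 q2 q3 k k1 k2 k3 := q3 * k + 3 * q2 * k1 + 3 * q1 * k2 + q * k3.

(* Components in the moving frame of the derivatives of Y. *)
Definition yT3 q q2 k := q2 - q ^+ 3 * k ^+ 2.
Definition yN3 q q1 k k1 := - (3 * q * q1 * k + q ^+ 2 * k1).
Definition yT4 q q1 q3 k k1 := q3 - 3 * q ^+ 2 * q1 * k ^+ 2 - 2 * q ^+ 3 * k * k1
  + q * k * yN3 q q1 k k1.
Definition yN4 q q1 q2 k k1 k2 := - (3 * q1 ^+ 2 * k + 3 * q * q2 * k + 5 * q * q1 * k1 + q ^+ 2 * k2)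
  - q * k * yT3 q q2 k.

Definition yN4_1 q q1 q2 q3 k k1 k2 k3 := - (9 * q1 * q2 * k + 8 * q1 ^+ 2 * k1 + 3 * q * q3 * k
    + 8 * q * q2 * k1 + 7 * q * q1 * k2 + q ^+ 2 * k3)
  - (q1 * k + q * k1) * yT3 q q2 k
  - q * k * (q3 - (3 * q ^+ 2 * q1 * k ^+ 2 + 2 * q ^+ 3 * k * k1)).
Definition yN5 q q1 q2 q3 k k1 k2 k3 := yN4_1 q q1 q2 q3 k k1 k2 k3
  - q * k * yT4 q q1 q3 k k1.

(** Substitution of the Taylor coefficients: the i-th derivatives of Y and Y_t divided by i!. In
    [ynorm3] the argument Wn is Y_tt . n, halved as the second-order term of the time increment. *)
Definition ytang1 q q1 k T1 T2 N1 N2 : R :=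
  tang1 q (2^-1 * q1) (- 2^-1 * q ^+ 2 * k) T1 (2^-1 * T2) N1 (2^-1 * N2).
Definition ytang3 q q1 q2 q3 k k1 k2 T1 T2 T3 T4 N1 N2 : R :=
  tang3 q (2^-1 * q1) (6^-1 * yT3 q q2 k) (24^-1 * yT4 q q1 q3 k k1)
    (- 2^-1 * q ^+ 2 * k) (6^-1 * yN3 q q1 k k1) (24^-1 * yN4 q q1 q2 k k1 k2)
    T1 (2^-1 * T2) (6^-1 * T3) (24^-1 * T4) N1 (2^-1 * N2).
Definition ynorm1 q q1 k A : R := norm1 q (2^-1 * q1) (- 2^-1 * q ^+ 2 * k) A.
Definition ynorm3 q q1 q2 q3 k k1 k2 B A Wn T1 T2 N1 N2 : R :=
  norm3 q (2^-1 * q1) (6^-1 * yT3 q q2 k) (24^-1 * yT4 q q1 q3 k k1)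
    (- 2^-1 * q ^+ 2 * k) (6^-1 * yN3 q q1 k k1) (24^-1 * yN4 q q1 q2 k k1 k2)
    B A (2^-1 * Wn) T1 (2^-1 * T2) N1 (2^-1 * N2).

(* Time derivatives: W'' . tau and W . n for W = Y_tt, in terms of scalar products
   of a = Y', b = Y'', u = Y_t', w = Y_t'' and m = b . R a, mt = w . R a + b . R u. *)
Definition Gamma_form (q wu wa au uu ab ub m mt : R) : R :=
  - (wu * q^-1 ^+ 2 - 2 * wa * au * q^-1 ^+ 4 - uu * ab * q^-1 ^+ 4
     - au * (ub + wa) * q^-1 ^+ 4 + 4 * au ^+ 2 * ab * q^-1 ^+ 6
     + 4^-1 * ((ub + wa) * m ^+ 2 * q^-1 ^+ 6 + 2 * ab * m * mt * q^-1 ^+ 6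
       - 6 * ab * m ^+ 2 * au * q^-1 ^+ 8)).
Definition Nu_form (q uRu vRa au m mt : R) : R :=
  - (uRu * q^-1 - vRa * au * q^-1 ^+ 3 - mt * q^-1 ^+ 3 + 3 * m * au * q^-1 ^+ 5).

Definition yGamma q q1 k T1 T2 N1 N2 : R :=
  Gamma_form q (T1 * T2 + N1 * N2) (T2 * q) (q * T1) (T1 ^+ 2 + N1 ^+ 2) (q * q1)
    (T1 * q1 - q ^+ 2 * k * N1) (- q ^+ 3 * k) (N2 * q - q1 * N1 - q ^+ 2 * k * T1).
Definition yNu q q1 k B A T1 N1 N2 : R :=
  Nu_form q (A * T1 - B * N1) (A * q) (q * T1) (- q ^+ 3 * k) (N2 * q - q1 * N1 - q ^+ 2 * k * T1).

(** H stands for h^2. At H = 0 the equation for beta_0 is exactly the vanishing of the leading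
    tangential coefficient; the correction V2 enters linearly. *)
Lemma ytang1E q q1 k k1 b b1 b2 a a1 e e1 e2 (H : R) : q != 0 ->
  b2 = beta0_form q q1 k k1 b b1 ->
  ytang1 q q1 k (vT1 (wf q k) (- k + H * a) (b1 + H * e1))
    (vT2 (wf q k) (wf1 q q1 k k1) (- k + H * a) (- k1 + H * a1) (b + H * e) (b2 + H * e2))
    0 0
  = H * (2 * q * dssV2 q q1 k k1 a a1 e e1 e2).
Proof.
move=> q0 ->; rewrite /ytang1 /tang1 /ut1 /un1 /quo1 /ni1 /vT1 /vT2 /wf /wf1 /beta0_form /dssV2.
by field.
Qed.

Lemma ynorm1E q q1 k a (H : R) : q != 0 -> ynorm1 q q1 k (- k + H * a) = H * (2 * q ^+ 2 * a).
Proof. by move=> q0; rewrite /ynorm1 /norm1 /un1 /quo1 /ni1; field. Qed.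

Section V0.
Variables (q q1 q2 q3 k k1 k2 k3 b b1 b2 b3 b4 : R).
Hypothesis q0 : q != 0.
Hypothesis b2E : b2 = beta0_form q q1 k k1 b b1.
Hypothesis b3E : b3 = beta0_form1 q q1 q2 k k1 k2 b b1 b2.
Hypothesis b4E : b4 = beta0_form2 q q1 q2 q3 k k1 k2 k3 b b1 b2 b3.
Let w := wf q k.
Let w1 := wf1 q q1 k k1.
Let w2 := wf2 q q1 q2 k k1 k2.
Let w3 := wf3 q q1 q2 q3 k k1 k2 k3.
Let T1 := vT1 w (- k) b1.
Let N1 := vN1 w b (- k1).
Let T2 := vT2 w w1 (- k) (- k1) b b2.
Let N2 := vN2 w w1 (- k) (- k2) b b1.
Let T3 := vT3 w w1 w2 (- k) (- k1) (- k2) b b1 b3.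
Let T4 := vT4 w w1 w2 w3 (- k) (- k1) (- k2) (- k3) b b1 b2 b4.

(** This is where the formula for alpha_2 comes from: it is the one normal correction that cancels
    the second normal coefficient of the flow by V0, the contribution of Y_tt included. *)
Lemma normal_identity :
  2 * q ^+ 2 * alpha2_form q q1 k k1 k2 b b1
  + ynorm3 q q1 q2 q3 k k1 k2 b (- k) (yNu q q1 k b (- k) T1 N1 N2) T1 T2 N1 N2 = 0.
Proof.
rewrite /ynorm3 /norm3 /yNu /Nu_form /alpha2_form /T2 /T1 /N1 /N2.
rewrite /un3 /ut1 /un1 /quo1 /quo3 /ni3 /ni2 /ni1 /nr3 /nr2.
rewrite /yT4 /yN4 /yT3 /yN3 /vT1 /vN1 /vT2 /vN2 /w /w1 /wf /wf1 /beta0_form.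
by field.
Qed.

(** The counterpart for beta_2: [G2_form] is the value of [dssV2] that cancels the second tangential
    coefficient. The derivatives of beta_0 of orders two to four are first eliminated through its
    equation. *)
Lemma tangential_identity :
  2 * q * G2_form q q1 q2 k k1 k2 k3 b b1 b2 b3
  + ytang3 q q1 q2 q3 k k1 k2 T1 T2 T3 T4 N1 N2
  + q * yGamma q q1 k T1 T2 N1 N2 = 0.
Proof.
rewrite /ytang3 /tang3 /yGamma /Gamma_form /T4 /T3 /T2 /T1 /N1 /N2.
rewrite /un3 /ut3 /ut1 /un1 /quo1 /quo3 /ni3 /ni2 /ni1 /nr3 /nr2.
rewrite /yT4 /yN4 /yT3 /yN3 /G2_form /S4_form /S2_form /ft /ft1 /ft2 /fn /fn1 /fn2 /=.
rewrite b4E b3E b2E /beta0_form2 /beta0_form1.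
rewrite /vT4 /vT3 /vN3 /vT1 /vN1 /vT2 /vN2 /w /w1 /w2 /w3 /wf /wf1 /wf2 /wf3 /beta0_form.
by field.
Qed.

End V0.

End Identities.

(** * Two time levels *)

Section TimeFamilies.
Context {R : realType} {I : Type} (T : R).
Implicit Types (F G : I -> R -> R -> R).

(** A curve index together with a time in [0, T]. Taken as one parameter, it makes every [CL] bound
    uniform over both. *)
Definition PT := {p : I * R | 0 <= p.2 <= T}.
Definition mkPT i t (tT : 0 <= t <= T) : PT := exist (fun p : I * R => is_true (0 <= p.2 <= T)) (i, t) tT.
Definition fam F : PT -> R -> R := fun p x => F (sval p).1 (sval p).2 x.
Definition TDF F F1 := forall i x, TD T (fun t => F i t x) (fun t => F1 i t x).

Context {Q : Type} (qi : Q -> I) (qt eps : Q -> R).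
Hypothesis qt0 : forall q, 0 <= qt q.
Hypothesis eps0 : forall q, 0 <= eps q.
Hypothesis qtT : forall q, qt q + eps q <= T.

Lemma mid_in q (s : R) : qt q <= s <= qt q + eps q -> 0 <= s <= T.
Proof. by move=> /andP[a b]; rewrite (le_trans (qt0 q) a) (le_trans b (qtT q)). Qed.

Lemma cur_in q : 0 <= qt q <= T.
Proof. by apply: (mid_in (q := q)); rewrite ?lexx lerDl eps0. Qed.
Lemma nxt_in q : 0 <= qt q + eps q <= T.
Proof. by apply: (mid_in (q := q)); rewrite ?lexx lerDl eps0. Qed.

Lemma step_le q : qt q <= qt q + eps q. Proof. by rewrite lerDl. Qed.
Lemma step_sub q : qt q + eps q - qt q = eps q. Proof. by rewrite addrAC subrr add0r. Qed.

Definition cur q : PT := mkPT (qi q) (cur_in q).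
Definition nxt q : PT := mkPT (qi q) (nxt_in q).

Lemma fdiff_fam_bound F j K : (forall p y x, `|fdiff j y (fam F p) x| <= K * `|y| ^+ j) ->
  forall i t y x, 0 <= t <= T -> `|fdiff j y (F i t) x| <= K * `|y| ^+ j.
Proof. by move=> h i t y x tT; exact: (h (mkPT i tT)). Qed.

(** No exchange of space and time derivatives is involved: the mean value inequality in time is
    applied to the j-th difference in space, and the j-th derivative is bounded afterwards. *)
Lemma time_close F F1 k j : TDF F F1 -> CL k (fam F) -> CL k (fam F1) -> (j <= k)%N ->
  exists K, forall q x, `|dn j (fam F) (nxt q) x - dn j (fam F) (cur q) x| <= K * eps q.
Proof.
move=> FF FL F1L jk; have [K [K0 FK]] := CL_fdiff_le F1L (leqW jk).
exists K => q x.
pose H i := (fun x => dn i (fam F) (nxt q) x - dn i (fam F) (cur q) x).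
have dH i : (i < k)%N -> forall x : R, is_derive x 1 (H i) (H i.+1 x).
  by move=> ik y; apply: is_deriveB; apply: (isder_dn FL ik).
have cH : continuous (H j).
  have : CL (k - j) (dn j (fam F)) by apply: CL_dn; rewrite subnK.
  move=> /CL_lip [B [_ FB]]; have cp p : continuous (dn j (fam F) p) by exact: lipschitz_continuous (FB p).
  by move=> y; apply: cvgB; exact: cp.
apply: (@fdiff_derive_le R j H (K * eps q)) => //.
  by move=> i ij; apply: dH; exact: leq_trans ij jk.
move=> y z; rewrite /H fdiffB.
have tde := TD_fdiff j y (fun z => FF (qi q) z) z.
have := TD_mean tde (qt0 q) (step_le q) (qtT q) (K := K * `|y| ^+ j).
rewrite step_sub.
move=> h; rewrite -mulrA [eps q * _]mulrC mulrA; apply: h => s sI.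
by apply: fdiff_fam_bound => //; exact: mid_in sI.
Qed.

(** For the derivative of order j + 1 a C^{j,1} bound of the second time derivative suffices, since
    j + 1 differences of it are already bounded. This saves one order for Y_tt and for Y_ttt. *)
Lemma time_taylor2 F F1 F2 k j : TDF F F1 -> TDF F1 F2 -> CL k (fam F) -> CL k (fam F1) ->
  CL j (fam F2) -> (j < k)%N ->
  exists K, forall q x, `|dn j.+1 (fam F) (nxt q) x - dn j.+1 (fam F) (cur q) x
    - eps q * dn j.+1 (fam F1) (cur q) x| <= K * eps q ^+ 2.
Proof.
move=> FF FF1 FL F1L F2L jk; have [K [K0 FK]] := CL_fdiff F2L.
exists K => q x.
pose H i := (fun x => dn i (fam F) (nxt q) x - dn i (fam F) (cur q) x - eps q * dn i (fam F1) (cur q) x).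
have dH i : (i < k)%N -> forall x : R, is_derive x 1 (H i) (H i.+1 x).
  move=> ik y; apply: is_deriveB.
    by apply: is_deriveB; apply: (isder_dn FL ik).
  exact: (isderZ (fun=> eps q) (isder_dn F1L ik)).
have cH : continuous (H j.+1).
  have : CL (k - j.+1) (dn j.+1 (fam F)) by apply: CL_dn; rewrite subnK.
  move=> /CL_lip [B [_ FB]]; have cp p : continuous (dn j.+1 (fam F) p) by exact: lipschitz_continuous (FB p).
  have : CL (k - j.+1) (dn j.+1 (fam F1)) by apply: CL_dn; rewrite subnK.
  move=> /CL_lip [B' [_ FB']]; have cp' p : continuous (dn j.+1 (fam F1) p) by exact: lipschitz_continuous (FB' p).
  move=> y; apply: cvgB; first by apply: cvgB; exact: cp.
  by apply: cvgM; [exact: cvg_cst|exact: cp'].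
apply: (@fdiff_derive_le R j.+1 H (K * eps q ^+ 2)) => //.
  by move=> i ij; apply: dH; exact: leq_trans ij jk.
move=> y z; rewrite /H fdiffB fdiffB fdiffZ.
have tde := TD_fdiff j.+1 y (fun z => FF (qi q) z) z.
have tde1 := TD_fdiff j.+1 y (fun z => FF1 (qi q) z) z.
have := TD_taylor2 tde tde1 (qt0 q) (step_le q) (qtT q) (K := K * `|y| ^+ j.+1).
rewrite step_sub.
move=> h; rewrite -mulrA [eps q ^+ 2 * _]mulrC mulrA; apply: h => s sI.
by apply: fdiff_fam_bound => //; exact: mid_in sI.
Qed.

Lemma time_taylor2_0 F F1 F2 : TDF F F1 -> TDF F1 F2 -> unif_bounded (fam F2) ->
  exists K, forall q x, `|fam F (nxt q) x - fam F (cur q) x - eps q * fam F1 (cur q) x|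
    <= K * eps q ^+ 2.
Proof.
move=> FF FF1 [K FK]; exists K => q x.
have := TD_taylor2 (FF (qi q) x) (FF1 (qi q) x) (qt0 q) (step_le q) (qtT q) (K := K).
rewrite step_sub; apply => s sI.
exact: (FK (mkPT (qi q) (mid_in sI))).
Qed.

Lemma time_taylor3 F F1 F2 F3 : TDF F F1 -> TDF F1 F2 -> TDF F2 F3 -> unif_bounded (fam F3) ->
  exists K, forall q x, `|fam F (nxt q) x - fam F (cur q) x - eps q * fam F1 (cur q) x
    - 2^-1 * eps q ^+ 2 * fam F2 (cur q) x| <= K * eps q ^+ 3.
Proof.
move=> FF FF1 FF2 [K FK]; exists K => q x.
have := TD_taylor3 (FF (qi q) x) (FF1 (qi q) x) (FF2 (qi q) x) (qt0 q) (step_le q) (qtT q) (K := K).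
rewrite step_sub; apply => s sI.
have sT := mid_in sI.
exact: (FK (mkPT (qi q) sT)).
Qed.

Definition wquot (h pt a b : Q -> R) G (p : PT) q : R :=
  (fam G p (pt q + h q) - fam G p (pt q)) / h q * a q
  - (fam G p (pt q - h q) - fam G p (pt q)) / (- h q) * b q.

(* The weights a and b stand for the inverse edge lengths, frozen at the initial time. *)
Lemma time_taylor3_quotient F F1 F2 F3 (h : Q -> R) (pt a b : Q -> R) :
  (forall q, 0 < h q) -> bdd a -> bdd b ->
  (exists K, forall q, `|a q - b q| <= K * h q) ->
  TDF F F1 -> TDF F1 F2 -> TDF F2 F3 -> CL 1 (fam F3) ->
  exists K, forall q,
    `|wquot h pt a b F (nxt q) q - wquot h pt a b F (cur q) q
      - eps q * wquot h pt a b F1 (cur q) q - 2^-1 * eps q ^+ 2 * wquot h pt a b F2 (cur q) q|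
    <= K * h q * eps q ^+ 3.
Proof.
move=> h0 [Ka aK] [Kb bK] [Kab abK] FF FF1 FF2 F3L.
have [K2 [K20 FK2]] := CL_fdiff F3L.
have [K1 [K10 FK1]] := CL_lip F3L.
exists (K2 * Ka + K1 * Kab) => q.
pose l (G : I -> R -> R -> R) s := (G (qi q) s (pt q + h q) - G (qi q) s (pt q)) / h q * a q
              - (G (qi q) s (pt q - h q) - G (qi q) s (pt q)) / (- h q) * b q.
(* The weighted jump is a fixed linear combination of point values, hence differentiable in time
   term by term. *)
have tdl G G1 : TDF G G1 -> TD T (l G) (l G1).
  move=> GG; have z u v w : TD T (fun s => G (qi q) s u * w - G (qi q) s v * w)
      (fun s => G1 (qi q) s u * w - G1 (qi q) s v * w).
    have tm x : TD T (fun s => G (qi q) s x * w) (fun s => G1 (qi q) s x * w).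
      move=> t tT e e0; have e1 : 0 < e / (`|w| + 1) by rewrite divr_gt0// ltr_wpDl.
      have [d d0 dP] := GG (qi q) x t tT _ e1; exists d => // s sT sd.
      have -> : G (qi q) s x * w - G (qi q) t x * w - (s - t) * (G1 (qi q) t x * w) =
        w * (G (qi q) s x - G (qi q) t x - (s - t) * G1 (qi q) t x) by ring.
      rewrite normrM; apply: le_trans (ler_wpM2l (normr_ge0 w) (dP s sT sd)) _.
      rewrite mulrA ler_wpM2r// mulrA ler_pdivrMr ?ltr_wpDl// mulrC.
      by rewrite ler_wpM2l ?(ltW e0)// lerDl.
    exact: TDB.
  have := TDB (z (pt q + h q) (pt q) ((h q)^-1 * a q)) (z (pt q - h q) (pt q) ((- h q)^-1 * b q)).
  have lE G' s : l G' s = G' (qi q) s (pt q + h q) * ((h q)^-1 * a q) - G' (qi q) s (pt q) * ((h q)^-1 * a q)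
    - (G' (qi q) s (pt q - h q) * ((- h q)^-1 * b q) - G' (qi q) s (pt q) * ((- h q)^-1 * b q)).
    by rewrite /l; ring.
  by rewrite (funext (lE G)) (funext (lE G1)).
have := TD_taylor3 (tdl _ _ FF) (tdl _ _ FF1) (tdl _ _ FF2) (qt0 q) (step_le q) (qtT q)
   (K := (K2 * Ka + K1 * Kab) * h q).
rewrite step_sub.
move=> H.
suff lK s : qt q <= s <= qt q + eps q -> `|l F3 s| <= (K2 * Ka + K1 * Kab) * h q by exact: (H lK).
move=> sI.
have sT := mid_in sI.
pose p : PT := mkPT (qi q) sT.
have := FK2 p (h q) (pt q - h q); rewrite /= /fam/= (gtr0_norm (h0 q)) => B2.
have := FK1 p (pt q - h q) (pt q); rewrite /fam/= addrAC subrr add0r normrN (gtr0_norm (h0 q)) => B1.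
have hn : h q != 0 by rewrite gt_eqF.
(* A second difference in space, of order h^2 before the division by h, plus a first difference
   quotient times a - b: both are of order h. *)
have -> : l F3 s = ((F3 (qi q) s (pt q - h q + h q + h q) - F3 (qi q) s (pt q - h q + h q)
    - (F3 (qi q) s (pt q - h q + h q) - F3 (qi q) s (pt q - h q))) / h q) * a q
  + ((F3 (qi q) s (pt q - h q) - F3 (qi q) s (pt q)) / (- h q)) * (a q - b q).
  by rewrite /l subrK; field.
apply: (le_trans (ler_normD _ _)); rewrite !normrM mulrDl; apply: lerD.
  rewrite [leRHS]mulrAC; apply: ler_pM => //.
  rewrite normfV (gtr0_norm (h0 q)) ler_pdivrMr//.
  by apply: le_trans B2 _; rewrite expr2 mulrA.
rewrite -[leRHS]mulrA; apply: ler_pM => //.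
by rewrite normfV normrN (gtr0_norm (h0 q)) ler_pdivrMr.
Qed.

End TimeFamilies.

(** * Derivatives of the closed formulas *)

Section FormDerivatives.
Context {R : realType} {P : Type}.
Variables (q q1 q2 q3 k k1 k2 k3 b b1 b2 b3 : P -> R -> R).
Hypotheses (dq : isder q q1) (dq1 : isder q1 q2) (dq2 : isder q2 q3).
Hypotheses (dk : isder k k1) (dk1 : isder k1 k2) (dk2 : isder k2 k3).
Hypotheses (db : isder b b1) (db1 : isder b1 b2) (db2 : isder b2 b3).
Hypothesis q0 : forall p x, q p x != 0.

Let dqV : isder (fun p x => (q p x)^-1) (fun p x => - (q p x)^-1 ^+ 2 * q1 p x).
Proof. exact: isderV. Qed.

Lemma isder_beta0_form :
  isder (fun p x => beta0_form (q p x) (q1 p x) (k p x) (k1 p x) (b p x) (b1 p x))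
  (fun p x => beta0_form1 (q p x) (q1 p x) (q2 p x) (k p x) (k1 p x) (k2 p x) (b p x) (b1 p x) (b2 p x)).
Proof.
apply: isder_ext; first by rewrite /beta0_form; isdertac.
by move=> p x; rewrite /beta0_form1 /=; ring.
Qed.

Lemma isder_beta0_form1 :
  isder (fun p x => beta0_form1 (q p x) (q1 p x) (q2 p x) (k p x) (k1 p x) (k2 p x)
    (b p x) (b1 p x) (b2 p x))
  (fun p x => beta0_form2 (q p x) (q1 p x) (q2 p x) (q3 p x) (k p x) (k1 p x) (k2 p x) (k3 p x)
    (b p x) (b1 p x) (b2 p x) (b3 p x)).
Proof.
apply: isder_ext; first by rewrite /beta0_form1; isdertac.
by move=> p x; rewrite /beta0_form2 /=; ring.
Qed.

Lemma isder_wf : isder (fun p x => q p x * k p x) (fun p x => wf1 (q p x) (q1 p x) (k p x) (k1 p x)).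
Proof. by rewrite /wf1; isdertac. Qed.

Lemma isder_wf1 : isder (fun p x => wf1 (q p x) (q1 p x) (k p x) (k1 p x))
  (fun p x => wf2 (q p x) (q1 p x) (q2 p x) (k p x) (k1 p x) (k2 p x)).
Proof.
rewrite /wf1 /wf2; apply: isder_ext; first by isdertac.
by move=> p x /=; ring.
Qed.

Lemma isder_wf2 : isder (fun p x => wf2 (q p x) (q1 p x) (q2 p x) (k p x) (k1 p x) (k2 p x))
  (fun p x => wf3 (q p x) (q1 p x) (q2 p x) (q3 p x) (k p x) (k1 p x) (k2 p x) (k3 p x)).
Proof.
rewrite /wf2 /wf3; apply: isder_ext; first by isdertac.
by move=> p x /=; ring.
Qed.

Lemma isder_yN2 : isder (fun p x => - (q p x ^+ 2 * k p x))
    (fun p x => - (2 * q p x * q1 p x * k p x + q p x ^+ 2 * k1 p x)).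
Proof. by apply: isder_ext; [isdertac|move=> p x /=; ring]. Qed.

Lemma isder_yT3 : isder (fun p x => yT3 (q p x) (q2 p x) (k p x))
    (fun p x => q3 p x - (3 * q p x ^+ 2 * q1 p x * k p x ^+ 2 + 2 * q p x ^+ 3 * k p x * k1 p x)).
Proof.
rewrite (_ : (fun p x => yT3 _ _ _) = fun p x => q2 p x - q p x * q p x ^+ 2 * k p x ^+ 2).
  by apply: isder_ext; [isdertac|move=> p x /=; ring].
by apply/funext => p; apply/funext => x; rewrite /yT3; ring.
Qed.

Lemma isder_yN3 : isder (fun p x => yN3 (q p x) (q1 p x) (k p x) (k1 p x))
    (fun p x => - (3 * q1 p x ^+ 2 * k p x + 3 * q p x * q2 p x * k p x + 5 * q p x * q1 p x * k1 p x
       + q p x ^+ 2 * k2 p x)).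
Proof. by rewrite /yN3; apply: isder_ext; [isdertac|move=> p x /=; ring]. Qed.

Lemma isder_yN4 : isder (fun p x => yN4 (q p x) (q1 p x) (q2 p x) (k p x) (k1 p x) (k2 p x))
  (fun p x => yN4_1 (q p x) (q1 p x) (q2 p x) (q3 p x) (k p x) (k1 p x) (k2 p x) (k3 p x)).
Proof.
have dT := isder_yT3.
apply: isder_ext.
  refine (isderB (isderN (isderD (isderD (isderD _ _) _) _)) (isderM (isderM dq dk) dT)); by isdertac.
by move=> p x; rewrite /yN4_1 /yT3 /=; ring.
Qed.

End FormDerivatives.

Section FrameFormDerivatives.
Context {R : realType} {P : Type}.
Variables (w w1 w2 w3 A A1 A2 A3 A4 B B1 B2 B3 B4 : P -> R -> R).
Hypotheses (dw : isder w w1) (dw1 : isder w1 w2) (dw2 : isder w2 w3).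
Hypotheses (dA : isder A A1) (dA1 : isder A1 A2) (dA2 : isder A2 A3) (dA3 : isder A3 A4).
Hypotheses (dB : isder B B1) (dB1 : isder B1 B2) (dB2 : isder B2 B3) (dB3 : isder B3 B4).

Lemma isder_vT2 : isder (fun p x => vT2 (w p x) (w1 p x) (A p x) (A1 p x) (B p x) (B2 p x))
  (fun p x => B3 p x + 3 * w1 p x * A1 p x + 2 * w p x * A2 p x + w2 p x * A p x
   - 2 * w p x * w1 p x * B p x - w p x ^+ 2 * B1 p x).
Proof. by rewrite /vT2; apply: isder_ext; [isdertac|move=> p x /=; ring]. Qed.

Lemma isder_vN2 : isder (fun p x => vN2 (w p x) (w1 p x) (A p x) (A2 p x) (B p x) (B1 p x))
  (fun p x => A3 p x - 3 * w1 p x * B1 p x - 2 * w p x * B2 p x - w2 p x * B p x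
   - 2 * w p x * w1 p x * A p x - w p x ^+ 2 * A1 p x).
Proof. by rewrite /vN2; apply: isder_ext; [isdertac|move=> p x /=; ring]. Qed.

(** The tangential component of the fourth derivative is the derivative of that of the third plus
    the rotation of the frame, w times the normal component; the latter is split off here. *)
Lemma isder_vT3 : isder (fun p x => vT3 (w p x) (w1 p x) (w2 p x) (A p x) (A1 p x) (A2 p x)
    (B p x) (B1 p x) (B3 p x))
  (fun p x => vT4 (w p x) (w1 p x) (w2 p x) (w3 p x) (A p x) (A1 p x) (A2 p x) (A3 p x)
     (B p x) (B1 p x) (B2 p x) (B4 p x)
   - w p x * vN3 (w p x) (w1 p x) (w2 p x) (A p x) (A1 p x) (A3 p x) (B p x) (B1 p x) (B2 p x)).
Proof.
rewrite /vT3 /vN2; apply: isder_ext; first by isdertac.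
by move=> p x; rewrite /vT4 /vN3 /vN2 /vT2 /=; ring.
Qed.

Lemma isder_vN3 : exists N3', isder (fun p x => vN3 (w p x) (w1 p x) (w2 p x) (A p x) (A1 p x) (A3 p x)
  (B p x) (B1 p x) (B2 p x)) N3'.
Proof. by eexists; rewrite /vN3 /vT2; isdertac. Qed.

End FrameFormDerivatives.

(** * Quantities that change by O(h^2) *)

Section Close.
Context {R : realType} {P Q : Type} (cur nxt : Q -> P) (pt h : Q -> R).

(** An algebra closed under all operations of the geometric formulas. Usually [cur] and [nxt] are
    two times one step apart; in the assembly they also stand for V0 and the full velocity at one
    and the same time. *)
Definition CS (F : P -> R -> R) := unif_bounded F /\
  exists K, forall q, `|F (nxt q) (pt q) - F (cur q) (pt q)| <= K * h q ^+ 2.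

Implicit Types F G : P -> R -> R.

Lemma CS_num (c : R) : CS (fun _ _ => c).
Proof.
split; first by exists `|c|.
by exists 0 => q; rewrite subrr normr0 mul0r.
Qed.

Lemma CSD F G : CS F -> CS G -> CS (fun p x => F p x + G p x).
Proof.
move=> [bF [K FK]] [bG [L GL]]; split; first exact: unif_boundedD.
exists (K + L) => q; rewrite opprD addrACA mulrDl.
by apply: le_trans (ler_normD _ _) _; exact: lerD.
Qed.

Lemma CSM F G : CS F -> CS G -> CS (fun p x => F p x * G p x).
Proof.
move=> [bF [K FK]] [bG [L GL]]; split; first exact: unif_boundedM.
have [A AF] := bF; have [B BG] := bG; exists (K * B + A * L) => q.
rewrite (_ : _ - _ = (F (nxt q) (pt q) - F (cur q) (pt q)) * G (nxt q) (pt q)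
   + F (cur q) (pt q) * (G (nxt q) (pt q) - G (cur q) (pt q))); last by ring.
apply: le_trans (ler_normD _ _) _; rewrite !normrM mulrDl; apply: lerD.
  by rewrite [leRHS]mulrAC; exact: ler_pM.
by rewrite -[leRHS]mulrA; exact: ler_pM.
Qed.

Lemma CSN F : CS F -> CS (fun p x => - F p x).
Proof.
move=> FC; have := CSM (CS_num (-1)) FC; congr CS.
by apply/funext => p; apply/funext => x; rewrite mulN1r.
Qed.

Lemma CSB F G : CS F -> CS G -> CS (fun p x => F p x - G p x).
Proof. by move=> FC GC; exact: CSD FC (CSN GC). Qed.

Lemma CSX F n : CS F -> CS (fun p x => F p x ^+ n).
Proof.
move=> FC; elim: n => [|n IH].
  by have := CS_num 1; congr CS; apply/funext => p; apply/funext => x; rewrite expr0.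
by have := CSM FC IH; congr CS; apply/funext => p; apply/funext => x; rewrite exprS.
Qed.

Lemma CSV F c : 0 < c -> (forall p x, c <= F p x) -> CS F -> CS (fun p x => (F p x)^-1).
Proof.
move=> c0 Fc [bF [K FK]].
have Fn p x : c <= `|F p x| by rewrite ger0_norm// (le_trans (ltW c0)).
have F0 p x : F p x != 0 by rewrite gt_eqF// (lt_le_trans c0).
have bV := unif_boundedV c0 Fn; split => //.
have [L VL] := bV; exists (L * K * L) => q.
have -> : (F (nxt q) (pt q))^-1 - (F (cur q) (pt q))^-1 =
  - ((F (nxt q) (pt q))^-1 * (F (nxt q) (pt q) - F (cur q) (pt q)) * (F (cur q) (pt q))^-1).
  by field; rewrite !F0.
rewrite normrN !normrM [leRHS]mulrAC; apply: ler_pM => //.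
by rewrite -mulrA; exact: ler_pM.
Qed.

Lemma CS_root F G c : 0 < c -> (forall p x, c <= G p x) -> (forall p x, F p x = G p x ^+ 2) ->
  CS F -> CS G.
Proof.
move=> c0 Gc FG [[B FB] [K FK]]; split.
  exists (B / c) => p x; have g0 := lt_le_trans c0 (Gc p x).
  rewrite (ger0_norm (ltW g0)) ler_pdivlMr//; apply: le_trans (FB p x).
  by rewrite FG ger0_norm ?sqr_ge0// expr2 ler_pM2l.
exists (K / c) => q; rewrite mulrAC ler_pdivlMr//; apply: le_trans (FK q).
rewrite !FG subr_sqr normrM ler_wpM2l//.
have a := Gc (nxt q) (pt q); have b := Gc (cur q) (pt q).
by rewrite ger0_norm; lra.
Qed.

(** A term h^2 F is of order h^2 at each of the two times, so that no regularity of F in time is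
    asked for. This is what the correction beta_2 relies on. *)
Lemma CS_small (hp : P -> R) F : (forall p, `|hp p| <= 1) -> (forall q, hp (cur q) = h q) ->
  (forall q, hp (nxt q) = h q) -> unif_bounded F -> CS (fun p x => hp p ^+ 2 * F p x).
Proof.
move=> h1 hc hn [K FK]; split.
  exists K => p x; rewrite normrM normrX -[leRHS]mul1r.
  by rewrite ler_pM// ?exprn_ge0// exprn_ile1.
exists (2 * K) => q; rewrite hc hn -mulrBr normrM (ger0_norm (sqr_ge0 (h q))) mulrC.
rewrite ler_wpM2r ?sqr_ge0//; apply: le_trans (ler_normB _ _) _.
by rewrite mulrDl !mul1r; exact: lerD.
Qed.

Lemma CS_ext F G : (forall p x, G p x = F p x) -> CS F -> CS G.
Proof. by move=> GF; congr CS; apply/funext => p; apply/funext => x. Qed.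

End Close.

Ltac CStac := repeat match goal with
  | |- CS ?c ?n ?y ?h (fun p x => (@?F p x) + (@?G p x)) => refine (@CSD _ _ _ c n y h F G _ _)
  | |- CS ?c ?n ?y ?h (fun p x => (@?F p x) * (@?G p x)) => refine (@CSM _ _ _ c n y h F G _ _)
  | |- CS ?c ?n ?y ?h (fun p x => - (@?F p x)) => refine (@CSN _ _ _ c n y h F _)
  | |- CS ?c ?n ?y ?h (fun p x => (@?F p x) ^+ ?m) => refine (@CSX _ _ _ c n y h F m _)
  | |- CS ?c ?n ?y ?h (fun _ _ => ?z) => refine (@CS_num _ _ _ c n y h z)
  | H : CS ?c ?n ?y ?h (fun p x => (?f p x)^-1) |- CS ?c ?n ?y ?h (fun p x => (?f p x)^-1) => exact H
  | H : CS ?c ?n ?y ?h (?f) |- CS ?c ?n ?y ?h (fun p x => ?f p x) => exact H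
  end.

Section CloseFacts.
Context {R : realType} {P Q : Type} (cur nxt : Q -> P) (pt h : Q -> R).
Local Notation CS := (CS cur nxt pt h).
Variables (c : R) (hp : P -> R).
Variables (X1 X2 X3 X4 X5 Z1 Z2 Z3 Z4 Z5 U0 U1 U0' U1' : P -> R -> R).
Variables (cc ss q q1 q2 q3 k k1 k2 k3 b b1 b2 b3 A B1 a e e1 : P -> R -> R).
Hypotheses (c0 : 0 < c) (cq : forall p x, c <= q p x).
Hypotheses (hp1 : forall p, `|hp p| <= 1) (hpc : forall z, hp (cur z) = h z)
  (hpn : forall z, hp (nxt z) = h z).
Hypotheses (X1C : CS X1) (X2C : CS X2) (X3C : CS X3) (X4C : CS X4) (X5C : CS X5).
Hypotheses (Z1C : CS Z1) (Z2C : CS Z2) (Z3C : CS Z3) (Z4C : CS Z4) (Z5C : CS Z5).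
Hypotheses (U0C : CS U0) (U1C : CS U1) (U0C' : CS U0') (U1C' : CS U1').
Hypotheses (e_bd : unif_bounded e) (e1_bd : unif_bounded e1).
Hypothesis ccE : forall p x, cc p x = (q p x)^-1 * X1 p x.
Hypothesis ssE : forall p x, ss p x = (q p x)^-1 * Z1 p x.
Hypothesis q_sqr : forall p x, q p x ^+ 2 = X1 p x ^+ 2 + Z1 p x ^+ 2.
Hypothesis t2 : forall p x, cc p x * X2 p x + ss p x * Z2 p x = q1 p x.
Hypothesis n2 : forall p x, ss p x * X2 p x - cc p x * Z2 p x = - (q p x ^+ 2 * k p x).
Hypothesis t3 : forall p x, cc p x * X3 p x + ss p x * Z3 p x = yT3 (q p x) (q2 p x) (k p x).
Hypothesis n3 : forall p x, ss p x * X3 p x - cc p x * Z3 p x =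
  yN3 (q p x) (q1 p x) (k p x) (k1 p x).
Hypothesis t4 : forall p x, cc p x * X4 p x + ss p x * Z4 p x =
  yT4 (q p x) (q1 p x) (q3 p x) (k p x) (k1 p x).
Hypothesis n4 : forall p x, ss p x * X4 p x - cc p x * Z4 p x =
  yN4 (q p x) (q1 p x) (q2 p x) (k p x) (k1 p x) (k2 p x).
Hypothesis n5 : forall p x, ss p x * X5 p x - cc p x * Z5 p x =
  yN5 (q p x) (q1 p x) (q2 p x) (q3 p x) (k p x) (k1 p x) (k2 p x) (k3 p x).
Hypothesis AE : forall p x, A p x = ss p x * U0 p x - cc p x * U1 p x.
Hypothesis BE : forall p x, cc p x * U0 p x + ss p x * U1 p x = b p x + hp p ^+ 2 * e p x.
Hypothesis T1E : forall p x, cc p x * U0' p x + ss p x * U1' p x =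
  vT1 (q p x * k p x) (A p x) (b1 p x + hp p ^+ 2 * e1 p x).
Hypothesis b2E : forall p x, b2 p x = beta0_form (q p x) (q1 p x) (k p x) (k1 p x) (b p x) (b1 p x).
Hypothesis b3E : forall p x, b3 p x = beta0_form1 (q p x) (q1 p x) (q2 p x) (k p x) (k1 p x) (k2 p x)
  (b p x) (b1 p x) (b2 p x).
Hypothesis aE : forall p x, a p x = alpha2_form (q p x) (q1 p x) (k p x) (k1 p x) (k2 p x) (b p x) (b1 p x).

(** Each relation is solved for the one quantity not yet treated: the speed, the frame, the
    curvature and their derivatives from Y', ..., Y^(5), then beta_0 and beta_0' from Y_t and Y_t',
    and higher derivatives of beta_0 from its equation. Closeness thus passes from Y and Y_t to
    everything else by algebra. *)
Lemma close_facts : [/\ CS q, CS a &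
  CS (fun p x => G2_form (q p x) (q1 p x) (q2 p x) (k p x) (k1 p x) (k2 p x) (k3 p x)
       (b p x) (b1 p x) (b2 p x) (b3 p x))].
Proof.
have q0 p x : q p x != 0 by rewrite gt_eqF// (lt_le_trans c0 (cq p x)).
have qC : CS q.
  have sC : CS (fun p x => X1 p x ^+ 2 + Z1 p x ^+ 2) by CStac.
  by refine (CS_root c0 cq _ sC) => p x; rewrite q_sqr.
have qVC : CS (fun p x => (q p x)^-1) by exact (CSV c0 cq qC).
have ccC : CS cc by apply: (CS_ext ccE); CStac.
have ssC : CS ss by apply: (CS_ext ssE); CStac.
have q1C : CS q1 by apply: (CS_ext (fun p x => esym (t2 p x))); CStac.
have kC : CS k.
  apply: (@CS_ext _ _ _ _ _ _ _ (fun p x => - ((q p x)^-1 ^+ 2 * (ss p x * X2 p x - cc p x * Z2 p x)))).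
    by move=> p x; rewrite n2; field.
  by CStac.
have q2C : CS q2.
  apply: (@CS_ext _ _ _ _ _ _ _ (fun p x => cc p x * X3 p x + ss p x * Z3 p x + q p x ^+ 3 * k p x ^+ 2)).
    by move=> p x; rewrite t3 /yT3; ring.
  by CStac.
have k1C : CS k1.
  apply: (@CS_ext _ _ _ _ _ _ _ (fun p x => - ((q p x)^-1 ^+ 2 * (ss p x * X3 p x - cc p x * Z3 p x
      + 3 * q p x * q1 p x * k p x)))).
    by move=> p x; rewrite n3 /yN3; field.
  by CStac.
have q3C : CS q3.
  apply: (@CS_ext _ _ _ _ _ _ _ (fun p x => cc p x * X4 p x + ss p x * Z4 p x
      + 3 * q p x ^+ 2 * q1 p x * k p x ^+ 2 + 2 * q p x ^+ 3 * k p x * k1 p x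
      + q p x * k p x * (3 * q p x * q1 p x * k p x + q p x ^+ 2 * k1 p x))).
    by move=> p x; rewrite t4 /yT4 /yN3; ring.
  by CStac.
have k2C : CS k2.
  apply: (@CS_ext _ _ _ _ _ _ _ (fun p x => - ((q p x)^-1 ^+ 2 * (ss p x * X4 p x - cc p x * Z4 p x
      + q p x * k p x * (q2 p x - q p x ^+ 3 * k p x ^+ 2)
      + 3 * q1 p x ^+ 2 * k p x + 3 * q p x * q2 p x * k p x + 5 * q p x * q1 p x * k1 p x)))).
    by move=> p x; rewrite n4 /yN4 /yT3; field.
  by CStac.
(* [yN5] is affine in its last argument with slope - q^2; the value 0 there leaves the terms already
   known to be close. *)
have k3C : CS k3.
  apply: (@CS_ext _ _ _ _ _ _ _ (fun p x => - ((q p x)^-1 ^+ 2 * (ss p x * X5 p x - cc p x * Z5 p x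
      - yN5 (q p x) (q1 p x) (q2 p x) (q3 p x) (k p x) (k1 p x) (k2 p x) 0)))).
    by move=> p x; rewrite n5 /yN5 /yN4_1; field.
  by rewrite /yN5 /yN4_1 /yT3 /yT4 /yN3; CStac.
have AC : CS A by apply: (CS_ext AE); CStac.
have eC : CS (fun p x => hp p ^+ 2 * e p x) by exact (CS_small _ hp1 hpc hpn e_bd).
have e1C : CS (fun p x => hp p ^+ 2 * e1 p x) by exact (CS_small _ hp1 hpc hpn e1_bd).
have bC : CS b.
  have BC : CS (fun p x => cc p x * U0 p x + ss p x * U1 p x) by CStac.
  by apply: (CS_ext _ (CSB BC eC)) => p x; rewrite BE; ring.
have b1C : CS b1.
  have BC : CS (fun p x => cc p x * U0' p x + ss p x * U1' p x - q p x * k p x * A p x) by CStac.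
  by apply: (CS_ext _ (CSB BC e1C)) => p x; rewrite T1E /vT1; ring.
have b2C : CS b2 by apply: (CS_ext b2E); rewrite /beta0_form; CStac.
have b3C : CS b3 by apply: (CS_ext b3E); rewrite /beta0_form1; CStac.
split => //.
- by apply: (CS_ext aE); rewrite /alpha2_form; CStac.
- by rewrite /G2_form /S4_form /S2_form /ft /ft1 /ft2 /fn /fn1 /fn2; CStac.
Qed.

End CloseFacts.

Ltac bddtac := repeat match goal with
  | H : bdd ?f |- bdd ?f => exact H
  | |- bdd (fun q => (@?F q) + (@?G q)) => refine (@bddD _ _ F G _ _)
  | |- bdd (fun q => (@?F q) * (@?G q)) => refine (@bddM _ _ F G _ _)
  | |- bdd (fun q => - (@?F q)) => refine (@bddN _ _ F _)
  | |- bdd (fun q => (@?F q) ^+ ?n) => refine (@bddX _ _ F n _)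
  | |- bdd (fun _ => ?c) => refine (@bdd_cst _ _ c)
  | H : bdd (fun q => (?f q)^-1) |- bdd (fun q => (?f q)^-1) => exact H
  | H : bdd ?f |- bdd (fun q => ?f q) => exact H
  end.

(** * Components of Y_tt from the flow equations at two times *)

Section TimeRelations.
Context {R : realType} {Q : Type} (h : Q -> R).
Hypothesis h0 : forall q, 0 < h q.
Hypothesis h1 : forall q, `|h q| <= 1.
Local Notation E2 F l := (Ex id (sqstep h) F l).
Let sq1 := sqstep_le1 h1.

(** F and Fn are one quantity at two consecutive times, equal to h^2 g and h^2 gn. As g changes only
    by O(h^2), the term D linear in the time step is O(h^2): the relation has been differentiated in
    time without a time derivative of g. *)
Lemma rate_small (Fn F D gn g : Q -> R) : E2 Fn [:: F; D] ->
  (forall q, Fn q = h q ^+ 2 * gn q) -> (forall q, F q = h q ^+ 2 * g q) ->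
  (exists K, forall q, `|gn q - g q| <= K * h q ^+ 2) ->
  exists d, bdd d /\ forall q, D q = h q ^+ 2 * d q.
Proof.
Transparent Ex.
move=> [_ [F1 [E1 [_ [F2 [E2 [K F2K]]]]]]] nE FE [L gL].
exists (fun q => (h q ^+ 2)^-1 * (gn q - g q) - F2 q).
have hn q : h q ^+ 2 != 0 by rewrite expf_neq0 ?gt_eqF.
split; last first.
  move=> q; have := E1 q; rewrite nE FE E2 /sqstep /= -mulrDr => /(mulfI (hn q)) e.
  by rewrite mulrBr mulVKf ?hn// e; ring.
exists (L + K) => q; apply: le_trans (ler_normB _ _) _; apply: lerD; last exact: F2K.
have hp : 0 < h q ^+ 2 by rewrite exprn_gt0.
by rewrite normrM normfV (gtr0_norm hp) mulrC ler_pdivrMr.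
Opaque Ex.
Qed.

Variables (X1n Z1n X2n Z2n U0n U1n P1n R1n P2n R2n : Q -> R).
Variables (X1 Z1 X2 Z2 U0 U1 P1 R1 P2 R2 W0 W1 S1 V1 S2 V2 : Q -> R) (c : R).
Hypotheses (X1E : E2 X1n [:: X1; P1]) (Z1E : E2 Z1n [:: Z1; R1]).
Hypotheses (X2E : E2 X2n [:: X2; P2]) (Z2E : E2 Z2n [:: Z2; R2]).
Hypotheses (U0E : E2 U0n [:: U0; W0]) (U1E : E2 U1n [:: U1; W1]).
Hypotheses (P1E : E2 P1n [:: P1; S1]) (R1E : E2 R1n [:: R1; V1]).
Hypotheses (P2E : E2 P2n [:: P2; S2]) (R2E : E2 R2n [:: R2; V2]).
Hypothesis c0 : 0 < c.
Hypothesis cn : forall q, c <= X1n q ^+ 2 + Z1n q ^+ 2.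
Hypothesis cc' : forall q, c <= X1 q ^+ 2 + Z1 q ^+ 2.

(** |Y'| times the sum of normal velocity and curvature, written with Y', Y'' and Y_t;
    [tangential_rate] is the equation for beta_0 written with Y', Y'', Y_t' and Y_t''. Both vanish
    for the flow by V0, and only inverse powers of |Y'|^2 occur, so that no root has to be expanded
    in time. *)
Definition normal_rate (x1 z1 x2 z2 u0 u1 : R) : R :=
  u0 * z1 - u1 * x1 - (x2 * z1 - z2 * x1) * (x1 ^+ 2 + z1 ^+ 2)^-1.
Definition tangential_rate (x1 z1 x2 z2 p1 r1 p2 r2 : R) : R :=
  let i := (x1 ^+ 2 + z1 ^+ 2)^-1 in let m := x2 * z1 - z2 * x1 in
  (p2 * x1 + r2 * z1) * i - (p1 * x1 + r1 * z1) * (x1 * x2 + z1 * z2) * i ^+ 2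
  + 4^-1 * (x1 * x2 + z1 * z2) * m ^+ 2 * i ^+ 3.

Let au q := P1 q * X1 q + R1 q * Z1 q.
Let ab q := X1 q * X2 q + Z1 q * Z2 q.
Let uu q := P1 q ^+ 2 + R1 q ^+ 2.
Let wa q := P2 q * X1 q + R2 q * Z1 q.
Let wu q := P2 q * P1 q + R2 q * R1 q.
Let ub q := P1 q * X2 q + R1 q * Z2 q.
Let m q := X2 q * Z1 q - Z2 q * X1 q.
Let mt q := P2 q * Z1 q - R2 q * X1 q + (X2 q * R1 q - Z2 q * P1 q).
Let i q := (X1 q ^+ 2 + Z1 q ^+ 2)^-1.

Let iE : E2 (fun q => (X1n q ^+ 2 + Z1n q ^+ 2)^-1) [:: i; fun q => - (2 * au q) * i q ^+ 2].
Proof.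
have Q2 := ExD2 (ExM2 sq1 X1E X1E) (ExM2 sq1 Z1E Z1E).
have eq2 : (fun s => X1n s * X1n s + Z1n s * Z1n s) = fun s => X1n s ^+ 2 + Z1n s ^+ 2.
  by apply/funext => s; rewrite !expr2.
rewrite eq2 in Q2.
have hn q : c <= `|X1n q ^+ 2 + Z1n q ^+ 2| by rewrite ger0_norm ?cn// addr_ge0 ?sqr_ge0.
have hc q : c <= `|X1 q * X1 q + Z1 q * Z1 q|.
  by rewrite -!expr2 ger0_norm ?cc'// addr_ge0 ?sqr_ge0.
have H := @ExV2 _ _ _ id (sqstep h) sq1 _ _ _ c c0 hn hc Q2.
apply: (Ex2_ext H) => q; rewrite // /i ?/au ?expr2 //; ring.
Qed.

Let abE : E2 (fun q => X1n q * X2n q + Z1n q * Z2n q) [:: ab; fun q => ub q + wa q].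
Proof.
apply: (Ex2_ext (ExD2 (ExM2 sq1 X1E X2E) (ExM2 sq1 Z1E Z2E))) => q //.
by rewrite /ub /wa; ring.
Qed.

Let mE : E2 (fun q => X2n q * Z1n q - Z2n q * X1n q) [:: m; mt].
Proof.
apply: (Ex2_ext (ExD2 (ExM2 sq1 X2E Z1E) (ExN2 (ExM2 sq1 Z2E X1E)))) => q //.
by rewrite /mt; ring.
Qed.

Lemma normal_rate_Ex : E2 (fun q => normal_rate (X1n q) (Z1n q) (X2n q) (Z2n q) (U0n q) (U1n q))
  [:: fun q => normal_rate (X1 q) (Z1 q) (X2 q) (Z2 q) (U0 q) (U1 q);
      fun q => W0 q * Z1 q - W1 q * X1 q + (U0 q * R1 q - U1 q * P1 q) - mt q * i q
        + 2 * m q * au q * i q ^+ 2].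
Proof.
have H := ExD2 (ExD2 (ExM2 sq1 U0E Z1E) (ExN2 (ExM2 sq1 U1E X1E))) (ExN2 (ExM2 sq1 mE iE)).
apply: (Ex2_ext H) => q /=; rewrite /normal_rate // /i /au /mt /m; ring.
Qed.

Lemma tangential_rate_Ex :
  E2 (fun q => tangential_rate (X1n q) (Z1n q) (X2n q) (Z2n q) (P1n q) (R1n q) (P2n q) (R2n q))
  [:: fun q => tangential_rate (X1 q) (Z1 q) (X2 q) (Z2 q) (P1 q) (R1 q) (P2 q) (R2 q);
      fun q => (S2 q * X1 q + V2 q * Z1 q) * i q - (S1 q * X1 q + V1 q * Z1 q) * ab q * i q ^+ 2
       + (wu q * i q - 2 * wa q * au q * i q ^+ 2 - uu q * ab q * i q ^+ 2
         - au q * (ub q + wa q) * i q ^+ 2 + 4 * au q ^+ 2 * ab q * i q ^+ 3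
         + 4^-1 * ((ub q + wa q) * m q ^+ 2 * i q ^+ 3 + 2 * ab q * m q * mt q * i q ^+ 3
           - 6 * ab q * m q ^+ 2 * au q * i q ^+ 4))].
Proof.
have waE := ExD2 (ExM2 sq1 P2E X1E) (ExM2 sq1 R2E Z1E).
have auE := ExD2 (ExM2 sq1 P1E X1E) (ExM2 sq1 R1E Z1E).
have iE2 := ExM2 sq1 iE iE.
have qE : E2 (fun=> 4^-1) [:: fun=> 4^-1; fun=> 0].
  exact: (@ExC2 _ _ _ id (sqstep h) (fun=> 4^-1) (bdd_cst _ _)).
have H1 := ExM2 sq1 waE iE.
have H2 := ExN2 (ExM2 sq1 (ExM2 sq1 auE abE) iE2).
have H3 := ExM2 sq1 (ExM2 sq1 (ExM2 sq1 qE abE) (ExM2 sq1 mE mE)) (ExM2 sq1 iE2 iE).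
apply: (Ex2_ext (ExD2 (ExD2 H1 H2) H3)) => q /=; rewrite /tangential_rate /=.
- ring.
- by rewrite /ab /m -/(i q); ring.
- by rewrite /wu /uu -/(au q) -/(wa q); ring.
Qed.

Variables (gn g fn f : Q -> R).
Hypothesis normal_n : forall q, normal_rate (X1n q) (Z1n q) (X2n q) (Z2n q) (U0n q) (U1n q)
  = h q ^+ 2 * gn q.
Hypothesis normal_c : forall q, normal_rate (X1 q) (Z1 q) (X2 q) (Z2 q) (U0 q) (U1 q)
  = h q ^+ 2 * g q.
Hypothesis g_close : exists K, forall q, `|gn q - g q| <= K * h q ^+ 2.
Hypothesis tangential_n : forall q, tangential_rate (X1n q) (Z1n q) (X2n q) (Z2n q) (P1n q) (R1n q)
  (P2n q) (R2n q) = h q ^+ 2 * fn q.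
Hypothesis tangential_c : forall q, tangential_rate (X1 q) (Z1 q) (X2 q) (Z2 q) (P1 q) (R1 q)
  (P2 q) (R2 q) = h q ^+ 2 * f q.
Hypothesis f_close : exists K, forall q, `|fn q - f q| <= K * h q ^+ 2.

Variables (cc ss q q1 k A B T1 N1 T2 N2 a : Q -> R).
Hypothesis cs1 : forall s, cc s ^+ 2 + ss s ^+ 2 = 1.
Hypothesis q0 : forall s, q s != 0.
Hypothesis X1F : forall s, X1 s = q s * cc s.
Hypothesis Z1F : forall s, Z1 s = q s * ss s.
Hypothesis X2F : forall s, X2 s = q1 s * cc s - q s ^+ 2 * k s * ss s.
Hypothesis Z2F : forall s, Z2 s = q1 s * ss s + q s ^+ 2 * k s * cc s.
Hypothesis U0F : forall s, U0 s = B s * cc s + A s * ss s.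
Hypothesis U1F : forall s, U1 s = B s * ss s - A s * cc s.
Hypothesis P1F : forall s, P1 s = T1 s * cc s + N1 s * ss s.
Hypothesis R1F : forall s, R1 s = T1 s * ss s - N1 s * cc s.
Hypothesis P2F : forall s, P2 s = T2 s * cc s + N2 s * ss s.
Hypothesis R2F : forall s, R2 s = T2 s * ss s - N2 s * cc s.
Hypothesis AF : forall s, A s = - k s + h s ^+ 2 * a s.
Hypotheses (a_bd : bdd a) (qV_bd : bdd (fun s => (q s)^-1)) (q_bd : bdd q) (T1_bd : bdd T1).

Let iF s : i s = (q s)^-1 ^+ 2.
Proof. by rewrite /i X1F Z1F !exprMn -mulrDr cs1 mulr1 exprVn. Qed.
Let auF s : au s = q s * T1 s.
Proof.
rewrite /au X1F Z1F P1F R1F.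
by transitivity (q s * T1 s * (cc s ^+ 2 + ss s ^+ 2)); [ring|rewrite cs1 mulr1].
Qed.
Let abF s : ab s = q s * q1 s.
Proof.
rewrite /ab X1F Z1F X2F Z2F.
by transitivity (q s * q1 s * (cc s ^+ 2 + ss s ^+ 2)); [ring|rewrite cs1 mulr1].
Qed.
Let uuF s : uu s = T1 s ^+ 2 + N1 s ^+ 2.
Proof.
rewrite /uu P1F R1F.
by transitivity ((T1 s ^+ 2 + N1 s ^+ 2) * (cc s ^+ 2 + ss s ^+ 2)); [ring|rewrite cs1 mulr1].
Qed.
Let waF s : wa s = T2 s * q s.
Proof.
rewrite /wa X1F Z1F P2F R2F.
by transitivity (T2 s * q s * (cc s ^+ 2 + ss s ^+ 2)); [ring|rewrite cs1 mulr1].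
Qed.
Let wuF s : wu s = T1 s * T2 s + N1 s * N2 s.
Proof.
rewrite /wu P1F R1F P2F R2F.
by transitivity ((T1 s * T2 s + N1 s * N2 s) * (cc s ^+ 2 + ss s ^+ 2)); [ring|rewrite cs1 mulr1].
Qed.
Let ubF s : ub s = T1 s * q1 s - q s ^+ 2 * k s * N1 s.
Proof.
rewrite /ub P1F R1F X2F Z2F.
by transitivity ((T1 s * q1 s - q s ^+ 2 * k s * N1 s) * (cc s ^+ 2 + ss s ^+ 2)); [ring|rewrite cs1 mulr1].
Qed.
Let mF s : m s = - q s ^+ 3 * k s.
Proof.
rewrite /m X1F Z1F X2F Z2F.
by transitivity (- q s ^+ 3 * k s * (cc s ^+ 2 + ss s ^+ 2)); [ring|rewrite cs1 mulr1].
Qed.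
Let mtF s : mt s = N2 s * q s - q1 s * N1 s - q s ^+ 2 * k s * T1 s.
Proof.
rewrite /mt X1F Z1F X2F Z2F P1F R1F P2F R2F.
transitivity ((N2 s * q s - q1 s * N1 s - q s ^+ 2 * k s * T1 s) * (cc s ^+ 2 + ss s ^+ 2)); first ring.
by rewrite cs1 mulr1.
Qed.

(** The time coefficient of [normal_rate] contains Y_tt . n linearly with factor q; since it is of
    order h^2, it can be solved for Y_tt . n. *)
Lemma acceleration_normal : exists d, bdd d /\ forall s,
  ss s * W0 s - cc s * W1 s = yNu (q s) (q1 s) (k s) (B s) (A s) (T1 s) (N1 s) (N2 s)
    + h s ^+ 2 * d s.
Proof.
have [d [bd dE]] := rate_small normal_rate_Ex normal_n normal_c g_close.
exists (fun s => (q s)^-1 * d s - T1 s * (q s)^-1 * a s); split; first by bddtac.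
move=> s; have qn := q0 s.
have W : W0 s * Z1 s - W1 s * X1 s = q s * (ss s * W0 s - cc s * W1 s).
  by rewrite X1F Z1F; ring.
have UP : U0 s * R1 s - U1 s * P1 s = A s * T1 s - B s * N1 s.
  rewrite U0F U1F P1F R1F.
  by transitivity ((A s * T1 s - B s * N1 s) * (cc s ^+ 2 + ss s ^+ 2)); [ring|rewrite cs1 mulr1].
have := dE s; rewrite W UP iF auF mtF mF => E.
have {E} -> : ss s * W0 s - cc s * W1 s = (q s)^-1 * (h s ^+ 2 * d s - (A s * T1 s - B s * N1 s)
   + (N2 s * q s - q1 s * N1 s - q s ^+ 2 * k s * T1 s) * (q s)^-1 ^+ 2
   - 2 * (- q s ^+ 3 * k s) * (q s * T1 s) * (q s)^-1 ^+ 2 ^+ 2).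
  by rewrite -E; field.
by rewrite /yNu /Nu_form AF; field.
Qed.

Lemma acceleration_tangential : exists d, bdd d /\ forall s,
  (cc s * S2 s + ss s * V2 s) * (q s)^-1 - (cc s * S1 s + ss s * V1 s) * q1 s * (q s)^-1 ^+ 2
  = yGamma (q s) (q1 s) (k s) (T1 s) (T2 s) (N1 s) (N2 s) + h s ^+ 2 * d s.
Proof.
have [d [bd dE]] := rate_small tangential_rate_Ex tangential_n tangential_c f_close.
exists d; split => // s; have qn := q0 s.
have E2 : S2 s * X1 s + V2 s * Z1 s = q s * (cc s * S2 s + ss s * V2 s).
  by rewrite X1F Z1F; ring.
have E1 : S1 s * X1 s + V1 s * Z1 s = q s * (cc s * S1 s + ss s * V1 s).
  by rewrite X1F Z1F; ring.
have := dE s; rewrite E1 E2 iF auF mtF mF abF uuF waF wuF ubF.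
move: (cc s * S2 s + ss s * V2 s) (cc s * S1 s + ss s * V1 s) => w2 w1 <-.
by rewrite /yGamma /Gamma_form; field.
Qed.

End TimeRelations.

Section ThirdOrderGrowth.
Context {R : realType}.

Lemma growth3 (G0 G1 G2 : R -> R) (w2 c1 B d : R) : 0 <= B ->
  (forall y : R, is_derive y 1 G0 (G1 y)) -> (forall y : R, is_derive y 1 G1 (G2 y)) ->
  (forall y, `|y| <= d -> `|G2 y - (w2 + c1 * y)| <= B) ->
  forall y, `|y| <= d ->
    `|G0 y - G0 0 - (G1 0 * y + w2 / 2 * y ^+ 2 + c1 / 6 * y ^+ 3)| <= B * `|y| ^+ 2.
Proof.
move=> B0 d0 d1 G2B.
pose a i : R := nth 0 [:: G0 0; G1 0; w2; c1] i.
have t4 y : tsum 4 a y = G0 0 + (G1 0 * y + w2 / 2 * y ^+ 2 + c1 / 6 * y ^+ 3).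
  by rewrite /tsum !big_ord_recl big_ord0 /a /= /bump /= !(fact0, factS) ?mulSn; field.
have t3 y : tsum 3 (fun i => a i.+1) y = G1 0 + w2 * y + c1 / 2 * y ^+ 2.
  by rewrite /tsum !big_ord_recl big_ord0 /a /= /bump /= !(fact0, factS) ?mulSn; field.
have t2 y : tsum 2 (fun i => a i.+2) y = w2 + c1 * y.
  by rewrite /tsum !big_ord_recl big_ord0 /a /= /bump /= !(fact0, factS) ?mulSn; field.
have h1 (y : R) : is_derive y 1 (fun z => G1 z - tsum 3 (fun i => a i.+1) z)
    (G2 y - tsum 2 (fun i => a i.+2) y).
  exact: (is_deriveB (d1 y) (is_derive_tsum 2 _ y)).
have h0 (y : R) : is_derive y 1 (fun z => G0 z - tsum 4 a z) (G1 y - tsum 3 (fun i => a i.+1) y).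
  exact: (is_deriveB (d0 y) (is_derive_tsum 3 _ y)).
have b1 y : `|y| <= d -> `|G1 y - tsum 3 (fun i => a i.+1) y| <= B * `|y|.
  apply: (is_derive_growth _ B0 h1) => [|z zd]; first by rewrite t3; ring.
  by rewrite t2; exact: G2B.
move=> y yd; have b1' z : `|z| <= `|y| -> `|G1 z - tsum 3 (fun i => a i.+1) z| <= B * `|y|.
  by move=> zy; apply: le_trans (b1 _ (le_trans zy yd)) _; rewrite ler_wpM2l.
have By : 0 <= B * `|y| by rewrite mulr_ge0.
have f0 : G0 0 - tsum 4 a 0 = 0 by rewrite t4; ring.
have := is_derive_growth f0 By h0 b1' (lexx `|y|).
rewrite t4 opprD addrA => /le_trans; apply; by rewrite -mulrA -expr2.
Qed.

End ThirdOrderGrowth.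

(** * A third coefficient for the tangential quotient of Y_tt *)

Section TangentialQuotient.
Context {R : realType} {Q P : Type} (h : Q -> R) (pr : Q -> P) (pt : Q -> R).
Hypothesis h0 : forall q, 0 < h q.
Hypothesis h1 : forall q, `|h q| <= 1.
Variables (cc ss W0 W1 S : P -> R -> R).
Hypotheses (ccL : CL 1 cc) (ssL : CL 1 ss) (W0L : CL 2 W0) (W1L : CL 2 W1) (SL : CL 1 S).
Hypothesis near : exists K, forall q x,
  `|cc (pr q) x * dn 2 W0 (pr q) x + ss (pr q) x * dn 2 W1 (pr q) x - S (pr q) x| <= K * h q ^+ 2.

Lemma CL1_expand (F : P -> R -> R) : CL 1 F -> exists K, 0 <= K /\
  forall p x y, `|F p (x + y) - (F p x + dn 1 F p x * y)| <= K * `|y| ^+ 2.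
Proof.
move=> /taylor_CL[K [K0 FK]]; exists K; split => // p x y; apply: le_trans (FK p x y).
by rewrite /tsum !big_ord_recl big_ord0 /= !(fact0, factS) !divr1 expr0 expr1 mulr1 addr0.
Qed.

Let w i q := cc (pr q) (pt q) * dn i W0 (pr q) (pt q) + ss (pr q) (pt q) * dn i W1 (pr q) (pt q).
Let c1 q := dn 1 S (pr q) (pt q) - (dn 1 cc (pr q) (pt q) * dn 2 W0 (pr q) (pt q)
   + dn 1 ss (pr q) (pt q) * dn 2 W1 (pr q) (pt q)).

(** The frame stays at the node while W'' moves. The moving combination follows S, and subtracting
    the first-order change of the frame leaves a linear function of y up to O(h^2). *)
Let frozen : exists K, 0 <= K /\ forall q y, `|y| <= h q ->
  `|cc (pr q) (pt q) * dn 2 W0 (pr q) (pt q + y) + ss (pr q) (pt q) * dn 2 W1 (pr q) (pt q + y)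
    - (w 2 q + c1 q * y)| <= K * h q ^+ 2.
Proof.
have [K0 N] := near; have [KS [KS0 SK]] := CL1_expand SL.
have L0 : CL 0 (dn 2 W0) := @CL_dn _ _ 0 2 _ W0L; have L1 : CL 0 (dn 2 W1) := @CL_dn _ _ 0 2 _ W1L.
have [Kc [Kc0 cK]] := CL1_expand ccL; have [Ks [Ks0 sK]] := CL1_expand ssL.
have D0 : CL 0 (dn 1 cc) := @CL_dn _ _ 0 1 _ ccL; have D1 : CL 0 (dn 1 ss) := @CL_dn _ _ 0 1 _ ssL.
have [M0 M0b] := CL_bounded L0; have [M1 M1b] := CL_bounded L1.
have [m0 m0b] := CL_bounded D0; have [m1 m1b] := CL_bounded D1.
have [l0 [l00 l0b]] := CL_lip L0; have [l1 [l10 l1b]] := CL_lip L1.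
pose K := K0 + KS + K0 + (Kc * M0 + m0 * l0) + (Ks * M1 + m1 * l1).
have bnd p x y hq : 0 <= hq -> `|y| <= hq ->
  `|cc p (x + y) * dn 2 W0 p (x + y) + ss p (x + y) * dn 2 W1 p (x + y) - S p (x + y)| <= K0 * hq ^+ 2 ->
  `|cc p x * dn 2 W0 p x + ss p x * dn 2 W1 p x - S p x| <= K0 * hq ^+ 2 ->
  `|cc p x * dn 2 W0 p (x + y) + ss p x * dn 2 W1 p (x + y)
    - (cc p x * dn 2 W0 p x + ss p x * dn 2 W1 p x
      + (dn 1 S p x - (dn 1 cc p x * dn 2 W0 p x + dn 1 ss p x * dn 2 W1 p x)) * y)| <= K * hq ^+ 2.
  move=> hq0 yh N1 N2; have y2 : `|y| ^+ 2 <= hq ^+ 2 by rewrite lerXn2r ?nnegrE ?normr_ge0.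
  have freeze (f F : P -> R -> R) (kf mf Mf lf : R) : 0 <= kf ->
      (forall p x y, `|f p (x + y) - (f p x + dn 1 f p x * y)| <= kf * `|y| ^+ 2) ->
      (forall p x, `|dn 1 f p x| <= mf) -> (forall p x, `|F p x| <= Mf) ->
      (forall p x y, `|F p x - F p y| <= lf * `|x - y|) ->
      `|(f p (x + y) - f p x) * F p (x + y) - dn 1 f p x * F p x * y| <= (kf * Mf + mf * lf) * hq ^+ 2.
    move=> kf0 fk fm FM Fl.
    have -> : (f p (x + y) - f p x) * F p (x + y) - dn 1 f p x * F p x * y =
      (f p (x + y) - (f p x + dn 1 f p x * y)) * F p (x + y) + dn 1 f p x * ((F p (x + y) - F p x) * y).
      by ring.
    apply: le_trans (ler_normD _ _) _; rewrite !normrM mulrDl; apply: lerD.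
      rewrite [leRHS]mulrAC; apply: ler_pM => //.
      by apply: le_trans (fk _ _ _) _; rewrite ler_wpM2l.
    rewrite -[leRHS]mulrA; apply: ler_pM => //.
    have := Fl p (x + y) x; rewrite addrAC subrr add0r => Fl'.
    apply: le_trans (ler_wpM2r (normr_ge0 y) Fl') _; rewrite -mulrA -expr2.
    rewrite ler_wpM2l//; have := Fl p (x + 1) x; rewrite addrAC subrr add0r normr1 mulr1.
    by move=> /(le_trans (normr_ge0 _)).
  have E0 := freeze cc (dn 2 W0) _ _ _ _ Kc0 cK m0b M0b l0b.
  have E1 := freeze ss (dn 2 W1) _ _ _ _ Ks0 sK m1b M1b l1b.
  have S1 : `|S p (x + y) - (S p x + dn 1 S p x * y)| <= KS * hq ^+ 2.
    by apply: le_trans (SK _ _ _) _; rewrite ler_wpM2l.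
  have aux (c s cy sy dc ds f0 f1 g0 g1 Sx Sy dS : R) :
    c * g0 + s * g1 - (c * f0 + s * f1 + (dS - (dc * f0 + ds * f1)) * y) =
    (cy * g0 + sy * g1 - Sy) + (Sy - (Sx + dS * y)) - (c * f0 + s * f1 - Sx)
    - ((cy - c) * g0 - dc * f0 * y) - ((sy - s) * g1 - ds * f1 * y) by ring.
  rewrite (aux _ _ (cc p (x + y)) (ss p (x + y)) _ _ _ _ _ _ (S p x) (S p (x + y))) /K.
  apply: (le_trans (ler_normB _ _)); rewrite [leRHS]mulrDl; apply: lerD; last exact: E1.
  apply: (le_trans (ler_normB _ _)); rewrite [leRHS]mulrDl; apply: lerD; last exact: E0.
  apply: (le_trans (ler_normB _ _)); rewrite [leRHS]mulrDl; apply: lerD; last exact: N2.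
  by apply: (le_trans (ler_normD _ _)); rewrite [leRHS]mulrDl; apply: lerD; [exact: N1|exact: S1].
exists `|K|; split => // q y yh.
apply: le_trans (bnd (pr q) (pt q) y (h q) (ltW (h0 q)) yh (N q _) (N q _)) _.
by rewrite ler_wpM2r ?sqr_ge0// ler_norm.
Qed.

(** W is only C^{2,1}, which accounts for two coefficients. A third one exists in the tangential
    direction, because there W'' agrees up to O(h^2) with S, which is C^{1,1}. *)
Lemma tangential_quotient : exists d, Ex fst (sgstep h)
  (fun s => cc (pr s.1) (pt s.1) * dquot h pr pt W0 s + ss (pr s.1) (pt s.1) * dquot h pr pt W1 s)
  [:: w 1; (fun q => w 2 q / 2); d].
Proof.
exists (fun q => c1 q / 6).
have bl F k i : CL k F -> (i <= k)%N -> bdd (fun q => dn i F (pr q) (pt q)).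
  move=> FL ik; have : CL (k - i) (dn i F) by apply: CL_dn; rewrite subnK.
  by move=> /CL_bounded[K FK]; exists K => q.
have c0 : bdd (fun q => cc (pr q) (pt q)) := bl cc 1%N 0%N ccL isT.
have s0 : bdd (fun q => ss (pr q) (pt q)) := bl ss 1%N 0%N ssL isT.
have dc1 := bl cc 1%N 1%N ccL isT; have ds1 := bl ss 1%N 1%N ssL isT.
have S1 := bl S 1%N 1%N SL isT.
have W01 := bl W0 2%N 1%N W0L isT; have W02 := bl W0 2%N 2%N W0L isT.
have W11 := bl W1 2%N 1%N W1L isT; have W12 := bl W1 2%N 2%N W1L isT.
apply: Ex_of_remainder; first exact: sgstep_neq0.
  move=> [|[|[|//]]] _ /=; rewrite /w /c1; bddtac.
have [K [K0 fz]] := frozen; exists K => -[q sg].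
have eta0 := sgstep_neq0 h0 (q, sg); have etah := norm_sgstep h0 (q, sg).
rewrite /= in etah; set eta := sgstep h (q, sg) in eta0 etah *.
pose G i y := cc (pr q) (pt q) * dn i W0 (pr q) (y + pt q) + ss (pr q) (pt q) * dn i W1 (pr q) (y + pt q).
have dG i : (i < 2)%N -> forall y : R, is_derive y 1 (G i) (G i.+1 y).
  move=> i2 y; apply: is_deriveD.
    exact: is_deriveZ (is_derive_shift (isder_dn W0L i2 (pr q) (y + pt q))).
  exact: is_deriveZ (is_derive_shift (isder_dn W1L i2 (pr q) (y + pt q))).
have B0 : 0 <= K * h q ^+ 2 by rewrite mulr_ge0 ?sqr_ge0.
have G2B y : `|y| <= h q -> `|G 2%N y - (w 2 q + c1 q * y)| <= K * h q ^+ 2.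
  by move=> yh; rewrite /G [y + pt q]addrC; exact: fz.
have := growth3 B0 (dG 0%N isT) (dG 1%N isT) G2B; move=> /(_ eta); rewrite etah => /(_ (lexx _)).
rewrite /G /= !add0r [eta + pt q]addrC => H.
have aux (c s f0 f1 F0 F1 w0 w2' c1' : R) :
  c * ((F0 - f0) / eta) + s * ((F1 - f1) / eta) - (w0 + eta * (w2' / 2 + eta * (c1' / 6 + eta * 0))) =
  (c * F0 + s * F1 - (c * f0 + s * f1) - (w0 * eta + w2' / 2 * eta ^+ 2 + c1' / 6 * eta ^+ 3)) / eta.
  by field.
rewrite /dquot /= -/eta (aux _ _ _ _ _ _ (w 1 q) (w 2 q) (c1 q)) normrM normfV etah ler_pdivrMr//.
apply: le_trans H _; rewrite le_eqVlt; apply/orP; left; apply/eqP; ring.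
Qed.

End TangentialQuotient.

(** * Cancellation of the leading orders *)

Section NodeQuantities.
Context {R : realType} {Q : Type} (h : Q -> R).
Variables (et en dt dn : Q * bool -> R) (vt vn : Q -> R).
Definition rlen (s : Q * bool) : R := Num.sqrt (et s ^+ 2 + en s ^+ 2).
Definition jump (f : Q * bool -> R) (q : Q) : R :=
  f (q, true) / rlen (q, true) - f (q, false) / rlen (q, false).
Definition esum (f : Q * bool -> R) (q : Q) : R := f (q, true) + f (q, false).

(* For E the sum of the two difference quotients of the curve at a node and D the
   value of the defect at that node, these are - D . E and D . R E. *)
Definition node_tang (q : Q) : R :=
  2^-1 * (rlen (q, true) - rlen (q, false)) * (jump et q ^+ 2 + jump en q ^+ 2)
  + h q ^+ 2 * (jump dt q * esum et q + jump dn q * esum en q).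
Definition node_norm (q : Q) : R :=
  h q * (2^-1 * (vn q * esum et q - vt q * esum en q) * (esum et q ^+ 2 + esum en q ^+ 2)
    / (rlen (q, true) + rlen (q, false)))
  - (jump en q * esum et q - jump et q * esum en q)
  - h q ^+ 2 * (jump dn q * esum et q - jump dt q * esum en q).
End NodeQuantities.

Section NodeBound.
Context {R : realType} {Q : Type} (h : Q -> R).
Hypothesis h0 : forall q, 0 < h q.
Hypothesis h1 : forall q, `|h q| <= 1.
Variables (et en dt dn' wt wn vqt vqn : Q * bool -> R) (q E1 E2 E3 E4 N1 N2 N3 N4 : Q -> R).
Variables (D0 D1 D2 D3 D4 M0 M1 M2 M3 M4 vt vn A0 A1 B0 B1 w1 w2 m1 m2 : Q -> R) (c : R).
Hypothesis c0 : 0 < c.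
Hypothesis qc : forall s, c <= q s.
Hypothesis rc : forall s, c <= rlen et en s.
Local Notation E5 F l := (Ex fst (sgstep h) F l).
Hypothesis etE : E5 et [:: q; E1; E2; E3; E4].
Hypothesis enE : E5 en [:: (fun=> 0); N1; N2; N3; N4].
Hypothesis dtE : E5 dt [:: D0; D1; D2; D3; D4].
Hypothesis dnE : E5 dn' [:: M0; M1; M2; M3; M4].
Hypothesis vtE : Ex id (sqstep h) vt [:: A0; A1].
Hypothesis vnE : Ex id (sqstep h) vn [:: B0; B1].
Hypothesis wtE : E5 wt [:: w1; (fun s => 2^-1 * w2 s)].
Hypothesis wnE : E5 wn [:: m1; m2].

Let sg1 := sgstep_le1 h1.
Let sq1 := sqstep_le1 h1.
Local Notation jp := (jump et en).

Hypothesis vqtE : exists K, forall s, `|jp vqt s - jp dt s - 2^-1 * h s ^+ 2 * jp wt s| <= K * h s ^+ 5.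
Hypothesis vqnE : exists K, forall s, `|jp vqn s - jp dn' s - 2^-1 * h s ^+ 2 * jp wn s| <= K * h s ^+ 5.

Lemma remainder_factor (F : Q -> R) n : (exists K, forall s, `|F s| <= K * h s ^+ n) ->
  exists G, bdd G /\ forall s, F s = h s ^+ n * G s.
Proof.
move=> [K FK]; exists (fun s => (h s ^+ n)^-1 * F s); split; last first.
  by move=> s; rewrite mulVKf// expf_neq0// gt_eqF.
exists K => s; have hn : 0 < h s ^+ n by rewrite exprn_gt0.
by rewrite normrM normfV (gtr0_norm hn) mulrC ler_pdivrMr.
Qed.

Lemma Ex2_factor F f0 f1 : Ex id (sqstep h) F [:: f0; f1] -> bdd f0 /\ bdd f1 /\
  exists G, bdd G /\ forall s, F s = f0 s + h s ^+ 2 * (f1 s + h s ^+ 2 * G s).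
Proof.
Transparent Ex.
move=> [b0 [F0 [FE0 [b1 [F1 [FE1 b2]]]]]]; do 2 split => //; exists F1; split => // s.
by rewrite FE0 FE1.
Opaque Ex.
Qed.

Let esum_et : exists G, bdd G /\ forall s, esum et s = 2 * q s + h s ^+ 2 * G s.
Proof.
have [b0 [b1 [G [bG E]]]] := Ex2_factor (Ex_even5 h1 etE).
have bh : bdd h by exists 1.
by exists (fun s => 2 * E2 s + h s ^+ 2 * G s); split; [bddtac|].
Qed.

(** The frame is aligned with the curve at the node, so the normal component has no constant term,
    and its linear term cancels between the two sides. *)
Let esum_en : exists G, bdd G /\ forall s, esum en s = h s ^+ 2 * G s.
Proof.
have [b0 [b1 [G [bG E]]]] := Ex2_factor (Ex_even5 h1 enE).
have bh : bdd h by exists 1.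
exists (fun s => 2 * N2 s + h s ^+ 2 * G s); split; first by bddtac.
by move=> s; rewrite /esum E; ring.
Qed.

Let invr : exists i2 i3 i4, E5 (fun s => (rlen et en s)^-1) [:: (fun s => (q s)^-1);
   (fun s => ni1 (q s) (E1 s)); i2; i3; i4].
Proof. by have [i4 iE] := node_i h1 c0 qc rc etE enE; do 3 eexists; exact: iE. Qed.

Let odd2 F f0 f1 : E5 F [:: f0; f1] -> exists X, bdd X /\ forall s, jp F s = h s * X s.
Proof.
move=> FE; have [i2 [i3 [i4 iE]]] := invr.
have iE2 : E5 (fun s => (rlen et en s)^-1) [:: (fun s => (q s)^-1); (fun s => ni1 (q s) (E1 s))].
  exact: (@Ex_trunc _ _ _ _ _ sg1 _ [:: _; _] [:: i2; i3; i4] iE).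
have := ExM2 sg1 FE iE2.
Transparent Ex.
move=> [_ [F0 [FE0 [[K1 b1] [F1 [FE1 [K b2]]]]]]].
exists (fun s => F0 (s, true) + F0 (s, false)); split.
  exists ((K1 + K) + (K1 + K)) => s; have bF0 sg : `|F0 (s, sg)| <= K1 + K.
    rewrite FE1; apply: le_trans (ler_normD _ _) _; apply: lerD; first exact: b1.
    by rewrite normrM -[K]mul1r; exact: ler_pM.
  by apply: le_trans (ler_normD _ _) _; exact: lerD.
move=> s; rewrite /jump.
have := FE0 (s, true); have := FE0 (s, false); rewrite /sgstep /= => -> ->; ring.
Opaque Ex.
Qed.

(** With three coefficients the jump is known up to h^3 instead of h; the tangential bound of order
    h^7 depends on this. *)
Let odd3 F f0 f1 f2 : E5 F [:: f0; f1; f2] -> exists X, bdd X /\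
  forall s, jp F s = h s * (2 * (f0 s * ni1 (q s) (E1 s) + f1 s * (q s)^-1) + h s ^+ 2 * X s).
Proof.
move=> FE; have [i2 [i3 [i4 iE]]] := invr.
have iE3 : E5 (fun s => (rlen et en s)^-1) [:: (fun s => (q s)^-1); (fun s => ni1 (q s) (E1 s)); i2].
  exact: (@Ex_trunc _ _ _ _ _ sg1 _ [:: _; _; _] [:: i3; i4] iE).
have P := ExM sg1 (erefl : size [:: f0; f1; f2] = size [:: (fun s => (q s)^-1); _; i2]) FE iE3.
have {P}[X [XE XL]] := Ex_odd3 P.
Transparent Ex.
move: XL => [_ [G [GE bG]]]; exists G; split => // s.
by rewrite /jump XE GE /sqstep /=; ring.
Opaque Ex.
Qed.

(** The Y_tt part of the jumps is kept apart in the tangential product, where it counts at order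
    h^5. In the normal product it is of order h^5 as well, but there this is the order of the
    remainder. *)
Let core : exists BT BN,
  [/\ Ex id (sqstep h) BT [:: (fun s => tang1 (q s) (E1 s) (N1 s) (D0 s) (D1 s) (M0 s) (M1 s));
        (fun s => tang3 (q s) (E1 s) (E2 s) (E3 s) (N1 s) (N2 s) (N3 s)
           (D0 s) (D1 s) (D2 s) (D3 s) (M0 s) (M1 s))],
      Ex id (sqstep h) BN [:: (fun s => norm1 (q s) (E1 s) (N1 s) (B0 s));
        (fun s => norm3 (q s) (E1 s) (E2 s) (E3 s) (N1 s) (N2 s) (N3 s) (A0 s) (B0 s) (B1 s)
          (D0 s) (D1 s) (M0 s) (M1 s))],
      exists G, bdd G /\ forall s, node_tang h et en vqt vqn s = h s ^+ 3 * BT s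
        + 2^-1 * h s ^+ 4 * (jp wt s * esum et s + jp wn s * esum en s) + h s ^+ 7 * G s &
      exists G, bdd G /\ forall s, node_norm h et en vqt vqn vt vn s = h s * BN s + h s ^+ 5 * G s].
Proof.
have [Xr [Xut [Xun [Xpt [Xpn [[XrE XutE XunE XptE XpnE] BT BN]]]]]] :=
  node_expansion h1 c0 qc rc etE enE dtE dnE.
have {}BN := BN _ _ _ _ _ _ vtE vnE.
have [Gt [bGt GtE]] := esum_et; have [Gn [bGn GnE]] := esum_en.
have bq : bdd q.
  Transparent Ex. by case: etE => bq _; exact: bq. Opaque Ex.
have bh : bdd h by exists 1.
have [St [bSt StE]] := remainder_factor vqtE; have [Sn [bSn SnE]] := remainder_factor vqnE.
have [Wt [bWt WtE]] := odd2 wtE; have [Wn [bWn WnE]] := odd2 wnE.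
have jE s : jp vqt s = h s * Xpt s + 2^-1 * h s ^+ 2 * jp wt s + h s ^+ 5 * St s.
  by rewrite -(XptE s) -/(jp dt s) -StE; ring.
have jnE s : jp vqn s = h s * Xpn s + 2^-1 * h s ^+ 2 * jp wn s + h s ^+ 5 * Sn s.
  by rewrite -(XpnE s) -/(jp dn' s) -SnE; ring.
eexists; eexists; split; [exact: BT|exact: BN| |].
- exists (fun s => St s * (2 * q s + h s ^+ 2 * Gt s) + Sn s * (h s ^+ 2 * Gn s)).
  split; first by bddtac.
  move=> s; rewrite /node_tang jE jnE /jump XutE XunE XrE -/(esum et s) -/(esum en s).
  by rewrite -(GtE s) -(GnE s); ring.
- exists (fun s => - (2^-1 * (Wn s * (2 * q s + h s ^+ 2 * Gt s) - Wt s * (h s ^+ 2 * Gn s)))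
    - h s ^+ 2 * (Sn s * (2 * q s + h s ^+ 2 * Gt s) - St s * (h s ^+ 2 * Gn s))).
  split; first by bddtac.
  move=> s; rewrite /node_norm jE jnE WtE WnE /jump XutE XunE -/(esum et s) -/(esum en s).
  by rewrite -(GtE s) -(GnE s); ring.
Qed.

Lemma node_bound_low (t1 n1 : Q -> R) : bdd t1 -> bdd n1 ->
  (forall s, tang1 (q s) (E1 s) (N1 s) (D0 s) (D1 s) (M0 s) (M1 s) = h s ^+ 2 * t1 s) ->
  (forall s, norm1 (q s) (E1 s) (N1 s) (B0 s) = h s ^+ 2 * n1 s) ->
  (exists G, bdd G /\ forall s, node_tang h et en vqt vqn s = h s ^+ 5 * G s) /\
  (exists G, bdd G /\ forall s, node_norm h et en vqt vqn vt vn s = h s ^+ 3 * G s).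
Proof.
move=> bt1 bn1 t1E n1E; have [BT [BN [/Ex2_factor[_ [b3 [GT [bGT GTE]]]]
  /Ex2_factor[_ [b3' [GN [bGN GNE]]]] [FT [bFT FTE]] [FN [bFN FNE]]]]] := core.
have [Gt [bGt GtE]] := esum_et; have [Gn [bGn GnE]] := esum_en.
have bq : bdd q.
  Transparent Ex. by case: etE => bq _; exact: bq. Opaque Ex.
have bh : bdd h by exists 1.
have [Wt [bWt WtE]] := odd2 wtE; have [Wn [bWn WnE]] := odd2 wnE.
pose t3 s := tang3 (q s) (E1 s) (E2 s) (E3 s) (N1 s) (N2 s) (N3 s)
  (D0 s) (D1 s) (D2 s) (D3 s) (M0 s) (M1 s).
pose n3 s := norm3 (q s) (E1 s) (E2 s) (E3 s) (N1 s) (N2 s) (N3 s) (A0 s) (B0 s) (B1 s)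
  (D0 s) (D1 s) (M0 s) (M1 s).
have {}GTE s : BT s = h s ^+ 2 * t1 s + h s ^+ 2 * (t3 s + h s ^+ 2 * GT s) by rewrite GTE -t1E.
have {}GNE s : BN s = h s ^+ 2 * n1 s + h s ^+ 2 * (n3 s + h s ^+ 2 * GN s) by rewrite GNE -n1E.
have bt3 : bdd t3 := b3; have bn3 : bdd n3 := b3'.
split.
- exists (fun s => t1 s + (t3 s + h s ^+ 2 * GT s)
    + 2^-1 * (Wt s * (2 * q s + h s ^+ 2 * Gt s) + Wn s * (h s ^+ 2 * Gn s)) + h s ^+ 2 * FT s).
  split; first by bddtac.
  by move=> s; rewrite FTE GTE WtE WnE GtE GnE; ring.
- exists (fun s => n1 s + (n3 s + h s ^+ 2 * GN s) + h s ^+ 2 * FN s).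
  split; first by bddtac.
  by move=> s; rewrite FNE GNE; ring.
Qed.

(** The last two hypotheses collect all terms of order h^5 in the tangential and of order h^3 in the
    normal product: what V2 leaves in the leading coefficient, the second coefficient, and Y_tt,
    which in the normal case sits inside [norm3]. *)
Lemma node_bound_high (t1 n1 u1 u2 : Q -> R) w3 : bdd u1 -> bdd u2 -> E5 wt [:: w1; (fun s => 2^-1 * w2 s); w3] ->
  (forall s, tang1 (q s) (E1 s) (N1 s) (D0 s) (D1 s) (M0 s) (M1 s) = h s ^+ 2 * t1 s) ->
  (forall s, norm1 (q s) (E1 s) (N1 s) (B0 s) = h s ^+ 2 * n1 s) ->
  (forall s, t1 s + tang3 (q s) (E1 s) (E2 s) (E3 s) (N1 s) (N2 s) (N3 s)
           (D0 s) (D1 s) (D2 s) (D3 s) (M0 s) (M1 s)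
         + 2 * q s * (w1 s * ni1 (q s) (E1 s) + 2^-1 * w2 s * (q s)^-1) = h s ^+ 2 * u1 s) ->
  (forall s, n1 s + norm3 (q s) (E1 s) (E2 s) (E3 s) (N1 s) (N2 s) (N3 s) (A0 s) (B0 s) (B1 s)
          (D0 s) (D1 s) (M0 s) (M1 s) = h s ^+ 2 * u2 s) ->
  (exists G, bdd G /\ forall s, node_tang h et en vqt vqn s = h s ^+ 7 * G s) /\
  (exists G, bdd G /\ forall s, node_norm h et en vqt vqn vt vn s = h s ^+ 5 * G s).
Proof.
move=> bu1 bu2 wtE3 t1E n1E t3E n3E; have [BT [BN [/Ex2_factor[_ [_ [GT [bGT GTE]]]]
  /Ex2_factor[_ [_ [GN [bGN GNE]]]] [FT [bFT FTE]] [FN [bFN FNE]]]]] := core.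
have [Gt [bGt GtE]] := esum_et; have [Gn [bGn GnE]] := esum_en.
Transparent Ex.
have [b0 [_ [_ [b1 [_ [_ _]]]]]] : Ex fst (sgstep h) wt [:: w1; (fun s => 2^-1 * w2 s)] := wtE.
have bw1 : bdd w1 by exact: b0.
have bw2 : bdd (fun s => 2^-1 * w2 s) by exact: b1.
have bq : bdd q by case: etE => bq _; exact: bq.
have bE1 : bdd E1 by case: etE => _ [? [_ [bE _]]]; exact: bE.
Opaque Ex.
have bh : bdd h by exists 1.
have bi : bdd (fun s => (q s)^-1).
  by apply: (bddV c0) => s; rewrite ger0_norm ?qc// (le_trans (ltW c0)).
have [Wt [bWt WtE]] := odd3 wtE3; have [Wn [bWn WnE]] := odd2 wnE.
pose t3 s := tang3 (q s) (E1 s) (E2 s) (E3 s) (N1 s) (N2 s) (N3 s)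
  (D0 s) (D1 s) (D2 s) (D3 s) (M0 s) (M1 s).
pose n3 s := norm3 (q s) (E1 s) (E2 s) (E3 s) (N1 s) (N2 s) (N3 s) (A0 s) (B0 s) (B1 s)
  (D0 s) (D1 s) (M0 s) (M1 s).
have {}GTE s : BT s = h s ^+ 2 * t1 s + h s ^+ 2 * (t3 s + h s ^+ 2 * GT s) by rewrite GTE -t1E.
have {}GNE s : BN s = h s ^+ 2 * n1 s + h s ^+ 2 * (n3 s + h s ^+ 2 * GN s) by rewrite GNE -n1E.
move: t3E n3E; rewrite -/t3 -/n3 => t3E n3E.
split.
- exists (fun s => u1 s + GT s + 2^-1 * (Wt s * (2 * q s + h s ^+ 2 * Gt s)
     + 2 * (w1 s * (- E1 s * (q s)^-1 ^+ 2) + 2^-1 * w2 s * (q s)^-1) * Gt s + Wn s * Gn s) + FT s).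
  split; first by bddtac.
  move=> s; rewrite FTE GTE WtE WnE GtE GnE.
  have -> : h s ^+ 7 * (u1 s + GT s + 2^-1 * (Wt s * (2 * q s + h s ^+ 2 * Gt s)
     + 2 * (w1 s * (- E1 s * (q s)^-1 ^+ 2) + 2^-1 * w2 s * (q s)^-1) * Gt s + Wn s * Gn s) + FT s)
   = h s ^+ 5 * (h s ^+ 2 * u1 s) + h s ^+ 7 * (GT s + 2^-1 * (Wt s * (2 * q s + h s ^+ 2 * Gt s)
     + 2 * (w1 s * (- E1 s * (q s)^-1 ^+ 2) + 2^-1 * w2 s * (q s)^-1) * Gt s + Wn s * Gn s) + FT s).
    by ring.
  rewrite -t3E -/(t3 s) /ni1.
  move: (w1 s * (- E1 s * (q s)^-1 ^+ 2) + 2^-1 * w2 s / q s) => L; by field.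
- exists (fun s => u2 s + GN s + FN s).
  split; first by bddtac.
  move=> s; rewrite FNE GNE.
  transitivity (h s ^+ 3 * (h s ^+ 2 * u2 s) + h s ^+ 5 * (GN s + FN s)); last by ring.
  by rewrite -n3E -/(n3 s); ring.
Qed.
End NodeBound.

(** * The relations for Y_tt applied to the flow *)

Section Acceleration.
Context {R : realType} {P Q : Type} (cur nxt : Q -> P) (pt h : Q -> R) (hp : P -> R).
Hypothesis h0 : forall z, 0 < h z.
Hypothesis h1 : forall z, `|h z| <= 1.
Hypothesis hpc : forall z, hp (cur z) = h z.
Hypothesis hpn : forall z, hp (nxt z) = h z.

Definition framed (cc ss F G t n : P -> R -> R) :=
  (forall p x, F p x = t p x * cc p x + n p x * ss p x) /\
  (forall p x, G p x = t p x * ss p x - n p x * cc p x).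

Definition taylor2 (F F1 : P -> R -> R) := exists K, forall z,
  `|F (nxt z) (pt z) - F (cur z) (pt z) - h z ^+ 2 * F1 (cur z) (pt z)| <= K * (h z ^+ 2) ^+ 2.

Variables (X Z U0 U1 W0 W1 cc ss q q1 k A B T1 N1 T2 N2 a G : P -> R -> R) (c : R).
Hypotheses (c0 : 0 < c) (cq : forall p x, c <= q p x).
Hypothesis cs1 : forall p x, cc p x ^+ 2 + ss p x ^+ 2 = 1.
Hypothesis FY1 : framed cc ss (dn 1 X) (dn 1 Z) q (fun _ _ => 0).
Hypothesis FY2 : framed cc ss (dn 2 X) (dn 2 Z) q1 (fun p x => - (q p x ^+ 2 * k p x)).
Hypothesis FU : framed cc ss U0 U1 B A.
Hypothesis FU1 : framed cc ss (dn 1 U0) (dn 1 U1) T1 N1.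
Hypothesis FU2 : framed cc ss (dn 2 U0) (dn 2 U1) T2 N2.
Hypothesis AE : forall p x, A p x = - k p x + hp p ^+ 2 * a p x.
Hypothesis tangE : forall p x, ytang1 (q p x) (q1 p x) (k p x) (T1 p x) (T2 p x) 0 0
  = hp p ^+ 2 * (2 * q p x * G p x).
Hypotheses (XL : CL 2 X) (ZL : CL 2 Z) (U0L : CL 2 U0) (U1L : CL 2 U1) (W0L : CL 2 W0) (W1L : CL 2 W1).
Hypotheses (qC : CS cur nxt pt h q) (aC : CS cur nxt pt h a) (GC : CS cur nxt pt h G).
Hypotheses (X1t : taylor2 (dn 1 X) (dn 1 U0)) (Z1t : taylor2 (dn 1 Z) (dn 1 U1)).
Hypotheses (X2t : taylor2 (dn 2 X) (dn 2 U0)) (Z2t : taylor2 (dn 2 Z) (dn 2 U1)).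
Hypotheses (U0t : taylor2 U0 W0) (U1t : taylor2 U1 W1).
Hypotheses (P1t : taylor2 (dn 1 U0) (dn 1 W0)) (R1t : taylor2 (dn 1 U1) (dn 1 W1)).
Hypotheses (P2t : taylor2 (dn 2 U0) (dn 2 W0)) (R2t : taylor2 (dn 2 U1) (dn 2 W1)).

Lemma taylor2_Ex F F1 : unif_bounded F -> unif_bounded F1 -> taylor2 F F1 ->
  Ex id (sqstep h) (fun z => F (nxt z) (pt z))
    [:: fun z => F (cur z) (pt z); fun z => F1 (cur z) (pt z)].
Proof.
move=> [K FK] [K1 F1K] [L FL]; apply: Ex_of_remainder.
- by move=> z; rewrite /sqstep expf_neq0 ?gt_eqF.
- by move=> [|[|//]] _ /=; [exists K|exists K1] => z.
- exists L => z; rewrite /= /sqstep mulr0 addr0 opprD addrA (ger0_norm (sqr_ge0 _)); exact: FL.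
Qed.

Let bd i (F : P -> R -> R) l : CL l F -> (i <= l)%N -> unif_bounded (dn i F).
Proof. by move=> FL ik; apply: (@CL_bounded _ _ (l - i)%N); apply: CL_dn; rewrite subnK. Qed.

Let speed_sqr p x : dn 1 X p x ^+ 2 + dn 1 Z p x ^+ 2 = q p x ^+ 2.
Proof.
rewrite FY1.1 FY1.2 !mul0r addr0 subr0 !exprMn -mulrDr cs1 mulr1 //.
Qed.

Let q0 p x : q p x != 0. Proof. by rewrite gt_eqF// (lt_le_trans c0 (cq p x)). Qed.

(** [normalP] and [tangentialP] hold for every parameter p, hence at both time levels; this is the
    only way in which the flow equations enter the relations for Y_tt. *)
Let normalP p x : normal_rate (dn 1 X p x) (dn 1 Z p x) (dn 2 X p x) (dn 2 Z p x) (U0 p x) (U1 p x)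
  = hp p ^+ 2 * (q p x * a p x).
Proof.
have q0' := q0 p x.
rewrite /normal_rate speed_sqr FY1.1 FY1.2 FY2.1 FY2.2 FU.1 FU.2.
transitivity (q p x * (A p x + k p x) * (cc p x ^+ 2 + ss p x ^+ 2)); first by field.
by rewrite cs1 AE; ring.
Qed.

Let tangentialP p x : tangential_rate (dn 1 X p x) (dn 1 Z p x) (dn 2 X p x) (dn 2 Z p x)
  (dn 1 U0 p x) (dn 1 U1 p x) (dn 2 U0 p x) (dn 2 U1 p x) = hp p ^+ 2 * G p x.
Proof.
have q0' := q0 p x.
have dotE (t n t' n' : R) : (t * cc p x + n * ss p x) * (t' * cc p x + n' * ss p x)
   + (t * ss p x - n * cc p x) * (t' * ss p x - n' * cc p x) = t * t' + n * n'.
  by transitivity ((t * t' + n * n') * (cc p x ^+ 2 + ss p x ^+ 2)); [ring|rewrite cs1 mulr1].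
have crossE (t n t' n' : R) : (t * cc p x + n * ss p x) * (t' * ss p x - n' * cc p x)
   - (t * ss p x - n * cc p x) * (t' * cc p x + n' * ss p x) = n * t' - t * n'.
  by transitivity ((n * t' - t * n') * (cc p x ^+ 2 + ss p x ^+ 2)); [ring|rewrite cs1 mulr1].
rewrite /tangential_rate speed_sqr FY1.1 FY1.2 FY2.1 FY2.2 FU1.1 FU1.2 FU2.1 FU2.2 /=.
rewrite !dotE !crossE.
have := tangE p x; rewrite /ytang1 /tang1 /ut1 /un1 /quo1 /ni1 => E.
apply: (mulfI (_ : 2 * q p x != 0)); first by rewrite mulf_neq0// pnatr_eq0.
by rewrite [RHS]mulrCA -E; field.
Qed.

Let clo F : CS cur nxt pt h F -> exists K, forall z,
  `|F (nxt z) (pt z) - F (cur z) (pt z)| <= K * h z ^+ 2.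
Proof. by case. Qed.

Let at_cur (F : P -> R -> R) z := F (cur z) (pt z).

Let bddc (F : P -> R -> R) : unif_bounded F -> bdd (at_cur F).
Proof. by move=> [K FK]; exists K => z; exact: FK. Qed.

Let c20 : 0 < c ^+ 2. Proof. by rewrite exprn_gt0. Qed.

Let speed_lower p x : c ^+ 2 <= dn 1 X p x ^+ 2 + dn 1 Z p x ^+ 2.
Proof. by rewrite speed_sqr lerXn2r ?nnegrE ?cq// ltW// (lt_le_trans c0 (cq p x)). Qed.

Hypothesis T1_bd : unif_bounded T1.

Lemma acceleration : (exists d, bdd d /\ forall z,
    ss (cur z) (pt z) * W0 (cur z) (pt z) - cc (cur z) (pt z) * W1 (cur z) (pt z) =
    yNu (q (cur z) (pt z)) (q1 (cur z) (pt z)) (k (cur z) (pt z)) (B (cur z) (pt z))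
      (A (cur z) (pt z)) (T1 (cur z) (pt z)) (N1 (cur z) (pt z)) (N2 (cur z) (pt z))
    + h z ^+ 2 * d z) /\
  (exists d, bdd d /\ forall z,
    (cc (cur z) (pt z) * dn 2 W0 (cur z) (pt z) + ss (cur z) (pt z) * dn 2 W1 (cur z) (pt z))
      * (q (cur z) (pt z))^-1
    - (cc (cur z) (pt z) * dn 1 W0 (cur z) (pt z) + ss (cur z) (pt z) * dn 1 W1 (cur z) (pt z))
      * q1 (cur z) (pt z) * (q (cur z) (pt z))^-1 ^+ 2 =
    yGamma (q (cur z) (pt z)) (q1 (cur z) (pt z)) (k (cur z) (pt z)) (T1 (cur z) (pt z))
      (T2 (cur z) (pt z)) (N1 (cur z) (pt z)) (N2 (cur z) (pt z)) + h z ^+ 2 * d z).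
Proof.
have eX1 := taylor2_Ex (bd (i := 1) XL isT) (bd (i := 1) U0L isT) X1t.
have eZ1 := taylor2_Ex (bd (i := 1) ZL isT) (bd (i := 1) U1L isT) Z1t.
have eX2 := taylor2_Ex (bd (i := 2) XL isT) (bd (i := 2) U0L isT) X2t.
have eZ2 := taylor2_Ex (bd (i := 2) ZL isT) (bd (i := 2) U1L isT) Z2t.
have eU0 := taylor2_Ex (CL_bounded U0L) (CL_bounded W0L) U0t.
have eU1 := taylor2_Ex (CL_bounded U1L) (CL_bounded W1L) U1t.
have eP1 := taylor2_Ex (bd (i := 1) U0L isT) (bd (i := 1) W0L isT) P1t.
have eR1 := taylor2_Ex (bd (i := 1) U1L isT) (bd (i := 1) W1L isT) R1t.
have eP2 := taylor2_Ex (bd (i := 2) U0L isT) (bd (i := 2) W0L isT) P2t.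
have eR2 := taylor2_Ex (bd (i := 2) U1L isT) (bd (i := 2) W1L isT) R2t.
have nn z := normalP (nxt z) (pt z); have nc z := normalP (cur z) (pt z).
have tn z := tangentialP (nxt z) (pt z); have tc z := tangentialP (cur z) (pt z).
have Cn := clo (CSM qC aC); have Ct := clo GC.
have F1 : (forall z, dn 1 X (cur z) (pt z) = q (cur z) (pt z) * cc (cur z) (pt z)) /\
          (forall z, dn 1 Z (cur z) (pt z) = q (cur z) (pt z) * ss (cur z) (pt z)).
  by split => z; rewrite ?FY1.1 ?FY1.2 mul0r ?addr0 ?subr0.
have F2 : (forall z, dn 2 X (cur z) (pt z) = q1 (cur z) (pt z) * cc (cur z) (pt z)
             - q (cur z) (pt z) ^+ 2 * k (cur z) (pt z) * ss (cur z) (pt z)) /\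
          (forall z, dn 2 Z (cur z) (pt z) = q1 (cur z) (pt z) * ss (cur z) (pt z)
             + q (cur z) (pt z) ^+ 2 * k (cur z) (pt z) * cc (cur z) (pt z)).
  by split => z; rewrite ?FY2.1 ?FY2.2; ring.
have nn' z : normal_rate (dn 1 X (nxt z) (pt z)) (dn 1 Z (nxt z) (pt z)) (dn 2 X (nxt z) (pt z))
   (dn 2 Z (nxt z) (pt z)) (U0 (nxt z) (pt z)) (U1 (nxt z) (pt z)) =
   h z ^+ 2 * (q (nxt z) (pt z) * a (nxt z) (pt z)) by rewrite nn hpn.
have nc' z : normal_rate (dn 1 X (cur z) (pt z)) (dn 1 Z (cur z) (pt z)) (dn 2 X (cur z) (pt z))
   (dn 2 Z (cur z) (pt z)) (U0 (cur z) (pt z)) (U1 (cur z) (pt z)) =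
   h z ^+ 2 * (q (cur z) (pt z) * a (cur z) (pt z)) by rewrite nc hpc.
have bqV : bdd (fun z => (q (cur z) (pt z))^-1).
  by apply: (bddV c0) => z; rewrite ger0_norm ?cq// (le_trans (ltW c0)).
have AE' z : A (cur z) (pt z) = - k (cur z) (pt z) + h z ^+ 2 * a (cur z) (pt z) by rewrite AE hpc.
split.
- exact: (acceleration_normal h0 h1 eX1 eZ1 eX2 eZ2 eU0 eU1 c20 (fun z => speed_lower _ _)
    (fun z => speed_lower _ _) nn' nc' Cn (fun z => cs1 _ _) (fun z => q0 _ _) F1.1 F1.2 F2.1 F2.2
    (fun z => FU.1 _ _) (fun z => FU.2 _ _) (fun z => FU1.1 _ _) (fun z => FU1.2 _ _)
    (fun z => FU2.1 _ _) (fun z => FU2.2 _ _) AE' (bddc aC.1) bqV (bddc T1_bd)).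
- have tn' z : tangential_rate (dn 1 X (nxt z) (pt z)) (dn 1 Z (nxt z) (pt z)) (dn 2 X (nxt z) (pt z))
   (dn 2 Z (nxt z) (pt z)) (dn 1 U0 (nxt z) (pt z)) (dn 1 U1 (nxt z) (pt z)) (dn 2 U0 (nxt z) (pt z))
   (dn 2 U1 (nxt z) (pt z)) = h z ^+ 2 * G (nxt z) (pt z) by rewrite tn hpn.
  have tc' z : tangential_rate (dn 1 X (cur z) (pt z)) (dn 1 Z (cur z) (pt z)) (dn 2 X (cur z) (pt z))
   (dn 2 Z (cur z) (pt z)) (dn 1 U0 (cur z) (pt z)) (dn 1 U1 (cur z) (pt z)) (dn 2 U0 (cur z) (pt z))
   (dn 2 U1 (cur z) (pt z)) = h z ^+ 2 * G (cur z) (pt z) by rewrite tc hpc.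
  exact: (acceleration_tangential h0 h1 eX1 eZ1 eX2 eZ2 eP1 eR1 eP2 eR2 c20 (fun z => speed_lower _ _)
    (fun z => speed_lower _ _) tn' tc' Ct (fun z => cs1 _ _) (fun z => q0 _ _) F1.1 F1.2 F2.1 F2.2
    (fun z => FU1.1 _ _) (fun z => FU1.2 _ _) (fun z => FU2.1 _ _) (fun z => FU2.2 _ _)).
Qed.

End Acceleration.

(** * Closeness of the second coefficients *)

Section CloseForms.
Context {R : realType} {P Q : Type} (cur nxt : Q -> P) (pt h : Q -> R).
Local Notation CS := (CS cur nxt pt h).
Implicit Types F : P -> R -> R.

Lemma CS_tang3 q E1 E2 E3 N1 N2 N3 D0 D1 D2 D3 M0 M1 :
  CS q -> CS (fun p x => (q p x)^-1) -> CS E1 -> CS E2 -> CS E3 -> CS N1 -> CS N2 -> CS N3 ->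
  CS D0 -> CS D1 -> CS D2 -> CS D3 -> CS M0 -> CS M1 ->
  CS (fun p x => tang3 (q p x) (E1 p x) (E2 p x) (E3 p x) (N1 p x) (N2 p x) (N3 p x)
    (D0 p x) (D1 p x) (D2 p x) (D3 p x) (M0 p x) (M1 p x)).
Proof.
move=> *; rewrite /tang3 /ut1 /ut3 /un1 /un3 /quo1 /quo3 /ni3 /ni2 /ni1 /nr3 /nr2.
(* The same expression with its inverses reduced to powers of q^-1, the form of inverse that [CStac]
   can treat. *)
apply: (@CS_ext _ _ _ _ _ _ _ (fun p x =>
  let iq := (q p x)^-1 in let r2 := E2 p x + 2^-1 * N1 p x ^+ 2 * iq in
  let r3 := E3 p x + N1 p x * N2 p x * iq - 2^-1 * E1 p x * N1 p x ^+ 2 * iq ^+ 2 in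
  let i1 := - E1 p x * iq ^+ 2 in let i2 := - r2 * iq ^+ 2 + E1 p x ^+ 2 * iq ^+ 3 in
  let i3 := - r3 * iq ^+ 2 + 2 * E1 p x * r2 * iq ^+ 3 - E1 p x ^+ 3 * iq ^+ 4 in
  4 * (r3 * ((q p x * i1 + E1 p x * iq) ^+ 2 + (0 * i1 + N1 p x * iq) ^+ 2)
    + 2 * E1 p x * ((q p x * i1 + E1 p x * iq) * (q p x * i3 + E1 p x * i2 + E2 p x * i1 + E3 p x * iq)
       + (0 * i1 + N1 p x * iq) * (0 * i3 + N1 p x * i2 + N2 p x * i1 + N3 p x * iq))
    + (D0 p x * i3 + D1 p x * i2 + D2 p x * i1 + D3 p x * iq) * q p x
    + (D0 p x * i1 + D1 p x * iq) * E2 p x + (M0 p x * i1 + M1 p x * iq) * N2 p x))).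
  by move=> p x /=; rewrite !invfM -?exprVn; ring.
by cbv zeta; CStac.
Qed.

Lemma CS_norm3 q E1 E2 E3 N1 N2 N3 A0 B0 B1 D0 D1 M0 M1 :
  CS q -> CS (fun p x => (q p x)^-1) -> CS E1 -> CS E2 -> CS E3 -> CS N1 -> CS N2 -> CS N3 ->
  CS A0 -> CS B0 -> CS B1 -> CS D0 -> CS D1 -> CS M0 -> CS M1 ->
  CS (fun p x => norm3 (q p x) (E1 p x) (E2 p x) (E3 p x) (N1 p x) (N2 p x) (N3 p x)
    (A0 p x) (B0 p x) (B1 p x) (D0 p x) (D1 p x) (M0 p x) (M1 p x)).
Proof.
move=> *; rewrite /norm3 /ut1 /un1 /un3 /quo1 /quo3 /ni3 /ni2 /ni1 /nr3 /nr2.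
apply: (@CS_ext _ _ _ _ _ _ _ (fun p x =>
  let iq := (q p x)^-1 in let r2 := E2 p x + 2^-1 * N1 p x ^+ 2 * iq in
  let r3 := E3 p x + N1 p x * N2 p x * iq - 2^-1 * E1 p x * N1 p x ^+ 2 * iq ^+ 2 in
  let i1 := - E1 p x * iq ^+ 2 in let i2 := - r2 * iq ^+ 2 + E1 p x ^+ 2 * iq ^+ 3 in
  let i3 := - r3 * iq ^+ 2 + 2 * E1 p x * r2 * iq ^+ 3 - E1 p x ^+ 3 * iq ^+ 4 in
  2 * q p x ^+ 2 * B1 p x + 6 * q p x * E2 p x * B0 p x - 2 * q p x * r2 * B0 p x
  - 2 * q p x * N2 p x * A0 p x
  - 4 * ((0 * i3 + N1 p x * i2 + N2 p x * i1 + N3 p x * iq) * q p x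
     + (0 * i1 + N1 p x * iq) * E2 p x - (q p x * i1 + E1 p x * iq) * N2 p x)
  - 4 * (M0 p x * i1 + M1 p x * iq) * q p x)).
  by move=> p x /=; rewrite !invfM -?exprVn; ring.
by cbv zeta; CStac.
Qed.

Lemma CS_yGamma q q1 k T1 T2 N1 N2 : CS q -> CS (fun p x => (q p x)^-1) -> CS q1 -> CS k ->
  CS T1 -> CS T2 -> CS N1 -> CS N2 ->
  CS (fun p x => yGamma (q p x) (q1 p x) (k p x) (T1 p x) (T2 p x) (N1 p x) (N2 p x)).
Proof. by move=> *; rewrite /yGamma /Gamma_form; CStac. Qed.

Lemma CS_yNu q q1 k B A T1 N1 N2 : CS q -> CS (fun p x => (q p x)^-1) -> CS q1 -> CS k ->
  CS B -> CS A -> CS T1 -> CS N1 -> CS N2 ->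
  CS (fun p x => yNu (q p x) (q1 p x) (k p x) (B p x) (A p x) (T1 p x) (N1 p x) (N2 p x)).
Proof. by move=> *; rewrite /yNu /Nu_form; CStac. Qed.

Lemma CL_yGamma m q q1 k T1 T2 N1 N2 : CL m q -> CL m (fun p x => (q p x)^-1) -> CL m q1 -> CL m k ->
  CL m T1 -> CL m T2 -> CL m N1 -> CL m N2 ->
  CL m (fun (p : P) (x : R) => yGamma (q p x) (q1 p x) (k p x) (T1 p x) (T2 p x) (N1 p x) (N2 p x)).
Proof. by move=> *; rewrite /yGamma /Gamma_form; CLtac. Qed.

Section Velocity.
Variables (q q1 q2 q3 k k1 k2 k3 A A1 A2 A3 B B1 B2 B3 B4 : P -> R -> R).
Hypotheses (qC : CS q) (qVC : CS (fun p x => (q p x)^-1)) (q1C : CS q1) (q2C : CS q2) (q3C : CS q3).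
Hypotheses (kC : CS k) (k1C : CS k1) (k2C : CS k2) (k3C : CS k3).
Hypotheses (AC : CS A) (A1C : CS A1) (A2C : CS A2) (A3C : CS A3).
Hypotheses (BC : CS B) (B1C : CS B1) (B2C : CS B2) (B3C : CS B3) (B4C : CS B4).

Let w p x := wf (q p x) (k p x).
Let w1 p x := wf1 (q p x) (q1 p x) (k p x) (k1 p x).
Let w2 p x := wf2 (q p x) (q1 p x) (q2 p x) (k p x) (k1 p x) (k2 p x).
Let w3 p x := wf3 (q p x) (q1 p x) (q2 p x) (q3 p x) (k p x) (k1 p x) (k2 p x) (k3 p x).

Definition velT1 p x := vT1 (w p x) (A p x) (B1 p x).
Definition velN1 p x := vN1 (w p x) (B p x) (A1 p x).
Definition velT2 p x := vT2 (w p x) (w1 p x) (A p x) (A1 p x) (B p x) (B2 p x).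
Definition velN2 p x := vN2 (w p x) (w1 p x) (A p x) (A2 p x) (B p x) (B1 p x).
Definition velT3 p x := vT3 (w p x) (w1 p x) (w2 p x) (A p x) (A1 p x) (A2 p x) (B p x) (B1 p x) (B3 p x).
Definition velT4 p x := vT4 (w p x) (w1 p x) (w2 p x) (w3 p x) (A p x) (A1 p x) (A2 p x) (A3 p x)
  (B p x) (B1 p x) (B2 p x) (B4 p x).

Lemma CS_vel : [/\ CS velT1, CS velN1, CS velT2 & CS velN2] /\ (CS velT3 /\ CS velT4).
Proof.
have c : CS w by rewrite /w /wf; CStac.
have c1 : CS w1 by rewrite /w1 /wf1; CStac.
have c2 : CS w2 by rewrite /w2 /wf2; CStac.
have c3 : CS w3 by rewrite /w3 /wf3; CStac.
move: c c1 c2 c3; rewrite /velT1 /velN1 /velT2 /velN2 /velT3 /velT4.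
move: w w1 w2 w3 => ω ω1 ω2 ω3 *.
by split; [split|split]; rewrite /vT4 /vT3 /vN3 /vT1 /vN1 /vN2 /vT2; CStac.
Qed.

(** The second coefficients of the products at a node as functions of the velocity, with [yGamma]
    and [yNu] in the place of the terms in Y_tt. *)
Definition tang_defect p x :=
  ytang3 (q p x) (q1 p x) (q2 p x) (q3 p x) (k p x) (k1 p x) (k2 p x) (velT1 p x) (velT2 p x)
    (velT3 p x) (velT4 p x) (velN1 p x) (velN2 p x)
  + q p x * yGamma (q p x) (q1 p x) (k p x) (velT1 p x) (velT2 p x) (velN1 p x) (velN2 p x).
Definition norm_defect p x :=
  ynorm3 (q p x) (q1 p x) (q2 p x) (q3 p x) (k p x) (k1 p x) (k2 p x) (B p x) (A p x)
    (yNu (q p x) (q1 p x) (k p x) (B p x) (A p x) (velT1 p x) (velN1 p x) (velN2 p x))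
    (velT1 p x) (velT2 p x) (velN1 p x) (velN2 p x).

Lemma CS_defects : CS tang_defect /\ CS norm_defect.
Proof.
have [[t1 n1 t2 n2] [t3 t4]] := CS_vel; rewrite /tang_defect /norm_defect.
move: t1 n1 t2 n2 t3 t4; move: velT1 velN1 velT2 velN2 velT3 velT4 => T1 N1 T2 N2 T3 T4 t1 n1 t2 n2 t3 t4.
have e1 : CS (fun p x => 2^-1 * q1 p x) by CStac.
have e2 : CS (fun p x => 6^-1 * yT3 (q p x) (q2 p x) (k p x)) by rewrite /yT3; CStac.
have e3 : CS (fun p x => 24^-1 * yT4 (q p x) (q1 p x) (q3 p x) (k p x) (k1 p x)).
  by rewrite /yT4 /yN3; CStac.
have m1 : CS (fun p x => - 2^-1 * q p x ^+ 2 * k p x) by CStac.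
have m2 : CS (fun p x => 6^-1 * yN3 (q p x) (q1 p x) (k p x) (k1 p x)) by rewrite /yN3; CStac.
have m3 : CS (fun p x => 24^-1 * yN4 (q p x) (q1 p x) (q2 p x) (k p x) (k1 p x) (k2 p x)).
  by rewrite /yN4 /yT3; CStac.
have s2 : CS (fun p x => 2^-1 * T2 p x) by CStac.
have s3 : CS (fun p x => 6^-1 * T3 p x) by CStac.
have s4 : CS (fun p x => 24^-1 * T4 p x) by CStac.
have r2 : CS (fun p x => 2^-1 * N2 p x) by CStac.
have nu := CS_yNu qC qVC q1C kC BC AC t1 n1 n2.
have nu2 : CS (fun p x => 2^-1 * yNu (q p x) (q1 p x) (k p x) (B p x) (A p x) (T1 p x) (N1 p x) (N2 p x)).
  exact: CSM (CS_num _ _ _ _ _) nu.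
split.
- apply: CSD; first exact (CS_tang3 qC qVC e1 e2 e3 m1 m2 m3 t1 s2 s3 s4 n1 r2).
  exact: CSM qC (CS_yGamma qC qVC q1C kC t1 t2 n1 n2).
- exact (CS_norm3 qC qVC e1 e2 e3 m1 m2 m3 BC AC nu2 t1 s2 n1 r2).
Qed.

End Velocity.
End CloseForms.

Section RotatedQuotients.
Context {R : realType} {P Q : Type} (cur : Q -> P) (pt h : Q -> R).
Hypothesis h0 : forall z, 0 < h z.

Variables (u v : Q -> R).
Hypotheses (u_bd : bdd u) (v_bd : bdd v).

(** With (u, v) the tangent or the normal at the node, this is a component of the difference
    quotient in a frame frozen there. Its coefficients are then the frame components of the
    derivatives at the node. *)
Definition rquot (F0 F1 : P -> R -> R) (s : Q * bool) : R :=
  u s.1 * dquot h cur pt F0 s + v s.1 * dquot h cur pt F1 s.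

Local Notation at_node i F z := (dn i F (cur z) (pt z)).

Lemma dquot_Ex_seq n (F : P -> R -> R) l : CL n F -> size l = n ->
  (forall i, (i < n)%N -> nth (fun=> 0) l i = dcoef cur pt F i.+1) ->
  Ex fst (sgstep h) (dquot h cur pt F) l.
Proof.
move=> FL sl ln; have := dquot_Ex cur pt h0 FL; congr Ex.
apply: (eq_from_nth (x0 := fun=> 0)) => [|i]; rewrite size_map size_iota ?sl// => i_n.
by rewrite ln// (nth_map 0%N) ?size_iota// nth_iota.
Qed.

Lemma ExR (p : Q * bool -> Q) (F F' : Q * bool -> R) l l' : size l = size l' ->
  Ex p (sgstep h) F l -> Ex p (sgstep h) F' l' ->
  Ex p (sgstep h) (fun s => u (p s) * F s + v (p s) * F' s) (sadd (sscale u l) (sscale v l')).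
Proof. by move=> sl FL FL'; apply: ExD; [rewrite !size_map|exact: ExZ|exact: ExZ]. Qed.

Lemma rquot_Ex5 F0 F1 t1 t2 t3 t4 : CL 5 F0 -> CL 5 F1 ->
  (forall z, u z * at_node 1 F0 z + v z * at_node 1 F1 z = t1 z) ->
  (forall z, u z * at_node 2 F0 z + v z * at_node 2 F1 z = 2 * t2 z) ->
  (forall z, u z * at_node 3 F0 z + v z * at_node 3 F1 z = 6 * t3 z) ->
  (forall z, u z * at_node 4 F0 z + v z * at_node 4 F1 z = 24 * t4 z) ->
  exists r, Ex fst (sgstep h) (rquot F0 F1) [:: t1; t2; t3; t4; r].
Proof.
move=> F0L F1L E1 E2 E3 E4.
have five F : CL 5 F -> Ex fst (sgstep h) (dquot h cur pt F)
   [:: dcoef cur pt F 1; dcoef cur pt F 2; dcoef cur pt F 3; dcoef cur pt F 4; dcoef cur pt F 5].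
  by move=> FL; apply: (dquot_Ex_seq FL) => // -[|[|[|[|[|]]]]].
have H := ExR _ (five _ F0L) (five _ F1L); have {}H := H (erefl 5%N).
have aux (s1 s2 x y t n : R) : n != 0 -> s1 * x + s2 * y = n * t -> s1 * (x / n) + s2 * (y / n) = t.
  by move=> n0 E; rewrite !mulrA -mulrDl E mulrC mulKf.
have n2 : 2 != 0 :> R by rewrite pnatr_eq0.
have n6 : 6 != 0 :> R by rewrite pnatr_eq0.
have n24 : 24 != 0 :> R by rewrite pnatr_eq0.
apply: (Ex_5 _ _ _ _ _ H) => // z; cbn [nth sadd sscale map]; rewrite /dcoef.
- have -> : (1`!)%:R = 1 :> R by [].
  by rewrite !divr1; exact: E1.
- have -> : (2`!)%:R = 2 :> R by rewrite !(factS, fact0).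
  exact (aux _ _ _ _ _ _ n2 (E2 z)).
- have -> : (3`!)%:R = 6 :> R by rewrite !(factS, fact0).
  exact (aux _ _ _ _ _ _ n6 (E3 z)).
- have -> : (4`!)%:R = 24 :> R by rewrite !(factS, fact0).
  exact (aux _ _ _ _ _ _ n24 (E4 z)).
Qed.

Lemma rquot_Ex2 F0 F1 t1 t2 : CL 2 F0 -> CL 2 F1 ->
  (forall z, u z * at_node 1 F0 z + v z * at_node 1 F1 z = t1 z) ->
  (forall z, u z * at_node 2 F0 z + v z * at_node 2 F1 z = t2 z) ->
  Ex fst (sgstep h) (rquot F0 F1) [:: t1; fun z => 2^-1 * t2 z].
Proof.
move=> F0L F1L E1 E2.
have two F : CL 2 F -> Ex fst (sgstep h) (dquot h cur pt F) [:: dcoef cur pt F 1; dcoef cur pt F 2].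
  by move=> FL; apply: (dquot_Ex_seq FL) => // -[|[|]].
have H := ExR _ (two _ F0L) (two _ F1L); have {}H := H (erefl 2%N).
apply: (Ex2_ext H) => // z; rewrite /dcoef.
- have -> : (1`!)%:R = 1 :> R by [].
  by rewrite !divr1; exact: E1.
- have -> : (2`!)%:R = 2 :> R by rewrite !(factS, fact0).
  by rewrite -E2 !mulrA -mulrDl mulrC.
Qed.

End RotatedQuotients.

(** * The products at a node for a family of flows *)

Section Assembly.
Context {R : realType} {P Q : Type} (cur nxt : Q -> P) (pt h : Q -> R) (hp : P -> R).
Hypothesis h0 : forall z, 0 < h z.
Hypothesis h1 : forall z, `|h z| <= 1.
Hypothesis hpc : forall z, hp (cur z) = h z.
Variables (X Z U0 U1 W0 W1 cc ss q q1 q2 q3 k k1 k2 : P -> R -> R).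
Variables (A B T1 T2 T3 T4 N1 N2 N3 N4 a G : P -> R -> R) (c c' : R).
Hypotheses (c0 : 0 < c) (cq : forall p x, c <= q p x).
Hypothesis cs1 : forall p x, cc p x ^+ 2 + ss p x ^+ 2 = 1.
Hypothesis (c'0 : 0 < c').
Hypothesis (cc' : c' <= c).
Hypothesis chord : forall s, c' <= Num.sqrt (dquot h cur pt X s ^+ 2 + dquot h cur pt Z s ^+ 2).
Hypothesis FY1 : framed cc ss (dn 1 X) (dn 1 Z) q (fun _ _ => 0).
Hypothesis FY2 : framed cc ss (dn 2 X) (dn 2 Z) q1 (fun p x => - (q p x ^+ 2 * k p x)).
Hypothesis FY3 : framed cc ss (dn 3 X) (dn 3 Z) (fun p x => yT3 (q p x) (q2 p x) (k p x))
  (fun p x => yN3 (q p x) (q1 p x) (k p x) (k1 p x)).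
Hypothesis FY4 : framed cc ss (dn 4 X) (dn 4 Z)
  (fun p x => yT4 (q p x) (q1 p x) (q3 p x) (k p x) (k1 p x))
  (fun p x => yN4 (q p x) (q1 p x) (q2 p x) (k p x) (k1 p x) (k2 p x)).
Hypothesis FU : framed cc ss U0 U1 B A.
Hypothesis FU1 : framed cc ss (dn 1 U0) (dn 1 U1) T1 N1.
Hypothesis FU2 : framed cc ss (dn 2 U0) (dn 2 U1) T2 N2.
Hypothesis FU3 : framed cc ss (dn 3 U0) (dn 3 U1) T3 N3.
Hypothesis FU4 : framed cc ss (dn 4 U0) (dn 4 U1) T4 N4.
Hypothesis AE : forall p x, A p x = - k p x + hp p ^+ 2 * a p x.
Hypothesis tangE : forall p x, ytang1 (q p x) (q1 p x) (k p x) (T1 p x) (T2 p x) 0 0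
  = hp p ^+ 2 * (2 * q p x * G p x).
Hypotheses (XL : CL 5 X) (ZL : CL 5 Z) (U0L : CL 5 U0) (U1L : CL 5 U1) (W0L : CL 2 W0) (W1L : CL 2 W1).
Hypotheses (cc_bd : unif_bounded cc) (ss_bd : unif_bounded ss) (q_bd : unif_bounded q).
Hypotheses (a_bd : unif_bounded a) (G_bd : unif_bounded G).

Definition value3 (F F1 F2 : P -> R -> R) := exists K, forall z x,
  `|F (nxt z) x - F (cur z) x - h z ^+ 2 * F1 (cur z) x - 2^-1 * (h z ^+ 2) ^+ 2 * F2 (cur z) x|
  <= K * (h z ^+ 2) ^+ 3.
(** Jump at the node of the difference quotients of F. The weights become the inverse lengths of the
    two edge quotients, taken at the initial time of the step. *)
Definition wjump (al be : Q -> R) (F : P -> R -> R) p z :=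
  (F p (pt z + h z) - F p (pt z)) / h z * al z
  - (F p (pt z - h z) - F p (pt z)) / (- h z) * be z.
Definition quotient3 (F F1 F2 : P -> R -> R) := forall al be, bdd al -> bdd be ->
  (exists K, forall z, `|al z - be z| <= K * h z) -> exists K, forall z,
  `|wjump al be F (nxt z) z - wjump al be F (cur z) z - h z ^+ 2 * wjump al be F1 (cur z) z
    - 2^-1 * (h z ^+ 2) ^+ 2 * wjump al be F2 (cur z) z| <= K * h z * (h z ^+ 2) ^+ 3.

Hypotheses (Xv : value3 X U0 W0) (Zv : value3 Z U1 W1).
Hypotheses (Xq : quotient3 X U0 W0) (Zq : quotient3 Z U1 W1).

Let u z := cc (cur z) (pt z).
Let v z := ss (cur z) (pt z).
Let v' z := - cc (cur z) (pt z).
Local Notation rqt := (rquot cur pt h u v).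
Local Notation rqn := (rquot cur pt h v v').
Local Notation at_node F := (fun z => F (cur z) (pt z)).

Definition inct (F : P -> R -> R) z x := (F (nxt z) x - F (cur z) x) / h z ^+ 2.
Definition incq F s := (inct F s.1 (pt s.1 + sgstep h s) - inct F s.1 (pt s.1)) / sgstep h s.
Definition incqt s := u s.1 * incq X s + v s.1 * incq Z s.
Definition incqn s := v s.1 * incq X s + v' s.1 * incq Z s.
Definition incvt z := u z * inct X z (pt z) + v z * inct Z z (pt z).
Definition incvn z := v z * inct X z (pt z) + v' z * inct Z z (pt z).

Let at_bd F : unif_bounded F -> bdd (fun z => F (cur z) (pt z)).
Proof. by move=> [K FK]; exists K => z; exact: FK. Qed.

Let u_bd : bdd u. Proof. exact: at_bd. Qed.
Let v_bd : bdd v. Proof. exact: at_bd. Qed.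
Let v'_bd : bdd v'. Proof. exact: bddN u_bd. Qed.

Let ft F0 F1 t n : framed cc ss F0 F1 t n -> forall z,
  u z * F0 (cur z) (pt z) + v z * F1 (cur z) (pt z) = t (cur z) (pt z).
Proof.
move=> [e0 e1] z; rewrite e0 e1 /u /v.
set p := cur z; set x := pt z.
by transitivity (t p x * (cc p x ^+ 2 + ss p x ^+ 2)); [ring|rewrite cs1 mulr1].
Qed.

Let fn F0 F1 t n : framed cc ss F0 F1 t n -> forall z,
  v z * F0 (cur z) (pt z) + v' z * F1 (cur z) (pt z) = n (cur z) (pt z).
Proof.
move=> [e0 e1] z; rewrite e0 e1 /v' /v.
set p := cur z; set x := pt z.
by transitivity (n p x * (cc p x ^+ 2 + ss p x ^+ 2)); [ring|rewrite cs1 mulr1].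
Qed.

Let et := rqt X Z.
Let en := rqn X Z.
Local Notation E5 F l := (Ex fst (sgstep h) F l).

Let etE : exists r, E5 et [:: at_node q; at_node (fun p x => 2^-1 * q1 p x);
  at_node (fun p x => 6^-1 * yT3 (q p x) (q2 p x) (k p x));
  at_node (fun p x => 24^-1 * yT4 (q p x) (q1 p x) (q3 p x) (k p x) (k1 p x)); r].
Proof.
apply: (rquot_Ex5 h0 u_bd v_bd XL ZL); first exact: (ft FY1).
- by move=> z; rewrite (ft FY2); field.
- by move=> z; rewrite (ft FY3); field.
- by move=> z; rewrite (ft FY4); field.
Qed.

Let enE : exists r, E5 en [:: (fun=> 0); at_node (fun p x => - 2^-1 * q p x ^+ 2 * k p x);
  at_node (fun p x => 6^-1 * yN3 (q p x) (q1 p x) (k p x) (k1 p x));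
  at_node (fun p x => 24^-1 * yN4 (q p x) (q1 p x) (q2 p x) (k p x) (k1 p x) (k2 p x)); r].
Proof.
apply: (rquot_Ex5 h0 v_bd v'_bd XL ZL); first exact: (fn FY1).
- by move=> z; rewrite (fn FY2); field.
- by move=> z; rewrite (fn FY3); field.
- by move=> z; rewrite (fn FY4); field.
Qed.

Let dtE : exists r, E5 (rqt U0 U1) [:: at_node T1; at_node (fun p x => 2^-1 * T2 p x);
  at_node (fun p x => 6^-1 * T3 p x); at_node (fun p x => 24^-1 * T4 p x); r].
Proof.
apply: (rquot_Ex5 h0 u_bd v_bd U0L U1L); first exact: (ft FU1).
- by move=> z; rewrite (ft FU2); field.
- by move=> z; rewrite (ft FU3); field.
- by move=> z; rewrite (ft FU4); field.
Qed.

Let dnE : exists r, E5 (rqn U0 U1) [:: at_node N1; at_node (fun p x => 2^-1 * N2 p x);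
  at_node (fun p x => 6^-1 * N3 p x); at_node (fun p x => 24^-1 * N4 p x); r].
Proof.
apply: (rquot_Ex5 h0 v_bd v'_bd U0L U1L); first exact: (fn FU1).
- by move=> z; rewrite (fn FU2); field.
- by move=> z; rewrite (fn FU3); field.
- by move=> z; rewrite (fn FU4); field.
Qed.

Let w i z := u z * dn i W0 (cur z) (pt z) + v z * dn i W1 (cur z) (pt z).
Let m i z := v z * dn i W0 (cur z) (pt z) + v' z * dn i W1 (cur z) (pt z).

Let wtE : E5 (rqt W0 W1) [:: w 1; fun z => 2^-1 * w 2 z].
Proof. exact: (rquot_Ex2 h0 u_bd v_bd W0L W1L). Qed.

Let wnE : E5 (rqn W0 W1) [:: m 1; fun z => 2^-1 * m 2 z].
Proof. exact: (rquot_Ex2 h0 v_bd v'_bd W0L W1L). Qed.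

Lemma rlenE s : rlen et en s = Num.sqrt (dquot h cur pt X s ^+ 2 + dquot h cur pt Z s ^+ 2).
Proof.
rewrite /rlen /et /en /rquot /v' /u /v; congr Num.sqrt.
move: (dquot _ _ _ X s) (dquot _ _ _ Z s) => d e.
have := cs1 (cur s.1) (pt s.1).
move: (cc _ _) (ss _ _) => c1 s1 E.
by transitivity ((d ^+ 2 + e ^+ 2) * (c1 ^+ 2 + s1 ^+ 2)); [ring|rewrite E mulr1].
Qed.

Let rc s : c' <= rlen et en s. Proof. by rewrite rlenE. Qed.

Let inctE F F1 F2 : unif_bounded F1 -> unif_bounded F2 -> value3 F F1 F2 ->
  Ex id (sqstep h) (fun z => inct F z (pt z)) [:: at_node F1; fun z => 2^-1 * F2 (cur z) (pt z)].
Proof.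
move=> b1 b2 [K FK]; apply: Ex_of_remainder.
- by move=> z; rewrite /sqstep expf_neq0 ?gt_eqF.
- move=> [|[|//]] _ /=; first exact: at_bd.
  by apply: bddM (at_bd b2); exact: bdd_cst.
- exists K => z; have hn : h z ^+ 2 != 0 by rewrite expf_neq0 ?gt_eqF.
  have h2 : 0 < h z ^+ 2 by rewrite exprn_gt0.
  rewrite /= /sqstep mulr0 addr0 (ger0_norm (sqr_ge0 _)).
  have -> : inct F z (pt z) - (F1 (cur z) (pt z) + h z ^+ 2 * (2^-1 * F2 (cur z) (pt z))) =
    (F (nxt z) (pt z) - F (cur z) (pt z) - h z ^+ 2 * F1 (cur z) (pt z)
     - 2^-1 * (h z ^+ 2) ^+ 2 * F2 (cur z) (pt z)) / h z ^+ 2.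
    rewrite /inct; move: hn; move: (h z ^+ 2) (F _ _) (F _ _) (F1 _ _) (F2 _ _) => H f g f1 f2 hn.
    by field.
  rewrite normrM normfV (gtr0_norm h2) ler_pdivrMr//; apply: le_trans (FK _ _) _.
  by rewrite exprSr mulrA.
Qed.

Let ExR2 (f g F F' : Q -> R) f0 f1 g0 g1 : bdd f -> bdd g ->
  Ex id (sqstep h) F [:: f0; f1] -> Ex id (sqstep h) F' [:: g0; g1] ->
  Ex id (sqstep h) (fun z => f z * F z + g z * F' z)
    [:: (fun z => f z * f0 z + g z * g0 z); (fun z => f z * f1 z + g z * g1 z)].
Proof. by move=> bf bg FE FE'; exact: (ExD2 (ExZ bf FE) (ExZ bg FE')). Qed.

Let vtE : Ex id (sqstep h) incvt [:: at_node B; fun z => 2^-1 * w 0 z].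
Proof.
have H := ExR2 u_bd v_bd (inctE (CL_bounded U0L) (CL_bounded W0L) Xv)
   (inctE (CL_bounded U1L) (CL_bounded W1L) Zv).
apply: (Ex2_ext H) => // z; first exact: (ft FU).
by rewrite /w mulrDr; congr (_ + _); exact: mulrCA.
Qed.

Let vnE : Ex id (sqstep h) incvn [:: at_node A; fun z => 2^-1 * m 0 z].
Proof.
have H := ExR2 v_bd v'_bd (inctE (CL_bounded U0L) (CL_bounded W0L) Xv)
   (inctE (CL_bounded U1L) (CL_bounded W1L) Zv).
apply: (Ex2_ext H) => // z; first exact: (fn FU).
by rewrite /m mulrDr; congr (_ + _); exact: mulrCA.
Qed.

Let al z := (rlen et en (z, true))^-1.
Let be z := (rlen et en (z, false))^-1.

Let inv_rlen_bd : bdd (fun s => (rlen et en s)^-1).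
Proof. by apply: (bddV c'0) => s; rewrite ger0_norm ?rc// sqrtr_ge0. Qed.

Let al_bd : bdd al. Proof. by have [K b] := inv_rlen_bd; exists K => z; exact: b. Qed.
Let be_bd : bdd be. Proof. by have [K b] := inv_rlen_bd; exists K => z; exact: b. Qed.

Let q_at z : c' <= q (cur z) (pt z). Proof. exact: le_trans cc' (cq _ _). Qed.

(** The two inverse lengths have the same leading coefficient 1/q. *)
Let al_be : exists K, forall z, `|al z - be z| <= K * h z.
Proof.
have [r0 rE] := etE; have [r1 sE] := enE.
have [i4 iE] := node_i h1 c'0 q_at rc rE sE.
Transparent Ex.
move: iE => [_ [F [FE FL]]].
have FL' : Ex fst (sgstep h) F [:: _; _; _; i4] := FL.
Opaque Ex.
have [K FK] := Ex_bdd (sgstep_le1 h1) FL'.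
exists (K + K) => z.
have -> : al z - be z = (F (z, true) + F (z, false)) * h z.
  by rewrite /al /be /rlen (FE (z, true)) (FE (z, false)) /sgstep /=; ring.
rewrite normrM (gtr0_norm (h0 z)) ler_wpM2r ?(ltW (h0 z))//.
by apply: le_trans (ler_normD _ _) _; exact: lerD.
Qed.

Let jump_rquot f g F0 F1 z : jump et en (rquot cur pt h f g F0 F1) z =
  f z * wjump al be F0 (cur z) z + g z * wjump al be F1 (cur z) z.
Proof.
have aux (f' g' a1 b1 a2 b2 r s : R) : (f' * a1 + g' * b1) * r - (f' * a2 + g' * b2) * s =
  f' * (a1 * r - a2 * s) + g' * (b1 * r - b2 * s) by ring.
exact: aux.
Qed.

Let jump_incq f g z : jump et en (fun s => f s.1 * incq X s + g s.1 * incq Z s) z =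
  (h z ^+ 2)^-1 * (f z * (wjump al be X (nxt z) z - wjump al be X (cur z) z)
    + g z * (wjump al be Z (nxt z) z - wjump al be Z (cur z) z)).
Proof.
have aux (f' g' xp xp' x x' xm xm' zp zp' z0 z' zm zm' i j r s : R) :
  (f' * (((xp' - xp) * i - (x' - x) * i) * j) + g' * (((zp' - zp) * i - (z' - z0) * i) * j)) * r
  - (f' * (((xm' - xm) * i - (x' - x) * i) * (- j)) + g' * (((zm' - zm) * i - (z' - z0) * i) * (- j))) * s
  = i * (f' * ((xp' - x') * j * r - (xm' - x') * (- j) * s - ((xp - x) * j * r - (xm - x) * (- j) * s))
     + g' * ((zp' - z') * j * r - (zm' - z') * (- j) * s - ((zp - z0) * j * r - (zm - z0) * (- j) * s))).
  by ring.
rewrite /jump /incq /inct /sgstep /wjump /= invrN; exact: aux.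
Qed.

(** The Taylor remainder in time of the jumps is of order h (h^2)^3; division by the time step h^2
    leaves h^5. *)
Let inc_jump f g : bdd f -> bdd g -> exists K, forall z,
  `|jump et en (fun s => f s.1 * incq X s + g s.1 * incq Z s) z
    - jump et en (rquot cur pt h f g U0 U1) z
    - 2^-1 * h z ^+ 2 * jump et en (rquot cur pt h f g W0 W1) z| <= K * h z ^+ 5.
Proof.
move=> [Kf fK] [Kg gK]; have [K1 K1P] := Xq al_bd be_bd al_be; have [K2 K2P] := Zq al_bd be_bd al_be.
exists (Kf * K1 + Kg * K2) => z; rewrite jump_incq !jump_rquot.
have h2 : 0 < h z ^+ 2 by rewrite exprn_gt0.
have := K1P z; have := K2P z; have := fK z; have := gK z.
move: (wjump al be X (nxt z) z) (wjump al be X (cur z) z) (wjump al be Z (nxt z) z)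
  (wjump al be Z (cur z) z) => x x' y y'.
move: (wjump _ _ U0 _ _) (wjump _ _ U1 _ _) (wjump _ _ W0 _ _) (wjump _ _ W1 _ _) => p p' w0 w0'.
move: (f z) (g z) => f' g' gB fB R2 R1.
have -> : (h z ^+ 2)^-1 * (f' * (x - x') + g' * (y - y')) - (f' * p + g' * p')
   - 2^-1 * h z ^+ 2 * (f' * w0 + g' * w0') =
  (f' * (x - x' - h z ^+ 2 * p - 2^-1 * (h z ^+ 2) ^+ 2 * w0)
   + g' * (y - y' - h z ^+ 2 * p' - 2^-1 * (h z ^+ 2) ^+ 2 * w0')) / h z ^+ 2.
  move: h2; move: (h z ^+ 2) => H H0.
  by field; rewrite gt_eqF.
rewrite normrM normfV (gtr0_norm h2) ler_pdivrMr//; apply: (le_trans (ler_normD _ _)).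
rewrite !normrM.
apply: (@le_trans _ _ (Kf * (K1 * h z * (h z ^+ 2) ^+ 3) + Kg * (K2 * h z * (h z ^+ 2) ^+ 3))).
  by apply: lerD; apply: ler_pM.
by rewrite le_eqVlt; apply/orP; left; apply/eqP; ring.
Qed.

Lemma node_low :
  (exists D, bdd D /\ forall z, node_tang h et en incqt incqn z = h z ^+ 5 * D z) /\
  (exists D, bdd D /\ forall z, node_norm h et en incqt incqn incvt incvn z = h z ^+ 3 * D z).
Proof.
have [e4 etE'] := etE; have [n4 enE'] := enE; have [d4 dtE'] := dtE; have [m4 dnE'] := dnE.
have ht := inc_jump u_bd v_bd; have hn := inc_jump v_bd v'_bd.
have t1_bd : bdd (fun z => 2 * q (cur z) (pt z) * G (cur z) (pt z)).
  by apply: bddM (at_bd G_bd); apply: bddM (at_bd q_bd); exact: bdd_cst.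
have n1_bd : bdd (fun z => 2 * q (cur z) (pt z) ^+ 2 * a (cur z) (pt z)).
  by apply: bddM (at_bd a_bd); apply: bddM (bddX _ (at_bd q_bd)); exact: bdd_cst.
have tE z := tangE (cur z) (pt z); have q0 z : q (cur z) (pt z) != 0.
  by rewrite gt_eqF// (lt_le_trans c0 (cq _ _)).
refine (node_bound_low h0 h1 c'0 q_at rc etE' enE' dtE' dnE' vtE vnE wtE wnE ht hn t1_bd n1_bd _ _).
- by move=> z; rewrite -(hpc z) -tE.
- move=> z; rewrite -(hpc z); have := ynorm1E (q1 (cur z) (pt z)) (k (cur z) (pt z)) (a (cur z) (pt z))
    (hp (cur z) ^+ 2) (q0 z); rewrite -AE; exact: id.
Qed.

Section High.
Variables (k3 b b1 b2 b3 b4 a1 a2 a3 e e1 e2 e3 e4 A1 A2 A3 B1 B2 B3 B4 : P -> R -> R).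
Hypothesis hp1 : forall p, `|hp p| <= 1.
Hypothesis T1E : forall p x, T1 p x = velT1 q k A B1 p x.
Hypothesis N1E : forall p x, N1 p x = velN1 q k A1 B p x.
Hypothesis T2E : forall p x, T2 p x = velT2 q q1 k k1 A A1 B B2 p x.
Hypothesis N2E : forall p x, N2 p x = velN2 q q1 k k1 A A2 B B1 p x.
Hypothesis T3E : forall p x, T3 p x = velT3 q q1 q2 k k1 k2 A A1 A2 B B1 B3 p x.
Hypothesis T4E : forall p x, T4 p x = velT4 q q1 q2 q3 k k1 k2 k3 A A1 A2 A3 B B1 B2 B4 p x.
Hypothesis A1E : forall p x, A1 p x = - k1 p x + hp p ^+ 2 * a1 p x.
Hypothesis A2E : forall p x, A2 p x = - k2 p x + hp p ^+ 2 * a2 p x.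
Hypothesis A3E : forall p x, A3 p x = - k3 p x + hp p ^+ 2 * a3 p x.
Hypothesis BE : forall p x, B p x = b p x + hp p ^+ 2 * e p x.
Hypothesis B1E : forall p x, B1 p x = b1 p x + hp p ^+ 2 * e1 p x.
Hypothesis B2E : forall p x, B2 p x = b2 p x + hp p ^+ 2 * e2 p x.
Hypothesis B3E : forall p x, B3 p x = b3 p x + hp p ^+ 2 * e3 p x.
Hypothesis B4E : forall p x, B4 p x = b4 p x + hp p ^+ 2 * e4 p x.
Hypothesis b2E : forall p x, b2 p x = beta0_form (q p x) (q1 p x) (k p x) (k1 p x) (b p x) (b1 p x).
Hypothesis b3E : forall p x, b3 p x = beta0_form1 (q p x) (q1 p x) (q2 p x) (k p x) (k1 p x) (k2 p x)
  (b p x) (b1 p x) (b2 p x).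
Hypothesis b4E : forall p x, b4 p x = beta0_form2 (q p x) (q1 p x) (q2 p x) (q3 p x) (k p x) (k1 p x)
  (k2 p x) (k3 p x) (b p x) (b1 p x) (b2 p x) (b3 p x).
Hypothesis aE : forall p x, a p x = alpha2_form (q p x) (q1 p x) (k p x) (k1 p x) (k2 p x) (b p x) (b1 p x).
Hypothesis GE : forall p x, G p x = G2_form (q p x) (q1 p x) (q2 p x) (k p x) (k1 p x) (k2 p x) (k3 p x)
  (b p x) (b1 p x) (b2 p x) (b3 p x).
Hypotheses (q1_bd : unif_bounded q1) (q2_bd : unif_bounded q2) (q3_bd : unif_bounded q3).
Hypotheses (k_bd : unif_bounded k) (k1_bd : unif_bounded k1) (k2_bd : unif_bounded k2) (k3_bd : unif_bounded k3).
Hypotheses (b_bd : unif_bounded b) (b1_bd : unif_bounded b1) (b2_bd : unif_bounded b2) (b3_bd : unif_bounded b3)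
  (b4_bd : unif_bounded b4).
Hypotheses (a1_bd : unif_bounded a1) (a2_bd : unif_bounded a2) (a3_bd : unif_bounded a3).
Hypotheses (e_bd : unif_bounded e) (e1_bd : unif_bounded e1) (e2_bd : unif_bounded e2) (e3_bd : unif_bounded e3)
  (e4_bd : unif_bounded e4).
Hypotheses (ccL : CL 1 cc) (ssL : CL 1 ss) (qL : CL 1 q) (qVL : CL 1 (fun p x => (q p x)^-1)).
Hypotheses (q1L : CL 1 q1) (kL : CL 1 k) (T1L : CL 1 T1) (T2L : CL 1 T2) (N1L : CL 1 N1) (N2L : CL 1 N2).
Hypothesis acc_n : exists d, bdd d /\ forall z,
    ss (cur z) (pt z) * W0 (cur z) (pt z) - cc (cur z) (pt z) * W1 (cur z) (pt z) =
    yNu (q (cur z) (pt z)) (q1 (cur z) (pt z)) (k (cur z) (pt z)) (B (cur z) (pt z))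
      (A (cur z) (pt z)) (T1 (cur z) (pt z)) (N1 (cur z) (pt z)) (N2 (cur z) (pt z))
    + h z ^+ 2 * d z.
(** Stated at every point of the curve and not only at the node, because the third coefficient of
    the quotient of W depends on values around the node. *)
Hypothesis acc_t : exists d : Q * R -> R, bdd d /\ forall z,
    (cc (cur z.1) z.2 * dn 2 W0 (cur z.1) z.2 + ss (cur z.1) z.2 * dn 2 W1 (cur z.1) z.2)
      * (q (cur z.1) z.2)^-1
    - (cc (cur z.1) z.2 * dn 1 W0 (cur z.1) z.2 + ss (cur z.1) z.2 * dn 1 W1 (cur z.1) z.2)
      * q1 (cur z.1) z.2 * (q (cur z.1) z.2)^-1 ^+ 2 =
    yGamma (q (cur z.1) z.2) (q1 (cur z.1) z.2) (k (cur z.1) z.2) (T1 (cur z.1) z.2)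
      (T2 (cur z.1) z.2) (N1 (cur z.1) z.2) (N2 (cur z.1) z.2) + h z.1 ^+ 2 * d z.

(* The pairs (p, true) carry the velocity of the curve and (p, false) its leading part V0. *)
Let curL z := (cur z, false).
Let nxtL z := (cur z, true).
Let lift0 (F : P -> R -> R) (p : P * bool) := F p.1.
Let lift (F D : P -> R -> R) (p : P * bool) x :=
  if p.2 then F p.1 x + hp p.1 ^+ 2 * D p.1 x else F p.1 x.

Let CS_lift0 F : unif_bounded F -> CS curL nxtL pt h (lift0 F).
Proof.
move=> [K FK]; split; first by exists K => p x; exact: FK.
by exists 0 => z; rewrite /lift0 /= subrr normr0 mul0r.
Qed.

Let CS_lift F D : unif_bounded F -> unif_bounded D -> CS curL nxtL pt h (lift F D).
Proof.
move=> [K FK] [L DL]; split.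
  exists (K + L) => -[p [] x]; rewrite /lift /=.
    apply: le_trans (ler_normD _ _) _; apply: lerD => //.
    rewrite normrM -[L]mul1r; apply: ler_pM => //.
    by rewrite normrX exprn_ile1.
  by apply: le_trans (FK p x) _; rewrite lerDl; exact: le_trans (normr_ge0 _) (DL p x).
exists L => z; rewrite /lift /= [X in X - _]addrC addrK hpc normrM (ger0_norm (sqr_ge0 _)) mulrC.
by rewrite ler_wpM2r ?sqr_ge0.
Qed.

(** By the identities these sums vanish when the velocity is replaced by V0. The actual velocity
    differs from V0 by h^2 V2, which by [CS_defects] changes them by O(h^2). *)
Let defects : (exists D, bdd D /\ forall z, 2 * q (cur z) (pt z) * G (cur z) (pt z)
      + (ytang3 (q (cur z) (pt z)) (q1 (cur z) (pt z)) (q2 (cur z) (pt z)) (q3 (cur z) (pt z))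
           (k (cur z) (pt z)) (k1 (cur z) (pt z)) (k2 (cur z) (pt z))
           (T1 (cur z) (pt z)) (T2 (cur z) (pt z)) (T3 (cur z) (pt z)) (T4 (cur z) (pt z))
           (N1 (cur z) (pt z)) (N2 (cur z) (pt z))
         + q (cur z) (pt z) * yGamma (q (cur z) (pt z)) (q1 (cur z) (pt z)) (k (cur z) (pt z))
           (T1 (cur z) (pt z)) (T2 (cur z) (pt z)) (N1 (cur z) (pt z)) (N2 (cur z) (pt z)))
      = h z ^+ 2 * D z) /\
  (exists D, bdd D /\ forall z, 2 * q (cur z) (pt z) ^+ 2 * a (cur z) (pt z)
      + ynorm3 (q (cur z) (pt z)) (q1 (cur z) (pt z)) (q2 (cur z) (pt z)) (q3 (cur z) (pt z))
         (k (cur z) (pt z)) (k1 (cur z) (pt z)) (k2 (cur z) (pt z)) (B (cur z) (pt z)) (A (cur z) (pt z))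
         (yNu (q (cur z) (pt z)) (q1 (cur z) (pt z)) (k (cur z) (pt z)) (B (cur z) (pt z))
            (A (cur z) (pt z)) (T1 (cur z) (pt z)) (N1 (cur z) (pt z)) (N2 (cur z) (pt z)))
         (T1 (cur z) (pt z)) (T2 (cur z) (pt z)) (N1 (cur z) (pt z)) (N2 (cur z) (pt z))
      = h z ^+ 2 * D z).
Proof.
have q0 z : q (cur z) (pt z) != 0 by rewrite gt_eqF// (lt_le_trans c0 (cq _ _)).
have qV_bd : unif_bounded (fun p x => (q p x)^-1) by exact: CL_bounded qVL.
have neg (F : P -> R -> R) : unif_bounded F -> unif_bounded (fun p x => - F p x) by exact: unif_boundedN.
have flip (x y x0 y0 : R) : x = x0 -> y = y0 -> - x + y = y0 - x0.
  by move=> -> ->; exact: addrC.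
have [t n] := CS_defects (CS_lift0 q_bd) (CS_lift0 qV_bd) (CS_lift0 q1_bd) (CS_lift0 q2_bd)
  (CS_lift0 q3_bd) (CS_lift0 k_bd) (CS_lift0 k1_bd) (CS_lift0 k2_bd) (CS_lift0 k3_bd)
  (CS_lift (neg _ k_bd) a_bd) (CS_lift (neg _ k1_bd) a1_bd) (CS_lift (neg _ k2_bd) a2_bd)
  (CS_lift (neg _ k3_bd) a3_bd) (CS_lift b_bd e_bd) (CS_lift b1_bd e1_bd) (CS_lift b2_bd e2_bd)
  (CS_lift b3_bd e3_bd) (CS_lift b4_bd e4_bd).
have [Dt [bDt DtE]] := remainder_factor h0 t.2; have [Dn [bDn DnE]] := remainder_factor h0 n.2.
split.
- exists Dt; split => // z; rewrite -DtE.
  have := tangential_identity (q0 z) (b2E (cur z) (pt z)) (b3E (cur z) (pt z)) (b4E (cur z) (pt z)).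
  rewrite -GE -addrA => /eqP; rewrite addr_eq0 => /eqP ->.
  refine (flip _ _ _ _ erefl _); rewrite T1E T2E T3E T4E N1E N2E.
  rewrite /velT1 /velT2 /velT3 /velT4 /velN1 /velN2.
  rewrite AE A1E A2E A3E BE B1E B2E B3E B4E; reflexivity.
- exists Dn; split => // z; rewrite -DnE.
  have := normal_identity (q1 (cur z) (pt z)) (q2 (cur z) (pt z)) (q3 (cur z) (pt z)) (k (cur z) (pt z))
    (k1 (cur z) (pt z)) (k2 (cur z) (pt z)) (b (cur z) (pt z)) (b1 (cur z) (pt z)) (b2 (cur z) (pt z)) (q0 z).
  rewrite -aE => /eqP; rewrite addr_eq0 => /eqP ->.
  refine (flip _ _ _ _ erefl _); rewrite T1E T2E N1E N2E.
  rewrite /velT1 /velT2 /velN1 /velN2.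
  rewrite AE A1E A2E BE B1E B2E; reflexivity.
Qed.

Let wtE3 : exists d, E5 (rqt W0 W1) [:: w 1; fun z => 2^-1 * w 2 z; d].
Proof.
(* The relation [acc_t] without its error term, solved for W'' . tau. *)
pose S p x := q p x * yGamma (q p x) (q1 p x) (k p x) (T1 p x) (T2 p x) (N1 p x) (N2 p x)
  + (cc p x * dn 1 W0 p x + ss p x * dn 1 W1 p x) * q1 p x * (q p x)^-1.
have W0d : CL 1 (dn 1 W0) := @CL_dn _ _ 1 1 _ W0L; have W1d : CL 1 (dn 1 W1) := @CL_dn _ _ 1 1 _ W1L.
have SL : CL 1 S.
  apply: CLD; first exact (CLM qL (CL_yGamma qL qVL q1L kL T1L T2L N1L N2L)).
  exact (CLM (CLM (CLD (CLM ccL W0d) (CLM ssL W1d)) q1L) qVL).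
have near : exists K, forall z x, `|cc (cur z) x * dn 2 W0 (cur z) x + ss (cur z) x * dn 2 W1 (cur z) x
    - S (cur z) x| <= K * h z ^+ 2.
  have [d [[K dK] dE]] := acc_t; have [L qL'] := q_bd; exists (L * K) => z x.
  have qn : q (cur z) x != 0 by rewrite gt_eqF// (lt_le_trans c0 (cq _ _)).
  have E := dE (z, x); rewrite /= in E.
  have aux (w2 w1 g d' Q0 Q1 H : R) : Q0 != 0 -> w2 * Q0^-1 - w1 * Q1 * Q0^-1 ^+ 2 = g + H * d' ->
    w2 - (Q0 * g + w1 * Q1 * Q0^-1) = Q0 * (d' * H).
    move=> Q0n e'; have -> : d' * H = w2 * Q0^-1 - w1 * Q1 * Q0^-1 ^+ 2 - g by rewrite e'; ring.
    by field.
  rewrite /S (aux _ _ _ _ _ _ _ qn E).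
  rewrite normrM -mulrA; apply: ler_pM => //; rewrite normrM (ger0_norm (sqr_ge0 _)).
  by rewrite ler_wpM2r ?sqr_ge0.
have [d dE] := tangential_quotient pt h0 ccL ssL W0L W1L SL near; exists d.
have E : (fun z => 2^-1 * w 2 z) = (fun z => w 2 z / 2) by apply/funext => z; rewrite mulrC.
by rewrite E; exact: dE.
Qed.

Lemma node_high :
  (exists D, bdd D /\ forall z, node_tang h et en incqt incqn z = h z ^+ 7 * D z) /\
  (exists D, bdd D /\ forall z, node_norm h et en incqt incqn incvt incvn z = h z ^+ 5 * D z).
Proof.
have [e4' etE'] := etE; have [n4 enE'] := enE; have [d4 dtE'] := dtE; have [m4 dnE'] := dnE.
have [w3 wtE3'] := wtE3.
have ht := inc_jump u_bd v_bd; have hn := inc_jump v_bd v'_bd.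
have [[Dt [bDt DtE]] [Dn [bDn DnE]]] := defects.
have [dn_ [bdn dnE_]] := acc_n; have [dt_ [bdt dtE_]] := acc_t.
have bdt' : bdd (fun z => dt_ (z, pt z)) by have [K dK] := bdt; exists K => z; exact: dK.
have u1_bd : bdd (fun z => Dt z + q (cur z) (pt z) * dt_ (z, pt z)).
  by apply: bddD bDt _; apply: bddM (at_bd q_bd) bdt'.
have u2_bd : bdd (fun z => Dn z + q (cur z) (pt z) ^+ 2 * dn_ z).
  by apply: bddD bDn _; apply: bddM (bddX _ (at_bd q_bd)) bdn.
have tE z := tangE (cur z) (pt z); have q0 z : q (cur z) (pt z) != 0.
  by rewrite gt_eqF// (lt_le_trans c0 (cq _ _)).
refine (node_bound_high h0 h1 c'0 q_at rc etE' enE' dtE' dnE' vtE vnE wtE wnE ht hn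
  (t1 := fun z => 2 * q (cur z) (pt z) * G (cur z) (pt z))
  (n1 := fun z => 2 * q (cur z) (pt z) ^+ 2 * a (cur z) (pt z)) u1_bd u2_bd wtE3' _ _ _ _).
- by move=> z; rewrite -(hpc z) -tE.
- move=> z; rewrite -(hpc z); have := ynorm1E (q1 (cur z) (pt z)) (k (cur z) (pt z)) (a (cur z) (pt z))
    (hp (cur z) ^+ 2) (q0 z); rewrite -AE; exact: id.
- move=> z; rewrite [RHS]mulrDr -DtE.
  have E := dtE_ (z, pt z); rewrite /= in E.
  have aux (x y g w1 w2 Q0 Q1 H d : R) : Q0 != 0 -> w2 * Q0^-1 - w1 * Q1 * Q0^-1 ^+ 2 = g + H * d ->
    x + y + 2 * Q0 * (w1 * (- (2^-1 * Q1) * Q0^-1 ^+ 2) + 2^-1 * w2 * Q0^-1) =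
    x + (y + Q0 * g) + H * (Q0 * d).
    move=> Q0n e'; have -> : g = w2 * Q0^-1 - w1 * Q1 * Q0^-1 ^+ 2 - H * d by rewrite e'; ring.
    by field.
  exact (aux _ _ _ _ _ _ _ _ _ (q0 z) E).
- move=> z; rewrite [RHS]mulrDr -DnE.
  have E := dnE_ z; have mE : m 0 z = ss (cur z) (pt z) * W0 (cur z) (pt z)
    - cc (cur z) (pt z) * W1 (cur z) (pt z) by rewrite /m /v /v' mulNr.
  have aux (Q0 E1' E2' E3' N1' N2' N3' A0' B0' nu x D0' D1' M0' M1' : R) :
    norm3 Q0 E1' E2' E3' N1' N2' N3' A0' B0' (2^-1 * (nu + x)) D0' D1' M0' M1' =
    norm3 Q0 E1' E2' E3' N1' N2' N3' A0' B0' (2^-1 * nu) D0' D1' M0' M1' + Q0 ^+ 2 * x.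
    rewrite /norm3; move: (un3 _ _ _ _ _ _ _) (un1 _ _ _) (ut1 _ _) (quo1 _ _ _ _) (nr2 _ _ _) => *.
    by field.
  rewrite mE E aux addrA [q _ _ ^+ 2 * (_ * dn_ z)]mulrCA; reflexivity.
Qed.

End High.
End Assembly.

(** * The contribution of one node in Cartesian coordinates *)

Section NodeAlgebraGlobal.
Context {R : realType}.
Variables (h xp zp xm zm dxp dzp dxm dzm vx vz : R).

Let rp := Num.sqrt (xp ^+ 2 + zp ^+ 2).
Let rm := Num.sqrt (xm ^+ 2 + zm ^+ 2).
Let E0 := xp + xm.
Let E1 := zp + zm.

(** [gtang] and [gnorm] are the products [node_tang] and [node_norm] in Cartesian components;
    [gterm] is the share of one node in the defect when the test function takes the value (f0, f1)
    there. *)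
Definition gtang : R :=
  2^-1 * (rp - rm) * ((xp / rp - xm / rm) ^+ 2 + (zp / rp - zm / rm) ^+ 2)
  + h ^+ 2 * ((dxp / rp - dxm / rm) * E0 + (dzp / rp - dzm / rm) * E1).
Definition gnorm : R :=
  h * (2^-1 * (vx * E1 - vz * E0) * (E0 ^+ 2 + E1 ^+ 2) / (rp + rm))
  - ((xp / rp - xm / rm) * E1 - (zp / rp - zm / rm) * E0)
  - h ^+ 2 * ((dxp / rp - dxm / rm) * E1 - (dzp / rp - dzm / rm) * E0).
Definition gterm (f0 f1 : R) : R :=
  2^-1 * ((h * rm + h * rp) * ((vx * E1 - vz * E0) / (rm + rp)) * ((f0 * E1 - f1 * E0) / (rm + rp)))
  + (((xm + h ^+ 2 * dxm) / rm - (xp + h ^+ 2 * dxp) / rp) * f0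
     + ((zm + h ^+ 2 * dzm) / rm - (zp + h ^+ 2 * dzp) / rp) * f1).

Hypotheses (rp0 : 0 < rp) (rm0 : 0 < rm).

(** E and R E are orthogonal and of equal length, so |E|^2 D = (D . E) E + (D . R E) R E. The mass
    term is a multiple of R E and drops out of D . E. *)
Lemma gtermE f0 f1 : gterm f0 f1 * (E0 ^+ 2 + E1 ^+ 2) =
  - gtang * (f0 * E0 + f1 * E1) + gnorm * (f0 * E1 - f1 * E0).
Proof.
have sp : rp ^+ 2 = xp ^+ 2 + zp ^+ 2 by rewrite sqr_sqrtr// addr_ge0 ?sqr_ge0.
have sm : rm ^+ 2 = xm ^+ 2 + zm ^+ 2 by rewrite sqr_sqrtr// addr_ge0 ?sqr_ge0.
(* For unit vectors u, u' one has (u - u') . (r u + s u') = (r - s) |u - u'|^2 / 2. A product linear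
   in the jumps becomes cubic, which is why the tangential product gains two powers of h. *)
have key : (xp / rp - xm / rm) * E0 + (zp / rp - zm / rm) * E1 =
   2^-1 * (rp - rm) * ((xp / rp - xm / rm) ^+ 2 + (zp / rp - zm / rm) ^+ 2).
  have up : (xp / rp) ^+ 2 + (zp / rp) ^+ 2 = 1.
    by rewrite !expr_div_n -mulrDl -sp divff// expf_neq0// gt_eqF.
  have um : (xm / rm) ^+ 2 + (zm / rm) ^+ 2 = 1.
    by rewrite !expr_div_n -mulrDl -sm divff// expf_neq0// gt_eqF.
  have xpE : xp = rp * (xp / rp) by rewrite mulrC divfK// gt_eqF.
  have zpE : zp = rp * (zp / rp) by rewrite mulrC divfK// gt_eqF.
  have xmE : xm = rm * (xm / rm) by rewrite mulrC divfK// gt_eqF.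
  have zmE : zm = rm * (zm / rm) by rewrite mulrC divfK// gt_eqF.
  rewrite /E0 /E1 {2}xpE {2}zpE {2}xmE {2}zmE.
  move: up um; move: (xp / rp) (zp / rp) (xm / rm) (zm / rm) => a b a' b' up um.
  have -> : (a - a') ^+ 2 + (b - b') ^+ 2 = (a ^+ 2 + b ^+ 2) + (a' ^+ 2 + b' ^+ 2) - 2 * (a * a' + b * b') by ring.
  rewrite up um.
  transitivity (rp * (a ^+ 2 + b ^+ 2) - rm * (a' ^+ 2 + b' ^+ 2) - (rp - rm) * (a * a' + b * b')); first by ring.
  by rewrite up um; field.
rewrite /gtang -key /gterm /gnorm.
move: rp0 rm0; move: rp rm E0 E1 => r s e0 e1 r0 s0.
have := lt_eqF (addr_gt0 s0 r0); have := lt_eqF r0; have := lt_eqF s0.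
by rewrite ![0 == _]eq_sym => s1 r1 sr1; field; rewrite s1 r1 ?sr1 ?[r + s]addrC ?sr1.
Qed.

End NodeAlgebraGlobal.

(** * Summation over the nodes *)

Section DiscreteSums.
Context {R : realType}.

(** Cauchy-Schwarz, from the nonnegativity of the variance of the a j. *)
Lemma sum_abs_le_l2 (n : nat) (a : nat -> R) :
  \sum_(1 <= j < n.+1) a j <= Num.sqrt (n%:R * \sum_(1 <= j < n.+1) a j ^+ 2).
Proof.
case: n => [|n]; first by rewrite !big_geq// mulr0 sqrtr0.
set S := \sum_(_ <= _ < _) a _; set Q := \sum_(_ <= _ < _) _ ^+ 2.
have n0 : 0 < n.+1%:R :> R by rewrite ltr0n.
have : 0 <= \sum_(1 <= j < n.+2) (a j - S / n.+1%:R) ^+ 2 by apply: sumr_ge0 => j _; exact: sqr_ge0.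
have -> : \sum_(1 <= j < n.+2) (a j - S / n.+1%:R) ^+ 2 = Q - S ^+ 2 / n.+1%:R.
  transitivity (\sum_(1 <= j < n.+2) (a j ^+ 2 + (- (2 * (S / n.+1%:R)) * a j + (S / n.+1%:R) ^+ 2))).
    by apply: eq_bigr => j _; ring.
  rewrite !big_split /= -mulr_sumr -/S -/Q sumr_const_nat subSS subn0 -[_ *+ n.+1]mulr_natl.
  by field; rewrite gt_eqF.
rewrite subr_ge0 ler_pdivrMr// mulrC => H.
by apply: (le_trans (ler_norm _)); rewrite -sqrtr_sqr ler_wsqrtr.
Qed.

Lemma dotpD (u v w : 'rV[R]_2) : dotp (u + v) w = dotp u w + dotp v w.
Proof. by rewrite !dotpE !mxE; ring. Qed.

Lemma dotpBl (u v w : 'rV[R]_2) : dotp (u - v) w = dotp u w - dotp v w.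
Proof. by rewrite !dotpE !mxE; ring. Qed.

Lemma dotpBr (u v w : 'rV[R]_2) : dotp w (u - v) = dotp w u - dotp w v.
Proof. by rewrite !dotpE !mxE; ring. Qed.

Lemma dotpZl a (u w : 'rV[R]_2) : dotp (a *: u) w = a * dotp u w.
Proof. by rewrite !dotpE !mxE; ring. Qed.

Lemma summation_by_parts (n : nat) (g f : int -> 'rV[R]_2) : f n%:Z = f 0 -> g (n%:Z + 1) = g 1 ->
  \sum_(1 <= j < n.+1) dotp (g j) (f j - f (j%:Z - 1)) =
  \sum_(1 <= j < n.+1) dotp (g j - g (j%:Z + 1)) (f j).
Proof.
move=> fn gn.
have H m : \sum_(1 <= j < m.+1) dotp (g j) (f j - f (j%:Z - 1)) =
   \sum_(1 <= j < m.+1) dotp (g j - g (j%:Z + 1)) (f j)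
   + dotp (g (m%:Z + 1)) (f m) - dotp (g 1) (f 0).
  elim: m => [|m IH]; first by rewrite !big_geq// add0r; ring.
  rewrite big_nat_recr//= IH [in RHS]big_nat_recr//= dotpBr dotpBl.
  have -> : (m.+1%:Z - 1 = m)%R by rewrite intS addrAC subrr add0r.
  have -> : (m%:Z + 1 = m.+1)%R by rewrite intS addrC.
  ring.
by rewrite H fn gn addrK.
Qed.

End DiscreteSums.

Section DefectSum.
Context {R : realType} (J : nat).
Hypothesis J3 : (3 <= J)%N.
Implicit Types (i j : int) (Y : R -> R -> 'rV[R]_2).
Local Notation h := (mesh J : R).
Local Notation nd := (@node R J).

Lemma mesh_gt0 : 0 < h.
Proof. by rewrite invr_gt0 ltr0n (leq_trans _ J3). Qed.

Lemma mesh_le1 : h <= 1.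
Proof.
have J1 : (1 <= J)%N by exact: leq_trans J3.
by rewrite /mesh -[leRHS]invr1 lef_pV2 ?posrE ?ltr0n// ler1n.
Qed.

Let hn : h != 0. Proof. by rewrite gt_eqF ?mesh_gt0. Qed.

Lemma nodeS j : nd (j + 1) = nd j + h.
Proof. by rewrite /node intrD mulrDl mul1r. Qed.

Lemma nodeP j : nd (j - 1) = nd j - h.
Proof. by rewrite /node intrB mulrBl mul1r. Qed.

Lemma node_period j : nd (j + J%:Z) = nd j + 1.
Proof.
have J0 : J%:R != 0 :> R by rewrite pnatr_eq0 -lt0n (leq_trans _ J3).
by rewrite /node intrD mulrDl /mesh -[(Posz J)%:~R]/(J%:R) divff.
Qed.

Lemma interp_node (V : lmodType R) (g : int -> V) j : interp J g (nd j) = g j.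
Proof.
rewrite /interp /node mulfK// intrKfloor subrr subr0 scale1r scale0r addr0 //.
Qed.

Variables (Y : R -> R -> 'rV[R]_2) (t : R).
Let s : R := t + h ^+ 2.

Definition increment (x : R) : 'rV[R]_2 := (h ^+ 2)^-1 *: (Y s x - Y t x).
Definition fquot (F : R -> 'rV[R]_2) (i : 'I_2) (x y : R) : R := (F (x + y) 0 i - F x 0 i) / y.

Definition local_term (j : int) (f : 'rV[R]_2) : R :=
  let x := nd j in
  gterm h (fquot (Y t) 0 x h) (fquot (Y t) 1 x h) (fquot (Y t) 0 x (- h)) (fquot (Y t) 1 x (- h))
    (fquot increment 0 x h) (fquot increment 1 x h) (fquot increment 0 x (- h))
    (fquot increment 1 x (- h)) (increment x 0 0) (increment x 0 1) (f 0 0) (f 0 1).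

Let edge_minus (F : R -> 'rV[R]_2) j :
  edge J (interp J (fun j => F (nd j))) j = h *: vec (fquot F 0 (nd j) (- h)) (fquot F 1 (nd j) (- h)).
Proof.
rewrite /edge !interp_node /fquot nodeP.
by apply: vecP; rewrite !mxE /= ?vec0 ?vec1; field.
Qed.

Let edge_plus (F : R -> 'rV[R]_2) j :
  edge J (interp J (fun j => F (nd j))) (j + 1) = h *: vec (fquot F 0 (nd j) h) (fquot F 1 (nd j) h).
Proof.
rewrite /edge !interp_node /fquot addrK nodeS.
by apply: vecP; rewrite !mxE /= ?vec0 ?vec1; field.
Qed.

Let enorm_vec (a b : R) : enorm (h *: vec a b) = h * Num.sqrt (a ^+ 2 + b ^+ 2).
Proof.
rewrite /enorm vecZ dotp_vec -!expr2 !exprMn -mulrDr sqrtrM ?sqr_ge0//.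
by rewrite sqrtr_sqr gtr0_norm// mesh_gt0.
Qed.

Let Yh := interp J (fun j => Y t (nd j)).
Let vh := interp J (fun j => increment (nd j)).

Let dotp_Ntilde j (w : 'rV[R]_2) : let x := nd j in
  dotp w (Ntilde J Yh j) =
  (w 0 0 * (fquot (Y t) 1 x h + fquot (Y t) 1 x (- h)) - w 0 1 * (fquot (Y t) 0 x h + fquot (Y t) 0 x (- h)))
  / (Num.sqrt (fquot (Y t) 0 x (- h) ^+ 2 + fquot (Y t) 1 x (- h) ^+ 2)
     + Num.sqrt (fquot (Y t) 0 x h ^+ 2 + fquot (Y t) 1 x h ^+ 2)).
Proof.
rewrite /= /Ntilde /Ttilde /Yh (edge_minus (Y t)) (edge_plus (Y t)) !enorm_vec.
rewrite -mulrDr !vecZ vecD vecZ rot_vec dotpE vec0 vec1 invfM.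
move: (fquot _ _ _ _) (fquot _ _ _ _) (fquot _ _ _ _) (fquot _ _ _ _) (_ + _)^-1 => a b c d r.
by field.
Qed.

Hypotheses (tP : periodic (Y t) 1) (sP : periodic (Y s) 1).

Lemma defectE (phi : R -> 'rV[R]_2) : phi (nd J%:Z) = phi (nd 0) ->
  defect J Y t phi = \sum_(1 <= j < J.+1) local_term j (phi (nd j)).
Proof.
move=> phiP; rewrite /defect -/Yh -/vh /mform /aform mulr_sumr -addrA mulr_sumr -!big_split /=.
(* Both stiffness forms use the edge lengths of Y_h, so they combine and are summed by parts
   together. *)
pose g j := (enorm (edge J Yh j))^-1 *: (edge J Yh j + h ^+ 2 *: edge J vh j).
have gP : g (J%:Z + 1) = g 1.
  have per (F : int -> 'rV[R]_2) : (forall j, F (j + J%:Z) = F j) -> forall j,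
      edge J (interp J F) (j + J%:Z) = edge J (interp J F) j.
    by move=> FP j; rewrite /edge !interp_node addrAC !FP.
  have p1 : edge J Yh (J%:Z + 1) = edge J Yh 1.
    by rewrite addrC; apply: per => j; rewrite node_period tP.
  have p2 : edge J vh (J%:Z + 1) = edge J vh 1.
    by rewrite addrC; apply: per => j; rewrite /increment node_period tP sP.
  by rewrite /g p1 p2.
have := summation_by_parts (f := fun j => phi (nd j)) phiP gP => parts.
transitivity (\sum_(1 <= j < J.+1) (2^-1 * ((enorm (edge J Yh j) + enorm (edge J Yh (j%:Z + 1)))
    * dotp (vh (nd j)) (Ntilde J Yh j) * dotp (phi (nd j)) (Ntilde J Yh j)))
   + \sum_(1 <= j < J.+1) dotp (g j) (phi (nd j) - phi (nd (j%:Z - 1)))).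
  rewrite -big_split /=; apply: eq_bigr => j _; congr (_ + _).
  by rewrite /g dotpZl dotpD dotpZl /edge; ring.
rewrite parts -big_split /=; apply: eq_bigr => j _.
rewrite !dotp_Ntilde /local_term /gterm /= /vh interp_node.
rewrite /g /Yh (edge_minus (Y t)) (edge_plus (Y t)) !enorm_vec (edge_minus increment) (edge_plus increment).
rewrite dotpE !mxE /=.
congr (_ + _).
rewrite !invfM.
move: (fquot _ _ _ _) (fquot _ _ _ _) (fquot _ _ _ _) (fquot _ _ _ _).
move: (fquot _ _ _ _) (fquot _ _ _ _) (fquot _ _ _ _) (fquot _ _ _ _) => *.
move: (Num.sqrt _)^-1 (Num.sqrt _)^-1 => *.
by field.
Qed.

(** The loss of one power of h: the norm carries the weight h, the sum over the 1/h nodes carries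
    none. *)
Let sum_bound (a : nat -> R) (F : nat -> R) (C : R) : 0 <= C -> (forall j : nat, `|F j| <= C * `|a j|) ->
  `|\sum_(1 <= j < J.+1) F j| <= C / h * Num.sqrt (h * \sum_(1 <= j < J.+1) `|a j| ^+ 2).
Proof.
move=> C0 Fa; apply: (le_trans (ler_norm_sum _ _ _)).
apply: (@le_trans _ _ (\sum_(1 <= j < J.+1) C * `|a j|)); first exact: ler_sum.
rewrite -mulr_sumr -mulrA ler_wpM2l//; apply: (le_trans (sum_abs_le_l2 J (fun j : nat => `|a j|))).
have -> : h^-1 = Num.sqrt (h^-1 ^+ 2) by rewrite sqrtr_sqr ger0_norm// invr_ge0 ltW ?mesh_gt0.
rewrite -sqrtrM ?sqr_ge0// ler_wsqrtr// le_eqVlt; apply/orP; left; apply/eqP.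
by rewrite expr2 -mulrA mulKf// invrK.
Qed.

Let xE (x : R) := fquot (Y t) 0 x h + fquot (Y t) 0 x (- h).
Let zE (x : R) := fquot (Y t) 1 x h + fquot (Y t) 1 x (- h).
Let rp (x : R) := Num.sqrt (fquot (Y t) 0 x h ^+ 2 + fquot (Y t) 1 x h ^+ 2).
Let rm (x : R) := Num.sqrt (fquot (Y t) 0 x (- h) ^+ 2 + fquot (Y t) 1 x (- h) ^+ 2).

Definition curve_tang (x : R) : R :=
  gtang h (fquot (Y t) 0 x h) (fquot (Y t) 1 x h) (fquot (Y t) 0 x (- h)) (fquot (Y t) 1 x (- h))
    (fquot increment 0 x h) (fquot increment 1 x h) (fquot increment 0 x (- h))
    (fquot increment 1 x (- h)).
Definition curve_norm (x : R) : R :=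
  gnorm h (fquot (Y t) 0 x h) (fquot (Y t) 1 x h) (fquot (Y t) 0 x (- h)) (fquot (Y t) 1 x (- h))
    (fquot increment 0 x h) (fquot increment 1 x h) (fquot increment 0 x (- h))
    (fquot increment 1 x (- h)) (increment x 0 0) (increment x 0 1).

Variables (e0 Bt Bn : R).
Hypotheses (e00 : 0 < e0) (rp0 : forall x, 0 < rp x) (rm0 : forall x, 0 < rm x).
Hypothesis E_ge : forall x, e0 <= Num.sqrt (xE x ^+ 2 + zE x ^+ 2).
Hypothesis tB : forall x, `|curve_tang x| <= Bt.
Hypothesis nB : forall x, `|curve_norm x| <= Bn.

Let Bt0 : 0 <= Bt. Proof. exact: le_trans (normr_ge0 _) (tB 0). Qed.
Let Bn0 : 0 <= Bn. Proof. exact: le_trans (normr_ge0 _) (nB 0). Qed.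

Let cauchy (a b c d : R) : `|a * b + c * d| <= Num.sqrt (a ^+ 2 + c ^+ 2) * Num.sqrt (b ^+ 2 + d ^+ 2).
Proof.
rewrite -sqrtrM ?addr_ge0 ?sqr_ge0// -sqrtr_sqr ler_wsqrtr// -subr_ge0.
have -> : (a ^+ 2 + c ^+ 2) * (b ^+ 2 + d ^+ 2) - (a * b + c * d) ^+ 2 = (a * d - c * b) ^+ 2 by ring.
exact: sqr_ge0.
Qed.

(** The conditional drops the normal product for test vectors parallel to E, so that one estimate
    serves general and tangential test functions. *)
Let local_bound j (f : 'rV[R]_2) B N : 0 <= B -> 0 <= N -> enorm f <= N ->
  Bt + (if f 0 0 * zE (nd j) - f 0 1 * xE (nd j) == 0 then 0 else Bn) <= B ->
  `|local_term j f| <= B / e0 * N.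
Proof.
move=> B0 N0 fN BB.
set x := nd j; pose r := Num.sqrt (xE x ^+ 2 + zE x ^+ 2).
have r0 : 0 < r := lt_le_trans e00 (E_ge x).
have r2 : r ^+ 2 = xE x ^+ 2 + zE x ^+ 2 by rewrite sqr_sqrtr// addr_ge0 ?sqr_ge0.
have H : local_term j f * r ^+ 2 = - curve_tang x * (f 0 0 * xE x + f 0 1 * zE x)
    + curve_norm x * (f 0 0 * zE x - f 0 1 * xE x) by rewrite r2; exact (gtermE _ _ _ _ _ _ _ (rp0 x) (rm0 x) _ _).
have fE : enorm f = Num.sqrt (f 0 0 ^+ 2 + f 0 1 ^+ 2) by rewrite /enorm dotpE -!expr2.
have c1 : `|f 0 0 * xE x + f 0 1 * zE x| <= N * r.
  by apply: le_trans (cauchy _ _ _ _) _; rewrite -fE ler_wpM2r// ltW.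
have c2 : `|f 0 0 * zE x - f 0 1 * xE x| <= N * r.
  rewrite -mulrN; apply: le_trans (cauchy _ _ _ _) _; rewrite -fE sqrrN [zE x ^+ 2 + _]addrC.
  by rewrite ler_wpM2r// ltW.
have H2 : `|local_term j f| * r ^+ 2 <= B * (N * r).
  rewrite -[r ^+ 2]ger0_norm ?sqr_ge0// -normrM H; apply: (le_trans (ler_normD _ _)).
  apply: (@le_trans _ _ (Bt * (N * r) + (if f 0 0 * zE x - f 0 1 * xE x == 0 then 0 else Bn) * (N * r))).
    rewrite !normrM normrN; apply: lerD; first exact: ler_pM.
    case: eqVneq => [->|_]; first by rewrite normr0 mulr0 mul0r.
    exact: ler_pM.
  by rewrite -mulrDl ler_wpM2r// mulr_ge0// ltW.
have H3 : `|local_term j f| * r <= B * N.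
  by rewrite -(ler_pM2r r0) -mulrA -expr2 -mulrA.
rewrite mulrAC ler_pdivlMr//; apply: le_trans H3; rewrite ler_wpM2l//; exact: E_ge.
Qed.

Lemma defect_bound (phi : R -> 'rV[R]_2) : phi (nd J%:Z) = phi (nd 0) ->
  `|defect J Y t phi| <= (Bt + Bn) / e0 / h * norm0h2 J phi.
Proof.
move=> phiP; rewrite defectE//.
have -> : norm0h2 J phi = Num.sqrt (h * \sum_(1 <= j < J.+1) `|enorm (phi (nd j))| ^+ 2).
  by congr Num.sqrt; congr (_ * _); apply: eq_bigr => j _; rewrite ger0_norm ?sqrtr_ge0.
have B0 : 0 <= Bt + Bn by rewrite addr_ge0.
apply: sum_bound => [|j]; first by rewrite divr_ge0// ltW.
apply: (local_bound B0) => //; first by rewrite ler_norm.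
by case: ifP => _; rewrite lerD2l.
Qed.

Let tangential_node (b : R -> R) j : tangential J b (Y t) (nd j) = b (nd j) *: Th J Yh j.
Proof. by rewrite /tangential interp_node. Qed.

Lemma defect_tangential_bound (b : R -> R) : b (nd J%:Z) = b (nd 0) ->
  `|defect J Y t (tangential J b (Y t))| <= Bt / e0 / h * norm0h J b.
Proof.
move=> bP; have ThP : Th J Yh J%:Z = Th J Yh 0.
  have per j : edge J Yh (j + J%:Z) = edge J Yh j.
    by rewrite /edge /Yh !interp_node addrAC !node_period !tP.
  have e1 : edge J Yh J%:Z = edge J Yh 0 by rewrite -[X in edge J Yh X]add0r per.
  have e2 : edge J Yh (J%:Z + 1) = edge J Yh (0 + 1) by rewrite [J%:Z + 1]addrC per add0r.
  by rewrite /Th /Ttilde e1 e2.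
rewrite defectE; last by rewrite !tangential_node bP ThP.
apply: sum_bound => [|j]; first by rewrite divr_ge0// ltW.
rewrite tangential_node.
(* T_h is parallel to E, so the normal product does not contribute. *)
have ThE : exists l, Th J Yh j = l *: vec (xE (nd j)) (zE (nd j)).
  rewrite /Th /Ttilde /Yh (edge_minus (Y t)) (edge_plus (Y t)) -scalerDr vecD !scalerA.
  by eexists; congr (_ *: vec _ _); exact: addrC.
apply: (local_bound Bt0) => //.
- have -> : enorm (b (nd j) *: Th J Yh j) = `|b (nd j)| * enorm (Th J Yh j).
    move: (Th J Yh j) => w.
    have E : dotp (b (nd j) *: w) (b (nd j) *: w) = b (nd j) ^+ 2 * dotp w w.
      by rewrite !dotpE !mxE; ring.
    by rewrite /enorm E sqrtrM ?sqr_ge0// sqrtr_sqr.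
  rewrite -[leRHS]mulr1 ler_wpM2l// /Th.
  set w := Ttilde J Yh j; rewrite /enorm dotpZl.
  have -> : dotp w ((Num.sqrt (dotp w w))^-1 *: w) = (Num.sqrt (dotp w w))^-1 * dotp w w.
    by rewrite !dotpE !mxE; ring.
  have dw : 0 <= dotp w w by rewrite dotpE -!expr2 addr_ge0 ?sqr_ge0.
  rewrite mulrA -expr2 -{2}(sqr_sqrtr dw) -exprMn sqrtr_sqr.
  (* A vanishing vector has zero as its normalisation; only the bound 1 on the length is claimed. *)
  have [->|w0] := eqVneq (Num.sqrt (dotp w w)) 0; first by rewrite mulr0 normr0.
  by rewrite mulVf// normr1.
- have [l ->] := ThE; rewrite !mxE /=.
  rewrite (_ : _ - _ = 0); last by ring.
  by rewrite eqxx addr0.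
Qed.
End DefectSum.

Section Rotation.
Context {R : realType} {Q : Type} (h : Q -> R).
Variables (x z dx dz : Q * bool -> R) (vx vz : Q -> R) (c s : Q -> R).
Hypothesis cs1 : forall q, c q ^+ 2 + s q ^+ 2 = 1.
Let et w := c w.1 * x w + s w.1 * z w.
Let en w := s w.1 * x w + - c w.1 * z w.
Let dt w := c w.1 * dx w + s w.1 * dz w.
Let dn w := s w.1 * dx w + - c w.1 * dz w.
Let vt q := c q * vx q + s q * vz q.
Let vn q := s q * vx q + - c q * vz q.

Let rlenE w : rlen et en w = Num.sqrt (x w ^+ 2 + z w ^+ 2).
Proof.
rewrite /rlen /et /en; congr Num.sqrt.
by transitivity ((x w ^+ 2 + z w ^+ 2) * (c w.1 ^+ 2 + s w.1 ^+ 2)); [ring|rewrite cs1 mulr1].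
Qed.

Let dot (a b a' b' c' s' : R) : c' ^+ 2 + s' ^+ 2 = 1 ->
  (c' * a + s' * b) * (c' * a' + s' * b') + (s' * a + - c' * b) * (s' * a' + - c' * b') = a * a' + b * b'.
Proof.
by move=> E; transitivity ((a * a' + b * b') * (c' ^+ 2 + s' ^+ 2)); [ring|rewrite E mulr1].
Qed.

Let cross (a b a' b' c' s' : R) : c' ^+ 2 + s' ^+ 2 = 1 ->
  (s' * a + - c' * b) * (c' * a' + s' * b') - (c' * a + s' * b) * (s' * a' + - c' * b') = a * b' - b * a'.
Proof.
by move=> E; transitivity ((a * b' - b * a') * (c' ^+ 2 + s' ^+ 2)); [ring|rewrite E mulr1].
Qed.

Let jump_et f g q : jump et en (fun w => f w.1 * x w + g w.1 * z w) q = f q * (x (q, true) / Num.sqrt (x (q, true) ^+ 2 + z (q, true) ^+ 2)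
   - x (q, false) / Num.sqrt (x (q, false) ^+ 2 + z (q, false) ^+ 2))
  + g q * (z (q, true) / Num.sqrt (x (q, true) ^+ 2 + z (q, true) ^+ 2)
   - z (q, false) / Num.sqrt (x (q, false) ^+ 2 + z (q, false) ^+ 2)).
Proof. by rewrite /jump !rlenE /=; ring. Qed.

Let jump_dt f g q : jump et en (fun w => f w.1 * dx w + g w.1 * dz w) q = f q * (dx (q, true) / Num.sqrt (x (q, true) ^+ 2 + z (q, true) ^+ 2)
   - dx (q, false) / Num.sqrt (x (q, false) ^+ 2 + z (q, false) ^+ 2))
  + g q * (dz (q, true) / Num.sqrt (x (q, true) ^+ 2 + z (q, true) ^+ 2)
   - dz (q, false) / Num.sqrt (x (q, false) ^+ 2 + z (q, false) ^+ 2)).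
Proof. by rewrite /jump !rlenE /=; ring. Qed.

Let esumE f g q : esum (fun w => f w.1 * x w + g w.1 * z w) q =
  f q * (x (q, true) + x (q, false)) + g q * (z (q, true) + z (q, false)).
Proof. by rewrite /esum /=; ring. Qed.

Lemma node_tang_rot q : node_tang h et en dt dn q =
  gtang (h q) (x (q, true)) (z (q, true)) (x (q, false)) (z (q, false))
    (dx (q, true)) (dz (q, true)) (dx (q, false)) (dz (q, false)).
Proof.
rewrite /node_tang /gtang !rlenE /dt /dn /et /en.
rewrite (jump_dt c s) (jump_dt s (fun q => - c q)) (jump_et c s) (jump_et s (fun q => - c q)).
rewrite (esumE c s) (esumE s (fun q => - c q)).
rewrite !expr2 (dot _ _ _ _ (cs1 q)) -!expr2 (dot _ _ _ _ (cs1 q)).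
reflexivity.
Qed.

Lemma node_norm_rot q : node_norm h et en dt dn vt vn q =
  gnorm (h q) (x (q, true)) (z (q, true)) (x (q, false)) (z (q, false))
    (dx (q, true)) (dz (q, true)) (dx (q, false)) (dz (q, false)) (vx q) (vz q).
Proof.
rewrite /node_norm /gnorm !rlenE /dt /dn /et /en /vt /vn.
rewrite (jump_dt c s) (jump_dt s (fun q => - c q)) (jump_et c s) (jump_et s (fun q => - c q)).
rewrite (esumE c s) (esumE s (fun q => - c q)).
rewrite !(cross _ _ _ _ (cs1 q)) !expr2 (dot _ _ _ _ (cs1 q)) -!expr2; reflexivity.
Qed.
End Rotation.

(** * Lower bounds for chords *)

Section Chord.
Context {R : realType} {P : Type}.
Variables (X Z cc ss q : P -> R -> R) (c : R).
Hypotheses (XL : CL 1 X) (ZL : CL 1 Z).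
Hypothesis cs1 : forall p x, cc p x ^+ 2 + ss p x ^+ 2 = 1.
Hypothesis tE : forall p x, cc p x * dn 1 X p x + ss p x * dn 1 Z p x = q p x.
Hypothesis cq : forall p x, c <= q p x.

(** The projection on the tangent at x is bounded below rather than the length, so that the bounds
    of the two quotients at a node add up and keep E away from zero. *)
Lemma chord_lower : exists K, 0 <= K /\ forall p x y, y != 0 ->
  c - K * `|y| <= cc p x * ((X p (x + y) - X p x) / y) + ss p x * ((Z p (x + y) - Z p x) / y).
Proof.
have [KX [KX0 XK]] := CL1_expand XL; have [KZ [KZ0 ZK]] := CL1_expand ZL.
exists (KX + KZ); split => [|p x y y0]; first exact: addr_ge0.
have y1 : 0 < `|y| by rewrite normr_gt0.
have le1 (a b : R) : a ^+ 2 + b ^+ 2 = 1 -> `|a| <= 1.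
  by move=> E; rewrite -[leRHS]sqrtr1 -sqrtr_sqr ler_wsqrtr// -E lerDl sqr_ge0.
have c1 : `|cc p x| <= 1 := le1 _ _ (cs1 p x).
have s1 : `|ss p x| <= 1 by apply: (le1 _ (cc p x)); rewrite addrC cs1.
have rem (F : P -> R -> R) K : (forall p x y, `|F p (x + y) - (F p x + dn 1 F p x * y)| <= K * `|y| ^+ 2) ->
    `|(F p (x + y) - F p x) / y - dn 1 F p x| <= K * `|y|.
  move=> FK; have -> : (F p (x + y) - F p x) / y - dn 1 F p x
     = (F p (x + y) - (F p x + dn 1 F p x * y)) / y by field.
  by rewrite normrM normfV ler_pdivrMr// -mulrA -expr2.
have rX := rem X KX XK; have rZ := rem Z KZ ZK.
have tp := tE p x; have qp := cq p x.
move: rX rZ; move: ((X p (x + y) - X p x) / y) ((Z p (x + y) - Z p x) / y) => a b rX rZ.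
have B : `|cc p x * (a - dn 1 X p x) + ss p x * (b - dn 1 Z p x)| <= (KX + KZ) * `|y|.
  apply: (le_trans (ler_normD _ _)); rewrite !normrM mulrDl; apply: lerD.
    by rewrite -[KX * _]mul1r; exact: ler_pM.
  by rewrite -[KZ * _]mul1r; exact: ler_pM.
have E : cc p x * a + ss p x * b = q p x + (cc p x * (a - dn 1 X p x) + ss p x * (b - dn 1 Z p x)).
  by rewrite -tp; ring.
rewrite E; apply: lerD => //; rewrite lerNl; apply: le_trans B.
by rewrite -normrN ler_norm.
Qed.
End Chord.

Section Uniqueness.
Context {R : realType}.

Lemma TD_uniq (T : R) (F F1 F2 : R -> R) : 0 < T -> TD T F F1 -> TD T F F2 ->
  forall t, 0 <= t <= T -> F1 t = F2 t.
Proof.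
move=> T0 H1 H2 t tT; apply/eqP; rewrite -subr_eq0 -normr_le0 leNgt; apply/negP => d0.
set d := `|F1 t - F2 t| in d0; have e0 : 0 < d / 3 by rewrite divr_gt0.
have [a a0 aP] := H1 t tT _ e0; have [a' a'0 a'P] := H2 t tT _ e0.
(* As r is at most T / 2, one of t + r and t - r lies in [0, T]. Two errors of at most d / 3 times r
   then contradict a difference of d times r. *)
pose r := Num.min (Num.min a a') T / 2.
have r0 : 0 < r by rewrite divr_gt0// !lt_min a0 a'0 T0.
have rm : r < Num.min (Num.min a a') T.
  by rewrite /r ltr_pdivrMr// mulr_natr mulr2n ltrDl !lt_min a0 a'0 T0.
have [ra ra' rT] : [/\ r < a, r < a' & r < T] by move: rm; rewrite !lt_min => /andP[/andP[-> ->] ->].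
have [s [s0 sr]] : exists s, 0 <= s <= T /\ `|s - t| = r.
  have /andP[t0 t1] := tT.
  have [tr|tr] := leP t (T / 2).
    exists (t + r); rewrite addrAC subrr add0r gtr0_norm//; split => //.
    have rT2 : r <= T / 2 by rewrite /r ler_pM2r// ge_min lexx orbT.
    by apply/andP; split; lra.
  exists (t - r); rewrite addrAC subrr add0r normrN gtr0_norm//; split => //.
  have rT2 : r <= T / 2 by rewrite /r ler_pM2r// ge_min lexx orbT.
  by apply/andP; split; lra.
have sa : `|s - t| < a by rewrite sr. have sa' : `|s - t| < a' by rewrite sr.
have A := aP s s0 sa; have B := a'P s s0 sa'; rewrite sr in A B.
have : `|(s - t) * (F1 t - F2 t)| <= d / 3 * r + d / 3 * r.
  have -> : (s - t) * (F1 t - F2 t) = (F s - F t - (s - t) * F2 t) - (F s - F t - (s - t) * F1 t) by ring.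
  by apply: (le_trans (ler_normB _ _)); exact: lerD.
rewrite normrM sr -/d -mulrDl mulrC ler_pM2r//; lra.
Qed.

Lemma is_derive_periodic (f g : R -> R) : periodic f 1 -> (forall x : R, is_derive x 1 f (g x)) ->
  periodic g 1.
Proof.
move=> fp fg x.
have h1 := is_derive_shift (fg (x + 1)).
have E : (fun z => f (z + 1)) = f by apply/funext => z; rewrite fp.
rewrite E in h1; have [_ <-] := h1; by have [_ <-] := fg x.
Qed.

Lemma sobolev_norm_ge0 k p (f : R -> R) : (0 <= sobolev_norm k p f)%E.
Proof.
apply: le_ereal_inf_tmp => _ [g _ <-]; apply: sume_ge0 => i _; exact: Lnorm_ge0.
Qed.

Lemma sobolev_norm2_coord k p (v : R -> 'rV[R]_2) (i : 'I_2) :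
  (sobolev_norm k p (fun x => v x 0%R i) <= sobolev_norm2 k p v)%E.
Proof.
rewrite /sobolev_norm2 (bigD1 i)//= leeDl//; apply: sume_ge0 => j _; exact: sobolev_norm_ge0.
Qed.

Lemma sobolev_norm2_ge0 k p (v : R -> 'rV[R]_2) : (0 <= sobolev_norm2 k p v)%E.
Proof. by apply: sume_ge0 => j _; exact: sobolev_norm_ge0. Qed.

End Uniqueness.

(** * Smooth curves *)

Section SpaceFacts.
Context {R : realType} {P : Type}.
Variables (Y U V : P -> R -> 'rV[R]_2) (c : R) (h : P -> R) (b a e : P -> R -> R).
Hypothesis c0 : 0 < c.
Hypothesis h0 : forall p, 0 < h p.
Hypothesis h1 : forall p, h p <= 1.
Hypothesis dY : forall p (x : R), derivable (Y p) x 1.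
Hypothesis cY : forall p x, c <= speed (Y p) x.
Hypothesis XL : CL 5 (fun p x => Y p x 0 0).
Hypothesis ZL : CL 5 (fun p x => Y p x 0 1).
Hypothesis U0L : CL 5 (fun p x => U p x 0 0).
Hypothesis U1L : CL 5 (fun p x => U p x 0 1).
Hypothesis V0L : CL 2 (fun p x => V p x 0 0).
Hypothesis V1L : CL 2 (fun p x => V p x 0 1).
Hypothesis VE : forall p x, V p x = velocity (Y p) (a p) (e p) x.
Hypothesis UE : forall p x, U p x = V0 (Y p) (b p) x + h p ^+ 2 *: V p x.
Hypothesis b_ode : forall p, is_beta0 (Y p) (b p).

Let X p x := Y p x 0 0.
Let Z p x := Y p x 0 1.
Let q p := speed (Y p).
Let k p := kappa (Y p).
Let cc p x := tau (Y p) x 0 0.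
Let ss p x := tau (Y p) x 0 1.
(** A and B are the normal and tangential components of Y_t. Defined from Y_t they are C^{4,1}
    uniformly in h, which is not visible on - kappa + h^2 alpha_2 and beta_0 + h^2 beta_2. *)
Let A p x := ss p x * U p x 0 0 - cc p x * U p x 0 1.
Let B p x := cc p x * U p x 0 0 + ss p x * U p x 0 1.
Let w p x := q p x * k p x.

Lemma q_gt0 p x : 0 < q p x. Proof. exact: lt_le_trans (cY p x). Qed.

Lemma q_neq0 p x : q p x != 0. Proof. by rewrite gt_eqF ?q_gt0. Qed.

Lemma cs1 p x : cc p x ^+ 2 + ss p x ^+ 2 = 1.
Proof. exact: (tau_unit c0 dY cY). Qed.

Lemma dcc : isder cc (fun p x => - (w p x * ss p x)).
Proof. exact: (frame_derivatives c0 dY cY XL ZL).1. Qed.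

Lemma dss : isder ss (fun p x => w p x * cc p x).
Proof. exact: (frame_derivatives c0 dY cY XL ZL).2. Qed.

Definition inframe (F G t n : P -> R -> R) :=
  (forall p x, F p x = t p x * cc p x + n p x * ss p x) /\
  (forall p x, G p x = t p x * ss p x - n p x * cc p x).

Lemma inframe_t F G t n : inframe F G t n ->
  forall p x, cc p x * F p x + ss p x * G p x = t p x.
Proof.
move=> [FE GE] p x; rewrite FE GE.
have -> : cc p x * (t p x * cc p x + n p x * ss p x) + ss p x * (t p x * ss p x - n p x * cc p x)
  = t p x * (cc p x ^+ 2 + ss p x ^+ 2) by ring.
by rewrite cs1 mulr1.
Qed.

Lemma inframe_n F G t n : inframe F G t n ->
  forall p x, ss p x * F p x - cc p x * G p x = n p x.
Proof.
move=> [FE GE] p x; rewrite FE GE.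
have -> : ss p x * (t p x * cc p x + n p x * ss p x) - cc p x * (t p x * ss p x - n p x * cc p x)
  = n p x * (cc p x ^+ 2 + ss p x ^+ 2) by ring.
by rewrite cs1 mulr1.
Qed.

Lemma inframe_der F F' G G' t n t' n' : inframe F G t n -> isder F F' -> isder G G' ->
  isder t t' -> isder n n' ->
  inframe F' G' (fun p x => t' p x + w p x * n p x) (fun p x => n' p x - w p x * t p x).
Proof.
move=> [FE GE] dF dG dt dn.
have FF : F = fun p x => t p x * cc p x + n p x * ss p x.
  by apply/funext => p; apply/funext => x; exact: FE.
have GG : G = fun p x => t p x * ss p x - n p x * cc p x.
  by apply/funext => p; apply/funext => x; exact: GE.
rewrite FF in dF; rewrite GG in dG.
have := isder_uniq dF (isderD (isderM dt dcc) (isderM dn dss)) => ->.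
have := isder_uniq dG (isderB (isderM dt dss) (isderM dn dcc)) => ->.
by split => p x; ring.
Qed.

Lemma inframe_ext F G t n t' n' : inframe F G t n -> (forall p x, t p x = t' p x) ->
  (forall p x, n p x = n' p x) -> inframe F G t' n'.
Proof. by move=> [FE GE] tt nn; split => p x; rewrite ?FE ?GE tt nn. Qed.

Lemma inframe_Y1 : inframe (dn 1 X) (dn 1 Z) q (fun _ _ => 0).
Proof.
have dX := isder_X c0 dY cY XL; have dZ := isder_Z c0 dY cY ZL.
have EX : dn 1 X = _ := isder_uniq (CL_isder XL) dX.
have EZ : dn 1 Z = _ := isder_uniq (CL_isder ZL) dZ.
by split => p x; rewrite ?EX ?EZ mul0r ?addr0 ?subr0.
Qed.

Lemma CL4_h2 : CL 4 (fun p (_ : R) => h p ^+ 2).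
Proof.
apply: (@CL_cst _ _ _ (fun p => h p ^+ 2) 1) => p.
by rewrite normrX exprn_ile1// ger0_norm ?h1// ltW.
Qed.

Lemma qL : CL 4 q. Proof. exact: CL_speed c0 dY cY XL ZL. Qed.
Lemma qVL : CL 4 (fun p x => (q p x)^-1). Proof. exact: CL_speedV c0 dY cY XL ZL. Qed.
Lemma ccL : CL 4 cc. Proof. exact: CL_tau0 c0 dY cY XL ZL. Qed.
Lemma ssL : CL 4 ss. Proof. exact: CL_tau1 c0 dY cY XL ZL. Qed.
Lemma kL : CL 3 k. Proof. exact: CL_kappa c0 dY cY XL ZL. Qed.

Lemma AL : CL 4 A.
Proof.
have u0 := CLS U0L; have u1 := CLS U1L; have s := ssL; have c' := ccL.
by apply: CLB; [exact: CLM s u0|exact: CLM c' u1].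
Qed.

Lemma BL : CL 4 B.
Proof.
have u0 := CLS U0L; have u1 := CLS U1L; have s := ssL; have c' := ccL.
by apply: CLD; [exact: CLM c' u0|exact: CLM s u1].
Qed.

Lemma inframe_U : inframe (fun p x => U p x 0 0) (fun p x => U p x 0 1) B A.
Proof.
split => p x; rewrite /A /B.
- transitivity (U p x 0 0 * (cc p x ^+ 2 + ss p x ^+ 2)); first by rewrite cs1 mulr1.
  ring.
- transitivity (U p x 0 1 * (cc p x ^+ 2 + ss p x ^+ 2)); first by rewrite cs1 mulr1.
  ring.
Qed.

Lemma inframe_V : inframe (fun p x => V p x 0 0) (fun p x => V p x 0 1) e a.
Proof.
split => p x; rewrite VE velocity_fr /fr ?vec0 ?vec1 -/(cc p x) -/(ss p x) //.
Qed.

Lemma UE_comp : (forall p x, A p x = - k p x + h p ^+ 2 * a p x) /\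
  (forall p x, B p x = b p x + h p ^+ 2 * e p x).
Proof.
have UV p x : U p x = fr cc ss (fun p x => b p x + h p ^+ 2 * e p x)
    (fun p x => - k p x + h p ^+ 2 * a p x) p x.
  rewrite UE VE /V0 (velocity_fr Y a e) (velocity_fr Y (fun p => alpha0 (Y p)) b).
  by rewrite (frZ cc ss (fun p _ => h p ^+ 2)) frD.
have fi : inframe (fun p x => U p x 0 0) (fun p x => U p x 0 1)
   (fun p x => b p x + h p ^+ 2 * e p x) (fun p x => - k p x + h p ^+ 2 * a p x).
  by split => p x; rewrite UV /fr ?vec0 ?vec1.
by split => p x; [rewrite -(inframe_n fi)|rewrite -(inframe_t fi)].
Qed.

Lemma aL : CL 2 a.
Proof.
have -> : a = fun p x => ss p x * V p x 0 0 - cc p x * V p x 0 1.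
  by apply/funext => p; apply/funext => x; rewrite (inframe_n inframe_V).
have s := ssL; have c' := ccL.
by apply: CLB; [apply: CLM V0L; exact: CL_le s|apply: CLM V1L; exact: CL_le c'].
Qed.

Lemma eL : CL 2 e.
Proof.
have -> : e = fun p x => cc p x * V p x 0 0 + ss p x * V p x 0 1.
  by apply/funext => p; apply/funext => x; rewrite (inframe_t inframe_V).
have s := ssL; have c' := ccL.
by apply: CLD; [apply: CLM V0L; exact: CL_le c'|apply: CLM V1L; exact: CL_le s].
Qed.

(** A bound on beta_0 without an elliptic estimate: it is the tangential velocity minus h^2 beta_2,
    and both are bounded by (Reg). The equation then raises the order. *)
Lemma bL2 : CL 2 b.
Proof.
have -> : b = fun p x => B p x - h p ^+ 2 * e p x.
  by apply/funext => p; apply/funext => x; rewrite UE_comp.2; ring.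
apply: CLB; first exact: CL_le BL.
by apply: CLM eL; exact: CL_le CL4_h2.
Qed.

Let q1 := dn 1 q. Let q2 := dn 2 q. Let q3 := dn 3 q.
Let k1 := dn 1 k. Let k2 := dn 2 k. Let k3 := dn 3 k.
Let b1 := dn 1 b. Let b2 := dn 2 b. Let b3 := dn 3 b. Let b4 := dn 4 b.

Lemma dq : isder q q1. Proof. exact: (isder_dn (i := 0) qL). Qed.
Lemma dq1 : isder q1 q2. Proof. exact: (isder_dn (i := 1) qL). Qed.
Lemma dq2 : isder q2 q3. Proof. exact: (isder_dn (i := 2) qL). Qed.
Lemma dk : isder k k1. Proof. exact: (isder_dn (i := 0) kL). Qed.
Lemma dk1 : isder k1 k2. Proof. exact: (isder_dn (i := 1) kL). Qed.
Lemma dk2 : isder k2 k3. Proof. exact: (isder_dn (i := 2) kL). Qed.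
Lemma db : isder b b1. Proof. exact: (isder_dn (i := 0) bL2). Qed.
Lemma db1 : isder b1 b2. Proof. exact: (isder_dn (i := 1) bL2). Qed.

Lemma b2E p x : b2 p x = beta0_form (q p x) (q1 p x) (k p x) (k1 p x) (b p x) (b1 p x).
Proof.
have [b1' [b2' [d1 d2 E]]] := beta0_ode c0 cY erefl erefl dq dk b_ode.
have e1 := isder_uniq db d1; rewrite -e1 in d2 E.
have e2 := isder_uniq db1 d2; rewrite -e2 in E.
exact: E.
Qed.

Lemma bL : CL 4 b.
Proof.
apply: (CL_beta0 qL qVL _ kL _ bL2 db db1 b2E).
- exact: CL_der qL dq.
- exact: CL_der kL dk.
Qed.

Lemma db2 : isder b2 b3. Proof. exact: (isder_dn (i := 2) bL). Qed.
Lemma db3 : isder b3 b4. Proof. exact: (isder_dn (i := 3) bL). Qed.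

Lemma b3E p x : b3 p x = beta0_form1 (q p x) (q1 p x) (q2 p x) (k p x) (k1 p x) (k2 p x)
  (b p x) (b1 p x) (b2 p x).
Proof.
have hd := isder_beta0_form dq dq1 dk dk1 db db1 q_neq0.
have Eb : b2 = _ := funext (fun p => funext (b2E p)).
by have h2 := db2; rewrite Eb in h2; rewrite (isder_uniq h2 hd).
Qed.

Lemma b4E p x : b4 p x = beta0_form2 (q p x) (q1 p x) (q2 p x) (q3 p x) (k p x) (k1 p x)
  (k2 p x) (k3 p x) (b p x) (b1 p x) (b2 p x) (b3 p x).
Proof.
have hd := isder_beta0_form1 dq dq1 dq2 dk dk1 dk2 db db1 db2 q_neq0.
have Eb : b3 = _ := funext (fun p => funext (b3E p)).
by have h3 := db3; rewrite Eb in h3; rewrite (isder_uniq h3 hd).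
Qed.

Let w1 p x := wf1 (q p x) (q1 p x) (k p x) (k1 p x).
Let w2 p x := wf2 (q p x) (q1 p x) (q2 p x) (k p x) (k1 p x) (k2 p x).
Let w3 p x := wf3 (q p x) (q1 p x) (q2 p x) (q3 p x) (k p x) (k1 p x) (k2 p x) (k3 p x).

Lemma dw : isder w w1. Proof. exact: isder_wf dq dk. Qed.
Lemma dw1 : isder w1 w2. Proof. exact: isder_wf1 dq dq1 dk dk1. Qed.
Lemma dw2 : isder w2 w3. Proof. exact: isder_wf2 dq dq1 dq2 dk dk1 dk2. Qed.

Lemma inframe_Y2 : inframe (dn 2 X) (dn 2 Z) q1 (fun p x => - (q p x ^+ 2 * k p x)).
Proof.
have := inframe_der inframe_Y1 (isder_dn (i := 1) XL _) (isder_dn (i := 1) ZL _) dq (isder_cst (fun=> 0)).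
move=> /(_ isT isT) H; apply: (inframe_ext H) => p x; rewrite /w; ring.
Qed.

Lemma inframe_Y3 : inframe (dn 3 X) (dn 3 Z)
  (fun p x => yT3 (q p x) (q2 p x) (k p x)) (fun p x => yN3 (q p x) (q1 p x) (k p x) (k1 p x)).
Proof.
have dN := isder_yN2 dq dk.
have := inframe_der inframe_Y2 (isder_dn (i := 2) XL _) (isder_dn (i := 2) ZL _) dq1 dN.
by move=> /(_ isT isT) H; apply: (inframe_ext H) => p x; rewrite /w /yT3 /yN3; ring.
Qed.

Lemma inframe_Y4 : inframe (dn 4 X) (dn 4 Z)
  (fun p x => yT4 (q p x) (q1 p x) (q3 p x) (k p x) (k1 p x))
  (fun p x => yN4 (q p x) (q1 p x) (q2 p x) (k p x) (k1 p x) (k2 p x)).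
Proof.
have dT := isder_yT3 dq dq2 dk; have dN := isder_yN3 dq dq1 dk dk1.
have := inframe_der inframe_Y3 (isder_dn (i := 3) XL _) (isder_dn (i := 3) ZL _) dT dN.
move=> /(_ isT isT) H; apply: (inframe_ext H) => p x; rewrite /w /yT4 /yN4 //; ring.
Qed.

(** From the fifth derivative only the normal component is needed, to recover kappa'''. *)
Lemma normal_Y5 p x : ss p x * dn 5 X p x - cc p x * dn 5 Z p x =
  yN5 (q p x) (q1 p x) (q2 p x) (q3 p x) (k p x) (k1 p x) (k2 p x) (k3 p x).
Proof.
have dN := isder_yN4 dq dq1 dq2 dk dk1 dk2.
have d4 := isderB (isderM dss (isder_dn (i := 4) XL isT)) (isderM dcc (isder_dn (i := 4) ZL isT)).
have E : (fun p x => ss p x * dn 4 X p x - cc p x * dn 4 Z p x) =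
   fun p x => yN4 (q p x) (q1 p x) (q2 p x) (k p x) (k1 p x) (k2 p x).
  by apply/funext => p'; apply/funext => x'; exact: (inframe_n inframe_Y4).
rewrite E in d4.
have := congr1 (fun f => f p x) (isder_uniq d4 dN) => /= E5.
have T4 := inframe_t inframe_Y4 p x.
have aux (s' c' x4 z4 x5 z5 w' T N : R) : w' * c' * x4 + s' * x5 - (- (w' * s') * z4 + c' * z5) = N ->
   c' * x4 + s' * z4 = T -> s' * x5 - c' * z5 = N - w' * T by move=> <- <-; ring.
exact: (aux _ _ _ _ _ _ _ _ _ E5 T4).
Qed.

Let U0 p x := U p x 0 0.
Let U1 p x := U p x 0 1.

Lemma inframe_U1 : inframe (dn 1 U0) (dn 1 U1)
  (fun p x => vT1 (w p x) (A p x) (dn 1 B p x)) (fun p x => vN1 (w p x) (B p x) (dn 1 A p x)).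
Proof.
exact: (inframe_der inframe_U (isder_dn (i := 0) U0L _) (isder_dn (i := 0) U1L _)
  (isder_dn (i := 0) BL _) (isder_dn (i := 0) AL _)).
Qed.

Lemma inframe_U2 : inframe (dn 2 U0) (dn 2 U1)
  (fun p x => vT2 (w p x) (w1 p x) (A p x) (dn 1 A p x) (B p x) (dn 2 B p x))
  (fun p x => vN2 (w p x) (w1 p x) (A p x) (dn 2 A p x) (B p x) (dn 1 B p x)).
Proof.
have a0 : isder A (dn 1 A) := isder_dn (i := 0) AL isT.
have a1 : isder (dn 1 A) (dn 2 A) := isder_dn (i := 1) AL isT.
have b0' : isder B (dn 1 B) := isder_dn (i := 0) BL isT.
have b1' : isder (dn 1 B) (dn 2 B) := isder_dn (i := 1) BL isT.
have := inframe_der inframe_U1 (isder_dn (i := 1) U0L _) (isder_dn (i := 1) U1L _)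
  (isderD b1' (isderM dw a0)) (isderB a1 (isderM dw b0')).
by move=> /(_ isT isT) H; apply: (inframe_ext H) => p x; rewrite /vT2 /vN2 /vT1 /vN1; ring.
Qed.

Lemma inframe_U34 : exists N4, inframe (dn 3 U0) (dn 3 U1)
  (fun p x => vT3 (w p x) (w1 p x) (w2 p x) (A p x) (dn 1 A p x) (dn 2 A p x) (B p x) (dn 1 B p x) (dn 3 B p x))
  (fun p x => vN3 (w p x) (w1 p x) (w2 p x) (A p x) (dn 1 A p x) (dn 3 A p x) (B p x) (dn 1 B p x) (dn 2 B p x))
  /\ inframe (dn 4 U0) (dn 4 U1)
  (fun p x => vT4 (w p x) (w1 p x) (w2 p x) (w3 p x) (A p x) (dn 1 A p x) (dn 2 A p x) (dn 3 A p x)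
     (B p x) (dn 1 B p x) (dn 2 B p x) (dn 4 B p x)) N4.
Proof.
have a0 : isder A (dn 1 A) := isder_dn (i := 0) AL isT.
have a1 : isder (dn 1 A) (dn 2 A) := isder_dn (i := 1) AL isT.
have a2 : isder (dn 2 A) (dn 3 A) := isder_dn (i := 2) AL isT.
have a3 : isder (dn 3 A) (dn 4 A) := isder_dn (i := 3) AL isT.
have b0' : isder B (dn 1 B) := isder_dn (i := 0) BL isT.
have b1' : isder (dn 1 B) (dn 2 B) := isder_dn (i := 1) BL isT.
have b2' : isder (dn 2 B) (dn 3 B) := isder_dn (i := 2) BL isT.
have b3' : isder (dn 3 B) (dn 4 B) := isder_dn (i := 3) BL isT.
have dT2 := isder_vT2 dw dw1 a0 a1 b0' b2'.
have dN2 := isder_vN2 dw dw1 a0 a2 b0' b1'.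
have H3 := inframe_der inframe_U2 (isder_dn (i := 2) U0L isT) (isder_dn (i := 2) U1L isT) dT2 dN2.
have I3 : inframe (dn 3 U0) (dn 3 U1)
  (fun p x => vT3 (w p x) (w1 p x) (w2 p x) (A p x) (dn 1 A p x) (dn 2 A p x) (B p x) (dn 1 B p x) (dn 3 B p x))
  (fun p x => vN3 (w p x) (w1 p x) (w2 p x) (A p x) (dn 1 A p x) (dn 3 A p x) (B p x) (dn 1 B p x) (dn 2 B p x)).
  by apply: (inframe_ext H3) => p x; rewrite /vT3 /vN3.
have dT3 := isder_vT3 dw dw1 dw2 a0 a1 a2 b0' b1' b3'.
have [N3' dN3] := isder_vN3 dw dw1 dw2 a0 a1 a3 b0' b1' b2'.
have H4 := inframe_der I3 (isder_dn (i := 3) U0L isT) (isder_dn (i := 3) U1L isT) dT3 dN3.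
eexists; split; first exact: I3.
by apply: (inframe_ext H4) => p x //; rewrite subrK.
Qed.

Lemma h2_neq0 p : h p ^+ 2 != 0.
Proof. by rewrite gt_eqF// exprn_gt0. Qed.

Lemma da : isder a (dn 1 a). Proof. exact: (isder_dn (i := 0) aL). Qed.
Lemma da1 : isder (dn 1 a) (dn 2 a). Proof. exact: (isder_dn (i := 1) aL). Qed.
Lemma de : isder e (dn 1 e). Proof. exact: (isder_dn (i := 0) eL). Qed.
Lemma de1 : isder (dn 1 e) (dn 2 e). Proof. exact: (isder_dn (i := 1) eL). Qed.

Lemma A1E p x : dn 1 A p x = - k1 p x + h p ^+ 2 * dn 1 a p x.
Proof.
have E : A = _ := funext (fun p => funext (UE_comp.1 p)).
have h1' : isder A (dn 1 A) := isder_dn (i := 0) AL isT; rewrite E in h1'.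
have h2' := isderD (isderN dk) (isderZ (fun p => h p ^+ 2) da).
by rewrite E (isder_uniq h1' h2').
Qed.

Lemma A2E p x : dn 2 A p x = - k2 p x + h p ^+ 2 * dn 2 a p x.
Proof.
have E : dn 1 A = _ := funext (fun p => funext (A1E p)).
have h1' : isder (dn 1 A) (dn 2 A) := isder_dn (i := 1) AL isT; rewrite E in h1'.
have h2' := isderD (isderN dk1) (isderZ (fun p => h p ^+ 2) da1).
by rewrite (isder_uniq h1' h2').
Qed.

Lemma B1E p x : dn 1 B p x = b1 p x + h p ^+ 2 * dn 1 e p x.
Proof.
have E : B = _ := funext (fun p => funext (UE_comp.2 p)).
have h1' : isder B (dn 1 B) := isder_dn (i := 0) BL isT; rewrite E in h1'.
have h2' := isderD db (isderZ (fun p => h p ^+ 2) de).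
by rewrite E (isder_uniq h1' h2').
Qed.

Lemma B2E p x : dn 2 B p x = b2 p x + h p ^+ 2 * dn 2 e p x.
Proof.
have E : dn 1 B = _ := funext (fun p => funext (B1E p)).
have h1' : isder (dn 1 B) (dn 2 B) := isder_dn (i := 1) BL isT; rewrite E in h1'.
have h2' := isderD db1 (isderZ (fun p => h p ^+ 2) de1).
by rewrite (isder_uniq h1' h2').
Qed.

Let T1 p x := vT1 (w p x) (A p x) (dn 1 B p x).
Let N1 p x := vN1 (w p x) (B p x) (dn 1 A p x).
Let T2 p x := vT2 (w p x) (w1 p x) (A p x) (dn 1 A p x) (B p x) (dn 2 B p x).
Let N2 p x := vN2 (w p x) (w1 p x) (A p x) (dn 2 A p x) (B p x) (dn 1 B p x).
Let G p x := dssV2 (q p x) (q1 p x) (k p x) (k1 p x) (a p x) (dn 1 a p x)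
  (e p x) (dn 1 e p x) (dn 2 e p x).

Lemma ytang1_V2 p x : ytang1 (q p x) (q1 p x) (k p x) (T1 p x) (T2 p x) 0 0 =
  h p ^+ 2 * (2 * q p x * G p x).
Proof.
rewrite /T1 /T2 UE_comp.1 UE_comp.2 A1E B1E B2E.
exact: (@ytang1E R _ _ _ _ _ _ _ _ _ _ _ _ _ (q_neq0 p x) (b2E p x)).
Qed.

Lemma CL_V2_tangential : CL 0 G.
Proof.
have qq := qL; have kk := kL; have aa := aL; have ee := eL.
have x0 : CL 0 q := CL_le (k := 4) (l := 0) isT qq.
have x0' : CL 0 (fun p x => (q p x)^-1) := CL_le (k := 4) (l := 0) isT qVL.
have x1 : CL 0 q1 := @CL_dn _ _ 0 1 _ (CL_le (k := 4) (l := 1) isT qq).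
have y0 : CL 0 k := CL_le (k := 3) (l := 0) isT kk.
have y1 : CL 0 k1 := @CL_dn _ _ 0 1 _ (CL_le (k := 3) (l := 1) isT kk).
have a0 : CL 0 a := CL_le (k := 2) (l := 0) isT aa.
have a1' : CL 0 (dn 1 a) := @CL_dn _ _ 0 1 _ (CL_le (k := 2) (l := 1) isT aa).
have e0 : CL 0 e := CL_le (k := 2) (l := 0) isT ee.
have e1' : CL 0 (dn 1 e) := @CL_dn _ _ 0 1 _ (CL_le (k := 2) (l := 1) isT ee).
have e2' : CL 0 (dn 2 e) := @CL_dn _ _ 0 2 _ ee.
exact: (CL_dssV2 x0 x0' x1 y0 y1 a0 a1' e0 e1' e2').
Qed.

Section Nodes.
Context {Q : Type} (cur nxt : Q -> P) (pt hq : Q -> R) (c' : R) (W0 W1 : P -> R -> R).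
Hypothesis hq0 : forall z, 0 < hq z.
Hypothesis hpc : forall z, h (cur z) = hq z.
Hypothesis hpn : forall z, h (nxt z) = hq z.
Hypotheses (c'0 : 0 < c') (cc' : c' <= c).
Hypothesis chord : forall s, c' <= cc (cur s.1) (pt s.1) * dquot hq cur pt X s
  + ss (cur s.1) (pt s.1) * dquot hq cur pt Z s.
Hypotheses (W0L : CL 2 W0) (W1L : CL 2 W1).
Hypotheses (Xv : value3 cur nxt hq X U0 W0) (Zv : value3 cur nxt hq Z U1 W1).
Hypotheses (Xq : quotient3 cur nxt pt hq X U0 W0) (Zq : quotient3 cur nxt pt hq Z U1 W1).

Let hq1 z : `|hq z| <= 1.
Proof. by rewrite -hpc ger0_norm ?h1 ?ltW. Qed.

Let chord_norm s : c' <= Num.sqrt (dquot hq cur pt X s ^+ 2 + dquot hq cur pt Z s ^+ 2).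
Proof.
apply: le_trans (chord s) _; apply: (le_trans (ler_norm _)); rewrite -sqrtr_sqr ler_wsqrtr//.
have := cs1 (cur s.1) (pt s.1).
move: (cc _ _) (ss _ _) (dquot _ _ _ X s) (dquot _ _ _ Z s) => c1 s1 d e' E.
have -> : d ^+ 2 + e' ^+ 2 = (c1 * d + s1 * e') ^+ 2 + (s1 * d - c1 * e') ^+ 2.
  by transitivity ((d ^+ 2 + e' ^+ 2) * (c1 ^+ 2 + s1 ^+ 2)); [rewrite E mulr1|ring].
by rewrite lerDl sqr_ge0.
Qed.

Definition tang_at z := gtang (hq z) (dquot hq cur pt X (z, true)) (dquot hq cur pt Z (z, true))
  (dquot hq cur pt X (z, false)) (dquot hq cur pt Z (z, false))
  (incq cur nxt pt hq X (z, true)) (incq cur nxt pt hq Z (z, true))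
  (incq cur nxt pt hq X (z, false)) (incq cur nxt pt hq Z (z, false)).
Definition norm_at z := gnorm (hq z) (dquot hq cur pt X (z, true)) (dquot hq cur pt Z (z, true))
  (dquot hq cur pt X (z, false)) (dquot hq cur pt Z (z, false))
  (incq cur nxt pt hq X (z, true)) (incq cur nxt pt hq Z (z, true))
  (incq cur nxt pt hq X (z, false)) (incq cur nxt pt hq Z (z, false))
  (inct cur nxt hq X z (pt z)) (inct cur nxt hq Z z (pt z)).

Let bdk (F : P -> R -> R) i m : CL m F -> (i <= m)%N -> unif_bounded (dn i F).
Proof. by move=> FL im; apply: (@CL_bounded _ _ (m - i)%N); apply: CL_dn; rewrite subnK. Qed.

Lemma node_estimate_low :
  (exists D, bdd D /\ forall z, tang_at z = hq z ^+ 5 * D z) /\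
  (exists D, bdd D /\ forall z, norm_at z = hq z ^+ 3 * D z).
Proof.
have [N4 [F3 F4]] := inframe_U34.
have [[D [bD DE]] [D' [bD' D'E]]] := node_low hq0 hq1 hpc c0 cY cs1 c'0 cc' chord_norm
  inframe_Y1 inframe_Y2 inframe_Y3 inframe_Y4 inframe_U inframe_U1 inframe_U2 F3 F4 UE_comp.1
  ytang1_V2 XL ZL U0L U1L W0L W1L (CL_bounded ccL) (CL_bounded ssL) (CL_bounded qL)
  (CL_bounded aL) (CL_bounded CL_V2_tangential) Xv Zv Xq Zq.
split.
- exists D; split => // z; rewrite -DE.
  exact (esym (node_tang_rot hq _ _ _ _ (fun z => cs1 (cur z) (pt z)) z)).
- exists D'; split => // z; rewrite -D'E.
  exact (esym (node_norm_rot hq _ _ _ _ _ _ (fun z => cs1 (cur z) (pt z)) z)).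
Qed.

Section SecondOrder.
Hypothesis aE : forall p x, a p x = alpha2 (Y p) (b p) x.
Hypothesis e_ode : forall p, is_beta2 (Y p) (b p) (e p).

Lemma a_form p x : a p x = alpha2_form (q p x) (q1 p x) (k p x) (k1 p x) (k2 p x) (b p x) (b1 p x).
Proof. by rewrite aE (alpha2E c0 cY erefl erefl dq dk dk1 db). Qed.

Lemma kL4 : CL 4 k.
Proof.
apply: (CL_kappa4 c0 cY qL qVL _ kL dk dk1 _ db aL a_form); first exact: CL_der qL dq.
exact: CL_le bL.
Qed.

Let G2 p x := G2_form (q p x) (q1 p x) (q2 p x) (k p x) (k1 p x) (k2 p x) (k3 p x)
  (b p x) (b1 p x) (b2 p x) (b3 p x).

Lemma dssV2E p x : dssV2 (q p x) (q1 p x) (k p x) (k1 p x) (a p x) (dn 1 a p x)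
  (e p x) (dn 1 e p x) (dn 2 e p x) = G2 p x.
Proof.
exact: (beta2_ode c0 dY cY XL ZL erefl erefl erefl erefl dq dq1 dk dk1 dk2 db db1 db2 aE da de de1 e_ode).
Qed.

(** The derivative gained in [kL4] is used here: kappa''' occurs in S2 and has to be C^{1,1}. *)
Lemma G2L : CL 1 G2.
Proof.
have qq := qL; have kk := kL4; have bb := bL.
have x0 : CL 1 q := CL_le (k := 4) (l := 1) isT qq.
have x0' : CL 1 (fun p x => (q p x)^-1) := CL_le (k := 4) (l := 1) isT qVL.
have x1 : CL 1 q1 := @CL_dn _ _ 1 1 _ (CL_le (k := 4) (l := 2) isT qq).
have x2 : CL 1 q2 := @CL_dn _ _ 1 2 _ (CL_le (k := 4) (l := 3) isT qq).
have y0 : CL 1 k := CL_le (k := 4) (l := 1) isT kk.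
have y1 : CL 1 k1 := @CL_dn _ _ 1 1 _ (CL_le (k := 4) (l := 2) isT kk).
have y2 : CL 1 k2 := @CL_dn _ _ 1 2 _ (CL_le (k := 4) (l := 3) isT kk).
have y3 : CL 1 k3 := @CL_dn _ _ 1 3 _ kk.
have z0 : CL 1 b := CL_le (k := 4) (l := 1) isT bb.
have z1 : CL 1 b1 := @CL_dn _ _ 1 1 _ (CL_le (k := 4) (l := 2) isT bb).
have z2 : CL 1 b2 := @CL_dn _ _ 1 2 _ (CL_le (k := 4) (l := 3) isT bb).
have z3 : CL 1 b3 := @CL_dn _ _ 1 3 _ bb.
exact: (CL_G2 x0 x0' x1 x2 y0 y1 y2 y3 z0 z1 z2 z3).
Qed.

Lemma eL3 : CL 3 e.
Proof.
have qq := qL; have kk := kL4.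
have x0 : CL 2 q := CL_le (k := 4) (l := 2) isT qq.
have x0' : CL 2 (fun p x => (q p x)^-1) := CL_le (k := 4) (l := 2) isT qVL.
have x1 : CL 2 q1 := @CL_dn _ _ 2 1 _ (CL_le (k := 4) (l := 3) isT qq).
have y0 : CL 2 k := CL_le (k := 4) (l := 2) isT kk.
have y1 : CL 2 k1 := @CL_dn _ _ 2 1 _ (CL_le (k := 4) (l := 3) isT kk).
exact: (CL_beta2 c0 cY x0 x0' x1 y0 y1 aL da eL de de1 G2L dssV2E).
Qed.

(** alpha_2 is bounded in C^{2,1} only. For fixed h its third derivative exists as this quotient,
    because A and kappa are smoother, and the Lipschitz bound of alpha_2'' makes it bounded
    independently of h. The same device gives e4, the fourth derivative of beta_2. *)
Let a3 p x := (h p ^+ 2)^-1 * (dn 3 A p x + k3 p x).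
Let e4 p x := (h p ^+ 2)^-1 * (dn 4 B p x - b4 p x).

Lemma A3E p x : dn 3 A p x = - k3 p x + h p ^+ 2 * a3 p x.
Proof. by rewrite /a3 mulVKf ?h2_neq0//; ring. Qed.

Lemma a3_bounded : unif_bounded a3.
Proof.
have d0 : CL 0 (dn 2 a) := @CL_dn _ _ 0 2 _ aL.
apply: (CL0_der_bounded d0).
have h3 : isder (dn 2 A) (dn 3 A) := isder_dn (i := 2) AL isT.
have := isderZ (fun p => (h p ^+ 2)^-1) (isderD h3 dk2).
congr isder; apply/funext => p; apply/funext => x.
by rewrite A2E -/k2 addrAC addNr add0r mulKf ?h2_neq0.
Qed.

Lemma B3E p x : dn 3 B p x = b3 p x + h p ^+ 2 * dn 3 e p x.
Proof.
have E : dn 2 B = _ := funext (fun p => funext (B2E p)).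
have h1' : isder (dn 2 B) (dn 3 B) := isder_dn (i := 2) BL isT; rewrite E in h1'.
have de2 : isder (dn 2 e) (dn 3 e) := isder_dn (i := 2) eL3 isT.
have h2' := isderD db2 (isderZ (fun p => h p ^+ 2) de2).
by rewrite (isder_uniq h1' h2').
Qed.

Lemma B4E p x : dn 4 B p x = b4 p x + h p ^+ 2 * e4 p x.
Proof. by rewrite /e4 mulVKf ?h2_neq0//; ring. Qed.

Lemma e4_bounded : unif_bounded e4.
Proof.
have d0 : CL 0 (dn 3 e) := @CL_dn _ _ 0 3 _ eL3.
apply: (CL0_der_bounded d0).
have h3 : isder (dn 3 B) (dn 4 B) := isder_dn (i := 3) BL isT.
have := isderZ (fun p => (h p ^+ 2)^-1) (isderB h3 db3).
congr isder; apply/funext => p; apply/funext => x.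
by rewrite B3E -/b3 addrAC subrr add0r mulKf ?h2_neq0.
Qed.

Hypothesis close_X : forall j, (1 <= j <= 5)%N -> exists K, forall z x,
  `|dn j X (nxt z) x - dn j X (cur z) x| <= K * hq z ^+ 2.
Hypothesis close_Z : forall j, (1 <= j <= 5)%N -> exists K, forall z x,
  `|dn j Z (nxt z) x - dn j Z (cur z) x| <= K * hq z ^+ 2.
Hypothesis close_U0 : forall j, (j <= 1)%N -> exists K, forall z x,
  `|dn j U0 (nxt z) x - dn j U0 (cur z) x| <= K * hq z ^+ 2.
Hypothesis close_U1 : forall j, (j <= 1)%N -> exists K, forall z x,
  `|dn j U1 (nxt z) x - dn j U1 (cur z) x| <= K * hq z ^+ 2.
Hypothesis taylor_X : forall j, (1 <= j <= 2)%N -> exists K, forall z x,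
  `|dn j X (nxt z) x - dn j X (cur z) x - hq z ^+ 2 * dn j U0 (cur z) x| <= K * (hq z ^+ 2) ^+ 2.
Hypothesis taylor_Z : forall j, (1 <= j <= 2)%N -> exists K, forall z x,
  `|dn j Z (nxt z) x - dn j Z (cur z) x - hq z ^+ 2 * dn j U1 (cur z) x| <= K * (hq z ^+ 2) ^+ 2.
Hypothesis taylor_U0 : forall j, (j <= 2)%N -> exists K, forall z x,
  `|dn j U0 (nxt z) x - dn j U0 (cur z) x - hq z ^+ 2 * dn j W0 (cur z) x| <= K * (hq z ^+ 2) ^+ 2.
Hypothesis taylor_U1 : forall j, (j <= 2)%N -> exists K, forall z x,
  `|dn j U1 (nxt z) x - dn j U1 (cur z) x - hq z ^+ 2 * dn j W1 (cur z) x| <= K * (hq z ^+ 2) ^+ 2.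

(** The relations for Y_tt are derived with the point x running freely, since they are needed in a
    neighbourhood of the node. *)
Let curx (y : Q * R) := cur y.1.
Let nxtx (y : Q * R) := nxt y.1.
Let ptx (y : Q * R) := y.2.
Let hx (y : Q * R) := hq y.1.

Let closex F : unif_bounded F -> (exists K, forall z x, `|F (nxt z) x - F (cur z) x| <= K * hq z ^+ 2) ->
  CS curx nxtx ptx hx F.
Proof. by move=> bF [K FK]; split => //; exists K => -[z x]; exact: FK. Qed.

Let taylorx F F1 : (exists K, forall z x, `|F (nxt z) x - F (cur z) x - hq z ^+ 2 * F1 (cur z) x|
  <= K * (hq z ^+ 2) ^+ 2) -> taylor2 curx nxtx ptx hx F F1.
Proof. by move=> [K FK]; exists K => -[z x]; exact: FK. Qed.

Let hx0 y : 0 < hx y. Proof. exact: hq0. Qed.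
Let hx1 y : `|hx y| <= 1. Proof. exact: hq1. Qed.
Let hxc y : h (curx y) = hx y. Proof. exact: hpc. Qed.
Let hxn y : h (nxtx y) = hx y. Proof. exact: hpn. Qed.
Let hp1 p : `|h p| <= 1. Proof. by rewrite ger0_norm ?h1 ?ltW. Qed.

Let e_bd : unif_bounded e := CL_bounded eL.
Let e1_bd : unif_bounded (dn 1 e) := bdk eL3 (isT : (1 <= 3)%N).

Let closed_forms : [/\ CS curx nxtx ptx hx q, CS curx nxtx ptx hx a & CS curx nxtx ptx hx G2].
Proof.
have cX j (jj : (1 <= j <= 5)%N) : CS curx nxtx ptx hx (dn j X).
  by apply: closex; [apply: bdk XL _; case/andP: jj|exact: close_X].
have cZ j (jj : (1 <= j <= 5)%N) : CS curx nxtx ptx hx (dn j Z).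
  by apply: closex; [apply: bdk ZL _; case/andP: jj|exact: close_Z].
have cU0 : CS curx nxtx ptx hx U0 := closex (CL_bounded U0L) (close_U0 (j := 0) isT).
have cU1 : CS curx nxtx ptx hx U1 := closex (CL_bounded U1L) (close_U1 (j := 0) isT).
have cU0' : CS curx nxtx ptx hx (dn 1 U0) := closex (bdk U0L (isT : (1 <= 5)%N)) (close_U0 (j := 1) isT).
have cU1' : CS curx nxtx ptx hx (dn 1 U1) := closex (bdk U1L (isT : (1 <= 5)%N)) (close_U1 (j := 1) isT).
have T1E p x : cc p x * dn 1 U0 p x + ss p x * dn 1 U1 p x =
    vT1 (q p x * k p x) (A p x) (b1 p x + h p ^+ 2 * dn 1 e p x).
  by rewrite (inframe_t inframe_U1) B1E.
have BE p x : cc p x * U0 p x + ss p x * U1 p x = b p x + h p ^+ 2 * e p x.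
  by rewrite -UE_comp.2.
exact: (close_facts c0 cY hp1 hxc hxn (cX 1%N isT) (cX 2%N isT) (cX 3%N isT) (cX 4%N isT) (cX 5%N isT)
  (cZ 1%N isT) (cZ 2%N isT) (cZ 3%N isT) (cZ 4%N isT) (cZ 5%N isT) cU0 cU1 cU0' cU1' e_bd e1_bd
  (tau0E dY) (tau1E dY) (speed_sqr dY) (inframe_t inframe_Y2) (inframe_n inframe_Y2)
  (inframe_t inframe_Y3) (inframe_n inframe_Y3) (inframe_t inframe_Y4) (inframe_n inframe_Y4)
  normal_Y5 (fun _ _ => erefl) BE T1E b2E b3E a_form).
Qed.

Let tangG2 p x : ytang1 (q p x) (q1 p x) (k p x) (T1 p x) (T2 p x) 0 0 =
  h p ^+ 2 * (2 * q p x * G2 p x).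
Proof. by rewrite ytang1_V2 /G dssV2E. Qed.

Let T1L : CL 1 T1.
Proof.
have -> : T1 = fun p x => cc p x * dn 1 U0 p x + ss p x * dn 1 U1 p x.
  by apply/funext => p; apply/funext => x; rewrite (inframe_t inframe_U1).
have u0 : CL 1 (dn 1 U0) := @CL_dn _ _ 1 1 _ (CL_le (k := 5) (l := 2) isT U0L).
have u1 : CL 1 (dn 1 U1) := @CL_dn _ _ 1 1 _ (CL_le (k := 5) (l := 2) isT U1L).
exact: CLD (CLM (CL_le (k := 4) (l := 1) isT ccL) u0) (CLM (CL_le (k := 4) (l := 1) isT ssL) u1).
Qed.

Let N1L : CL 1 N1.
Proof.
have -> : N1 = fun p x => ss p x * dn 1 U0 p x - cc p x * dn 1 U1 p x.
  by apply/funext => p; apply/funext => x; rewrite (inframe_n inframe_U1).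
have u0 : CL 1 (dn 1 U0) := @CL_dn _ _ 1 1 _ (CL_le (k := 5) (l := 2) isT U0L).
have u1 : CL 1 (dn 1 U1) := @CL_dn _ _ 1 1 _ (CL_le (k := 5) (l := 2) isT U1L).
exact: CLB (CLM (CL_le (k := 4) (l := 1) isT ssL) u0) (CLM (CL_le (k := 4) (l := 1) isT ccL) u1).
Qed.

Let T2L : CL 1 T2.
Proof.
have -> : T2 = fun p x => cc p x * dn 2 U0 p x + ss p x * dn 2 U1 p x.
  by apply/funext => p; apply/funext => x; rewrite (inframe_t inframe_U2).
have u0 : CL 1 (dn 2 U0) := @CL_dn _ _ 1 2 _ (CL_le (k := 5) (l := 3) isT U0L).
have u1 : CL 1 (dn 2 U1) := @CL_dn _ _ 1 2 _ (CL_le (k := 5) (l := 3) isT U1L).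
exact: CLD (CLM (CL_le (k := 4) (l := 1) isT ccL) u0) (CLM (CL_le (k := 4) (l := 1) isT ssL) u1).
Qed.

Let N2L : CL 1 N2.
Proof.
have -> : N2 = fun p x => ss p x * dn 2 U0 p x - cc p x * dn 2 U1 p x.
  by apply/funext => p; apply/funext => x; rewrite (inframe_n inframe_U2).
have u0 : CL 1 (dn 2 U0) := @CL_dn _ _ 1 2 _ (CL_le (k := 5) (l := 3) isT U0L).
have u1 : CL 1 (dn 2 U1) := @CL_dn _ _ 1 2 _ (CL_le (k := 5) (l := 3) isT U1L).
exact: CLB (CLM (CL_le (k := 4) (l := 1) isT ssL) u0) (CLM (CL_le (k := 4) (l := 1) isT ccL) u1).
Qed.

Lemma node_estimate_high :
  (exists D, bdd D /\ forall z, tang_at z = hq z ^+ 7 * D z) /\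
  (exists D, bdd D /\ forall z, norm_at z = hq z ^+ 5 * D z).
Proof.
have [qC aC GC] := closed_forms.
have le52 (F : P -> R -> R) : CL 5 F -> CL 2 F by move=> H; exact (CL_le (k := 5) (l := 2) isT H).
have [An At] := acceleration hx0 hx1 hxc hxn c0 cY cs1 inframe_Y1 inframe_Y2 inframe_U inframe_U1
  inframe_U2 UE_comp.1 tangG2 (le52 _ XL) (le52 _ ZL) (le52 _ U0L) (le52 _ U1L) W0L W1L qC aC GC
  (taylorx (taylor_X (j := 1) isT)) (taylorx (taylor_Z (j := 1) isT))
  (taylorx (taylor_X (j := 2) isT)) (taylorx (taylor_Z (j := 2) isT))
  (taylorx (taylor_U0 (j := 0) isT)) (taylorx (taylor_U1 (j := 0) isT))
  (taylorx (taylor_U0 (j := 1) isT)) (taylorx (taylor_U1 (j := 1) isT))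
  (taylorx (taylor_U0 (j := 2) isT)) (taylorx (taylor_U1 (j := 2) isT)) (CL_bounded T1L).
have acc_n : exists d, bdd d /\ forall z,
    ss (cur z) (pt z) * W0 (cur z) (pt z) - cc (cur z) (pt z) * W1 (cur z) (pt z) =
    yNu (q (cur z) (pt z)) (q1 (cur z) (pt z)) (k (cur z) (pt z)) (B (cur z) (pt z))
      (A (cur z) (pt z)) (T1 (cur z) (pt z)) (N1 (cur z) (pt z)) (N2 (cur z) (pt z))
    + hq z ^+ 2 * d z.
  have [d [[K dK] dE]] := An; exists (fun z => d (z, pt z)); split.
    by exists K => z; exact: dK.
  by move=> z; exact: (dE (z, pt z)).
have [N4 [F3 F4]] := inframe_U34.
have kk := kL4; have bb := bL; have qq := qL.
have [[D [bD DE]] [D' [bD' D'E]]] := node_high hq0 hq1 hpc c0 cY cs1 c'0 cc' chord_norm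
  inframe_Y1 inframe_Y2 inframe_Y3 inframe_Y4 inframe_U inframe_U1 inframe_U2 F3 F4 UE_comp.1
  tangG2 XL ZL U0L U1L W0L W1L (CL_bounded ccL) (CL_bounded ssL) (CL_bounded qL)
  (CL_bounded aL) Xv Zv Xq Zq
  hp1 (fun _ _ => erefl) (fun _ _ => erefl) (fun _ _ => erefl) (fun _ _ => erefl) (fun _ _ => erefl)
  (fun _ _ => erefl) A1E A2E A3E UE_comp.2 B1E B2E B3E B4E b2E b3E b4E a_form (fun _ _ => erefl)
  (bdk qq (isT : (1 <= 4)%N)) (bdk qq (isT : (2 <= 4)%N)) (bdk qq (isT : (3 <= 4)%N))
  (CL_bounded kk) (bdk kk (isT : (1 <= 4)%N)) (bdk kk (isT : (2 <= 4)%N)) (bdk kk (isT : (3 <= 4)%N))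
  (CL_bounded bb) (bdk bb (isT : (1 <= 4)%N)) (bdk bb (isT : (2 <= 4)%N)) (bdk bb (isT : (3 <= 4)%N))
  (bdk bb (isT : (4 <= 4)%N)) (bdk aL (isT : (1 <= 2)%N)) (bdk aL (isT : (2 <= 2)%N)) a3_bounded
  e_bd e1_bd (bdk eL3 (isT : (2 <= 3)%N)) (bdk eL3 (isT : (3 <= 3)%N)) e4_bounded
  (CL_le (k := 4) (l := 1) isT ccL) (CL_le (k := 4) (l := 1) isT ssL) (CL_le (k := 4) (l := 1) isT qL)
  (CL_le (k := 4) (l := 1) isT qVL) (@CL_dn _ _ 1 1 _ (CL_le (k := 4) (l := 2) isT qq))
  (CL_le (k := 4) (l := 1) isT kk) T1L T2L N1L N2L acc_n At.
split.
- exists D; split => // z; rewrite -DE.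
  exact (esym (node_tang_rot hq _ _ _ _ (fun z => cs1 (cur z) (pt z)) z)).
- exists D'; split => // z; rewrite -D'E.
  exact (esym (node_norm_rot hq _ _ _ _ _ _ (fun z => cs1 (cur z) (pt z)) z)).
Qed.

End SecondOrder.
End Nodes.
End SpaceFacts.

(** * The two flows *)

Section Flow.
Context {R : realType} {I : Type}.
Variables (T c M : R) (hI : I -> R) (Y Yt Ytt Yttt : I -> R -> R -> 'rV[R]_2) (b a e : I -> R -> R -> R).
Hypotheses (T0 : 0 < T) (c0 : 0 < c).
Hypotheses (hI0 : forall i, 0 < hI i) (hI1 : forall i, hI i <= 1).
Hypotheses (d1 : forall i, tderiv T (Y i) (Yt i)) (d2 : forall i, tderiv T (Yt i) (Ytt i))
  (d3 : forall i, tderiv T (Ytt i) (Yttt i)).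
Hypotheses (r1 : forall i, C0_sobolev2 T 6 +oo%E (Y i)) (r2 : forall i, C0_sobolev2 T 6 +oo%E (Yt i))
  (r3 : forall i, C0_sobolev2 T 3 +oo%E (Ytt i)) (r4 : forall i, C0_sobolev2 T 2 +oo%E (Yttt i)).
Hypotheses (ra : forall i, coef_regular T (a i)) (re : forall i, coef_regular T (e i)).
Hypothesis sp : forall i t x, 0 <= t <= T -> c <= speed (Y i t) x.
Hypothesis nb : forall i t, 0 <= t <= T ->
  (sobolev_norm2 6 +oo (Y i t) + sobolev_norm2 6 +oo (Yt i t)
   + sobolev_norm2 3 +oo (Ytt i t) + sobolev_norm2 2 +oo (Yttt i t)
   + sobolev_norm2 3 +oo (velocity (Y i t) (a i t) (e i t)) <= M%:E)%E.
Hypothesis curve : forall i t, 0 <= t <= T -> closed_curve (Y i t) /\ is_beta0 (Y i t) (b i t).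
Hypothesis flow : forall i, tderiv T (Y i)
  (fun t x => V0 (Y i t) (b i t) x + hI i ^+ 2 *: velocity (Y i t) (a i t) (e i t) x).

Local Notation P := (@PT R I T).
Let at_p (S : Type) (F : I -> R -> S) (p : P) : S := F (sval p).1 (sval p).2.
Let h (p : P) : R := hI (sval p).1.
Let X p x := at_p Y p x 0 0.
Let Z p x := at_p Y p x 0 1.
Let V p x := velocity (at_p Y p) (at_p a p) (at_p e p) x.

Lemma five_le (m1 m2 m3 m4 m5 : \bar R) (K : R) : (0 <= m1)%E -> (0 <= m2)%E -> (0 <= m3)%E ->
  (0 <= m4)%E -> (0 <= m5)%E -> (m1 + m2 + m3 + m4 + m5 <= K%:E)%E ->
  [/\ (m1 <= K%:E)%E, (m2 <= K%:E)%E, (m3 <= K%:E)%E & (m4 <= K%:E)%E /\ (m5 <= K%:E)%E].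
Proof.
move=> p1 p2 p3 p4 p5 H.
have s12 := adde_ge0 p1 p2; have s123 := adde_ge0 s12 p3; have s1234 := adde_ge0 s123 p4.
have H4 : (m1 + m2 + m3 + m4 <= K%:E)%E by apply: le_trans H; rewrite leeDl.
have H3 : (m1 + m2 + m3 <= K%:E)%E by apply: le_trans H4; rewrite leeDl.
have H2 : (m1 + m2 <= K%:E)%E by apply: le_trans H3; rewrite leeDl.
split; last split.
- by apply: le_trans H2; rewrite leeDl.
- by apply: le_trans H2; rewrite leeDr.
- by apply: le_trans H3; rewrite leeDr.
- by apply: le_trans H4; rewrite leeDr.
- by apply: le_trans H; rewrite leeDr.
Qed.

Let bounds (p : P) : [/\ (sobolev_norm2 6 +oo (at_p Y p) <= M%:E)%E, (sobolev_norm2 6 +oo (at_p Yt p) <= M%:E)%E,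
  (sobolev_norm2 3 +oo (at_p Ytt p) <= M%:E)%E & (sobolev_norm2 2 +oo (at_p Yttt p) <= M%:E)%E /\
  (sobolev_norm2 3 +oo (V p) <= M%:E)%E].
Proof. by apply: five_le (nb _ (svalP p)); exact: sobolev_norm2_ge0. Qed.

Lemma coord_CL k (F : I -> R -> R -> 'rV[R]_2) (i : 'I_2) :
  (forall j, C0_sobolev2 T k.+1 +oo%E (F j)) ->
  (forall p : P, (sobolev_norm2 k.+1 +oo (at_p F p) <= M%:E)%E) ->
  CL k (fun (p : P) x => at_p F p x 0 i).
Proof.
move=> rF nF; apply: (@sobolev_CL _ _ _ _ M).
- by move=> p; have [[_ cF _] _] := rF (sval p).1 i (sval p).2 (svalP p).
- by move=> p; have [[pF _ _] _] := rF (sval p).1 i (sval p).2 (svalP p).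
- by move=> p; apply: le_trans (sobolev_norm2_coord _ _ _ i) (nF p).
Qed.

Let XL : CL 5 X. Proof. by apply: (coord_CL _ r1) => p; have [] := bounds p. Qed.
Let ZL : CL 5 Z. Proof. by apply: (coord_CL _ r1) => p; have [] := bounds p. Qed.
Let U0L : CL 5 (fun p x => at_p Yt p x 0 0).
Proof. by apply: (coord_CL _ r2) => p; have [] := bounds p. Qed.
Let U1L : CL 5 (fun p x => at_p Yt p x 0 1).
Proof. by apply: (coord_CL _ r2) => p; have [] := bounds p. Qed.
Let W0L : CL 2 (fun p x => at_p Ytt p x 0 0).
Proof. by apply: (coord_CL _ r3) => p; have [] := bounds p. Qed.
Let W1L : CL 2 (fun p x => at_p Ytt p x 0 1).
Proof. by apply: (coord_CL _ r3) => p; have [] := bounds p. Qed.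
Let S0L : CL 1 (fun p x => at_p Yttt p x 0 0).
Proof. by apply: (coord_CL _ r4) => p; have [_ _ _ []] := bounds p. Qed.
Let S1L : CL 1 (fun p x => at_p Yttt p x 0 1).
Proof. by apply: (coord_CL _ r4) => p; have [_ _ _ []] := bounds p. Qed.

Let dY p x : derivable (at_p Y p) x 1.
Proof. by have [[_ [dy _ _] _ _] _] := curve (sval p).1 (svalP p); exact: dy. Qed.

Let cY p x : c <= speed (at_p Y p) x. Proof. exact: sp (svalP p). Qed.

Let b_ode p : is_beta0 (at_p Y p) (at_p b p).
Proof. by have [] := curve (sval p).1 (svalP p). Qed.

Let cc p x := tau (at_p Y p) x 0 0.
Let ss p x := tau (at_p Y p) x 0 1.

Let frame_periodic p : periodic (cc p) 1 /\ periodic (ss p) 1.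
Proof.
have [[pY _ _ _] _] := curve (sval p).1 (svalP p).
have pX : periodic (X p) 1 by move=> x; rewrite /X /at_p pY.
have pZ : periodic (Z p) 1 by move=> x; rewrite /Z /at_p pY.
have dX := is_derive_periodic pX (CL_isder XL p); have dZ := is_derive_periodic pZ (CL_isder ZL p).
have qP x : speed (at_p Y p) (x + 1) = speed (at_p Y p) x by rewrite !(speedE dY) dX dZ.
by split => x; rewrite /cc /ss ?(tau0E dY) ?(tau1E dY) qP ?dX ?dZ.
Qed.

Let cl_continuous k (F : P -> R -> R) p : CL k F -> continuous (F p).
Proof. by move=> /CL_lip[K [_ FK]]; exact: lipschitz_continuous (FK p). Qed.

Let V_vec p x : V p x = fr cc ss (at_p e) (at_p a) p x.
Proof. exact: velocity_fr. Qed.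

Let coef_cont p : (periodic (at_p a p) 1 /\ continuous (at_p a p)) /\
  (periodic (at_p e p) 1 /\ continuous (at_p e p)).
Proof.
have [[pa ca _] _] := (ra (sval p).1).1 _ (svalP p).
by have [[pe ce _] _] := (re (sval p).1).1 _ (svalP p).
Qed.

Lemma sobolev_CL_ext k (F G : P -> R -> R) : (forall p x, F p x = G p x) ->
  (forall p, continuous (G p)) -> (forall p, periodic (G p) 1) ->
  (forall p, (sobolev_norm k.+1 +oo (F p) <= M%:E)%E) -> CL k F.
Proof.
move=> FG; have -> : F = G by apply/funext => p; apply/funext => x; exact: FG.
exact: sobolev_CL.
Qed.

(** A Sobolev bound yields a pointwise one only for continuous periodic functions; for V2 these
    properties come from those of its coefficients and of the frame. *)
Let V0L : CL 2 (fun p x => V p x 0 0).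
Proof.
have ccC := ccL c0 dY cY XL ZL; have ssC := ssL c0 dY cY XL ZL.
apply: (@sobolev_CL_ext _ _ (fun p x => at_p e p x * cc p x + at_p a p x * ss p x)) => p.
- by move=> x; rewrite V_vec /fr vec0.
- move=> x; apply: cvgD; apply: cvgM.
  + exact: (coef_cont p).2.2.
  + exact: cl_continuous ccC _.
  + exact: (coef_cont p).1.2.
  + exact: cl_continuous ssC _.
- move=> x; have [pc ps] := frame_periodic p.
  by rewrite pc ps (coef_cont p).1.1 (coef_cont p).2.1.
- by apply: le_trans (sobolev_norm2_coord _ _ _ 0) _; have [_ _ _ []] := bounds p.
Qed.

Let V1L : CL 2 (fun p x => V p x 0 1).
Proof.
have ccC := ccL c0 dY cY XL ZL; have ssC := ssL c0 dY cY XL ZL.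
apply: (@sobolev_CL_ext _ _ (fun p x => at_p e p x * ss p x - at_p a p x * cc p x)) => p.
- by move=> x; rewrite V_vec /fr vec1.
- move=> x; apply: cvgB; apply: cvgM.
  + exact: (coef_cont p).2.2.
  + exact: cl_continuous ssC _.
  + exact: (coef_cont p).1.2.
  + exact: cl_continuous ccC _.
- move=> x; have [pc ps] := frame_periodic p.
  by rewrite pc ps (coef_cont p).1.1 (coef_cont p).2.1.
- by apply: le_trans (sobolev_norm2_coord _ _ _ 1) _; have [_ _ _ []] := bounds p.
Qed.

(** (Reg) provides one time derivative of Y and the flow another; they agree because derivatives on
    [0, T] are unique, T being positive. *)
Let UE p x : at_p Yt p x = V0 (at_p Y p) (at_p b p) x + h p ^+ 2 *: V p x.
Proof.
have E i := TD_uniq T0 (TD_tderiv x i (@d1 (sval p).1)) (TD_tderiv x i (@flow (sval p).1)) (svalP p).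
by apply: vecP; [exact: (E 0)|exact: (E 1)].
Qed.

Let h0 p : 0 < h p. Proof. exact: hI0. Qed.
Let h1 p : h p <= 1. Proof. exact: hI1. Qed.
Let cs p x : cc p x ^+ 2 + ss p x ^+ 2 = 1. Proof. exact: (cs1 c0 dY cY). Qed.

Let chord : exists K, 0 <= K /\ forall p x y, y != 0 ->
  c - K * `|y| <= cc p x * ((X p (x + y) - X p x) / y) + ss p x * ((Z p (x + y) - Z p x) / y).
Proof.
apply: (chord_lower (CL_le (k := 5) (l := 1) isT XL) (CL_le (k := 5) (l := 1) isT ZL) cs _ cY).
exact: (inframe_t c0 dY cY (inframe_Y1 c0 dY cY XL ZL)).
Qed.

Lemma flow_chord : exists hmax, [/\ 0 < hmax,
  exists K, [/\ 0 <= K, K * hmax <= c / 2 & forall p x y, y != 0 ->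
    c - K * `|y| <= cc p x * ((X p (x + y) - X p x) / y) + ss p x * ((Z p (x + y) - Z p x) / y)] &
  forall i t (x : R), 0 <= t <= T -> hI i <= hmax ->
    let u j := fquot (Y i t) j x (hI i) in let v j := fquot (Y i t) j x (- hI i) in
    [/\ 0 < Num.sqrt (u 0 ^+ 2 + u 1 ^+ 2), 0 < Num.sqrt (v 0 ^+ 2 + v 1 ^+ 2) &
        c <= Num.sqrt ((u 0 + v 0) ^+ 2 + (u 1 + v 1) ^+ 2)]].
Proof.
(* K h <= c / 2 makes each projected quotient at least c / 2 and their sum at least c; K + 1 in
   place of K keeps the denominator positive. *)
have [K [K0 Kc]] := chord; pose hmax := c / (2 * (K + 1)).
have K1 : 0 < 2 * (K + 1) by rewrite mulr_gt0// ltr_wpDl.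
have Kh : K * hmax <= c / 2.
  rewrite /hmax mulrA ler_pdivrMr//.
  have -> : c / 2 * (2 * (K + 1)) = (K + 1) * c by field.
  by rewrite ler_pM2r// lerDl.
exists hmax; split; [exact: divr_gt0|by exists K|].
move=> i t x tT ih u v; pose p := mkPT i tT.
have hn := hI0 i; have hi0 : hI i != 0 by rewrite gt_eqF.
have hi0' : - hI i != 0 by rewrite oppr_eq0.
have Khi : K * hI i <= c / 2 by apply: le_trans Kh; rewrite ler_wpM2l.
have := Kc p x _ hi0; have := Kc p x _ hi0'; rewrite normrN (gtr0_norm hn).
rewrite -/(u 0) -/(u 1) -/(v 0) -/(v 1) => Hv Hu.
have E := cs p x; move: Hu Hv E; rewrite -/(fquot (at_p Y p) 0 x (hI i)) -/(fquot (at_p Y p) 1 x (hI i)).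
rewrite -/(fquot (at_p Y p) 0 x (- hI i)) -/(fquot (at_p Y p) 1 x (- hI i)).
rewrite -/(u 0) -/(u 1) -/(v 0) -/(v 1).
move: (cc p x) (ss p x) (u 0) (u 1) (v 0) (v 1) => c1 s1 u0 u1 v0 v1 Hu Hv E.
have low (y0 y1 B : R) : B <= c1 * y0 + s1 * y1 -> B <= Num.sqrt (y0 ^+ 2 + y1 ^+ 2).
  move=> H; apply: le_trans H _; apply: (le_trans (ler_norm _)); rewrite -sqrtr_sqr ler_wsqrtr//.
  have -> : y0 ^+ 2 + y1 ^+ 2 = (c1 * y0 + s1 * y1) ^+ 2 + (s1 * y0 - c1 * y1) ^+ 2.
    by transitivity ((y0 ^+ 2 + y1 ^+ 2) * (c1 ^+ 2 + s1 ^+ 2)); [rewrite E mulr1|ring].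
  by rewrite lerDl sqr_ge0.
have c2 : 0 < c / 2 by rewrite divr_gt0.
split.
- by apply: (lt_le_trans c2); apply: low; lra.
- by apply: (lt_le_trans c2); apply: low; lra.
- by apply: low; lra.
Qed.

Section Threshold.
Variable hmax : R.
Hypothesis hmax_chord : exists K, [/\ 0 <= K, K * hmax <= c / 2 & forall p x y, y != 0 ->
  c - K * `|y| <= cc p x * ((X p (x + y) - X p x) / y) + ss p x * ((Z p (x + y) - Z p x) / y)].

(** A curve whose step is below the threshold, a time that leaves room for one time step, and an
    arbitrary real point in the role of the node. *)
Let Q := {z : I * R * R | [&& 0 <= z.1.2, z.1.2 + hI z.1.1 ^+ 2 <= T & hI z.1.1 <= hmax]}.
Let qi (z : Q) : I := (sval z).1.1.
Let qt (z : Q) : R := (sval z).1.2.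
Let pt (z : Q) : R := (sval z).2.
Let hq (z : Q) : R := hI (qi z).
Let eps (z : Q) : R := hq z ^+ 2.
Let qt0 z : 0 <= qt z. Proof. by have /and3P[] := svalP z. Qed.
Let eps0 z : 0 <= eps z. Proof. exact: sqr_ge0. Qed.
Let qtT z : qt z + eps z <= T. Proof. by have /and3P[] := svalP z. Qed.
Let hq_max z : hq z <= hmax. Proof. by have /and3P[] := svalP z. Qed.
Let curq := cur qi qt0 eps0 qtT.
Let nxtq := nxt qi qt0 eps0 qtT.
Let hq0 z : 0 < hq z. Proof. exact: hI0. Qed.

Let chord_q s : c / 2 <= cc (curq s.1) (pt s.1) * dquot hq curq pt X s
  + ss (curq s.1) (pt s.1) * dquot hq curq pt Z s.
Proof.
have [K [K0 Kh Kc]] := hmax_chord.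
have := Kc (curq s.1) (pt s.1) _ (sgstep_neq0 hq0 s); apply: le_trans.
rewrite (norm_sgstep hq0) lerBrDr; have : K * hq s.1 <= K * hmax by rewrite ler_wpM2l.
by move=> H; have := le_trans H Kh; lra.
Qed.

Let TDc (F G : I -> R -> R -> 'rV[R]_2) (j : 'I_2) : (forall i, tderiv T (F i) (G i)) ->
  TDF T (fun i t x => F i t x 0 j) (fun i t x => G i t x 0 j).
Proof. by move=> FG i x; exact: TD_tderiv. Qed.

Let Xv : value3 curq nxtq hq X (fun p x => at_p Yt p x 0 0) (fun p x => at_p Ytt p x 0 0).
Proof. exact: (time_taylor3 qi qt0 eps0 qtT (TDc 0 d1) (TDc 0 d2) (TDc 0 d3) (CL_bounded S0L)). Qed.
Let Zv : value3 curq nxtq hq Z (fun p x => at_p Yt p x 0 1) (fun p x => at_p Ytt p x 0 1).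
Proof. exact: (time_taylor3 qi qt0 eps0 qtT (TDc 1 d1) (TDc 1 d2) (TDc 1 d3) (CL_bounded S1L)). Qed.

Let Xq : quotient3 curq nxtq pt hq X (fun p x => at_p Yt p x 0 0) (fun p x => at_p Ytt p x 0 0).
Proof.
move=> al be bal bbe ab.
exact: (time_taylor3_quotient qi qt0 eps0 qtT pt hq0 bal bbe ab (TDc 0 d1) (TDc 0 d2) (TDc 0 d3) S0L).
Qed.
Let Zq : quotient3 curq nxtq pt hq Z (fun p x => at_p Yt p x 0 1) (fun p x => at_p Ytt p x 0 1).
Proof.
move=> al be bal bbe ab.
exact: (time_taylor3_quotient qi qt0 eps0 qtT pt hq0 bal bbe ab (TDc 1 d1) (TDc 1 d2) (TDc 1 d3) S1L).
Qed.

Definition flow_tang (i : I) (t x : R) : R :=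
  let v (j : 'I_2) (y : R) := (Y i (t + hI i ^+ 2) y 0 j - Y i t y 0 j) / hI i ^+ 2 in
  gtang (hI i) (fquot (Y i t) 0 x (hI i)) (fquot (Y i t) 1 x (hI i))
    (fquot (Y i t) 0 x (- hI i)) (fquot (Y i t) 1 x (- hI i))
    ((v 0 (x + hI i) - v 0 x) / hI i) ((v 1 (x + hI i) - v 1 x) / hI i)
    ((v 0 (x - hI i) - v 0 x) / - hI i) ((v 1 (x - hI i) - v 1 x) / - hI i).
Definition flow_norm (i : I) (t x : R) : R :=
  let v (j : 'I_2) (y : R) := (Y i (t + hI i ^+ 2) y 0 j - Y i t y 0 j) / hI i ^+ 2 in
  gnorm (hI i) (fquot (Y i t) 0 x (hI i)) (fquot (Y i t) 1 x (hI i))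
    (fquot (Y i t) 0 x (- hI i)) (fquot (Y i t) 1 x (- hI i))
    ((v 0 (x + hI i) - v 0 x) / hI i) ((v 1 (x + hI i) - v 1 x) / hI i)
    ((v 0 (x - hI i) - v 0 x) / - hI i) ((v 1 (x - hI i) - v 1 x) / - hI i) (v 0 x) (v 1 x).

Let mkQ (i : I) (t x : R) (t0 : 0 <= t) (tT : t + hI i ^+ 2 <= T) (ih : hI i <= hmax) : Q.
Proof. by exists (i, t, x); rewrite /= t0 tT ih. Defined.

Let transfer n (F : I -> R -> R -> R) (Fq : Q -> R) :
  (forall i t x t0 tT ih, Fq (@mkQ i t x t0 tT ih) = F i t x) ->
  (exists D, bdd D /\ forall z, Fq z = hq z ^+ n * D z) ->
  exists K, 0 <= K /\ forall i t x, 0 <= t -> t + hI i ^+ 2 <= T -> hI i <= hmax ->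
    `|F i t x| <= K * hI i ^+ n.
Proof.
move=> FF [D [[K DK] DE]]; exists `|K|; split => // i t x t0 tT ih.
rewrite -(FF _ _ x t0 tT ih) DE normrM normrX (gtr0_norm (hq0 _)) mulrC.
by rewrite ler_wpM2r ?exprn_ge0 ?(ltW (hI0 i))//; apply: le_trans (DK _) (ler_norm _).
Qed.

Lemma flow_low : (exists K, 0 <= K /\ forall i t x, 0 <= t -> t + hI i ^+ 2 <= T -> hI i <= hmax ->
    `|flow_tang i t x| <= K * hI i ^+ 5) /\
  (exists K, 0 <= K /\ forall i t x, 0 <= t -> t + hI i ^+ 2 <= T -> hI i <= hmax ->
    `|flow_norm i t x| <= K * hI i ^+ 3).
Proof.
have c20 : 0 < c / 2 by rewrite divr_gt0.
have c2c : c / 2 <= c by lra.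
have [A B] := node_estimate_low c0 h0 h1 dY cY XL ZL U0L U1L V0L V1L (fun _ _ => erefl) UE b_ode
  (cur := curq) (nxt := nxtq) (pt := pt) hq0 (fun _ => erefl) c20 c2c chord_q W0L W1L Xv Zv Xq Zq.
by split; [apply: transfer A|apply: transfer B].
Qed.

Section Corrected.
Hypothesis aE : forall i t x, 0 <= t <= T -> a i t x = alpha2 (Y i t) (b i t) x.
Hypothesis e_ode : forall i t, 0 <= t <= T -> is_beta2 (Y i t) (b i t) (e i t).

Lemma flow_high : (exists K, 0 <= K /\ forall i t x, 0 <= t -> t + hI i ^+ 2 <= T -> hI i <= hmax ->
    `|flow_tang i t x| <= K * hI i ^+ 7) /\
  (exists K, 0 <= K /\ forall i t x, 0 <= t -> t + hI i ^+ 2 <= T -> hI i <= hmax ->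
    `|flow_norm i t x| <= K * hI i ^+ 5).
Proof.
have c20 : 0 < c / 2 by rewrite divr_gt0.
have c2c : c / 2 <= c by lra.
have close (F G : I -> R -> R -> R) k j : TDF T F G -> CL k (fam (T := T) F) -> CL k (fam (T := T) G) -> (j <= k)%N ->
    exists K, forall z x, `|dn j (fam (T := T) F) (nxtq z) x - dn j (fam (T := T) F) (curq z) x| <= K * hq z ^+ 2.
  by move=> FG FL GL jk; exact: (time_close qi qt0 eps0 qtT FG FL GL jk).
have taylor (F F1 F2 : I -> R -> R -> R) k j : TDF T F F1 -> TDF T F1 F2 -> CL k (fam (T := T) F) ->
    CL k (fam (T := T) F1) -> CL j (fam (T := T) F2) -> (j < k)%N ->
    exists K, forall z x, `|dn j.+1 (fam (T := T) F) (nxtq z) x - dn j.+1 (fam (T := T) F) (curq z) x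
      - hq z ^+ 2 * dn j.+1 (fam (T := T) F1) (curq z) x| <= K * (hq z ^+ 2) ^+ 2.
  by move=> FG FG1 FL F1L F2L jk; exact: (time_taylor2 qi qt0 eps0 qtT FG FG1 FL F1L F2L jk).
have le52 (F : P -> R -> R) : CL 5 F -> CL 2 F by move=> H; exact (CL_le (k := 5) (l := 2) isT H).
have j2 j : (1 <= j.+1 <= 2)%N -> (j <= 2)%N by case/andP => _; exact: ltnW.
have tX j : (1 <= j <= 2)%N -> exists K, forall z x, `|dn j X (nxtq z) x - dn j X (curq z) x
    - hq z ^+ 2 * dn j (fun p x => at_p Yt p x 0 0) (curq z) x| <= K * (hq z ^+ 2) ^+ 2.
  case: j => [//|j] jj.
  by apply: (taylor _ _ _ 5%N j (TDc 0 d1) (TDc 0 d2) XL U0L (CL_le (j2 _ jj) W0L)); exact: leq_ltn_trans (j2 _ jj) _.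
have tZ j : (1 <= j <= 2)%N -> exists K, forall z x, `|dn j Z (nxtq z) x - dn j Z (curq z) x
    - hq z ^+ 2 * dn j (fun p x => at_p Yt p x 0 1) (curq z) x| <= K * (hq z ^+ 2) ^+ 2.
  case: j => [//|j] jj.
  by apply: (taylor _ _ _ 5%N j (TDc 1 d1) (TDc 1 d2) ZL U1L (CL_le (j2 _ jj) W1L)); exact: leq_ltn_trans (j2 _ jj) _.
have tU0 j : (j <= 2)%N -> exists K, forall z x, `|dn j (fun p x => at_p Yt p x 0 0) (nxtq z) x
    - dn j (fun p x => at_p Yt p x 0 0) (curq z) x
    - hq z ^+ 2 * dn j (fun p x => at_p Ytt p x 0 0) (curq z) x| <= K * (hq z ^+ 2) ^+ 2.
  case: j => [_|j jj].
    exact: (time_taylor2_0 qi qt0 eps0 qtT (TDc 0 d2) (TDc 0 d3) (CL_bounded S0L)).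
  exact: (taylor _ _ _ 2%N j (TDc 0 d2) (TDc 0 d3) (le52 _ U0L) W0L (CL_le (jj : (j <= 1)%N) S0L) jj).
have tU1 j : (j <= 2)%N -> exists K, forall z x, `|dn j (fun p x => at_p Yt p x 0 1) (nxtq z) x
    - dn j (fun p x => at_p Yt p x 0 1) (curq z) x
    - hq z ^+ 2 * dn j (fun p x => at_p Ytt p x 0 1) (curq z) x| <= K * (hq z ^+ 2) ^+ 2.
  case: j => [_|j jj].
    exact: (time_taylor2_0 qi qt0 eps0 qtT (TDc 1 d2) (TDc 1 d3) (CL_bounded S1L)).
  exact: (taylor _ _ _ 2%N j (TDc 1 d2) (TDc 1 d3) (le52 _ U1L) W1L (CL_le (jj : (j <= 1)%N) S1L) jj).
have cX j : (1 <= j <= 5)%N -> exists K, forall z x, `|dn j X (nxtq z) x - dn j X (curq z) x| <= K * hq z ^+ 2.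
  by case/andP => _ jj; exact: (close _ _ 5%N j (TDc 0 d1) XL U0L jj).
have cZ j : (1 <= j <= 5)%N -> exists K, forall z x, `|dn j Z (nxtq z) x - dn j Z (curq z) x| <= K * hq z ^+ 2.
  by case/andP => _ jj; exact: (close _ _ 5%N j (TDc 1 d1) ZL U1L jj).
have cU0 j : (j <= 1)%N -> exists K, forall z x, `|dn j (fun p x => at_p Yt p x 0 0) (nxtq z) x
    - dn j (fun p x => at_p Yt p x 0 0) (curq z) x| <= K * hq z ^+ 2.
  by move=> jj; exact: (close _ _ 2%N j (TDc 0 d2) (le52 _ U0L) W0L (leqW jj)).
have cU1 j : (j <= 1)%N -> exists K, forall z x, `|dn j (fun p x => at_p Yt p x 0 1) (nxtq z) x
    - dn j (fun p x => at_p Yt p x 0 1) (curq z) x| <= K * hq z ^+ 2.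
  by move=> jj; exact: (close _ _ 2%N j (TDc 1 d2) (le52 _ U1L) W1L (leqW jj)).
have aE' p x : at_p a p x = alpha2 (at_p Y p) (at_p b p) x by exact: (@aE _ _ x (svalP p)).
have e_ode' p : is_beta2 (at_p Y p) (at_p b p) (at_p e p) by exact: (@e_ode _ _ (svalP p)).
have [A B] := node_estimate_high c0 h0 h1 dY cY XL ZL U0L U1L V0L V1L (fun _ _ => erefl) UE b_ode
  (cur := curq) (nxt := nxtq) (pt := pt) hq0 (fun _ => erefl) (fun _ => erefl) c20 c2c chord_q W0L W1L
  Xv Zv Xq Zq aE' e_ode' cX cZ cU0 cU1 tX tZ tU0 tU1.
by split; [apply: transfer A|apply: transfer B].
Qed.

End Corrected.
End Threshold.
End Flow.

(** * From node estimates to the defect, uniformly in the mesh *)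

Section MeshFamily.
Context {R : realType}.
Variables (T c M : R) (Y : nat -> R -> R -> 'rV[R]_2) (b a e : nat -> R -> R -> R).
Hypotheses (T0 : 0 < T) (c0 : 0 < c).
Hypothesis curve : forall J, (3 <= J)%N -> forall t, 0 <= t <= T ->
  closed_curve (Y J t) /\ is_beta0 (Y J t) (b J t).
Hypothesis flow : forall J, (3 <= J)%N -> tderiv T (Y J)
  (fun t x => V0 (Y J t) (b J t) x + mesh J ^+ 2 *: velocity (Y J t) (a J t) (e J t) x).
Hypothesis reg : forall J, (3 <= J)%N ->
  curve_reg T c M (Y J) (fun t => alpha0 (Y J t)) (b J) (a J) (e J).

(** The meshes themselves index the family of curves, so that constants uniform over the family do
    not depend on h. *)
Let I := {J : nat | (3 <= J)%N}.
Let hI (i : I) : R := mesh (sval i).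
Let Yi (i : I) := Y (sval i).
Let bi (i : I) := b (sval i).
Let ai (i : I) := a (sval i).
Let ei (i : I) := e (sval i).

(** n is the order of the normal product at a node; the tangential product has order n + 2, and the
    summation loses one power of each. *)
Definition estimates (n : nat) := exists h0 C : R, [/\ 0 < h0, 0 < C &
  forall J, (3 <= J)%N -> mesh J <= h0 -> forall t : R, 0 <= t <= T - mesh J ^+ 2 ->
  forall (phi : R -> 'rV[R]_2) (g : R -> R), in_Sh2 J phi -> in_Sh J g ->
  `|defect J (Y J) t phi| <= C * mesh J ^+ n.-1 * norm0h2 J phi /\
  `|defect J (Y J) t (tangential J g (Y J t))| <= C * mesh J ^+ n.+1 * norm0h J g].

Let hI0 i : 0 < hI i. Proof. exact: mesh_gt0 (svalP i). Qed.
Let hI1 i : hI i <= 1. Proof. exact: mesh_le1 (svalP i). Qed.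

Lemma estimates_of_flow n hmax : (0 < n)%N -> 0 < hmax ->
  (exists K, 0 <= K /\ forall i t x, 0 <= t -> t + hI i ^+ 2 <= T -> hI i <= hmax ->
    `|flow_tang hI Yi i t x| <= K * hI i ^+ n.+2) ->
  (exists K, 0 <= K /\ forall i t x, 0 <= t -> t + hI i ^+ 2 <= T -> hI i <= hmax ->
    `|flow_norm hI Yi i t x| <= K * hI i ^+ n) ->
  (forall i t (x : R), 0 <= t <= T -> hI i <= hmax ->
    let u j := fquot (Yi i t) j x (hI i) in let v j := fquot (Yi i t) j x (- hI i) in
    [/\ 0 < Num.sqrt (u 0 ^+ 2 + u 1 ^+ 2), 0 < Num.sqrt (v 0 ^+ 2 + v 1 ^+ 2) &
        c <= Num.sqrt ((u 0 + v 0) ^+ 2 + (u 1 + v 1) ^+ 2)]) ->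
  estimates n.
Proof.
move=> n0 hm [K1 [K10 K1P]] [K2 [K20 K2P]] ch.
exists hmax, ((K1 + K2) / c + 1); split => //; first by rewrite ltr_wpDl// divr_ge0 ?addr_ge0// ltW.
move=> J J3 Jh t /andP[t0 tT] phi g phiS gS.
pose i : I := exist _ J J3; have tT' : t + hI i ^+ 2 <= T by rewrite -lerBrDr.
have h0 : 0 < mesh J :> R := mesh_gt0 J3; have h1 : mesh J <= 1 :> R := mesh_le1 J3.
have tT0 : 0 <= t <= T by rewrite t0 (le_trans _ tT')// lerDl sqr_ge0.
have tT1 : 0 <= t + mesh J ^+ 2 <= T by rewrite addr_ge0 ?sqr_ge0.
have pt : periodic (Y J t) 1 by have [[]] := curve J3 tT0.
have ps : periodic (Y J (t + mesh J ^+ 2)) 1 by have [[]] := curve J3 tT1.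
have incE j x : increment J (Y J) t x 0 j = (Y J (t + mesh J ^+ 2) x 0 j - Y J t x 0 j) / mesh J ^+ 2.
  by rewrite /increment !mxE mulrC.
have tB x : `|curve_tang J (Y J) t x| <= K1 * mesh J ^+ n.+2.
  have := K1P i t x t0 tT' Jh; rewrite /flow_tang /curve_tang /fquot !incE; exact: id.
have nB x : `|curve_norm J (Y J) t x| <= K2 * mesh J ^+ n.
  have := K2P i t x t0 tT' Jh; rewrite /flow_norm /curve_norm /fquot !incE; exact: id.
have rp1 x : 0 < Num.sqrt (fquot (Y J t) 0 x (mesh J) ^+ 2 + fquot (Y J t) 1 x (mesh J) ^+ 2).
  by have [] := ch i t x tT0 Jh.
have rp2 x : 0 < Num.sqrt (fquot (Y J t) 0 x (- mesh J) ^+ 2 + fquot (Y J t) 1 x (- mesh J) ^+ 2).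
  by have [] := ch i t x tT0 Jh.
have rp3 x : c <= Num.sqrt ((fquot (Y J t) 0 x (mesh J) + fquot (Y J t) 0 x (- mesh J)) ^+ 2
    + (fquot (Y J t) 1 x (mesh J) + fquot (Y J t) 1 x (- mesh J)) ^+ 2).
  by have [] := ch i t x tT0 Jh.
have ih : 0 < (mesh J)^-1 :> R by rewrite invr_gt0.
have ic : 0 < c^-1 by rewrite invr_gt0.
have nodeJ : node J J%:Z = node J 0 + 1 :> R by rewrite -(node_period J3) add0r.
have B1 : K1 * mesh J ^+ n.+2 <= K1 * mesh J ^+ n.
  by rewrite ler_wpM2l// -[X in _ <= X]mul1r -addn2 addnC exprD ler_pM2r ?exprn_gt0// exprn_ile1// ltW.
split.
- have phiP : phi (node J J%:Z) = phi (node J 0).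
    by rewrite nodeJ; apply: vecP; [have [_ -> _] := phiS 0|have [_ -> _] := phiS 1].
  have bnd : `|defect J (Y J) t phi|
      <= (K1 * mesh J ^+ n.+2 + K2 * mesh J ^+ n) / c / mesh J * norm0h2 J phi.
    exact (defect_bound J3 pt ps c0 rp1 rp2 rp3 tB nB phiP).
  apply: (le_trans bnd); rewrite ler_wpM2r ?sqrtr_ge0//.
  have -> : mesh J ^+ n.-1 = mesh J ^+ n / mesh J :> R.
    by rewrite -[in RHS](prednK n0) exprSr mulfK// gt_eqF.
  rewrite mulrA (ler_pM2r ih).
  apply: (@le_trans _ _ ((K1 + K2) / c * mesh J ^+ n)).
    rewrite [leRHS]mulrAC (ler_pM2r ic) mulrDl; apply: lerD => //; exact: B1.
  by rewrite ler_pM2r ?exprn_gt0// lerDl.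
- have gP : g (node J J%:Z) = g (node J 0) by rewrite nodeJ; have [_ -> _] := gS.
  have bnd : `|defect J (Y J) t (tangential J g (Y J t))|
      <= K1 * mesh J ^+ n.+2 / c / mesh J * norm0h J g.
    exact (defect_tangential_bound J3 pt ps c0 rp1 rp2 rp3 tB nB gP).
  apply: (le_trans bnd); rewrite ler_wpM2r ?sqrtr_ge0//.
  have -> : mesh J ^+ n.+1 = mesh J ^+ n.+2 / mesh J :> R by rewrite [in RHS]exprSr mulfK// gt_eqF.
  rewrite mulrA (ler_pM2r ih).
  apply: (@le_trans _ _ ((K1 + K2) / c * mesh J ^+ n.+2)).
    by rewrite [leRHS]mulrAC (ler_pM2r ic) ler_pM2r ?exprn_gt0// lerDl.
  by rewrite ler_pM2r ?exprn_gt0// lerDl.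
Qed.

Let data := (R -> R -> 'rV[R]_2)%type.

(** (Reg) asserts the existence of the time derivatives for each mesh separately; the axiom of
    choice turns them into families. *)
Let derivatives : exists Yt Ytt Yttt : I -> data, forall i,
  [/\ [/\ tderiv T (Yi i) (Yt i), tderiv T (Yt i) (Ytt i) & tderiv T (Ytt i) (Yttt i)],
      [/\ C0_sobolev2 T 6 +oo%E (Yi i), C0_sobolev2 T 6 +oo%E (Yt i),
          C0_sobolev2 T 3 +oo%E (Ytt i) & C0_sobolev2 T 2 +oo%E (Yttt i)],
      [/\ coef_regular T (fun t => alpha0 (Yi i t)), coef_regular T (bi i),
          coef_regular T (ai i) & coef_regular T (ei i)],
      (forall t x, 0 <= t <= T -> c <= speed (Yi i t) x) &
      (forall t, 0 <= t <= T ->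
        (sobolev_norm2 6 +oo (Yi i t) + sobolev_norm2 6 +oo (Yt i t)
         + sobolev_norm2 3 +oo (Ytt i t) + sobolev_norm2 2 +oo (Yttt i t)
         + sobolev_norm2 3 +oo (velocity (Yi i t) (ai i t) (ei i t)) <= M%:E)%E)].
Proof.
have H i : exists y : data * data * data,
  [/\ [/\ tderiv T (Yi i) y.1.1, tderiv T y.1.1 y.1.2 & tderiv T y.1.2 y.2],
      [/\ C0_sobolev2 T 6 +oo%E (Yi i), C0_sobolev2 T 6 +oo%E y.1.1,
          C0_sobolev2 T 3 +oo%E y.1.2 & C0_sobolev2 T 2 +oo%E y.2],
      [/\ coef_regular T (fun t => alpha0 (Yi i t)), coef_regular T (bi i),
          coef_regular T (ai i) & coef_regular T (ei i)],
      (forall t x, 0 <= t <= T -> c <= speed (Yi i t) x) &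
      (forall t, 0 <= t <= T ->
        (sobolev_norm2 6 +oo (Yi i t) + sobolev_norm2 6 +oo (y.1.1 t)
         + sobolev_norm2 3 +oo (y.1.2 t) + sobolev_norm2 2 +oo (y.2 t)
         + sobolev_norm2 3 +oo (velocity (Yi i t) (ai i t) (ei i t)) <= M%:E)%E)].
  by have [y1 [y2 [y3 yP]]] := reg (svalP i); exists (y1, y2, y3).
have [y yP] := choice H.
by exists (fun i => (y i).1.1), (fun i => (y i).1.2), (fun i => (y i).2).
Qed.

Let curve_i i t : 0 <= t <= T -> closed_curve (Yi i t) /\ is_beta0 (Yi i t) (bi i t).
Proof. exact: curve (svalP i) t. Qed.

Let flow_i i : tderiv T (Yi i)
  (fun t x => V0 (Yi i t) (bi i t) x + hI i ^+ 2 *: velocity (Yi i t) (ai i t) (ei i t) x).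
Proof. exact: flow (svalP i). Qed.

Lemma estimates_low : estimates 3.
Proof.
have [Yt [Ytt [Yttt D]]] := derivatives.
have d1 i : tderiv T (Yi i) (Yt i) by have [[]] := D i.
have d2 i : tderiv T (Yt i) (Ytt i) by have [[]] := D i.
have d3 i : tderiv T (Ytt i) (Yttt i) by have [[]] := D i.
have r1 i : C0_sobolev2 T 6 +oo%E (Yi i) by have [_ []] := D i.
have r2 i : C0_sobolev2 T 6 +oo%E (Yt i) by have [_ []] := D i.
have r3 i : C0_sobolev2 T 3 +oo%E (Ytt i) by have [_ []] := D i.
have r4 i : C0_sobolev2 T 2 +oo%E (Yttt i) by have [_ []] := D i.
have ra i : coef_regular T (ai i) by have [_ _ []] := D i.
have re i : coef_regular T (ei i) by have [_ _ []] := D i.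
have sp i : forall t x, 0 <= t <= T -> c <= speed (Yi i t) x by have [] := D i.
have nb i : forall t, 0 <= t <= T -> (sobolev_norm2 6 +oo (Yi i t) + sobolev_norm2 6 +oo (Yt i t)
   + sobolev_norm2 3 +oo (Ytt i t) + sobolev_norm2 2 +oo (Yttt i t)
   + sobolev_norm2 3 +oo (velocity (Yi i t) (ai i t) (ei i t)) <= M%:E)%E by have [] := D i.
have [hmax [hm hc ch]] := flow_chord c0 hI0 r1 sp nb curve_i.
have [A B] := flow_low T0 c0 hI0 hI1 d1 d2 d3 r1 r2 r3 r4 ra re sp nb curve_i flow_i hc.
exact: (estimates_of_flow (n := 3) isT hm A B ch).
Qed.

Lemma estimates_high :
  (forall J, (3 <= J)%N -> forall t x, 0 <= t <= T -> a J t x = alpha2 (Y J t) (b J t) x) ->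
  (forall J, (3 <= J)%N -> forall t, 0 <= t <= T -> is_beta2 (Y J t) (b J t) (e J t)) ->
  estimates 5.
Proof.
move=> aE e_ode.
have [Yt [Ytt [Yttt D]]] := derivatives.
have d1 i : tderiv T (Yi i) (Yt i) by have [[]] := D i.
have d2 i : tderiv T (Yt i) (Ytt i) by have [[]] := D i.
have d3 i : tderiv T (Ytt i) (Yttt i) by have [[]] := D i.
have r1 i : C0_sobolev2 T 6 +oo%E (Yi i) by have [_ []] := D i.
have r2 i : C0_sobolev2 T 6 +oo%E (Yt i) by have [_ []] := D i.
have r3 i : C0_sobolev2 T 3 +oo%E (Ytt i) by have [_ []] := D i.
have r4 i : C0_sobolev2 T 2 +oo%E (Yttt i) by have [_ []] := D i.
have ra i : coef_regular T (ai i) by have [_ _ []] := D i.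
have re i : coef_regular T (ei i) by have [_ _ []] := D i.
have sp i : forall t x, 0 <= t <= T -> c <= speed (Yi i t) x by have [] := D i.
have nb i : forall t, 0 <= t <= T -> (sobolev_norm2 6 +oo (Yi i t) + sobolev_norm2 6 +oo (Yt i t)
   + sobolev_norm2 3 +oo (Ytt i t) + sobolev_norm2 2 +oo (Yttt i t)
   + sobolev_norm2 3 +oo (velocity (Yi i t) (ai i t) (ei i t)) <= M%:E)%E by have [] := D i.
have [hmax [hm hc ch]] := flow_chord c0 hI0 r1 sp nb curve_i.
have [A B] := flow_high T0 c0 hI0 hI1 d1 d2 d3 r1 r2 r3 r4 ra re sp nb curve_i flow_i hc
  (fun i => aE _ (svalP i)) (fun i => e_ode _ (svalP i)).
exact: (estimates_of_flow (n := 5) isT hm A B ch).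
Qed.

End MeshFamily.

Theorem theorem4p9 (R : realType) (T c M : R) (Yinit : R -> 'rV[R]_2)
    (Y0 : R -> R -> 'rV[R]_2) (b00 : R -> R -> R)
    (Y2 : nat -> R -> R -> 'rV[R]_2) (b20 b22 : nat -> R -> R -> R)
    (T_gt0 : 0 < T) (c_gt0 : 0 < c) (M_gt0 : 0 < M)
    (Y0_init : Y0 0 = Yinit)
    (Y0_curve : forall t : R, 0 <= t <= T ->
      closed_curve (Y0 t) /\ is_beta0 (Y0 t) (b00 t))
    (Y0_flow : tderiv T Y0 (fun t => V0 (Y0 t) (b00 t)))
    (Y0_reg : curve_reg T c M Y0 (fun t => alpha0 (Y0 t)) b00
      (fun _ _ => 0) (fun _ _ => 0))
    (Y2_init : forall J, (3 <= J)%N -> Y2 J 0 = Yinit)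
    (Y2_curve : forall J, (3 <= J)%N -> forall t : R, 0 <= t <= T ->
      [/\ closed_curve (Y2 J t), is_beta0 (Y2 J t) (b20 J t) &
          is_beta2 (Y2 J t) (b20 J t) (b22 J t)])
    (Y2_flow : forall J, (3 <= J)%N ->
      tderiv T (Y2 J) (fun t => V0 (Y2 J t) (b20 J t)
        \+ mesh J ^+ 2 \*: V2 (Y2 J t) (b20 J t) (b22 J t)))
    (Y2_reg : forall J, (3 <= J)%N ->
      curve_reg T c M (Y2 J) (fun t => alpha0 (Y2 J t)) (b20 J)
        (fun t => alpha2 (Y2 J t) (b20 J t)) (b22 J)) :
  exists h0 C : R, [/\ 0 < h0, 0 < C &
    forall J, (3 <= J)%N -> mesh J <= h0 ->
    forall t : R, 0 <= t <= T - mesh J ^+ 2 ->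
    forall (phi : R -> 'rV[R]_2) (b : R -> R), in_Sh2 J phi -> in_Sh J b ->
    [/\ `|defect J Y0 t phi| <= C * mesh J ^+ 2 * norm0h2 J phi,
        `|defect J Y0 t (tangential J b (Y0 t))|
          <= C * mesh J ^+ 4 * norm0h J b,
        `|defect J (Y2 J) t phi| <= C * mesh J ^+ 4 * norm0h2 J phi &
        `|defect J (Y2 J) t (tangential J b (Y2 J t))|
          <= C * mesh J ^+ 6 * norm0h J b]].
Proof.
(* Y^[0] does not depend on the mesh. It is treated as a constant family with zero correction, to
   which the estimates of lower order apply. *)
have flow0 J : (3 <= J)%N -> tderiv T Y0 (fun t x => V0 (Y0 t) (b00 t) x
    + mesh J ^+ 2 *: velocity (Y0 t) (fun=> 0) (fun=> 0) x).
  move=> _; have -> : (fun t x => V0 (Y0 t) (b00 t) x + mesh J ^+ 2 *: velocity (Y0 t) (fun=> 0) (fun=> 0) x)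
     = fun t => V0 (Y0 t) (b00 t); last exact: Y0_flow.
  apply/funext => t; apply/funext => x.
  by rewrite /velocity !scale0r addr0 scaler0 addr0.
have [h1 [C1 [h10 C10 E1]]] := @estimates_low R T c M (fun=> Y0) (fun=> b00) (fun _ _ _ => 0) (fun _ _ _ => 0)
  T_gt0 c_gt0 (fun _ _ => Y0_curve) flow0 (fun _ _ => Y0_reg).
have curve2 J (J3 : (3 <= J)%N) t (tT : 0 <= t <= T) : closed_curve (Y2 J t) /\ is_beta0 (Y2 J t) (b20 J t).
  by have [] := Y2_curve J J3 t tT.
have ode2 J (J3 : (3 <= J)%N) t (tT : 0 <= t <= T) : is_beta2 (Y2 J t) (b20 J t) (b22 J t).
  by have [] := Y2_curve J J3 t tT.
have [h2 [C2 [h20 C20 E2]]] := @estimates_high R T c M Y2 b20 (fun J t => alpha2 (Y2 J t) (b20 J t)) b22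
  T_gt0 c_gt0 curve2 Y2_flow Y2_reg (fun _ _ _ _ _ => erefl) ode2.
exists (Num.min h1 h2), (C1 + C2); split; [by rewrite lt_min h10|exact: addr_gt0|].
move=> J J3; rewrite le_min => /andP[Jh1 Jh2] t tT phi b phiS bS.
have [A1 A2] := E1 J J3 Jh1 t tT phi b phiS bS; have [B1 B2] := E2 J J3 Jh2 t tT phi b phiS bS.
have J0 : 0 < mesh J :> R := mesh_gt0 J3.
have up (C C' x : R) n N : 0 <= N -> C <= C' -> x <= C * mesh J ^+ n * N -> x <= C' * mesh J ^+ n * N.
  by move=> N0 CC /le_trans; apply; rewrite ler_wpM2r// ler_wpM2r// exprn_ge0// ltW.
have C1l : C1 <= C1 + C2 by rewrite lerDl ltW.
have C2l : C2 <= C1 + C2 by rewrite lerDr ltW.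
by split; [apply: up A1|apply: up A2|apply: up B1|apply: up B2]; rewrite ?sqrtr_ge0.
Qed.
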